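(* The functors $\mathbb B$ and $\mathbb B^\vee$, equipped with the structure maps described in the context, are part of an adjunction between linear $\infty$-operads and linear $\infty$-cooperads: $\mathbb B^\vee$, from linear $\infty$-cooperads to linear $\infty$-operads, is left adjoint to $\mathbb B$, from linear $\infty$-operads to linear $\infty$-cooperads, with unit $\eta:Y\to\mathbb B(\mathbb B^\vee(Y))$ and counit $\varepsilon:\mathbb B^\vee(\mathbb B(M))\to M$.
   Context: **The category $\mathbb A$.** Trees are finite, rooted, non-planar, with a root edge and leaf edges; $E(T)$ is the set of inner edges of $T$ (edges joining two vertices). Objects of $\mathbb A$ are trees all of whose vertices have at least $2$ inputs. A morphism $S\to T$ in $\mathbb A$ is an isomorphism from $S$ to a tree obtained from $T$ by contracting some set of inner edges of $T$; it is determined by the induced injection on edges (denoted by the same letter), which preserves the root, is a bijection on leaves, and maps $E(S)$ into $E(T)$. The codimension of $\alpha:S\to T$ is $|E(T)\setminus\alpha(E(S))|$. For $e\in E(T)$, $\partial_e:\partial_eT\to T$ is the morphism contracting $e$. If $\alpha:S\to T$ and $e\notin\alpha(E(S))$, $\partial_e^*(\alpha):S\to\partial_eT$ is the unique morphism with $\partial_e\circ\partial_e^*(\alpha)=\alpha$. For trees $S,R$ with at least one vertex and a leaf $a$ of $S$, $S\circ_aR$ is the tree obtained by grafting $R$ onto $S$ at $a$; $E(S\circ_aR)=E(S)\sqcup E(R)\sqcup\{a\}$. **Complexes.** $Ch$ is the category of chain complexes of modules over a fixed commutative ring. $sx\in(sA)_n$ for $x\in A_{n-1}$, $\partial(sx)=-s\partial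 x$; $s^{-1}$ is the inverse shift, $\partial(s^{-1}y)=-s^{-1}\partial y$. In exponents of signs an enumeration stands for its length. **$\infty$-(co)operads.** A linear $\infty$-preoperad is a functor $M:\mathbb A^{op}\to Ch$ with chain maps $\theta_{S,R,a}:M(S\circ_aR)\to M(S)\otimes M(R)$, natural in $S$ and $R$ (with respect to morphisms $\beta\circ\gamma:S\circ_aR\to S'\circ_{\beta a}R'$ for $\beta:S\to S'$, $\gamma:R\to R'$ in $\mathbb A$) and associative: $(id\otimes\theta_{R,Q,b})\theta_{S,R\circ_bQ,a}=(\theta_{S,R,a}\otimes id)\theta_{S\circ_aR,Q,b}$ for $a$ a leaf of $S$, $b$ a leaf of $R$; and, for distinct leaves $a,b$ of $S$, $(\theta_{S,R,a}\otimes id)\theta_{S\circ_aR,Q,b}$ equals $(\theta_{S,Q,b}\otimes id)\theta_{S\circ_bQ,R,a}$ followed by the symmetry exchanging the last two factors. It is a linear $\infty$-operad if all $\theta$ are quasi-isomorphisms. A linear $\infty$-precooperad is a covariant functor $Y:\mathbb A\to Ch$ with chain maps $\theta_{S,R,a}:Y(S\circ_aR)\to Y(S)\otimes Y(R)$ natural in $S,R$ and satisfying the same (co)associativity equations; it is a linear $\infty$-cooperad if these are all quasi-isomorphisms. Morphisms in either case are natural transformations commuting with the structure maps. **Bar construction.** For $M:\mathbb A^{op}\to Ch$, elements of $\mathbb B(M)(S)$ are sums of classes $[\alpha,d|e,x]$ with $\alpha:S\to T$ in $\mathbb A$, $d$ an enumeration of $E(S)$, $e=(e_0,\dots,e_{p-1})$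 an enumeration of $E(T)\setminus\alpha(E(S))$ and $x\in(sM)_n(T)$ (linear in $x$); the degree is $n+|d|+|e|$. Relations: $[\alpha,d|e,\theta^*x']=[\theta\alpha,d|\theta e,x']$ for isomorphisms $\theta:T\to T'$, and $[\alpha,d|e,x]=\mathrm{sgn}(\sigma)\,\mathrm{sgn}(\tau)[\alpha,d\sigma|e\tau,x]$ for permutations $\sigma,\tau$. The differential is $\partial_{ext}+\partial_{int}$: $$\partial_{ext}[\alpha,d|e,x]=\sum_{i=0}^{p-1}(-1)^{d+i}[\partial_{e_i}^*(\alpha),d|(e_0,\dots,\widehat{e_i},\dots,e_{p-1}),\partial_{e_i}^*x],\qquad \partial_{int}[\alpha,d|e,x]=(-1)^{d+e}[\alpha,d|e,\partial_{sM}x].$$ For $\gamma:S\to S'$ of codimension $c$: $\gamma_*[\alpha,d|e,x]=0$ if $\alpha$ does not factor through $\gamma$; if $\alpha=\beta\gamma$, then, after permuting $e$ (with sign) so that $e_0,\dots,e_{c-1}$ are the edges in the image of $\beta$, $\gamma_*[\alpha,d|e,x]=[\beta,(\gamma d,\beta^{-1}e_0,\dots,\beta^{-1}e_{c-1})|(e_c,\dots,e_{p-1}),x]$. **Cobar construction.** For $Y:\mathbb A\to Ch$, elements of $\mathbb B^\vee(Y)(R)$ are sums of classes $[\alpha,b|d,y]$ with $\alpha:R\to S$ in $\mathbb A$, $b$ an enumeration of $E(R)$, $d$ an enumeration of $E(S)\setminus\alpha(E(R))$, $y\in(s^{-1}Y)_n(S)$ (linear in $y$); the degree is $n-|b|-|d|$.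 Relations: $[\alpha,b|d,y]=[\theta\alpha,b|\theta d,\theta_*y]$ for isomorphisms $\theta:S\to S'$, and $[\alpha,b|d,y]=\mathrm{sgn}(\sigma)\,\mathrm{sgn}(\tau)[\alpha,b\sigma|d\tau,y]$. The differential is $\partial_{ext}+\partial_{int}$: $$\partial_{ext}[\alpha,b|d,y]=\sum_{[f:S\to S']}[f\alpha,b|(f(d),f),f_*y],\qquad \partial_{int}[\alpha,b|d,y]=(-1)^{b+d}[\alpha,b|d,\partial_{s^{-1}Y}y],$$ the sum being over isomorphism classes (under $S$) of codimension $1$ morphisms $f:S\to S'$, with $f$ also denoting the unique edge in $E(S')\setminus f(E(S))$. For $\beta:R'\to R$, write (with sign, after permuting) $b=(\beta(b'),b'')$ with $b'$ an enumeration of $E(R')$; then $\beta^*[\alpha,b|d,y]=[\alpha\beta,b'|(\alpha(b''),d),y]$. **Structure maps.** A morphism $\alpha:S\circ_aR\to T$ decomposes as $T=T_S\circ_{\alpha(a)}T_R$ with induced $\alpha_S:S\to T_S$, $\alpha_R:R\to T_R$. Let $d_S,d_R$ enumerate $E(S),E(R)$ and $e_S,e_R$ enumerate $E(T_S)\setminus\alpha_S(E(S))$, $E(T_R)\setminus\alpha_R(E(R))$. If $M$ is a linear $\infty$-operad and $\theta(x)=\sum x_1\otimes x_2\in M(T_S)\otimes M(T_R)$, the $\infty$-cooperad structure of $\mathbb B(M)$ is $$\Delta[\alpha,(a,d_S,d_R)|(e_S,e_R),sx]=\sum(-1)^{\kappa}[\alpha_S,d_S|e_S,sx_1]\otimes[\alpha_R,d_R|e_R,sx_2],$$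 $\kappa=1+d_S+e_S+d_R+e_R+e_Sd_R+(d_R+e_R)(|x_1|+1)+|x_1|$. If $Y$ is a linear $\infty$-cooperad and $\theta(y)=\sum y_1\otimes y_2\in Y(T_S)\otimes Y(T_R)$, the $\infty$-operad structure of $\mathbb B^\vee(Y)$ is $$\Delta[\alpha,(a,d_S,d_R)|(e_S,e_R),s^{-1}y]=\sum(-1)^{\kappa'}[\alpha_S,d_S|e_S,s^{-1}y_1]\otimes[\alpha_R,d_R|e_R,s^{-1}y_2],$$ $\kappa'=(d_S+e_S)(d_R+e_R)+d_Re_S+|y_1|+(d_R+e_R)(|y_1|-1)$. **Unit and counit.** For $y\in Y(S)$, $\eta_S(y)=\sum_{[\alpha:S\to T]}[\alpha,a|e,\,s[id_T,(\alpha(a),e)|\varnothing,\,s^{-1}\alpha_*y]]$, the sum over isomorphism classes of morphisms $\alpha$ with source $S$, with $a$ any enumeration of $E(S)$ and $e$ of $E(T)\setminus\alpha(E(S))$. For $\alpha:S\to T$, $\beta:T\to R$, $x\in M(R)$, and enumerations $a,e,f$ of $E(S)$, $E(T)\setminus\alpha(E(S))$, $E(R)\setminus\beta(E(T))$, $\varepsilon_S[\alpha,a|e,\,s^{-1}[\beta,(\alpha(a),e)|f,\,sx]]$ is $0$ if $\operatorname{codim}(\beta)>0$ and $\alpha^*\beta^*(x)$ if $\operatorname{codim}(\beta)=0$. *)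

(* Defs.v *)
From HB Require Import structures.
From mathcomp Require Import all_boot all_order all_algebra perm.
From mathcomp Require Import zify ring boolp.

Set Implicit Arguments.
Unset Strict Implicit.
Unset Printing Implicit Defensive.

Import GRing.Theory.
Local Open Scope ring_scope.

(** A tree is given by its finite set of edges, ordered by [le x y] iff the
    path from [y] down to the root passes through [x].  A vertex is identified
    with its output edge, so the vertices are the edges that are not leaves
    (there are no vertices without inputs), and the inputs of a vertex are the
    edges lying immediately above its output edge. *)

Section TreeOrder.
Variables (E : finType) (le : rel E).

Definition order_leaf (x : E) : bool := [forall y, le x y ==> (y == x)].

Definition order_inputs (x : E) : {set E} :=
  [set y | [&& le x y, y != x &
            [forall z, le x z && le z y ==> (z == x) || (z == y)]]].

Record is_tree (r : E) : Prop := IsTree {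
  it_refl : reflexive le;
  it_anti : antisymmetric le;
  it_trans : transitive le;
  it_root : forall x, le r x;
  it_chain : forall x y z, le x z -> le y z -> le x y || le y x;
  it_inputs : forall x, ~~ order_leaf x -> (2 <= #|order_inputs x|)%N }.

Hypothesis le_refl : reflexive le.
Hypothesis le_anti : antisymmetric le.
Hypothesis le_trans : transitive le.

Let down_lt x y : le x y -> x != y ->
  (#|[set w | le w x]| < #|[set w | le w y]|)%N.
Proof.
move=> xy nxy; apply: proper_card; apply/properP; split.
  by apply/subsetP => w; rewrite !inE => wx; apply: le_trans wx xy.
exists y; rewrite !inE ?le_refl //; apply/negP => yx.
by case/negP: nxy; apply/eqP/le_anti; rewrite xy yx.
Qed.

Lemma input_below x y : le x y -> y != x ->
  exists2 c, c \in order_inputs x & le c y.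
Proof.
move=> xy nyx; pose P := [pred c | [&& le x c, c != x & le c y]].
have Py : P y by rewrite /= xy nyx le_refl.
case: (arg_minnP (fun c => #|[set w | le w c]|) Py) => c /and3P[xc nc cy] cmin.
exists c => //; rewrite inE xc nc /=; apply/forallP => z; apply/implyP => /andP[xz zc].
case: eqVneq => //= nzx; apply/negPn/negP => nzc.
have Pz : P z by rewrite /= xz nzx (le_trans zc cy).
by have := cmin z Pz; rewrite leqNgt down_lt.
Qed.

Lemma leaf_above x : exists2 l, order_leaf l & le x l.
Proof.
case: (arg_maxnP (fun c => #|[set w | le w c]|) (le_refl x : [pred c | le x c] x)) => l /= xl lmax.
exists l => //; apply/forallP => y; apply/implyP => ly; apply/negPn/negP => nly.
have := lmax y (le_trans xl ly); rewrite leqNgt down_lt // 1?eq_sym //.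
Qed.

Lemma two_inputsP x :
  reflect (exists y1 y2, [/\ le x y1, y1 != x, le x y2, y2 != x &
             forall w, le x w -> w != x -> le w y1 -> le w y2 -> False])
          (2 <= #|order_inputs x|)%N.
Proof.
apply: (iffP idP).
  case/card_gt1P => y1 [y2] [/[!inE] /and3P[xy1 n1 /forallP h1] /and3P[xy2 n2 /forallP h2] n12].
  exists y1, y2; split => // w xw nw w1 w2.
  have := h1 w; rewrite xw w1 (negbTE nw) /= => /eqP e1.
  have := h2 w; rewrite xw w2 (negbTE nw) /= => /eqP e2.
  by rewrite -e1 e2 eqxx in n12.
case=> y1 [y2] [xy1 n1 xy2 n2 h].
have [c1 c1P c1y] := input_below xy1 n1; have [c2 c2P c2y] := input_below xy2 n2.
apply/card_gt1P; exists c1, c2; split => //; apply/negP => /eqP e; subst c2.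
by move: c1P; rewrite inE => /and3P[a b _]; apply: (h c1).
Qed.

End TreeOrder.

(** Edges are taken in ['I_n] so that trees form a small set; [mk_tree] turns
    any finite tree into such a tree. *)
Record tree := Tree {
  tree_size : nat;
  below : 'I_tree_size -> 'I_tree_size -> bool;
  root : 'I_tree_size;
  treeP : is_tree below root }.

Definition edge (T : tree) : predArgType := 'I_(tree_size T).
Coercion edge : tree >-> predArgType.
HB.instance Definition _ (T : tree) := Finite.on (edge T).

Section TreeNotions.
Variable T : tree.
Definition le_edge : rel T := @below T.
Definition root_edge : T := root T.
Definition leaf (x : T) : bool := order_leaf le_edge x.
Definition inputs (x : T) : {set T} := order_inputs le_edge x.
Definition has_vertex : bool := ~~ leaf root_edge.

(** An edge joins two vertices iff it is neither the root nor a leaf. *)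
Definition inner : {set T} := [set x | (x != root_edge) && ~~ leaf x].

Lemma le_edge_refl : reflexive le_edge. Proof. exact: it_refl (treeP T). Qed.
Lemma le_edge_anti : antisymmetric le_edge. Proof. exact: it_anti (treeP T). Qed.
Lemma le_edge_trans : transitive le_edge. Proof. exact: it_trans (treeP T). Qed.
Lemma le_root x : le_edge root_edge x. Proof. exact: it_root (treeP T) x. Qed.
Lemma le_edge_chain x y z : le_edge x z -> le_edge y z -> le_edge x y || le_edge y x.
Proof. exact: it_chain (treeP T) x y z. Qed.
Lemma inputs_gt1 x : ~~ leaf x -> (2 <= #|inputs x|)%N.
Proof. exact: it_inputs (treeP T) x. Qed.

Lemma leafP x : reflect (forall y, le_edge x y -> y = x) (leaf x).
Proof.
apply: (iffP forallP) => h y; first by move=> xy; have := h y; rewrite xy => /eqP.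
by apply/implyP => /h ->.
Qed.

Lemma nleafP x : reflect (exists2 y, le_edge x y & y != x) (~~ leaf x).
Proof.
rewrite /leaf negb_forall; apply: (iffP existsP) => -[y].
  by rewrite negb_imply => /andP[]; exists y.
by move=> xy nyx; exists y; rewrite negb_imply xy.
Qed.
End TreeNotions.
Arguments root_edge : clear implicits.

Section MkTree.
Variables (E : finType) (le : rel E) (r : E).
Hypothesis h : is_tree le r.

Definition mk_below : rel 'I_#|E| := fun x y => le (enum_val x) (enum_val y).

Lemma mk_treeP : is_tree mk_below (enum_rank r).
Proof.
have mr : reflexive mk_below by move=> x; apply: it_refl h _.
have ma : antisymmetric mk_below.
  by move=> x y /(it_anti h) /enum_val_inj.
have mt : transitive mk_below by move=> x y z; apply: it_trans h _ _ _.
split => //.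
- by move=> x; rewrite /mk_below enum_rankK; apply: it_root h _.
- by move=> x y z; apply: it_chain h _ _ _.
move=> x nlx; apply/(two_inputsP mr ma mt).
have nl : ~~ order_leaf le (enum_val x).
  move: nlx; rewrite /order_leaf !negb_forall => /existsP[y]; rewrite negb_imply => /andP[xy nyx].
  by apply/existsP; exists (enum_val y); rewrite negb_imply (inj_eq enum_val_inj) nyx andbT.
have /(two_inputsP (it_refl h) (it_anti h) (it_trans h)) := it_inputs h nl.
case=> y1 [y2] [a1 n1 a2 n2 hw].
exists (enum_rank y1), (enum_rank y2); rewrite /mk_below !enum_rankK; split => //.
- by apply: contraNneq n1 => <-; rewrite enum_rankK.
- by apply: contraNneq n2 => <-; rewrite enum_rankK.
by move=> w xw nw; apply: hw => //; rewrite (inj_eq enum_val_inj).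
Qed.

Definition mk_tree : tree := Tree mk_treeP.
Definition to_tree (x : E) : mk_tree := enum_rank x.
Definition of_tree (x : mk_tree) : E := enum_val x.
Lemma to_treeK : cancel to_tree of_tree. Proof. exact: enum_rankK. Qed.
Lemma of_treeK : cancel of_tree to_tree. Proof. exact: enum_valK. Qed.
Lemma le_mk (x y : mk_tree) : le_edge x y = le (of_tree x) (of_tree y).
Proof. by []. Qed.
End MkTree.

(** [contract D] contracts the inner edges belonging to [D]; the other elements
    of [D], if any, are kept. *)
Section Contraction.
Variables (T : tree) (D : {set T}).

Definition kept (x : T) : bool := ~~ ((x \in D) && (x \in inner T)).
Definition contract_edge := {x : T | kept x}.
Definition contract_le : rel contract_edge := fun x y => le_edge (val x) (val y).

Lemma kept_root : kept (root_edge T).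
Proof. by rewrite /kept !inE eqxx andbF. Qed.

Lemma kept_leaf x : leaf x -> kept x.
Proof. by move=> lx; rewrite /kept !inE lx !andbF. Qed.

Definition contract_root : contract_edge := exist _ (root_edge T) kept_root.

Lemma contract_is_tree : is_tree contract_le contract_root.
Proof.
have mr : reflexive contract_le by move=> x; apply: le_edge_refl.
have ma : antisymmetric contract_le by move=> x y /le_edge_anti /val_inj.
have mt : transitive contract_le by move=> x y z; apply: le_edge_trans.
split => //.
- by move=> x; apply: le_root.
- by move=> x y z; apply: le_edge_chain.
move=> x nlx; apply/(two_inputsP mr ma mt).
have nl : ~~ leaf (val x).
  move: nlx; rewrite /order_leaf negb_forall => /existsP[y]; rewrite negb_imply => /andP[xy nyx].
  by apply/nleafP; exists (val y).
have /(two_inputsP (@le_edge_refl T) (@le_edge_anti T) (@le_edge_trans T)) := inputs_gt1 nl.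
case=> y1 [y2] [a1 n1 a2 n2 hw].
have [l1 L1 yl1] := leaf_above (@le_edge_refl T) (@le_edge_anti T) (@le_edge_trans T) y1.
have [l2 L2 yl2] := leaf_above (@le_edge_refl T) (@le_edge_anti T) (@le_edge_trans T) y2.
have lift_ne y l : le_edge (val x) y -> y != val x -> le_edge y l -> l != val x.
  move=> xy nyx yl; apply: contraNneq nyx => e; subst l.
  by apply/eqP/le_edge_anti; rewrite yl xy.
exists (exist _ l1 (kept_leaf L1)), (exist _ l2 (kept_leaf L2)); split.
- exact: le_edge_trans yl1.
- by rewrite -(inj_eq val_inj) /=; apply: lift_ne yl1.
- exact: le_edge_trans yl2.
- by rewrite -(inj_eq val_inj) /=; apply: lift_ne yl2.
move=> w; rewrite /contract_le /= -(inj_eq val_inj) /= => xw nw w1 w2.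
have := le_edge_chain w1 yl1; have := le_edge_chain w2 yl2.
case/orP => [wy2|y2w]; case/orP => [wy1|y1w].
- exact: hw wy1 wy2.
- by apply: (hw y1) => //; [apply: le_edge_refl|apply: le_edge_trans y1w wy2].
- by apply: (hw y2) => //; [apply: le_edge_trans y2w wy1|apply: le_edge_refl].
have := le_edge_chain y1w y2w.
case/orP => yy; first by apply: (hw y1) => //; apply: le_edge_refl.
by apply: (hw y2) => //; apply: le_edge_refl.
Qed.

Definition contract : tree := mk_tree contract_is_tree.
Definition contract_incl (x : contract) : T := val (of_tree x).

Lemma contract_incl_inj : injective contract_incl.
Proof. by move=> x y /val_inj /enum_val_inj. Qed.
Lemma le_contract x y : le_edge (contract_incl x) (contract_incl y) = le_edge x y.
Proof. by []. Qed.
Lemma contract_kept x : kept (contract_incl x).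
Proof. exact: valP (of_tree x). Qed.
Definition contract_lift (x : T) (kx : kept x) : contract :=
  to_tree contract_is_tree (exist _ x kx).
Lemma contract_liftK x (kx : kept x) : contract_incl (contract_lift kx) = x.
Proof. by rewrite /contract_incl /contract_lift to_treeK. Qed.
End Contraction.

Implicit Types S T U P Q : tree.

Definition tree_iso (S T : tree) (g : S -> T) : Prop :=
  bijective g /\ {mono g : x y / le_edge x y}.

Definition is_hom (S T : tree) (f : S -> T) : Prop :=
  exists2 D : {set T}, D \subset inner T &
  exists2 g : S -> contract D, tree_iso g & forall x, f x = contract_incl (g x).

Record hom (S T : tree) := Hom { hom_fun :> S -> T; homP : is_hom hom_fun }.

Lemma hom_ext S T (f g : hom S T) : f =1 g -> f = g.
Proof.
case: f g => f hf [g hg] /= /funext e; subst g.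
by rewrite (Prop_irrelevance hf hg).
Qed.

Lemma is_homP S T (f : S -> T) :
  is_hom f <-> {mono f : x y / le_edge x y} /\
               (forall y, (forall x, f x != y) -> y \in inner T).
Proof.
split.
  case=> D /subsetP Din [g [[g' gK g'K] gm] fE]; split.
    by move=> x y; rewrite !fE le_contract gm.
  move=> y hy; apply/negPn/negP => ny.
  have ky : kept D y by rewrite /kept (negbTE ny) andbF.
  have := hy (g' (contract_lift ky)).
  by rewrite fE g'K contract_liftK eqxx.
case=> fm fin; pose D := [set y | [forall x, f x != y]].
have finj : injective f.
  by move=> x y e; apply: le_edge_anti; rewrite -!fm e le_edge_refl.
have Din : D \subset inner T.
  by apply/subsetP => y; rewrite inE => /forallP; apply: fin.
have kf x : kept D (f x).
  rewrite /kept inE negb_and negb_forall; apply/orP; left.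
  by apply/existsP; exists x; rewrite eqxx.
exists D => //; exists (fun x => contract_lift (kf x)); last by move=> x; rewrite contract_liftK.
have gi : injective (fun x => contract_lift (kf x)).
  by move=> x y /(congr1 (@contract_incl _ _)); rewrite !contract_liftK; apply: finj.
split; last by move=> x y; rewrite -le_contract !contract_liftK fm.
apply: inj_card_bij => //; rewrite -(card_imset predT (@contract_incl_inj T D)) -(card_imset predT finj).
apply: subset_leq_card; apply/subsetP => _ /imsetP[c _ ->].
have := contract_kept c; rewrite /kept negb_and inE => /orP[|nin].
  by rewrite negb_forall => /existsP[x]; rewrite negbK => /eqP <-; apply: imset_f.
have : ~ (forall x, f x != contract_incl c) by move/fin; apply/negP.
move/existsNP => [x /negP]; rewrite negbK => /eqP <-; exact: imset_f.
Qed.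

Section HomTheory.
Variables (S T : tree) (f : hom S T).

Lemma hom_mono : {mono f : x y / le_edge x y}.
Proof. by have [] := (is_homP f).1 (homP f). Qed.
Lemma hom_inj : injective f.
Proof. by move=> x y e; apply: le_edge_anti; rewrite -!hom_mono e le_edge_refl. Qed.
Lemma hom_missed y : (forall x, f x != y) -> y \in inner T.
Proof. by have [_] := (is_homP f).1 (homP f); apply. Qed.
Lemma hom_onto y : y \notin inner T -> exists x, f x = y.
Proof.
move=> ny; apply: contrapT => /forallNP h; case/negP: ny; apply: hom_missed => x.
by apply/eqP; apply: h.
Qed.

Lemma hom_root : f (root_edge S) = root_edge T.
Proof.
have [x xE] : exists x, f x = root_edge T by apply: hom_onto; rewrite inE eqxx.
by apply: le_edge_anti; rewrite le_root -xE hom_mono le_root.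
Qed.

Lemma hom_leaf x : leaf (f x) = leaf x.
Proof.
apply/leafP/leafP => h y xy.
  by apply: hom_inj; apply: h; rewrite hom_mono.
have [l ll yl] := leaf_above (@le_edge_refl T) (@le_edge_anti T) (@le_edge_trans T) y.
have [z zE] : exists z, f z = l by apply: hom_onto; rewrite inE [leaf l]ll andbF.
have zx : z = x by apply: h; rewrite -hom_mono zE; apply: le_edge_trans yl.
by apply: le_edge_anti; rewrite xy -zx zE yl.
Qed.

Lemma hom_inner x : (f x \in inner T) = (x \in inner S).
Proof. by rewrite !inE hom_leaf -hom_root (inj_eq hom_inj). Qed.

Lemma hom_has_vertex : has_vertex T = has_vertex S.
Proof. by rewrite /has_vertex -hom_root hom_leaf. Qed.
End HomTheory.

Lemma is_hom_id S : is_hom (fun x : S => x).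
Proof. by apply/is_homP; split => // y /(_ y); rewrite eqxx. Qed.
Definition hom_id S : hom S S := Hom (is_hom_id S).

Lemma is_hom_comp S T U (g : hom T U) (f : hom S T) : is_hom (fun x => g (f x)).
Proof.
apply/is_homP; split; first by move=> x y; rewrite !hom_mono.
move=> y hy; apply/negPn/negP => ny; have [z zE] := hom_onto g ny.
case/negP: ny; rewrite -zE hom_inner.
by apply: (hom_missed (f := f)) => x; have := hy x; rewrite -zE (inj_eq (hom_inj (f := g))).
Qed.
Definition hom_comp S T U (g : hom T U) (f : hom S T) : hom S U :=
  Hom (is_hom_comp g f).

Definition isom S T (f : hom S T) : Prop :=
  exists g : hom T S, hom_comp g f = hom_id S /\ hom_comp f g = hom_id T.

(** [E(T) \ f(E(S))] *)
Definition new_edges S T (f : hom S T) : {set T} :=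
  inner T :\: [set f x | x in inner S].

Definition codim S T (f : hom S T) : nat := #|new_edges f|.

Definition is_enum (T : tree) (s : seq T) (A : {set T}) : bool := perm_eq s (enum A).

Definition face (T : tree) (e : T) : tree := contract [set e].

Lemma face_is_hom T (e : T) : is_hom (@contract_incl T [set e]).
Proof.
apply/is_homP; split => // y hy; apply/negPn/negP => ny.
have ky : kept [set e] y by rewrite /kept (negbTE ny) andbF.
by have := hy (contract_lift ky); rewrite contract_liftK eqxx.
Qed.
Definition face_hom T (e : T) : hom (face e) T := Hom (face_is_hom e).

Section FaceLift.
Variables (S T : tree) (f : hom S T) (e : T).
Hypothesis ne : e \notin [set f x | x in inner S].

Lemma face_kept x : kept [set e] (f x).
Proof.
rewrite /kept inE; apply/negP => /andP[/eqP fx]; rewrite hom_inner => xin.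
by case/negP: ne; rewrite -fx imset_f.
Qed.

Definition face_lift_fun x : face e := contract_lift (face_kept x).

Lemma face_lift_is_hom : is_hom face_lift_fun.
Proof.
apply/is_homP; split.
  by move=> x y; rewrite -le_contract !contract_liftK hom_mono.
move=> y hy; rewrite -(hom_inner (face_hom e)); apply: (hom_missed (f := f)) => x.
apply: contraNneq (hy x) => /= fx; apply/eqP/contract_incl_inj.
by rewrite contract_liftK.
Qed.

Definition face_lift : hom S (face e) := Hom face_lift_is_hom.

Lemma face_liftK : hom_comp (face_hom e) face_lift = f.
Proof. by apply: hom_ext => x /=; rewrite contract_liftK. Qed.
End FaceLift.

Lemma enum_new_notin S T (f : hom S T) (e : seq T) :
  is_enum e (new_edges f) ->
  forall i : 'I_(size e), tnth (in_tuple e) i \notin [set f x | x in inner S].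
Proof.
move=> he i; have := mem_tnth i (in_tuple e).
by rewrite (perm_mem he) mem_enum inE => /andP[].
Qed.

(** The part of a sequence of edges of [T] that survives in [∂_eT]. *)
Definition face_seq (T : tree) (e : T) (s : seq T) : seq (face e) :=
  [seq to_tree (contract_is_tree [set e]) x
     | x <- pmap (insub : T -> option (contract_edge [set e])) s].

Section Grafting.
Variables (S : tree) (a : S) (R : tree).

(** The root edge of [R] is identified with the edge [a] of [S]; this is the
    grafting of trees when [a] is a leaf of [S]. *)
Definition graft_edge : Type := (S + {r : R | r != root_edge R})%type.
HB.instance Definition _ := Finite.on graft_edge.

Definition graft_le : rel graft_edge := fun x y =>
  match x, y with
  | inl s, inl s' => le_edge s s'
  | inl s, inr _ => le_edge s a
  | inr _, inl _ => false
  | inr r, inr r' => le_edge (val r) (val r')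
  end.

Lemma graft_is_tree : is_tree graft_le (inl (root_edge S)).
Proof.
have mr : reflexive graft_le by case=> x /=; apply: le_edge_refl.
have ma : antisymmetric graft_le.
  case=> x [] y /=; rewrite ?andbF //.
    by move=> h; rewrite (le_edge_anti h).
  by move=> h; rewrite (val_inj (le_edge_anti h)).
have mt : transitive graft_le.
  case=> y [] x [] z //=; try exact: le_edge_trans.
split => //.
- by case=> x /=; apply: le_root.
- case=> x [] y [] z //=; try exact: le_edge_chain.
  by move=> ->.
move=> x nlx; apply/(two_inputsP mr ma mt).
have key U (u : U) : ~~ leaf u -> _ := fun h => elimT
  (two_inputsP (@le_edge_refl U) (@le_edge_anti U) (@le_edge_trans U) u) (inputs_gt1 h).
case: x nlx => x; rewrite /order_leaf negb_forall => /existsP[y]; rewrite negb_imply => /andP[xy nyx].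
  have [lx|/key] := boolP (leaf x); last first.
    case=> y1 [y2] [a1 n1 a2 n2 hw].
    by exists (inl y1), (inl y2); split => // -[w|w] //=; apply: hw.
  case: y xy nyx => y /= xy nyx.
    by move/leafP: lx => /(_ _ xy) e; rewrite e eqxx in nyx.
  have ax := (leafP _ lx) _ xy; subst x.
  have : ~~ leaf (root_edge R).
    by apply/nleafP; exists (val y); [apply: le_root|exact: (valP y)].
  case/key => y1 [y2] [a1 n1 a2 n2 hw].
  exists (inr (exist _ y1 n1)), (inr (exist _ y2 n2)); split => // -[w|w] /=.
    move=> aw nw wa _; case/negP: nw; apply/eqP; congr inl.
    by apply: le_edge_anti; rewrite aw wa.
  by move=> _ _; apply: hw; [apply: le_root|exact: (valP w)].
case: y xy nyx => y //= xy nyx.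
have : ~~ leaf (val x) by apply/nleafP; exists (val y).
case/key => y1 [y2] [a1 n1 a2 n2 hw].
have nr z : le_edge (val x) z -> z != root_edge R.
  move=> xz; apply: contraNneq (valP x) => zr; apply/eqP/le_edge_anti.
  by move: xz; rewrite zr => ->; apply: le_root.
exists (inr (exist _ y1 (nr _ a1))), (inr (exist _ y2 (nr _ a2))); split => //.
- by case=> w //=; apply: hw.
Qed.

Definition graft : tree := mk_tree graft_is_tree.
Definition graft_in (x : graft_edge) : graft := to_tree graft_is_tree x.
Definition graft_out (x : graft) : graft_edge := of_tree x.
Lemma graft_inK : cancel graft_in graft_out. Proof. exact: to_treeK. Qed.
Lemma graft_outK : cancel graft_out graft_in. Proof. exact: of_treeK. Qed.
Lemma le_graft x y : le_edge (graft_in x) (graft_in y) = graft_le x y.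
Proof. by rewrite le_mk -!/(graft_out _) !graft_inK. Qed.

Definition graft_inl (s : S) : graft := graft_in (inl s).
Definition graft_inr (r : R) : graft :=
  graft_in (if insub r is Some r' then inr r' else inl a).

Lemma graft_root : root_edge graft = graft_inl (root_edge S).
Proof. by []. Qed.

Lemma graft_leaf_in x : leaf (graft_in x) = order_leaf graft_le x.
Proof.
apply/leafP/forallP => h y.
  apply/implyP => xy; rewrite -(inj_eq (can_inj graft_inK)); apply/eqP/h.
  by rewrite le_graft.
rewrite -[y]graft_outK le_graft => xy; have := h (graft_out y).
by rewrite xy => /eqP->.
Qed.

Lemma graft_leaf_inr_out (r : {r : R | r != root_edge R}) :
  leaf (graft_in (inr r)) = leaf (val r).
Proof.
rewrite graft_leaf_in; apply/forallP/leafP => h y.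
  move=> ry; have ny : y != root_edge R.
    apply: contraNneq (valP r) => yr; apply/eqP/le_edge_anti.
    by move: ry; rewrite yr => ->; apply: le_root.
  by have := h (inr (exist _ y ny)); rewrite /= ry => /eqP [] <-.
by apply/implyP; case: y => y //= /h /val_inj ->.
Qed.

Lemma graft_leaf_inl s : leaf s -> s != a -> leaf (graft_inl s).
Proof.
move=> ls nsa; rewrite graft_leaf_in; apply/forallP => y; apply/implyP.
case: y => y /= sy; first by rewrite ((leafP _ ls) _ sy).
by rewrite ((leafP _ ls) _ sy) eqxx in nsa.
Qed.

Lemma graft_leaf_inr r : has_vertex R -> leaf r -> leaf (graft_inr r).
Proof.
move=> vR lr; have [e|nr] := eqVneq r (root_edge R).
  by rewrite /has_vertex -e lr in vR.
by rewrite /graft_inr (insubT (fun x => x != root_edge R) nr) graft_leaf_inr_out.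
Qed.

Lemma graft_has_vertex : has_vertex S -> has_vertex graft.
Proof.
move=> /nleafP[y ry ny]; apply/nleafP; exists (graft_inl y).
  by rewrite graft_root le_graft.
by rewrite (inj_eq (can_inj graft_inK)).
Qed.
End Grafting.
Arguments graft : clear implicits.
Arguments graft_in {S a R} x.
Arguments graft_out {S a R} x.
Arguments graft_inl {S} a R s.
Arguments graft_inr {S} a {R} r.

Section GraftOrder.
Variables (S : tree) (a : S) (R : tree).

Lemma graft_inr_root : graft_inr a (root_edge R) = graft_inl a R a.
Proof. by rewrite /graft_inr insubF ?eqxx. Qed.

Lemma graft_inrE r (nr : r != root_edge R) :
  graft_inr a r = graft_in (inr (exist _ r nr)).
Proof. by rewrite /graft_inr insubT. Qed.

Lemma graft_out_inl s : graft_out (graft_inl a R s) = inl s.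
Proof. exact: graft_inK. Qed.

Lemma le_inl_inl s t : le_edge (graft_inl a R s) (graft_inl a R t) = le_edge s t.
Proof. exact: le_graft. Qed.

Lemma le_inl_inr s (r : R) : le_edge (graft_inl a R s) (graft_inr a r) = le_edge s a.
Proof.
have [->|nr] := eqVneq r (root_edge R); first by rewrite graft_inr_root le_inl_inl.
by rewrite graft_inrE le_graft.
Qed.

Lemma le_inr_inl s (r : R) :
  le_edge (graft_inr a r) (graft_inl a R s) = (r == root_edge R) && le_edge a s.
Proof.
have [->|nr] := eqVneq r (root_edge R); first by rewrite graft_inr_root le_inl_inl.
by rewrite graft_inrE le_graft.
Qed.

Lemma le_edge_root (r : R) : le_edge r (root_edge R) = (r == root_edge R).
Proof.
apply/idP/eqP => [h|->]; last exact: le_root.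
by apply: le_edge_anti; rewrite h le_root.
Qed.

Lemma le_inr_inr (r t : R) : le_edge (graft_inr a r) (graft_inr a t) = le_edge r t.
Proof.
have [->|nt] := eqVneq t (root_edge R).
  by rewrite graft_inr_root le_inr_inl le_edge_refl andbT le_edge_root.
have [->|nr] := eqVneq r (root_edge R).
  by rewrite graft_inr_root le_inl_inr le_edge_refl le_root.
by rewrite !graft_inrE le_graft.
Qed.

Lemma graftP (x : graft S a R) :
  (exists s, x = graft_inl a R s) \/
  (exists2 r, r != root_edge R & x = graft_inr a r).
Proof.
rewrite -[x]graft_outK; case: (graft_out x) => [s|[r nr]]; [left; by exists s|right].
by exists r => //; rewrite graft_inrE.
Qed.
End GraftOrder.

Section GraftHom.
Variables (S S' : tree) (f : hom S S') (a : S) (R R' : tree) (g : hom R R').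

Lemma hom_nroot (r : {r : R | r != root_edge R}) : g (val r) != root_edge R'.
Proof. by rewrite -(hom_root g) (inj_eq (hom_inj (f := g))) (valP r). Qed.

Definition graft_hom_fun (x : graft S a R) : graft S' (f a) R' :=
  graft_in match graft_out x with
           | inl s => inl (f s)
           | inr r => inr (exist _ (g (val r)) (hom_nroot r))
           end.

Lemma graft_hom_is_hom : is_hom graft_hom_fun.
Proof.
apply/is_homP; split.
  move=> x y; rewrite -[x in RHS]graft_outK -[y in RHS]graft_outK !le_graft.
  by case: (graft_out x) (graft_out y) => u [] v //=; rewrite hom_mono.
move=> y; rewrite -[y]graft_outK; case: (graft_out y) => {y} [s|r] hy.
  have : s \in inner S'.
    apply: (hom_missed (f := f)) => x; apply: contraNneq (hy (graft_inl a R x)) => <-.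
    by rewrite /graft_hom_fun graft_inK.
  rewrite !inE => /andP[nr nl]; rewrite graft_root (inj_eq (can_inj (@graft_inK _ _ _))).
  rewrite -[inl s == _]/(s == _) nr /=; case/nleafP: nl => t st nts.
  by apply/nleafP; exists (graft_inl _ _ t); rewrite ?le_graft // (inj_eq (can_inj (@graft_inK _ _ _))).
have : val r \in inner R'.
  apply: (hom_missed (f := g)) => x; apply/negP => /eqP gx.
  have nx : x != root_edge R.
    by apply: contraNneq (valP r) => e; rewrite -gx e hom_root.
  case/negP: (hy (graft_in (inr (exist _ x nx)))); rewrite /graft_hom_fun graft_inK.
  by apply/eqP; congr (graft_in (inr _)); apply: val_inj.
rewrite !inE graft_leaf_inr_out => /andP[_ ->].
by rewrite graft_root (inj_eq (can_inj (@graft_inK _ _ _))).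
Qed.

Definition graft_hom : hom (graft S a R) (graft S' (f a) R') := Hom graft_hom_is_hom.
End GraftHom.

Lemma is_hom_bij S T (f : S -> T) :
  {mono f : x y / le_edge x y} -> (forall y, exists x, f x = y) -> is_hom f.
Proof.
move=> fm fs; apply/is_homP; split => // y hy; have [x xE] := fs y.
by have := hy x; rewrite xE eqxx.
Qed.

(** The canonical isomorphism (S ∘_a R) ∘_b Q -> S ∘_a (R ∘_b Q). *)
Section GraftAssoc.
Variables (S : tree) (a : S) (R : tree) (b : R) (Q : tree).

Definition graft_assoc_fun (x : graft (graft S a R) (graft_inr a b) Q) :
    graft S a (graft R b Q) :=
  match graft_out x with
  | inl y => match graft_out y with
             | inl s => graft_inl a _ s
             | inr r => graft_inr a (graft_inl b Q (val r))
             end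
  | inr q => graft_inr a (graft_inr b (val q))
  end.

Lemma graft_assoc_ll s : graft_assoc_fun (graft_inl _ Q (graft_inl a R s)) = graft_inl a _ s.
Proof. by rewrite /graft_assoc_fun !graft_out_inl. Qed.

Lemma graft_assoc_lr r :
  graft_assoc_fun (graft_inl _ Q (graft_inr a r)) = graft_inr a (graft_inl b Q r).
Proof.
have [->|nr] := eqVneq r (root_edge R).
  by rewrite graft_inr_root graft_assoc_ll -graft_root graft_inr_root.
by rewrite /graft_assoc_fun graft_out_inl graft_inrE graft_inK.
Qed.

Lemma graft_assoc_r q :
  graft_assoc_fun (graft_inr (graft_inr a b) q) = graft_inr a (graft_inr b q).
Proof.
have [->|nq] := eqVneq q (root_edge Q); first by rewrite !graft_inr_root graft_assoc_lr.
by rewrite /graft_assoc_fun (graft_inrE _ nq) graft_inK.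
Qed.

Lemma graft_assoc_is_hom : is_hom graft_assoc_fun.
Proof.
have key (x : graft (graft S a R) (graft_inr a b) Q) :
    [\/ exists s, x = graft_inl _ Q (graft_inl a R s),
        exists2 r, r != root_edge R & x = graft_inl _ Q (graft_inr a r) |
        exists2 q, q != root_edge Q & x = graft_inr _ q].
  have [[y ->]|[q nq ->]] := graftP x; last by apply: Or33; exists q.
  by have [[s ->]|[r nr ->]] := graftP y; [apply: Or31; exists s|apply: Or32; exists r].
have nl r : r != root_edge R -> graft_inl b Q r != root_edge _.
  by move=> nr; rewrite graft_root (inj_eq (can_inj (@graft_inK _ _ _))).
have nr q : q != root_edge Q -> graft_inr b q != root_edge _.
  by move=> nq; rewrite graft_root graft_inrE (inj_eq (can_inj (@graft_inK _ _ _))).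
apply: is_hom_bij => [x y|y].
  have [[s ->]|[r hr ->]|[q hq ->]] := key x; have [[t ->]|[u hu ->]|[v hv ->]] := key y;
  rewrite ?(graft_assoc_ll, graft_assoc_lr, graft_assoc_r) ?(le_inl_inl, le_inl_inr, le_inr_inl, le_inr_inr) //.
  - by rewrite (negbTE hr) (negbTE (nl _ hr)).
  - by rewrite (negbTE hq) (negbTE (nr _ hq)).
have [[s ->]|[z nz ->]] := graftP y.
  by exists (graft_inl _ Q (graft_inl a R s)); rewrite graft_assoc_ll.
have [[r ->]|[q nq ->]] := graftP z.
  by exists (graft_inl _ Q (graft_inr a r)); rewrite graft_assoc_lr.
by exists (graft_inr _ q); rewrite graft_assoc_r.
Qed.

Definition graft_assoc : hom (graft (graft S a R) (graft_inr a b) Q)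
                             (graft S a (graft R b Q)) := Hom graft_assoc_is_hom.
End GraftAssoc.

(** The canonical isomorphism (S ∘_a R) ∘_b Q -> (S ∘_b Q) ∘_a R. *)
Section GraftExch.
Variables (S : tree) (a b : S) (R Q : tree).

Definition graft_exch_fun (x : graft (graft S a R) (graft_inl a R b) Q) :
    graft (graft S b Q) (graft_inl b Q a) R :=
  match graft_out x with
  | inl y => match graft_out y with
             | inl s => graft_inl _ R (graft_inl b Q s)
             | inr r => graft_inr _ (val r)
             end
  | inr q => graft_inl _ R (graft_inr b (val q))
  end.

Lemma graft_exch_ll s :
  graft_exch_fun (graft_inl _ Q (graft_inl a R s)) = graft_inl _ R (graft_inl b Q s).
Proof. by rewrite /graft_exch_fun !graft_out_inl. Qed.

Lemma graft_exch_lr r :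
  graft_exch_fun (graft_inl _ Q (graft_inr a r)) = graft_inr _ r.
Proof.
have [->|nr] := eqVneq r (root_edge R).
  by rewrite !graft_inr_root graft_exch_ll.
by rewrite /graft_exch_fun graft_out_inl (graft_inrE _ nr) graft_inK.
Qed.

Lemma graft_exch_r q :
  graft_exch_fun (graft_inr (graft_inl a R b) q) = graft_inl _ R (graft_inr b q).
Proof.
have [->|nq] := eqVneq q (root_edge Q); first by rewrite !graft_inr_root graft_exch_ll.
by rewrite /graft_exch_fun (graft_inrE _ nq) graft_inK.
Qed.

Lemma graft_exch_is_hom : is_hom graft_exch_fun.
Proof.
have key (x : graft (graft S a R) (graft_inl a R b) Q) :
    [\/ exists s, x = graft_inl _ Q (graft_inl a R s),
        exists2 r, r != root_edge R & x = graft_inl _ Q (graft_inr a r) |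
        exists2 q, q != root_edge Q & x = graft_inr _ q].
  have [[y ->]|[q nq ->]] := graftP x; last by apply: Or33; exists q.
  by have [[s ->]|[r nr ->]] := graftP y; [apply: Or31; exists s|apply: Or32; exists r].
apply: is_hom_bij => [x y|y].
  have [[s ->]|[r hr ->]|[q hq ->]] := key x; have [[t ->]|[u hu ->]|[v hv ->]] := key y;
  rewrite ?(graft_exch_ll, graft_exch_lr, graft_exch_r) ?(le_inl_inl, le_inl_inr, le_inr_inl, le_inr_inr) //.
have [[z ->]|[r nr ->]] := graftP y; last first.
  by exists (graft_inl _ Q (graft_inr a r)); rewrite graft_exch_lr.
have [[s ->]|[q nq ->]] := graftP z.
  by exists (graft_inl _ Q (graft_inl a R s)); rewrite graft_exch_ll.
by exists (graft_inr _ q); rewrite graft_exch_r.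
Qed.

Definition graft_exch : hom (graft (graft S a R) (graft_inl a R b) Q)
  (graft (graft S b Q) (graft_inl b Q a) R) := Hom graft_exch_is_hom.
End GraftExch.

Section Presentation.
Variables (R : comPzRingType) (G : Type).

Inductive lterm : Type :=
| Lgen of G
| Lzero
| Ladd of lterm & lterm
| Lscale of R & lterm.

Fixpoint leval (V : lmodType R) (f : G -> V) (t : lterm) : V :=
  match t with
  | Lgen g => f g
  | Lzero => 0
  | Ladd t u => leval f t + leval f u
  | Lscale c t => c *: leval f t
  end.

Variable rel : lterm -> lterm -> Prop.

(** The congruence generated by [rel] and the axioms of modules. *)
Inductive lcong : lterm -> lterm -> Prop :=
| lc_rel t u of rel t u : lcong t u
| lc_refl t : lcong t t
| lc_sym t u of lcong t u : lcong u t
| lc_trans t u v of lcong t u & lcong u v : lcong t v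
| lc_add t t' u u' of lcong t t' & lcong u u' : lcong (Ladd t u) (Ladd t' u')
| lc_scale c t t' of lcong t t' : lcong (Lscale c t) (Lscale c t')
| lc_addA t u v : lcong (Ladd t (Ladd u v)) (Ladd (Ladd t u) v)
| lc_addC t u : lcong (Ladd t u) (Ladd u t)
| lc_add0 t : lcong (Ladd Lzero t) t
| lc_addN t : lcong (Ladd (Lscale (-1) t) t) Lzero
| lc_scaleA c c' t : lcong (Lscale c (Lscale c' t)) (Lscale (c * c') t)
| lc_scale1 t : lcong (Lscale 1 t) t
| lc_scaleDr c t u : lcong (Lscale c (Ladd t u)) (Ladd (Lscale c t) (Lscale c u))
| lc_scaleDl c c' t : lcong (Lscale (c + c') t) (Ladd (Lscale c t) (Lscale c' t)).

Definition pres : Type := {C : lterm -> Prop | exists t, C = lcong t}.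

Definition pclass (t : lterm) : pres := exist _ (lcong t) (ex_intro _ t erefl).
Definition pgen (g : G) : pres := pclass (Lgen g).
Definition prepr (x : pres) : lterm := projT1 (cid (svalP x)).

Lemma preprK : cancel prepr pclass.
Proof.
move=> x; rewrite /prepr; case: cid => t /= tE; case: x tE => C hC /= CE.
by subst C; rewrite /pclass; congr exist; apply: Prop_irrelevance.
Qed.

Lemma pclass_eq t u : pclass t = pclass u <-> lcong t u.
Proof.
split=> [[e]|tu]; first by rewrite e; apply: lc_refl.
have e : lcong t = lcong u.
  apply/funext => v; apply/propext; split; first exact/lc_trans/lc_sym.
  exact: lc_trans.
by rewrite /pclass; move: (ex_intro _ t _) (ex_intro _ u _); rewrite e => p q; congr exist; apply: Prop_irrelevance.
Qed.

Lemma preprP t : lcong (prepr (pclass t)) t.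
Proof. by apply/pclass_eq; rewrite preprK. Qed.

HB.instance Definition _ := gen_eqMixin pres.
HB.instance Definition _ := gen_choiceMixin pres.

Definition padd (x y : pres) := pclass (Ladd (prepr x) (prepr y)).
Definition pscale (c : R) (x : pres) := pclass (Lscale c (prepr x)).
Definition popp (x : pres) := pscale (-1) x.

Lemma pclassD t u : padd (pclass t) (pclass u) = pclass (Ladd t u).
Proof. by apply/pclass_eq/lc_add; apply: preprP. Qed.
Lemma pclassZ c t : pscale c (pclass t) = pclass (Lscale c t).
Proof. by apply/pclass_eq/lc_scale; apply: preprP. Qed.
Lemma pclassW (P : pres -> Prop) : (forall t, P (pclass t)) -> forall x, P x.
Proof. by move=> h x; rewrite -[x]preprK. Qed.

Let paddA : associative padd.
Proof.
elim/pclassW => t; elim/pclassW => u; elim/pclassW => v.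
by rewrite !pclassD; apply/pclass_eq/lc_addA.
Qed.
Let paddC : commutative padd.
Proof. by elim/pclassW => t; elim/pclassW => u; rewrite !pclassD; apply/pclass_eq/lc_addC. Qed.
Let padd0 : left_id (pclass Lzero) padd.
Proof. by elim/pclassW => t; rewrite pclassD; apply/pclass_eq/lc_add0. Qed.
Let paddN : left_inverse (pclass Lzero) popp padd.
Proof. by elim/pclassW => t; rewrite /popp pclassZ pclassD; apply/pclass_eq/lc_addN. Qed.
HB.instance Definition _ := GRing.isZmodule.Build pres paddA paddC padd0 paddN.

Let pscaleA c c' x : pscale c (pscale c' x) = pscale (c * c') x.
Proof. by elim/pclassW: x => t; rewrite !pclassZ; apply/pclass_eq/lc_scaleA. Qed.
Let pscale1 : left_id 1 pscale.
Proof. by elim/pclassW => t; rewrite pclassZ; apply/pclass_eq/lc_scale1. Qed.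
Let pscaleDr : right_distributive pscale +%R.
Proof.
move=> c; elim/pclassW => t; elim/pclassW => u.
by rewrite [_ + _]pclassD !pclassZ [_ + _]pclassD; apply/pclass_eq/lc_scaleDr.
Qed.
Let pscaleDl x : {morph pscale^~ x : c c' / c + c'}.
Proof.
by elim/pclassW: x => t c c'; rewrite !pclassZ [RHS]pclassD; apply/pclass_eq/lc_scaleDl.
Qed.
HB.instance Definition _ :=
  GRing.Zmodule_isLmodule.Build R pres pscaleA pscale1 pscaleDr pscaleDl.

Lemma pclass_leval t : pclass t = leval pgen t.
Proof.
elim: t => //= [t IHt u IHu|c t IHt]; first by rewrite -IHt -IHu [RHS]pclassD.
by rewrite -IHt [RHS]pclassZ.
Qed.

Lemma pres_rel t u : rel t u -> leval pgen t = leval pgen u.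
Proof. by move=> tu; rewrite -!pclass_leval; apply/pclass_eq/lc_rel. Qed.

Lemma pres_ind (P : pres -> Prop) :
  (forall g, P (pgen g)) -> P 0 -> (forall x y, P x -> P y -> P (x + y)) ->
  (forall c x, P x -> P (c *: x)) -> forall x, P x.
Proof.
move=> Pg P0 PD PZ; elim/pclassW => t; rewrite pclass_leval.
by elim: t => //= [t IHt u IHu|c t IHt]; [apply: PD|apply: PZ].
Qed.

Lemma pres_ext (V : lmodType R) (f g : {linear pres -> V}) :
  (forall x, f (pgen x) = g (pgen x)) -> f =1 g.
Proof.
move=> fg; elim/pres_ind => //; first by rewrite !linear0.
- by move=> x y fx fy; rewrite !linearD fx fy.
- by move=> c x fx; rewrite !linearZ /= fx.
Qed.

Section Lift.
Variables (V : lmodType R) (f : G -> V).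
Hypothesis hf : forall t u, rel t u -> leval f t = leval f u.

Lemma leval_lcong t u : lcong t u -> leval f t = leval f u.
Proof.
elim=> {t u} //=.
- by move=> t u v _ -> _ ->.
- by move=> t t' u u' _ -> _ ->.
- by move=> c t t' _ ->.
- by move=> t u v; rewrite addrA.
- by move=> t u; rewrite addrC.
- by move=> t; rewrite add0r.
- by move=> t; rewrite scaleN1r addNr.
- by move=> c c' t; rewrite scalerA.
- by move=> t; rewrite scale1r.
- by move=> c t u; rewrite scalerDr.
- by move=> c c' t; rewrite scalerDl.
Qed.

Definition plift_fun (x : pres) : V := leval f (prepr x).

Lemma plift_class t : plift_fun (pclass t) = leval f t.
Proof. exact/leval_lcong/preprP. Qed.

Lemma plift_linear : linear plift_fun.
Proof.
move=> c; elim/pclassW => t; elim/pclassW => u.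
have -> : c *: pclass t + pclass u = pclass (Ladd (Lscale c t) u).
  by rewrite -[c *: _]/(pscale _ _) pclassZ [LHS]pclassD.
by rewrite !plift_class.
Qed.
HB.instance Definition _ := GRing.isLinear.Build R pres V *:%R plift_fun plift_linear.
Definition plift : {linear pres -> V} := plift_fun.

Lemma plift_gen g : plift (pgen g) = f g.
Proof. exact: plift_class. Qed.
End Lift.
End Presentation.
Arguments Lgen {R G}.
Arguments Lzero {R G}.
Arguments Ladd {R G}.
Arguments Lscale {R G}.

Section Complexes.
Variable R : comPzRingType.

Definition ksgn (n : int) : R := (-1) ^+ `|n|%N.

Lemma ksgn_odd n : ksgn n = (-1) ^+ odd `|n|%N.
Proof. by rewrite signr_odd. Qed.
Lemma ksgnD m n : ksgn (m + n) = ksgn m * ksgn n.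
Proof.
rewrite !ksgn_odd -signr_addb; congr (_ ^+ nat_of_bool _); lia.
Qed.
Lemma ksgnB1 n : ksgn (n - 1) = - ksgn n.
Proof. by rewrite ksgnD /ksgn /= expr1 mulrN1. Qed.
Lemma ksgn2 n : ksgn n * ksgn n = 1.
Proof. by rewrite -ksgnD ksgn_odd (_ : odd _ = false) //; lia. Qed.

Record complex := Complex {
  cx_mod :> int -> lmodType R;
  cx_d : forall n, {linear cx_mod n -> cx_mod (n - 1)};
  cx_dd : forall n (x : cx_mod n), cx_d (n - 1) (cx_d n x) = 0 }.

Record chain_map (A B : complex) := ChainMap {
  cm_fun :> forall n, A n -> B n;
  cm_linear : forall n, linear (@cm_fun n);
  cm_d : forall n (x : A n), cm_fun (cx_d A n x) = cx_d B n (cm_fun x) }.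

HB.instance Definition _ (A B : complex) (f : chain_map A B) n :=
  GRing.isLinear.Build R (A n) (B n) *:%R (@cm_fun _ _ f n) (cm_linear f (n := n)).

Lemma chain_map_ext A B (f g : chain_map A B) : (forall n x, f n x = g n x) -> f = g.
Proof.
case: f g => f fl fd [g gl gd] /= e.
have {}e : f = g by apply: functional_extensionality_dep => n; apply/funext => x.
by subst g; congr ChainMap; apply: Prop_irrelevance.
Qed.

Definition cm_id A : chain_map A A :=
  @ChainMap A A (fun n x => x) (fun n c x y => erefl) (fun n x => erefl).

Lemma cm_comp_linear A B C (g : chain_map B C) (f : chain_map A B) n :
  linear (fun x : A n => g n (f n x)).
Proof. by move=> c x y; rewrite !linearP. Qed.
Lemma cm_comp_d A B C (g : chain_map B C) (f : chain_map A B) n (x : A n) :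
  g _ (f _ (cx_d A n x)) = cx_d C n (g n (f n x)).
Proof. by rewrite !cm_d. Qed.
Definition cm_comp A B C (g : chain_map B C) (f : chain_map A B) : chain_map A C :=
  ChainMap (cm_comp_linear g f) (cm_comp_d g f).

(** [f] induces bijections [H_{n-1}(A) -> H_{n-1}(B)] for all integers [n]:
    injectivity and surjectivity on cycles modulo boundaries. *)
Definition quasi_iso A B (f : chain_map A B) : Prop :=
  forall n : int,
    (forall z : A (n - 1), cx_d A _ z = 0 ->
       (exists b : B n, f _ z = cx_d B n b) -> exists a : A n, z = cx_d A n a) /\
    (forall w : B (n - 1), cx_d B _ w = 0 ->
       exists2 z : A (n - 1), cx_d A _ z = 0 &
       exists b : B n, w = f _ z + cx_d B n b).

Section Tensor.
Variables A B : complex.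

Record tsym := Tsym { ts_p : int; ts_q : int; ts_a : A ts_p; ts_b : B ts_q }.

(** [(A ⊗ B)_k] is generated by the [a ⊗ b] with [|a| + |b| = k] (the symbols of
    other degrees are set to zero), modulo bilinearity. *)
Inductive trel (k : int) : lterm R tsym -> lterm R tsym -> Prop :=
| trel_deg p q (a : A p) (b : B q) :
    p + q != k -> trel k (Lgen (Tsym a b)) Lzero
| trel_l p q c (a a' : A p) (b : B q) :
    trel k (Lgen (Tsym (c *: a + a') b))
           (Ladd (Lscale c (Lgen (Tsym a b))) (Lgen (Tsym a' b)))
| trel_r p q c (a : A p) (b b' : B q) :
    trel k (Lgen (Tsym a (c *: b + b')))
           (Ladd (Lscale c (Lgen (Tsym a b))) (Lgen (Tsym a b'))).

Definition tmod (k : int) : lmodType R := pres (trel k).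

Definition ten k p q (a : A p) (b : B q) : tmod k := pgen (trel k) (Tsym a b).

Lemma ten0 k p q (a : A p) (b : B q) : p + q != k -> ten k a b = 0.
Proof. by move=> h; apply: (pres_rel (trel_deg a b h)). Qed.
Lemma ten_linl k p q (b : B q) : linear (fun a : A p => ten k a b).
Proof. by move=> c a a'; apply: (pres_rel (trel_l k c a a' b)). Qed.
Lemma ten_linr k p q (a : A p) : linear (fun b : B q => ten k a b).
Proof. by move=> c b b'; apply: (pres_rel (trel_r k c a b b')). Qed.
Lemma ten_0l k p q (b : B q) : ten k (0 : A p) b = 0.
Proof.
have := ten_linl k b (-1) (0 : A p) 0.
by rewrite scaler0 addr0 scaleN1r addNr.
Qed.
Lemma ten_0r k p q (a : A p) : ten k a (0 : B q) = 0.
Proof.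
have := ten_linr k a (-1) (0 : B q) 0.
by rewrite scaler0 addr0 scaleN1r addNr.
Qed.
Lemma ten_Zr k p q c (a : A p) (b : B q) : ten k a (c *: b) = c *: ten k a b.
Proof. by have := ten_linr k a c b 0; rewrite !addr0 ten_0r addr0. Qed.
Lemma ten_Zl k p q c (a : A p) (b : B q) : ten k (c *: a) b = c *: ten k a b.
Proof. by have := ten_linl k b c a 0; rewrite !addr0 ten_0l addr0. Qed.

Definition bilift (k : int) (V : lmodType R) (f : forall p q, A p -> B q -> V)
  (f0 : forall p q (a : A p) (b : B q), p + q != k -> f p q a b = 0)
  (fl : forall p q (b : B q), linear (fun a : A p => f p q a b))
  (fr : forall p q (a : A p), linear (f p q a)) :
  {linear tmod k -> V}.
Proof.
apply: (@plift R tsym (trel k) V (fun s => f _ _ (ts_a s) (ts_b s))).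
move=> t u [] /=.
- by move=> p q a b /f0.
- by move=> p q c a a' b; apply: fl.
- by move=> p q c a b b'; apply: fr.
Defined.

Lemma biliftE k V f f0 fl fr p q (a : A p) (b : B q) :
  @bilift k V f f0 fl fr (ten k a b) = f p q a b.
Proof. exact: plift_gen. Qed.

Lemma ten_ind k (P : tmod k -> Prop) :
  (forall p q (a : A p) (b : B q), P (ten k a b)) -> P 0 ->
  (forall x y, P x -> P y -> P (x + y)) ->
  (forall c x, P x -> P (c *: x)) -> forall x, P x.
Proof. by move=> Pg; apply: pres_ind => -[p q a b]; apply: Pg. Qed.

Lemma ten_ext k (V : lmodType R) (f g : {linear tmod k -> V}) :
  (forall p q (a : A p) (b : B q), f (ten k a b) = g (ten k a b)) -> f =1 g.
Proof. by move=> fg; apply: pres_ext => -[p q a b]; apply: fg. Qed.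

Definition tdiff_fun k p q (a : A p) (b : B q) : tmod (k - 1) :=
  ten (k - 1) (cx_d A p a) b + ksgn p *: ten (k - 1) a (cx_d B q b).

Lemma tdiff_fun0 k p q (a : A p) (b : B q) : p + q != k -> tdiff_fun k a b = 0.
Proof. by move=> h; rewrite /tdiff_fun !ten0 ?scaler0 ?addr0 //; lia. Qed.
Lemma tdiff_funl k p q (b : B q) : linear (fun a : A p => tdiff_fun k a b).
Proof.
move=> c a a'; rewrite /tdiff_fun linearP !ten_linl !scalerDr !scalerA.
by rewrite (mulrC (ksgn p)) addrACA.
Qed.
Lemma tdiff_funr k p q (a : A p) : linear (fun b : B q => tdiff_fun k a b).
Proof.
move=> c b b'; rewrite /tdiff_fun linearP !ten_linr !scalerDr !scalerA.
by rewrite (mulrC (ksgn p)) addrACA.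
Qed.

Definition tdiff k : {linear tmod k -> tmod (k - 1)} :=
  bilift (@tdiff_fun0 k) (@tdiff_funl k) (@tdiff_funr k).

Lemma tdiffE k p q (a : A p) (b : B q) :
  tdiff k (ten k a b) =
  ten (k - 1) (cx_d A p a) b + ksgn p *: ten (k - 1) a (cx_d B q b).
Proof. exact: biliftE. Qed.

Lemma tdiff_dd k (x : tmod k) : tdiff (k - 1) (tdiff k x) = 0.
Proof.
elim/ten_ind: x; last first.
- by move=> c x IH; rewrite !linearZ /= IH scaler0.
- by move=> x y IHx IHy; rewrite !linearD /= IHx IHy addr0.
- by rewrite !linear0.
move=> p q a b; rewrite tdiffE linearD linearZ /= !tdiffE !cx_dd ten_0l ten_0r.
by rewrite ksgnB1 scaler0 add0r addr0 scaleNr addNr.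
Qed.

Definition tensor : complex := Complex tdiff_dd.
End Tensor.

Section TensorMaps.
Variables A B A' B' : complex.
Variables (f : chain_map A A') (g : chain_map B B').

Let tm_fun k p q (a : A p) (b : B q) : tmod A' B' k := ten k (f p a) (g q b).
Lemma tens_map_0 k p q (a : A p) (b : B q) : p + q != k -> tm_fun k a b = 0.
Proof. exact: ten0. Qed.
Lemma tens_map_l k p q (b : B q) : linear (fun a : A p => tm_fun k a b).
Proof. by move=> c a a'; rewrite /tm_fun linearP ten_linl. Qed.
Lemma tens_map_r k p q (a : A p) : linear (fun b : B q => tm_fun k a b).
Proof. by move=> c b b'; rewrite /tm_fun linearP ten_linr. Qed.

Definition tens_fun k : {linear tmod A B k -> tmod A' B' k} :=
  bilift (@tens_map_0 k) (@tens_map_l k) (@tens_map_r k).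

Lemma tens_funE k p q (a : A p) (b : B q) :
  tens_fun k (ten k a b) = ten k (f p a) (g q b).
Proof. exact: biliftE. Qed.

Lemma tens_fun_d k (x : tmod A B k) :
  tens_fun (k - 1) (tdiff A B k x) = tdiff A' B' k (tens_fun k x).
Proof.
elim/ten_ind: x; last first.
- by move=> c x IH; rewrite !linearZ /= IH.
- by move=> x y IHx IHy; rewrite !linearD /= IHx IHy.
- by rewrite !linear0.
move=> p q a b; rewrite tens_funE !tdiffE linearD linearZ /=.
by rewrite !tens_funE !cm_d.
Qed.

Definition tens_map : chain_map (tensor A B) (tensor A' B') :=
  @ChainMap (tensor A B) (tensor A' B') (fun k => tens_fun k)
    (fun k => linearP (tens_fun k)) tens_fun_d.
End TensorMaps.

(** [(a ⊗ b) ⊗ c ↦ a ⊗ (b ⊗ c)] and [(a ⊗ b) ⊗ c ↦ (-1)^{|b||c|} (a ⊗ c) ⊗ b]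
    (lemmas [tens_assocE] and [tens_exchE]).  For [a ⊗ b] of degree [p], the
    inner degrees below vanish unless [|a| + |b| = p]. *)
Section Associator.
Variables A B C : complex.

Section Nested.
Variable V : lmodType R.
Variable k : int.
Variable f : forall (p q p' q' : int), A p' -> B q' -> C q -> V.
Hypothesis f0 : forall p q p' q' (a : A p') (b : B q') (c : C q),
  (p + q != k) || (p' + q' != p) -> f p a b c = 0.
Hypothesis fa : forall p q p' q' (b : B q') (c : C q), linear (fun a : A p' => f p a b c).
Hypothesis fb : forall p q p' q' (a : A p') (c : C q), linear (fun b : B q' => f p a b c).
Hypothesis fc : forall p q p' q' (a : A p') (b : B q'), linear (fun c : C q => f p a b c).

Lemma nest0 p q (c : C q) p' q' (a : A p') (b : B q') :
  p' + q' != p -> f p a b c = 0.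
Proof. by move=> h; apply: f0; rewrite h orbT. Qed.

Definition nest_inner p q (u : tensor A B p) (c : C q) : V :=
  bilift (@nest0 p q c) (fun p' q' b => @fa p q p' q' b c)
         (fun p' q' a => @fb p q p' q' a c) u.

Lemma nest_innerE p q p' q' (a : A p') (b : B q') (c : C q) :
  nest_inner (ten p a b) c = f p a b c.
Proof. exact: biliftE. Qed.
Lemma nest_inner_l p q (c : C q) : linear (fun u : tensor A B p => nest_inner u c).
Proof. by move=> e u v; rewrite /nest_inner linearP. Qed.
Lemma nest_inner0 p q (c : C q) : nest_inner (0 : tmod A B p) c = 0.
Proof. exact: linear0. Qed.
Lemma nest_innerD p q (u v : tmod A B p) (c : C q) :
  nest_inner (u + v) c = nest_inner u c + nest_inner v c.
Proof. exact: linearD. Qed.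
Lemma nest_innerZ p q e (u : tmod A B p) (c : C q) :
  nest_inner (e *: u) c = e *: nest_inner u c.
Proof. exact: linearZ. Qed.
Lemma nest_inner_r p q (u : tensor A B p) : linear (fun c : C q => nest_inner u c).
Proof.
move=> e c c'; elim/ten_ind: u.
- by move=> p' q' a b; rewrite !nest_innerE fc.
- by rewrite !nest_inner0 scaler0 addr0.
- by move=> u v IHu IHv; rewrite !nest_innerD IHu IHv scalerDr addrACA.
- by move=> d u IH; rewrite !nest_innerZ IH scalerDr !scalerA (mulrC d).
Qed.
Lemma nest_inner_0 p q (u : tensor A B p) (c : C q) : p + q != k -> nest_inner u c = 0.
Proof.
move=> h; elim/ten_ind: u.
- by move=> p' q' a b; rewrite nest_innerE f0 // h.
- exact: nest_inner0.
- by move=> u v IHu IHv; rewrite nest_innerD IHu IHv addr0.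
- by move=> d u IH; rewrite nest_innerZ IH scaler0.
Qed.

Definition nest : {linear tensor (tensor A B) C k -> V} :=
  bilift nest_inner_0 (fun p q b => @nest_inner_l p q b) nest_inner_r.

Lemma nestE p q p' q' (a : A p') (b : B q') (c : C q) :
  nest (ten k (ten p a b : tensor A B p) c) = f p a b c.
Proof. by rewrite /nest biliftE nest_innerE. Qed.
End Nested.

Definition assoc_fun k p q p' q' (a : A p') (b : B q') (c : C q) :
    tensor A (tensor B C) k :=
  ten k a (ten (p - p' + q) b c : tensor B C _).

Definition tens_assoc_lin k : {linear tensor (tensor A B) C k -> tensor A (tensor B C) k}.
Proof.
apply: (@nest _ k (@assoc_fun k)); rewrite /assoc_fun.
- move=> p q p' q' a b c h; have [e|ne] := eqVneq (p' + q') p.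
    by rewrite ten0 //; move: h; lia.
  by rewrite (@ten0 B C) ?ten_0r //; lia.
- by move=> p q p' q' b c e a a'; rewrite ten_linl.
- by move=> p q p' q' a c e b b'; rewrite ten_linl ten_linr.
- by move=> p q p' q' a b e c c'; rewrite !ten_linr.
Defined.

Lemma tens_assocE k p q r (a : A p) (b : B q) (c : C r) :
  tens_assoc_lin k (ten k (ten (p + q) a b : tensor A B _) c) =
  ten k a (ten (q + r) b c : tensor B C _).
Proof.
rewrite /tens_assoc_lin nestE /assoc_fun; congr (ten k a (ten _ b c : tensor B C _)).
lia.
Qed.

Definition exch_fun k p q p' q' (a : A p') (b : B q') (c : C q) :
    tensor (tensor A C) B k :=
  ksgn (q' * q) *: ten k (ten (p - q' + q) a c : tensor A C _) b.

Definition tens_exch_lin k : {linear tensor (tensor A B) C k -> tensor (tensor A C) B k}.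
Proof.
apply: (@nest _ k (@exch_fun k)); rewrite /exch_fun.
- move=> p q p' q' a b c h; have [e|ne] := eqVneq (p' + q') p.
    by rewrite (@ten0 (tensor A C) B) ?scaler0 //; move: h; lia.
  by rewrite (@ten0 A C) ?ten_0l ?scaler0 //; lia.
- by move=> p q p' q' b c e a a'; rewrite !ten_linl scalerDr !scalerA (mulrC e).
- by move=> p q p' q' a c e b b'; rewrite ten_linr scalerDr !scalerA (mulrC e).
- by move=> p q p' q' a b e c c'; rewrite ten_linr ten_linl scalerDr !scalerA (mulrC e).
Defined.

Lemma tens_exchE k p q r (a : A p) (b : B q) (c : C r) :
  tens_exch_lin k (ten k (ten (p + q) a b : tensor A B _) c) =
  ksgn (q * r) *: ten k (ten (p + r) a c : tensor A C _) b.
Proof.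
rewrite /tens_exch_lin nestE /exch_fun; congr (_ *: ten k (ten _ a c : tensor A C _) b).
lia.
Qed.
End Associator.
End Complexes.
Arguments tens_assoc_lin {R A B C} k.
Arguments tens_exch_lin {R A B C} k.

Section Operads.
Variable R : comPzRingType.

Record presheaf := Presheaf {
  psh_ob :> tree -> complex R;
  psh_map : forall S T, hom S T -> chain_map (psh_ob T) (psh_ob S);
  psh_id : forall S n (x : psh_ob S n), psh_map (hom_id S) n x = x;
  psh_comp : forall S T U (g : hom T U) (f : hom S T) n (x : psh_ob U n),
    psh_map (hom_comp g f) n x = psh_map f n (psh_map g n x) }.

Record copresheaf := Copresheaf {
  cps_ob :> tree -> complex R;
  cps_map : forall S T, hom S T -> chain_map (cps_ob S) (cps_ob T);
  cps_id : forall S n (y : cps_ob S n), cps_map (hom_id S) n y = y;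
  cps_comp : forall S T U (g : hom T U) (f : hom S T) n (y : cps_ob S n),
    cps_map (hom_comp g f) n y = cps_map g n (cps_map f n y) }.

(** [preoperad], [precooperad], [operad], [cooperad] are the linear
    ∞-preoperads, ∞-precooperads, ∞-operads and ∞-cooperads.
    In the two (co)associativity equations, the trees that coincide only up to
    canonical isomorphism are identified through [graft_assoc] and
    [graft_exch].  The side conditions on leaves and vertices of grafted or
    target trees always hold, by [hom_leaf], [hom_has_vertex],
    [graft_leaf_inl], [graft_leaf_inr] and [graft_has_vertex]. *)
Record preoperad := Preoperad {
  po_psh :> presheaf;
  po_theta : forall S (a : S) Q, leaf a -> has_vertex S -> has_vertex Q ->
    chain_map (po_psh (graft S a Q)) (tensor (po_psh S) (po_psh Q));
  po_natural : forall S S' Q Q' (f : hom S S') (g : hom Q Q') (a : S)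
    (la : leaf a) (vS : has_vertex S) (vQ : has_vertex Q)
    (la' : leaf (f a)) (vS' : has_vertex S') (vQ' : has_vertex Q')
    n (x : po_psh (graft S' (f a) Q') n),
    po_theta la vS vQ n (psh_map po_psh (graft_hom f a g) n x) =
    tens_map (psh_map po_psh f) (psh_map po_psh g) n (po_theta la' vS' vQ' n x);
  po_assoc : forall S Q P (a : S) (b : Q)
    (la : leaf a) (lb : leaf b) (lb' : leaf (graft_inr a b))
    (vS : has_vertex S) (vQ : has_vertex Q) (vP : has_vertex P)
    (vSQ : has_vertex (graft S a Q)) (vQP : has_vertex (graft Q b P))
    n (x : po_psh (graft S a (graft Q b P)) n),
    tens_map (cm_id _) (po_theta lb vQ vP) n (po_theta la vS vQP n x) =
    tens_assoc_lin n
      (tens_map (po_theta la vS vQ) (cm_id _) n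
         (po_theta lb' vSQ vP n (psh_map po_psh (graft_assoc a b P) n x)));
  po_exch : forall S Q P (a b : S)
    (la : leaf a) (lb : leaf b) (nab : a != b)
    (lb' : leaf (graft_inl a Q b)) (la' : leaf (graft_inl b P a))
    (vS : has_vertex S) (vQ : has_vertex Q) (vP : has_vertex P)
    (vSQ : has_vertex (graft S a Q)) (vSP : has_vertex (graft S b P))
    n (x : po_psh (graft (graft S b P) (graft_inl b P a) Q) n),
    tens_map (po_theta la vS vQ) (cm_id _) n
      (po_theta lb' vSQ vP n (psh_map po_psh (graft_exch a b Q P) n x)) =
    tens_exch_lin n
      (tens_map (po_theta lb vS vP) (cm_id _) n (po_theta la' vSP vQ n x)) }.

Record precooperad := Precooperad {
  pc_cps :> copresheaf;
  pc_theta : forall S (a : S) Q, leaf a -> has_vertex S -> has_vertex Q ->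
    chain_map (pc_cps (graft S a Q)) (tensor (pc_cps S) (pc_cps Q));
  pc_natural : forall S S' Q Q' (f : hom S S') (g : hom Q Q') (a : S)
    (la : leaf a) (vS : has_vertex S) (vQ : has_vertex Q)
    (la' : leaf (f a)) (vS' : has_vertex S') (vQ' : has_vertex Q')
    n (y : pc_cps (graft S a Q) n),
    pc_theta la' vS' vQ' n (cps_map pc_cps (graft_hom f a g) n y) =
    tens_map (cps_map pc_cps f) (cps_map pc_cps g) n (pc_theta la vS vQ n y);
  pc_assoc : forall S Q P (a : S) (b : Q)
    (la : leaf a) (lb : leaf b) (lb' : leaf (graft_inr a b))
    (vS : has_vertex S) (vQ : has_vertex Q) (vP : has_vertex P)
    (vSQ : has_vertex (graft S a Q)) (vQP : has_vertex (graft Q b P))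
    n (y : pc_cps (graft (graft S a Q) (graft_inr a b) P) n),
    tens_map (cm_id _) (pc_theta lb vQ vP) n
      (pc_theta la vS vQP n (cps_map pc_cps (graft_assoc a b P) n y)) =
    tens_assoc_lin n
      (tens_map (pc_theta la vS vQ) (cm_id _) n (pc_theta lb' vSQ vP n y));
  pc_exch : forall S Q P (a b : S)
    (la : leaf a) (lb : leaf b) (nab : a != b)
    (lb' : leaf (graft_inl a Q b)) (la' : leaf (graft_inl b P a))
    (vS : has_vertex S) (vQ : has_vertex Q) (vP : has_vertex P)
    (vSQ : has_vertex (graft S a Q)) (vSP : has_vertex (graft S b P))
    n (y : pc_cps (graft (graft S a Q) (graft_inl a Q b) P) n),
    tens_map (pc_theta la vS vQ) (cm_id _) n (pc_theta lb' vSQ vP n y) =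
    tens_exch_lin n
      (tens_map (pc_theta lb vS vP) (cm_id _) n
         (pc_theta la' vSP vQ n (cps_map pc_cps (graft_exch a b Q P) n y))) }.

Record operad := Operad {
  op_pre :> preoperad;
  op_qi : forall S (a : S) Q (la : leaf a) (vS : has_vertex S) (vQ : has_vertex Q),
    quasi_iso (po_theta op_pre la vS vQ) }.

Record cooperad := Cooperad {
  co_pre :> precooperad;
  co_qi : forall S (a : S) Q (la : leaf a) (vS : has_vertex S) (vQ : has_vertex Q),
    quasi_iso (pc_theta co_pre la vS vQ) }.

Record operad_mor (M N : preoperad) := OperadMor {
  om_fun :> forall T, chain_map (M T) (N T);
  om_natural : forall S T (f : hom S T) n (x : M T n),
    om_fun S n (psh_map M f n x) = psh_map N f n (om_fun T n x);
  om_theta : forall S (a : S) Q (la : leaf a) (vS : has_vertex S)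
    (vQ : has_vertex Q) n (x : M (graft S a Q) n),
    tens_map (om_fun S) (om_fun Q) n (po_theta M la vS vQ n x) =
    po_theta N la vS vQ n (om_fun _ n x) }.

Record cooperad_mor (Y Z : precooperad) := CooperadMor {
  cmor_fun :> forall T, chain_map (Y T) (Z T);
  cmor_natural : forall S T (f : hom S T) n (y : Y S n),
    cmor_fun T n (cps_map Y f n y) = cps_map Z f n (cmor_fun S n y);
  cmor_theta : forall S (a : S) Q (la : leaf a) (vS : has_vertex S)
    (vQ : has_vertex Q) n (y : Y (graft S a Q) n),
    tens_map (cmor_fun S) (cmor_fun Q) n (pc_theta Y la vS vQ n y) =
    pc_theta Z la vS vQ n (cmor_fun _ n y) }.

Lemma tens_map_id (A B : complex R) n (x : tensor A B n) :
  tens_map (cm_id A) (cm_id B) n x = x.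
Proof.
exact: (@ten_ext _ A B n _ (tens_fun (cm_id A) (cm_id B) n) idfun
  (fun p q a b => tens_funE _ _ _ _ _)).
Qed.

Lemma tens_map_comp (A B A' B' A'' B'' : complex R) (f : chain_map A A')
  (g : chain_map B B') (f' : chain_map A' A'') (g' : chain_map B' B'') n x :
  tens_map (cm_comp f' f) (cm_comp g' g) n x =
  tens_map f' g' n (tens_map f g n x).
Proof.
apply: (@ten_ext _ A B n _ (tens_fun (cm_comp f' f) (cm_comp g' g) n)
   (tens_fun f' g' n \o tens_fun f g n)) => p q a b.
by rewrite tens_funE -[RHS]/(tens_fun f' g' n (tens_fun f g n _)) !tens_funE.
Qed.

Lemma operad_mor_ext M N (f g : operad_mor M N) :
  (forall T n x, f T n x = g T n x) -> f = g.
Proof.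
case: f g => f fn ft [g gn gt] /= e.
have {}e : f = g by apply: functional_extensionality_dep => T; apply: chain_map_ext.
by subst g; congr OperadMor; apply: Prop_irrelevance.
Qed.

Lemma cooperad_mor_ext Y Z (f g : cooperad_mor Y Z) :
  (forall T n y, f T n y = g T n y) -> f = g.
Proof.
case: f g => f fn ft [g gn gt] /= e.
have {}e : f = g by apply: functional_extensionality_dep => T; apply: chain_map_ext.
by subst g; congr CooperadMor; apply: Prop_irrelevance.
Qed.

Definition operad_id (M : preoperad) : operad_mor M M.
Proof.
by apply: (@OperadMor M M (fun T => cm_id (M T))) => // *; apply: tens_map_id.
Defined.

Definition operad_comp (M N P : preoperad) (g : operad_mor N P)
  (f : operad_mor M N) : operad_mor M P.
Proof.
exists (fun T => cm_comp (g T) (f T)).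
- by move=> S T h n x; rewrite /= !om_natural.
- by move=> S a Q la vS vQ n x; rewrite tens_map_comp !om_theta.
Defined.

Definition cooperad_id (Y : precooperad) : cooperad_mor Y Y.
Proof.
by apply: (@CooperadMor Y Y (fun T => cm_id (Y T))) => // *; apply: tens_map_id.
Defined.

Definition cooperad_comp (Y Z W : precooperad) (g : cooperad_mor Z W)
  (f : cooperad_mor Y Z) : cooperad_mor Y W.
Proof.
exists (fun T => cm_comp (g T) (f T)).
- by move=> S T h n x; rewrite /= !cmor_natural.
- by move=> S a Q la vS vQ n x; rewrite tens_map_comp !cmor_theta.
Defined.
End Operads.

Record category := Category {
  c_ob :> Type;
  c_hom : c_ob -> c_ob -> Type;
  c_id : forall X, c_hom X X;
  c_comp : forall X Y Z, c_hom Y Z -> c_hom X Y -> c_hom X Z;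
  c_idl : forall X Y (f : c_hom X Y), c_comp (c_id Y) f = f;
  c_idr : forall X Y (f : c_hom X Y), c_comp f (c_id X) = f;
  c_assoc : forall X Y Z W (h : c_hom Z W) (g : c_hom Y Z) (f : c_hom X Y),
    c_comp h (c_comp g f) = c_comp (c_comp h g) f }.

Record functor (C D : category) := Functor {
  f_ob :> C -> D;
  f_hom : forall X Y, c_hom X Y -> c_hom (f_ob X) (f_ob Y);
  f_id : forall X, f_hom (c_id X) = c_id (f_ob X);
  f_comp : forall X Y Z (g : c_hom Y Z) (f : c_hom X Y),
    f_hom (c_comp g f) = c_comp (f_hom g) (f_hom f) }.

(** [adjunction F G]: [F] is left adjoint to [G]. *)
Record adjunction (C D : category) (F : functor C D) (G : functor D C) := Adjunction {
  adj_unit : forall X : C, c_hom X (G (F X));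
  adj_counit : forall Z : D, c_hom (F (G Z)) Z;
  adj_unit_natural : forall (X Y : C) (f : c_hom X Y),
    c_comp (adj_unit Y) f = c_comp (f_hom G (f_hom F f)) (adj_unit X);
  adj_counit_natural : forall (Z W : D) (g : c_hom Z W),
    c_comp g (adj_counit Z) = c_comp (adj_counit W) (f_hom F (f_hom G g));
  adj_triangle_l : forall X : C,
    c_comp (adj_counit (F X)) (f_hom F (adj_unit X)) = c_id (F X);
  adj_triangle_r : forall Z : D,
    c_comp (f_hom G (adj_counit Z)) (adj_unit (G Z)) = c_id (G Z) }.

Definition Operads (R : comPzRingType) : category.
Proof.
exists (operad R) (fun M N => operad_mor M N) (fun M => operad_id M)
  (fun M N L g f => operad_comp g f) => *; exact: operad_mor_ext.
Defined.

Definition Cooperads (R : comPzRingType) : category.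
Proof.
exists (cooperad R) (fun Y Z => cooperad_mor Y Z) (fun Y => cooperad_id Y)
  (fun Y Z W g f => cooperad_comp g f) => *; exact: cooperad_mor_ext.
Defined.

Definition iso_under S T T' (f : hom S T) (f' : hom S T') : Prop :=
  exists2 t : hom T T', isom t & hom_comp t f = f'.

(** [v] is the sum of [F f] over the isomorphism classes (under [S]) of the
    morphisms [f] with source [S] satisfying [P]; that is, there are finitely
    many classes and [v] is the sum over a system of representatives. *)
Definition class_sum S (P : forall T, hom S T -> Prop) (V : zmodType)
    (F : forall T, hom S T -> V) (v : V) : Prop :=
  exists n (rep : 'I_n -> {T : tree & hom S T}),
    [/\ forall i, P _ (projT2 (rep i)),
        forall T (f : hom S T), P T f ->
          exists! i, iso_under f (projT2 (rep i)) &
        v = \sum_(i < n) F _ (projT2 (rep i))].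

(** [sσ = (s_{σ 0}, ..., s_{σ (k - 1)})] *)
Definition perm_enum T (s : seq T) (sigma : 'S_(size s)) : seq T :=
  [seq tnth (in_tuple s) (sigma i) | i <- enum 'I_(size s)].

Section Bar.
Variable R : comPzRingType.

Section BarModule.
Variable M : presheaf R.

(** [BarSym α d e x] stands for [[α, d|e, sx]], where [x] has degree [bs_n]
    and [sx] degree [bs_n + 1]. *)
Record bar_sym (S : tree) := BarSym {
  bs_T : tree;
  bs_hom : hom S bs_T;
  bs_d : seq S;
  bs_e : seq bs_T;
  bs_n : int;
  bs_x : M bs_T bs_n }.

Definition bar_deg S (s : bar_sym S) : int :=
  bs_n s + 1 + (size (bs_d s))%:Z + (size (bs_e s))%:Z.

Definition bar_ok S (s : bar_sym S) : bool :=
  is_enum (bs_d s) (inner S) && is_enum (bs_e s) (new_edges (bs_hom s)).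

(** The degree [k] part is generated by the symbols of degree [k] in which [d]
    and [e] are enumerations as required; the other symbols are set to zero. *)
Inductive bar_rel S (k : int) : lterm R (bar_sym S) -> lterm R (bar_sym S) -> Prop :=
| bar_rel_zero (s : bar_sym S) :
    ~~ ((bar_deg s == k) && bar_ok s) -> bar_rel k (Lgen s) Lzero
| bar_rel_linear T (f : hom S T) d e n c (x x' : M T n) :
    bar_rel k (Lgen (BarSym f d e (c *: x + x')))
      (Ladd (Lscale c (Lgen (BarSym f d e x))) (Lgen (BarSym f d e x')))
| bar_rel_iso T T' (t : hom T T') (f : hom S T) d e n (x' : M T' n) :
    isom t ->
    bar_rel k (Lgen (BarSym f d e (psh_map M t n x')))
      (Lgen (BarSym (hom_comp t f) d (map t e) x'))
| bar_rel_perm T (f : hom S T) d e n (x : M T n)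
    (sigma : 'S_(size d)) (tau : 'S_(size e)) :
    bar_rel k (Lgen (BarSym f d e x))
      (Lscale ((-1) ^+ sigma * (-1) ^+ tau)
         (Lgen (BarSym f (perm_enum sigma) (perm_enum tau) x))).

Definition bar_mod S (k : int) : lmodType R := pres (@bar_rel S k).
End BarModule.

(** [C] is the bar construction of [M]: its modules are identified with
    [bar_mod M S k] in such a way that the differential, the functoriality and
    the structure maps are given by the formulas on the generating symbols.
    The relations bring every symbol to the form required by [bm_map] or
    [bm_theta], so [C] is determined by these formulas. In [bm_theta], every
    expression of [θ(x)] as a sum of tensors [x_1 ⊗ x_2] is allowed. *)
Record bar_model (M : preoperad R) (C : precooperad R) := BarModel {
  bm_iso : forall S k, {linear bar_mod M S k -> C S k};
  bm_bij : forall S k, bijective (bm_iso S k);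
  bm_cls := fun S k (s : bar_sym M S) => bm_iso S k (pgen _ s) : C S k;

  bm_d : forall S T (f : hom S T) d e n (x : M T n)
      (hd : is_enum d (inner S)) (he : is_enum e (new_edges f)),
    let k := bar_deg (BarSym f d e x) in
    cx_d (C S) k (bm_cls k (BarSym f d e x)) =
      \sum_(i < size e)
        ksgn R ((size d)%:Z + i%:Z) *:
        bm_cls (k - 1)
          (BarSym (face_lift (enum_new_notin he i)) d
             (face_seq (tnth (in_tuple e) i) e)
             (psh_map M (face_hom (tnth (in_tuple e) i)) n x))
      (* the differential of [sM] is [s x |-> - s (∂ x)] *)
      + ksgn R ((size d)%:Z + (size e)%:Z) *:
        bm_cls (k - 1) (BarSym f d e (- cx_d (M T) n x));

  bm_map : forall S S' T (g : hom S S') (h : hom S' T) d (c : seq S') e n (x : M T n),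
    is_enum d (inner S) -> is_enum c (new_edges g) -> is_enum e (new_edges h) ->
    let s := BarSym (hom_comp h g) d (map h c ++ e) x in
    cps_map C g (bar_deg s) (bm_cls (bar_deg s) s) =
    bm_cls (bar_deg s) (BarSym h (map g d ++ c) e x);

  bm_map0 : forall S S' T (g : hom S S') (f : hom S T) d e n (x : M T n),
    (forall h : hom S' T, f <> hom_comp h g) ->
    let s := BarSym f d e x in
    cps_map C g (bar_deg s) (bm_cls (bar_deg s) s) = 0;

  bm_theta : forall S (a : S) Q (la : leaf a) (vS : has_vertex S) (vQ : has_vertex Q)
      S' Q' (f : hom S S') (g : hom Q Q')
      (la' : leaf (f a)) (vS' : has_vertex S') (vQ' : has_vertex Q')
      (dS : seq S) (dQ : seq Q) (eS : seq S') (eQ : seq Q')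
      n (x : M (graft S' (f a) Q') n) (l : seq (tsym (M S') (M Q'))),
    is_enum dS (inner S) -> is_enum dQ (inner Q) ->
    is_enum eS (new_edges f) -> is_enum eQ (new_edges g) ->
    po_theta M la' vS' vQ' n x = \sum_(t <- l) ten n (ts_a t) (ts_b t) ->
    let s := BarSym (graft_hom f a g)
      (graft_inl a Q a :: map (graft_inl a Q) dS ++ map (graft_inr a) dQ)
      (map (graft_inl (f a) Q') eS ++ map (graft_inr (f a)) eQ) x in
    pc_theta C la vS vQ (bar_deg s) (bm_cls (bar_deg s) s) =
    \sum_(t <- l)
      let: (ds, es, dr, er) := ((size dS)%:Z, (size eS)%:Z, (size dQ)%:Z, (size eQ)%:Z) in
      let s1 := BarSym f dS eS (ts_a t) in
      let s2 := BarSym g dQ eQ (ts_b t) in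
      ksgn R (1 + ds + es + dr + er + es * dr
              + (dr + er) * (ts_p t + 1) + ts_p t) *:
      ten (bar_deg s) (bm_cls (bar_deg s1) s1) (bm_cls (bar_deg s2) s2) }.
End Bar.

Section Cobar.
Variable R : comPzRingType.

Section CobarModule.
Variable Y : copresheaf R.

(** [CobarSym α b d y] stands for [[α, b|d, s^{-1}y]], where [y] has degree
    [cs_n] and [s^{-1}y] degree [cs_n - 1]. *)
Record cobar_sym (S : tree) := CobarSym {
  cs_T : tree;
  cs_hom : hom S cs_T;
  cs_b : seq S;
  cs_d : seq cs_T;
  cs_n : int;
  cs_y : Y cs_T cs_n }.

Definition cobar_deg S (s : cobar_sym S) : int :=
  cs_n s - 1 - (size (cs_b s))%:Z - (size (cs_d s))%:Z.

Definition cobar_ok S (s : cobar_sym S) : bool :=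
  is_enum (cs_b s) (inner S) && is_enum (cs_d s) (new_edges (cs_hom s)).

Inductive cobar_rel S (k : int) :
    lterm R (cobar_sym S) -> lterm R (cobar_sym S) -> Prop :=
| cobar_rel_zero (s : cobar_sym S) :
    ~~ ((cobar_deg s == k) && cobar_ok s) -> cobar_rel k (Lgen s) Lzero
| cobar_rel_linear T (f : hom S T) b d n c (y y' : Y T n) :
    cobar_rel k (Lgen (CobarSym f b d (c *: y + y')))
      (Ladd (Lscale c (Lgen (CobarSym f b d y))) (Lgen (CobarSym f b d y')))
| cobar_rel_iso T T' (t : hom T T') (f : hom S T) b d n (y : Y T n) :
    isom t ->
    cobar_rel k (Lgen (CobarSym f b d y))
      (Lgen (CobarSym (hom_comp t f) b (map t d) (cps_map Y t n y)))
| cobar_rel_perm T (f : hom S T) b d n (y : Y T n)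
    (sigma : 'S_(size b)) (tau : 'S_(size d)) :
    cobar_rel k (Lgen (CobarSym f b d y))
      (Lscale ((-1) ^+ sigma * (-1) ^+ tau)
         (Lgen (CobarSym f (perm_enum sigma) (perm_enum tau) y))).

Definition cobar_mod S (k : int) : lmodType R := pres (@cobar_rel S k).
End CobarModule.

Record cobar_model (Y : precooperad R) (M : preoperad R) := CobarModel {
  cbm_iso : forall S k, {linear cobar_mod Y S k -> M S k};
  cbm_bij : forall S k, bijective (cbm_iso S k);
  cbm_cls := fun S k (s : cobar_sym Y S) => cbm_iso S k (pgen _ s) : M S k;

  cbm_d : forall S T (f : hom S T) b d n (y : Y T n),
    is_enum b (inner S) -> is_enum d (new_edges f) ->
    let k := cobar_deg (CobarSym f b d y) in
    exists2 v : M S (k - 1),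
      (* [enum (new_edges g)] is the singleton of the new edge of [g] *)
      class_sum (fun T' (g : hom T T') => codim g = 1%N)
        (fun T' g => cbm_cls (k - 1)
           (CobarSym (hom_comp g f) b (map g d ++ enum (new_edges g))
              (cps_map Y g n y))) v &
      cx_d (M S) k (cbm_cls k (CobarSym f b d y)) =
        v + ksgn R ((size b)%:Z + (size d)%:Z) *:
            cbm_cls (k - 1) (CobarSym f b d (- cx_d (Y T) n y));

  cbm_map : forall S' S T (g : hom S' S) (f : hom S T) (b' : seq S') b'' d n (y : Y T n),
    is_enum b' (inner S') -> is_enum b'' (new_edges g) -> is_enum d (new_edges f) ->
    let s := CobarSym f (map g b' ++ b'') d y in
    psh_map M g (cobar_deg s) (cbm_cls (cobar_deg s) s) =
    cbm_cls (cobar_deg s) (CobarSym (hom_comp f g) b' (map f b'' ++ d) y);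

  cbm_theta : forall S (a : S) Q (la : leaf a) (vS : has_vertex S) (vQ : has_vertex Q)
      S' Q' (f : hom S S') (g : hom Q Q')
      (la' : leaf (f a)) (vS' : has_vertex S') (vQ' : has_vertex Q')
      (dS : seq S) (dQ : seq Q) (eS : seq S') (eQ : seq Q')
      n (y : Y (graft S' (f a) Q') n) (l : seq (tsym (Y S') (Y Q'))),
    is_enum dS (inner S) -> is_enum dQ (inner Q) ->
    is_enum eS (new_edges f) -> is_enum eQ (new_edges g) ->
    pc_theta Y la' vS' vQ' n y = \sum_(t <- l) ten n (ts_a t) (ts_b t) ->
    let s := CobarSym (graft_hom f a g)
      (graft_inl a Q a :: map (graft_inl a Q) dS ++ map (graft_inr a) dQ)
      (map (graft_inl (f a) Q') eS ++ map (graft_inr (f a)) eQ) y in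
    po_theta M la vS vQ (cobar_deg s) (cbm_cls (cobar_deg s) s) =
    \sum_(t <- l)
      let: (ds, es, dr, er) := ((size dS)%:Z, (size eS)%:Z, (size dQ)%:Z, (size eQ)%:Z) in
      let s1 := CobarSym f dS eS (ts_a t) in
      let s2 := CobarSym g dQ eQ (ts_b t) in
      ksgn R ((ds + es) * (dr + er) + dr * es + ts_p t
              + (dr + er) * (ts_p t - 1)) *:
      ten (cobar_deg s) (cbm_cls (cobar_deg s1) s1) (cbm_cls (cobar_deg s2) s2) }.
End Cobar.

Section Functors.
Variable R : comPzRingType.

Section BarFunctor.
Variable B : functor (Operads R) (Cooperads R).
Variable mB : forall M : operad R, bar_model M (B M : cooperad R).

Definition bar_functorial : Prop :=
  forall (M N : operad R) (phi : operad_mor M N) S T (f : hom S T) d e n (x : M T n),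
    let s := BarSym f d e x in
    (f_hom B (phi : c_hom (M : Operads R) N) : cooperad_mor _ _) S (bar_deg s)
      (bm_cls (mB M) (bar_deg s) s) =
    bm_cls (mB N) (bar_deg s) (BarSym f d e (phi T n x)).

Variable Bv : functor (Cooperads R) (Operads R).
Variable mBv : forall Y : cooperad R, cobar_model Y (Bv Y : operad R).

Definition cobar_functorial : Prop :=
  forall (Y Z : cooperad R) (phi : cooperad_mor Y Z) S T (f : hom S T) b d n (y : Y T n),
    let s := CobarSym f b d y in
    (f_hom Bv (phi : c_hom (Y : Cooperads R) Z) : operad_mor _ _) S (cobar_deg s)
      (cbm_cls (mBv Y) (cobar_deg s) s) =
    cbm_cls (mBv Z) (cobar_deg s) (CobarSym f b d (phi T n y)).

(** [η_S(y) = Σ_{[α]} [α, a|e, s[id, (αa, e)|∅, s^{-1}α_* y]]], for any choice of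
    the enumerations. *)
Definition is_bar_unit
    (eta : forall Y : cooperad R, cooperad_mor Y (B (Bv Y) : cooperad R)) : Prop :=
  forall (Y : cooperad R) S n (y : Y S n) (a : seq S) (e : forall T, hom S T -> seq T),
    is_enum a (inner S) -> (forall T (f : hom S T), is_enum (e T f) (new_edges f)) ->
    class_sum (fun T (f : hom S T) => True)
      (fun T f =>
         let u := CobarSym (hom_id T) (map f a ++ e T f) [::] (cps_map Y f n y) in
         bm_cls (mB (Bv Y)) n (BarSym f a (e T f) (cbm_cls (mBv Y) (cobar_deg u) u)))
      (eta Y S n y).

(** [ε_S[α, a|e, s^{-1}[β, (αa, e)|f, sx]]] *)
Definition is_bar_counit
    (eps : forall M : operad R, operad_mor (Bv (B M) : operad R) M) : Prop :=
  forall (M : operad R) S T U (alpha : hom S T) (beta : hom T U) n (x : M U n)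
    (a : seq S) (e : seq T) (f : seq U),
    is_enum a (inner S) -> is_enum e (new_edges alpha) -> is_enum f (new_edges beta) ->
    let v := BarSym beta (map alpha a ++ e) f x in
    let w := CobarSym alpha a e (bm_cls (mB M) (bar_deg v) v) in
    ((0 < codim beta)%N ->
       eps M S (cobar_deg w) (cbm_cls (mBv (B M)) (cobar_deg w) w) = 0) /\
    (codim beta = 0%N ->
       eps M S n (cbm_cls (mBv (B M)) n w) = psh_map M alpha n (psh_map M beta n x)).
End BarFunctor.
End Functors.

(* Main.v *)
(** A morphism of trees is both a monomorphism and an epimorphism, since an edge
    is determined by the leaves above it; hence the isomorphism classes of
    morphisms with source [S] form a finite set.  A symbol [[f, d|e, x]] depends
    only on [f], on [x] and on the word [f(d) e] in the inner edges of the target,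
    so [B(M)(S)] and [B^v(Y)(S)] become spaces of families of elements [x_f] of
    [X(T)], [f : S -> T], equivariant up to sign under isomorphisms of [T].  Such a
    family is a finite sum of generators [iota f x]; the bar construction is
    described on coordinates, the cobar construction on generators.  [d^2 = 0]
    holds because the two factorizations of a map of codimension 2 into maps of
    codimension 1 carry opposite signs.  A morphism out of [S o_a Q] splits as
    [f o_a g], so the structure map is, up to sign, the sum over pairs [(f, g)] of
    the structure maps of [X]; eliminating the pairs one at a time in the order of
    codimension shows that its cone is acyclic.  The unit is the family
    [f |-> iota id (f_* y)] and the counit is [iota f v |-> f^* (v_id)]; on both
    sides the signs [kappa] and [kappa'] cancel. *)

From HB Require Import structures.
From mathcomp Require Import all_boot all_order all_algebra perm.
From mathcomp Require Import zify ring boolp.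
Require Import Defs.

Set Implicit Arguments.
Unset Strict Implicit.
Unset Printing Implicit Defensive.

Import GRing.Theory.
Local Open Scope ring_scope.
Implicit Types S T U P Q : tree.

(** * Parity of enumerations *)

(** Structure maps point the same way for operads and cooperads; only the variance in morphisms of
    trees differs. So whatever uses isomorphisms of targets alone (families, structure maps, their
    associativity, the elimination) is done once, for an [isofun]. The differentials also get a
    common shape: the component of the bar differential at [f : S -> T], and the value of the cobar
    differential on a generator at [f], both contain a sum over codimension 1 morphisms out of [T],
    weighted by the signs [hsg]. This is why one side uses coordinates and the other generators; the
    sum over faces in the definition returns only in the comparison with symbols. The obstacles are
    signs and degrees. Words are compared with the arbitrary but fixed [enum (inner T)]; the
    resulting signs depend on this choice, and the computations rest on how they multiply under
    composition and grafting and on their squares being 1. Modules in provably equal degrees are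
    different types, so a family has a component in every degree, forced to vanish in all but one,
    and most transports are confined to [cst]. *)

Section Parity.
Variable X : eqType.
Implicit Types (x y : X) (s t u : seq X).

(** For enumerations [s] and [t] of the same set: the parity of the permutation
    relating them (other arguments give junk). *)
Fixpoint par s t : bool :=
  if s is x :: s' then odd (index x t) (+) par s' (rem x t) else false.

Lemma par_cons x s t : par (x :: s) (x :: t) = par s t.
Proof. by rewrite /= eqxx. Qed.

Lemma par_refl s : par s s = false.
Proof. by elim: s => // x s IH; rewrite par_cons. Qed.

Lemma index_rem x y t : uniq t -> x != y -> x \in t -> y \in t ->
  index y (rem x t) = (index y t - (index x t < index y t))%N.
Proof.
elim: t => // z t IH /= /andP[nz ut] nxy.
rewrite !inE; case: (eqVneq z x) => [zx _|zx].
  subst z; rewrite (negbTE nxy) /= eq_sym (negbTE nxy) /= => yt.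
  by rewrite subn1.
rewrite eq_sym => /= xt; case: (eqVneq z y) => [zy _|zy].
  by [].
move=> /= yt; rewrite IH // ltnS.
case: (ltnP (index x t) (index y t)) => h; lia.
Qed.

(** In exactly one of the two orders, removing the first letter lowers the index of the second by
    one; this shift is the sign of the transposition. *)
Lemma par_swap x y s t : uniq t -> x != y -> x \in t -> y \in t ->
  par (x :: y :: s) t = ~~ par (y :: x :: s) t.
Proof.
move=> ut nxy xt yt /=.
have -> : rem y (rem x t) = rem x (rem y t).
  by rewrite !rem_filter ?filter_uniq // -!filter_predI; apply: eq_filter => z /=; rewrite andbC.
rewrite !addbA -addNb; congr (_ (+) _).
rewrite (index_rem ut nxy) // (@index_rem y x) // 1?eq_sym //.
have : index x t != index y t.
  by apply: contraNneq nxy => e; rewrite -(nth_index x xt) e nth_index.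
rewrite neq_ltn => /orP[] h; rewrite h ltnNge (ltnW h) /= ?subn0 !subn1.
- by move: h; case: (index y t) => // j _; rewrite -addNb negbK addbC.
- by move: h; case: (index x t) => // j _ /=; rewrite addbC addbN.
Qed.

(** Bringing [x] to the front takes one application of [par_swap] for each letter of [s1]. *)
Lemma par_skip x s1 s2 t : uniq (s1 ++ x :: s2) -> perm_eq (s1 ++ x :: s2) t ->
  par (s1 ++ x :: s2) t = odd (size s1) (+) par (x :: s1 ++ s2) t.
Proof.
elim: s1 t => // y s1 IH t us pt.
have ut : uniq t by rewrite -(perm_uniq pt).
have mt : t =i y :: s1 ++ x :: s2 by move=> z; rewrite (perm_mem pt).
have nyx : y != x.
  by move: us; rewrite /= mem_cat inE !negb_or => /andP[/andP[_ /andP[]]].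
have pt' : perm_eq (s1 ++ x :: s2) (rem y t).
  rewrite -(perm_cons y) -[y :: _ ++ _]/((y :: s1) ++ _) (perm_trans pt) //.
  by apply: perm_to_rem; rewrite mt inE eqxx.
rewrite cat_cons /= IH //; last by move: us => /= /andP[].
have := @par_swap x y (s1 ++ s2) t ut; rewrite eq_sym nyx !mt !inE !mem_cat !inE !eqxx !orbT.
move=> /(_ isT isT isT) /= ->; case: (odd _) (odd _) (odd _) (par _ _) => [] [] [] [] //.
Qed.

(** The cocycle property, by which a reference enumeration can be changed. Induction on [s]: its
    head is cut out of [t], and [par_skip] accounts for the place it had there. *)
Lemma par_trans s t u : uniq s -> perm_eq s t -> perm_eq t u ->
  par s u = par s t (+) par t u.
Proof.
elim: s t u => [|x s IH] t u us st tu.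
  by move: st tu; rewrite perm_sym => /perm_nilP ->; rewrite perm_sym => /perm_nilP ->.
have ut : uniq t by rewrite -(perm_uniq st).
have xt : x \in t by rewrite -(perm_mem st) inE eqxx.
case/splitPr: xt st ut tu => t1 t2 st ut tu.
have nx : x \notin t1 by move: ut; rewrite cat_uniq /= negb_or => /and3P[_ /andP[]].
rewrite par_skip //= index_cat (negbTE nx) /= eqxx addn0.
have -> : rem x (t1 ++ x :: t2) = t1 ++ t2.
  by elim: t1 nx {st ut tu} => /= [|y t1 IHt]; rewrite ?eqxx // inE negb_or => /andP[nxy /IHt ->];
     rewrite eq_sym (negbTE nxy).
have st' : perm_eq s (t1 ++ t2).
  rewrite -(perm_cons x) (perm_trans st) // perm_sym -cat1s.
  by rewrite -[x :: t2]cat1s perm_catCA.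
have tu' : perm_eq (t1 ++ t2) (rem x u).
  rewrite -(perm_cons x); apply: perm_trans (perm_to_rem _).
    by apply: perm_trans tu; rewrite -cat1s -[x :: t2]cat1s perm_catCA.
  by rewrite -(perm_mem tu) mem_cat inE eqxx orbT.
rewrite (IH (t1 ++ t2)) //; last by case/andP: us.
by case: (odd _) (odd _) (par _ _) (par _ _) => [] [] [] [].
Qed.

Lemma par_cat s1 s2 t1 t2 : perm_eq s1 t1 -> perm_eq s2 t2 ->
  par (s1 ++ s2) (t1 ++ t2) = par s1 t1 (+) par s2 t2.
Proof.
move=> + p2; elim: s1 t1 => [|x s1 IH] t1 p1 /=.
  by move: p1; rewrite perm_sym => /perm_nilP ->.
have xt : x \in t1 by rewrite -(perm_mem p1) inE eqxx.
rewrite index_cat xt; have -> : rem x (t1 ++ t2) = rem x t1 ++ t2.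
  by elim: t1 xt {IH p1} => //= y t1 IHt; rewrite inE eq_sym; case: eqVneq => //= _ /IHt ->.
rewrite IH ?addbA // -(perm_cons x); apply: perm_trans p1 (perm_to_rem xt).
Qed.

(** After [par_trans] only the two blocks matter; the letters of [t] cross [s1] one at a time. *)
Lemma par_move s0 s1 t s2 u : uniq (s0 ++ s1 ++ t ++ s2) ->
  perm_eq (s0 ++ s1 ++ t ++ s2) u ->
  par (s0 ++ s1 ++ t ++ s2) u =
  odd (size s1 * size t) (+) par (s0 ++ t ++ s1 ++ s2) u.
Proof.
move=> us pu; have pc : perm_eq (s1 ++ t ++ s2) (t ++ s1 ++ s2) by rewrite perm_catCA.
have pc0 : perm_eq (s0 ++ s1 ++ t ++ s2) (s0 ++ t ++ s1 ++ s2) by rewrite perm_cat2l.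
rewrite (par_trans us pc0); last by rewrite perm_sym in pc0; apply: perm_trans pc0 pu.
rewrite (par_cat (perm_refl _) pc) par_refl /=; congr (_ (+) _).
have {us} us : uniq (s1 ++ t ++ s2) by move: us; rewrite cat_uniq => /and3P[].
elim: t us {pu pc pc0} => [|x t IH] us; first by rewrite muln0 par_refl.
rewrite cat_cons par_skip //; last by rewrite -cat_cons perm_catCA.
rewrite par_cons IH; last first.
  by move: us; rewrite uniq_catCA /= => /andP[_]; rewrite uniq_catCA.
by rewrite mulnS oddD.
Qed.
End Parity.

Lemma par_map (X Y : eqType) (f : X -> Y) s t :
  injective f -> par (map f s) (map f t) = par s t.
Proof.
move=> fi; elim: s t => //= x s IH t; rewrite index_map //; congr (_ (+) _).
rewrite -IH; congr par; elim: t => //= y t ->.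
by rewrite (inj_eq fi); case: eqP.
Qed.

Lemma rem_index (X : eqType) (s : seq X) (x0 : X) j : uniq s -> (j < size s)%N ->
  rem (nth x0 s j) s = [seq nth x0 s (bump j i) | i <- iota 0 (size s).-1].
Proof.
elim: s j => // x s IH [|j] /= /andP[nx us]; rewrite ?eqxx ?ltnS.
  by move=> _; rewrite -{1}(mkseq_nth x0 s); apply: eq_map => i.
move=> js; have jx : nth x0 s j != x by apply: contraNneq nx => <-; apply: mem_nth.
rewrite eq_sym (negbTE jx) IH //.
case: s js {IH nx us jx} => // y s js /=; congr cons.
rewrite [in RHS](iotaDl 1 0) -map_comp; case: j js => /= [|j] js.
  by apply: eq_map.
by apply: eq_map => i; rewrite /= /bump add1n ltnS addnS.
Qed.

Lemma perm_enumE (T : tree) (s : seq T) (x0 : T) (sigma : 'S_(size s)) :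
  perm_enum sigma = [seq nth x0 s (sigma i) | i <- enum 'I_(size s)].
Proof. by apply: eq_map => i; rewrite (tnth_nth x0). Qed.

(** The link with the signs in the relations of the presentations: [odd_perm] obeys the recursion
    that defines [par], through [odd_lift_perm]. *)
Lemma par_nth_perm (X : eqType) (x0 : X) n (s : seq X) (sigma : 'S_n) : uniq s -> size s = n ->
  par [seq nth x0 s (sigma i) | i <- enum 'I_n] s = odd_perm sigma.
Proof.
elim: n s sigma => [|n IH] s sigma us sn.
  rewrite (size0nil sn) /=; have -> : sigma = 1%g by apply/permP => -[].
  by rewrite odd_perm1 (size0nil (size_enum_ord 0)).
pose j := sigma ord0.
(* Expansion along the first letter: [tau] is what [sigma] does to the other positions,
   renumbered. *)
have [tau sE] : exists tau : 'S_n, sigma = lift_perm ord0 j tau.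
  have kP (k : 'I_n) : {k' : 'I_n | sigma (lift ord0 k) = lift j k'}.
    case: (unliftP j (sigma (lift ord0 k))) => [k' ->|e]; first by exists k'.
    by have := perm_inj e => /eqP; rewrite eq_sym (negbTE (neq_lift _ _)).
  pose g k := sval (kP k).
  have gi : injective g.
    move=> k1 k2 e; apply: (@lift_inj _ ord0); apply: (@perm_inj _ sigma).
    by rewrite (svalP (kP k1)) (svalP (kP k2)); congr lift.
  exists (perm gi); apply/permP => i; case: (unliftP ord0 i) => [k|] ->.
    by rewrite lift_perm_lift permE (svalP (kP k)).
  by rewrite lift_perm_id.
have -> : odd_perm sigma = odd j (+) tau by rewrite sE odd_lift_perm.
rewrite enum_ordSl /= -/j index_uniq ?sn //; congr (_ (+) _).
have us' : uniq (rem (nth x0 s j) s) by apply: rem_uniq.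
have sn' : size (rem (nth x0 s j) s) = n by rewrite size_rem ?mem_nth ?sn.
rewrite -(IH _ tau us' sn'); congr par; rewrite -map_comp; apply: eq_map => i /=.
rewrite sE lift_perm_lift rem_index ?sn //= (nth_map 0%N) ?size_iota //.
by rewrite nth_iota // add0n.
Qed.

Lemma par_perm_enum (T : tree) (s : seq T) (sigma : 'S_(size s)) : uniq s ->
  par (perm_enum sigma) s = odd_perm sigma.
Proof.
case: s sigma => [|x0 s] sigma us.
  have -> : sigma = 1%g by apply/permP => -[].
  by rewrite odd_perm1 /perm_enum (size0nil (size_enum_ord 0)).
by rewrite (perm_enumE x0) par_nth_perm.
Qed.

Lemma perm_enum_perm (T : tree) (s : seq T) (sigma : 'S_(size s)) : perm_eq (perm_enum sigma) s.
Proof.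
have sE : [seq tnth (in_tuple s) i | i <- enum 'I_(size s)] = s.
  case: s sigma => [|x0 s] sigma; first by rewrite (size0nil (size_enum_ord 0)).
  apply: (@eq_from_nth _ x0); first by rewrite size_map size_enum_ord.
  rewrite size_map size_enum_ord => i hi; rewrite (nth_map (Ordinal hi)) ?size_enum_ord //.
  by rewrite (tnth_nth x0) /= nth_enum_ord.
rewrite -[X in perm_eq _ X]sE /perm_enum (map_comp (tnth (in_tuple s)) sigma).
apply: perm_map; apply: uniq_perm; rewrite ?enum_uniq //.
  by rewrite map_inj_uniq ?enum_uniq //; apply: perm_inj.
by move=> i; rewrite mem_enum inE; apply/mapP; exists (sigma^-1 i)%g; rewrite ?mem_enum ?permKV.
Qed.

Lemma perm_enum_exists (T : tree) (s t : seq T) : perm_eq t s ->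
  exists sigma : 'S_(size s), t = perm_enum sigma.
Proof.
move=> ts; have sz : size t = size s := perm_size ts.
have /tuple_permP[p pE] : perm_eq t (in_tuple s) by [].
by exists p.
Qed.

Lemma par_perm_size (T : tree) (s : seq T) (sigma : 'S_(size s)) : size (perm_enum sigma) = size s.
Proof. by rewrite size_map size_enum_ord. Qed.

(** * Parity of integer exponents *)

Section IntParity.
Variable R : comPzRingType.
Definition podd (z : int) : bool := odd `|z|%N.
Lemma poddD a b : podd (a + b) = podd a (+) podd b. Proof. rewrite /podd; lia. Qed.
Lemma poddN a : podd (- a) = podd a. Proof. rewrite /podd; lia. Qed.
Lemma poddM a b : podd (a * b) = podd a && podd b. Proof. by rewrite /podd abszM oddM. Qed.
Lemma podd_nat n : podd n%:Z = odd n. Proof. by []. Qed.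
Lemma podd1 : podd 1 = true. Proof. by []. Qed.
Lemma ksgnE z : ksgn R z = (-1) ^+ podd z. Proof. exact: ksgn_odd. Qed.
End IntParity.

(** * Leaves and the rigidity of morphisms *)

Lemma two_above T (x : T) : ~~ leaf x -> exists y1 y2, [/\ le_edge x y1, y1 != x,
  le_edge x y2, y2 != x &
  forall w, le_edge x w -> w != x -> le_edge w y1 -> le_edge w y2 -> False].
Proof.
by move/inputs_gt1 => h; apply/(two_inputsP (@le_edge_refl T) (@le_edge_anti T) (@le_edge_trans T)).
Qed.

Lemma leaf_over T (x : T) : exists2 l, leaf l & le_edge x l.
Proof. exact: leaf_above (@le_edge_refl T) (@le_edge_anti T) (@le_edge_trans T) x. Qed.

Lemma le_edge_neq T (x y z : T) : le_edge x y -> y != x -> le_edge y z -> z != x.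
Proof.
move=> xy nyx yz; apply: contraNneq nyx => e; apply/eqP/le_edge_anti.
by rewrite xy andbT -e.
Qed.

(** This is where vertices with at least two inputs are needed: if [y] is strictly above [x], it
    cannot be below the leaves over two branches that separate at [x]. *)
Lemma leaves_inj T (x y : T) :
  (forall l, leaf l -> le_edge x l = le_edge y l) -> x = y.
Proof.
wlog xy : x y / le_edge x y.
  move=> wl h; have [l ll xl] := leaf_over x.
  have yl : le_edge y l by rewrite -h.
  case/orP: (le_edge_chain xl yl) => [xy|yx]; first exact: wl xy h.
  by apply/esym/wl => // k lk; rewrite h.
move=> h; apply/eqP/negPn/negP => nxy.
have nl : ~~ leaf x by apply/nleafP; exists y => //; rewrite eq_sym.
have [y1 [y2 [x1 n1 x2 n2 hw]]] := two_above nl.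
have [l1 ll1 yl1] := leaf_over y1; have [l2 ll2 yl2] := leaf_over y2.
have k1 : le_edge y l1 by rewrite -h // (le_edge_trans x1).
have k2 : le_edge y l2 by rewrite -h // (le_edge_trans x2).
have nyx : y != x by rewrite eq_sym.
(* Each case yields an edge strictly above [x] and below both [y1] and [y2], against [hw]. *)
case/orP: (le_edge_chain k1 yl1) => [a1|b1]; case/orP: (le_edge_chain k2 yl2) => [a2|b2].
- exact: (hw y).
- by apply: (hw y2) => //; [apply: le_edge_trans b2 a1|apply: le_edge_refl].
- by apply: (hw y1) => //; [apply: le_edge_refl|apply: le_edge_trans b1 a2].
- case/orP: (le_edge_chain b1 b2) => yy.
    by apply: (hw y1) => //; apply: le_edge_refl.
  by apply: (hw y2) => //; apply: le_edge_refl.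
Qed.

Lemma homE S T (f g : hom S T) : f = g -> f =1 g.
Proof. by move=> ->. Qed.

Lemma hom_compA S T U P (h : hom U P) (g : hom T U) (f : hom S T) :
  hom_comp h (hom_comp g f) = hom_comp (hom_comp h g) f.
Proof. exact: hom_ext. Qed.
Lemma hom_idl S T (f : hom S T) : hom_comp (hom_id T) f = f.
Proof. exact: hom_ext. Qed.
Lemma hom_idr S T (f : hom S T) : hom_comp f (hom_id S) = f.
Proof. exact: hom_ext. Qed.

Lemma leaf_onto S T (f : hom S T) l : leaf l -> exists2 s, leaf s & f s = l.
Proof.
move=> ll; have [s sE] : exists s, f s = l by apply: hom_onto; rewrite inE ll andbF.
by exists s => //; rewrite -(hom_leaf f) sE.
Qed.

(** Every leaf of [U] comes from a leaf [s] of [S], and whether it lies above [g x] is decided in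
    [T], by [le_edge x (f s)]. *)
Lemma hom_epi S T U (f : hom S T) (g g' : hom T U) :
  hom_comp g f = hom_comp g' f -> g = g'.
Proof.
move=> e; apply: hom_ext => x; apply: leaves_inj => l ll.
have [s ls sE] := leaf_onto (hom_comp g f) ll; have sE' := homE e s.
by rewrite -{1}sE hom_mono -sE sE' hom_mono.
Qed.

Lemma hom_monic S T U (f f' : hom S T) (g : hom T U) :
  hom_comp g f = hom_comp g f' -> f = f'.
Proof. by move=> e; apply: hom_ext => x; apply: (@hom_inj _ _ g); apply: (homE e). Qed.

(** * Isomorphism classes of morphisms with a fixed source *)

(** Edges of [T] are coded by the leaves of [S] above them, so that the set of codes
    determines [f] up to isomorphism under [S]. *)
Definition cl S T (f : hom S T) (x : T) : {set S} :=
  [set s | leaf s && le_edge x (f s)].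

(** Edges with a common leaf above them are comparable; in the wrong order, the inclusion makes
    their leaves coincide, and then the edges are equal. *)
Lemma cl_le S T (f : hom S T) x y : (cl f y \subset cl f x) = le_edge x y.
Proof.
apply/subsetP/idP => [h|xy s]; last first.
  by rewrite !inE => /andP[-> /(le_edge_trans xy)].
have [l ll yl] := leaf_over y; have [s ls sE] := leaf_onto f ll; subst l.
have xs : le_edge x (f s) by have := h s; rewrite !inE ls yl => /(_ isT).
case/orP: (le_edge_chain xs yl) => // yx.
suff -> : x = y by apply: le_edge_refl.
apply: leaves_inj => l lf; have [s' ls' sE'] := leaf_onto f lf; subst l.
apply/idP/idP => h'; first exact: le_edge_trans h'.
by have := h s'; rewrite !inE ls' h' => /(_ isT).
Qed.

Lemma cl_inj S T (f : hom S T) : injective (cl f).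
Proof. by move=> x y e; apply: le_edge_anti; rewrite -!(cl_le f) e subxx. Qed.

Definition code S T (f : hom S T) : {set {set S}} := [set cl f x | x : T].

Lemma cl_comp S T U (g : hom T U) (f : hom S T) x : cl (hom_comp g f) (g x) = cl f x.
Proof. by apply/setP => s; rewrite !inE /= hom_mono. Qed.

(** Each edge of [T] goes to the edge of [T'] with the same code; this preserves and reflects the
    order because [cl_le] reads the order off the codes. *)
Lemma code_le S T T' (f : hom S T) (f' : hom S T') :
  code f \subset code f' -> exists g : hom T T', hom_comp g f = f'.
Proof.
move/subsetP => h; have gP x : exists y, cl f' y = cl f x.
  by have /imsetP[y _ ->] := h (cl f x) (imset_f _ isT); exists y.
pose g x := sval (cid (gP x)); have gE x : cl f' (g x) = cl f x := svalP (cid (gP x)).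
have gf s : g (f s) = f' s.
  by apply: (@cl_inj _ _ f'); rewrite gE; apply/setP => t; rewrite !inE !hom_mono.
have gh : is_hom g.
  apply/is_homP; split=> [x y|y hy]; first by rewrite -!(cl_le f') !gE cl_le.
  apply/negPn/negP => /(hom_onto f')[s sE].
  by have := hy (f s); rewrite gf sE eqxx.
by exists (Hom gh); apply: hom_ext.
Qed.

(** The inverse is kept as data, so that a presheaf acts covariantly on isomorphisms, through
    [ti_g], without a choice. *)
Record tiso S T := TIso {
  ti_f :> hom S T;
  ti_g : hom T S;
  ti_gf : hom_comp ti_g ti_f = hom_id S;
  ti_fg : hom_comp ti_f ti_g = hom_id T }.

Lemma tiso_ext S T (s t : tiso S T) : ti_f s = ti_f t -> s = t.
Proof.
case: s t => [f g gf fg] [f' g' gf' fg'] /= e; subst f'.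
have {}e : g = g' by apply: (@hom_epi _ _ _ f); rewrite gf gf'.
by subst g'; congr TIso; apply: Prop_irrelevance.
Qed.

Definition ti_id S : tiso S S := TIso (hom_idl (hom_id S)) (hom_idl (hom_id S)).
Definition ti_inv S T (t : tiso S T) : tiso T S := TIso (ti_fg t) (ti_gf t).

Lemma ti_comp_proof S T U (t : tiso T U) (s : tiso S T) :
  hom_comp (hom_comp (ti_g s) (ti_g t)) (hom_comp t s) = hom_id S.
Proof.
by rewrite hom_compA -(hom_compA (ti_g s)) ti_gf hom_idr ti_gf.
Qed.
Definition ti_comp S T U (t : tiso T U) (s : tiso S T) : tiso S U :=
  TIso (ti_comp_proof t s) (ti_comp_proof (ti_inv s) (ti_inv t)).

Lemma ti_isom S T (t : tiso S T) : isom t.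
Proof. by exists (ti_g t); rewrite ti_gf ti_fg. Qed.

Lemma isom_ti S T (f : hom S T) : isom f -> exists t : tiso S T, ti_f t = f.
Proof. by case=> g [gf fg]; exists (TIso gf fg). Qed.

Lemma ti_KgK S T (t : tiso S T) x : ti_g t (t x) = x.
Proof. exact: homE (ti_gf t) x. Qed.
Lemma ti_KfK S T (t : tiso S T) x : t (ti_g t x) = x.
Proof. exact: homE (ti_fg t) x. Qed.

Lemma code_eq S T T' (f : hom S T) (f' : hom S T') :
  code f = code f' -> exists t : tiso T T', hom_comp t f = f'.
Proof.
move=> e; have [g gE] : exists g : hom T T', hom_comp g f = f' by apply: code_le; rewrite e.
have [g' gE'] : exists g : hom T' T, hom_comp g f' = f by apply: code_le; rewrite e.
have e1 : hom_comp g' g = hom_id T by apply: (@hom_epi _ _ _ f); rewrite -hom_compA gE gE' hom_idl.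
have e2 : hom_comp g g' = hom_id T' by apply: (@hom_epi _ _ _ f'); rewrite -hom_compA gE' gE hom_idl.
by exists (TIso e1 e2).
Qed.

Lemma code_iso S T T' (f : hom S T) (t : tiso T T') : code (hom_comp t f) = code f.
Proof.
apply/setP => A; apply/imsetP/imsetP => -[x _ ->].
  by exists (ti_g t x) => //; rewrite -[in LHS](ti_KfK t x) cl_comp.
by exists (t x) => //; rewrite cl_comp.
Qed.

Lemma surj_ti S T (f : hom S T) : (forall y, exists x, f x = y) -> exists t : tiso S T, ti_f t = f.
Proof.
move=> fs; have [t tE] : exists t : tiso S T, hom_comp t (hom_id S) = f.
  apply: code_eq; apply/setP => A; apply/imsetP/imsetP => -[x _ ->].
    by exists (f x) => //; rewrite -[f](hom_idr f) cl_comp.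
  by have [y <-] := fs x; exists y => //; rewrite -{1}[f](hom_idr f) cl_comp.
by exists t; rewrite -tE hom_idr.
Qed.

(** An edge missed by a morphism is automatically inner, so membership reduces to being outside the
    image. *)
Lemma mem_new S T (f : hom S T) y :
  (y \in new_edges f) = [forall x, f x != y].
Proof.
rewrite inE; apply/andP/forallP => [[ny yi] x|h].
  apply: contraNneq ny => e; subst y; rewrite imset_f //.
  by rewrite -(hom_inner f).
split; last exact: hom_missed h.
by apply/imsetP => -[x _ e]; have := h x; rewrite e eqxx.
Qed.

Lemma new_edgesN S T (f : hom S T) y : (y \notin new_edges f) <-> exists x, f x = y.
Proof.
rewrite mem_new negb_forall; split; first by move/existsP => [x]; rewrite negbK => /eqP; exists x.
by case=> x e; apply/existsP; exists x; rewrite e eqxx.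
Qed.

Lemma new_in S T (f : hom S T) x : f x \in new_edges f = false.
Proof. by apply/negbTE/new_edgesN; exists x. Qed.

Lemma new_inner S T (f : hom S T) : new_edges f \subset inner T.
Proof. exact: subsetDl. Qed.

Lemma codim0_ti S T (f : hom S T) : codim f = 0%N -> exists t : tiso S T, ti_f t = f.
Proof.
move=> c0; apply: surj_ti => y; apply/new_edgesN.
by move: c0; rewrite /codim => /cards0_eq ->; rewrite inE.
Qed.

Lemma codim_ti S T (t : tiso S T) : codim t = 0%N.
Proof.
apply/eqP; rewrite cards_eq0; apply/eqP/setP => y; rewrite in_set0.
by apply/negbTE/new_edgesN; exists (ti_g t y); rewrite ti_KfK.
Qed.

Lemma card_inner S T (f : hom S T) : #|inner T| = (#|inner S| + codim f)%N.
Proof.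
rewrite /codim /new_edges cardsD (setIidPr _); last first.
  by apply/subsetP => _ /imsetP[x xi ->]; rewrite hom_inner.
rewrite card_imset; last exact: hom_inj.
rewrite subnKC //.
rewrite -(card_imset (mem (inner S)) (@hom_inj _ _ f)); apply: subset_leq_card.
by apply/subsetP => _ /imsetP[x xi ->]; rewrite hom_inner.
Qed.

Lemma new_comp S T U (g : hom T U) (f : hom S T) y :
  (y \in new_edges (hom_comp g f)) =
  (y \in new_edges g) || (y \in [set g x | x in new_edges f]).
Proof.
case: (boolP (y \in new_edges g)) => [yn|/new_edgesN[x <-]] /=.
  move: yn; rewrite !mem_new => /forallP h; apply/forallP => x; exact: h (f x).
rewrite mem_imset; last exact: hom_inj.
by rewrite !mem_new; apply: eq_forallb => z; rewrite /= (inj_eq (@hom_inj _ _ g)).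
Qed.

Lemma codim_comp S T U (g : hom T U) (f : hom S T) :
  codim (hom_comp g f) = (codim g + codim f)%N.
Proof.
by have := card_inner (hom_comp g f); rewrite (card_inner g) (card_inner f); lia.
Qed.

Lemma enum_inner_perm S T (f : hom S T) :
  perm_eq (map f (enum (inner S)) ++ enum (new_edges f)) (enum (inner T)).
Proof.
apply: uniq_perm; rewrite ?enum_uniq //.
  rewrite cat_uniq map_inj_uniq ?enum_uniq; last exact: hom_inj.
  rewrite andbT /=; apply/hasPn => y; rewrite mem_enum => yn.
  by apply/mapP => -[x _ e]; rewrite e new_in in yn.
move=> y; rewrite mem_cat !mem_enum; case: (boolP (y \in new_edges f)) => yn.
  by rewrite orbT (subsetP (new_inner f)).
case/new_edgesN: yn => x <-; rewrite orbF mem_map ?mem_enum ?hom_inner //.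
exact: hom_inj.
Qed.

(** * Signs of words and of morphisms *)

Section Signs.
Variable R : comPzRingType.

(** The coordinate of the wedge of the letters of [w] in the top exterior power on the inner edges,
    with [enum (inner T)] as chosen generator. *)
Definition wsgn T (w : seq T) : R := (-1) ^+ par w (enum (inner T)).

Lemma sgn2 (b : bool) : (-1) ^+ b * (-1) ^+ b = 1 :> R.
Proof. by rewrite -signr_addb addbb. Qed.

Lemma wsgn2 T (w : seq T) : wsgn w * wsgn w = 1.
Proof. exact: sgn2. Qed.

Lemma enum_uniq_of T (w : seq T) A : is_enum w A -> uniq w.
Proof. by move/perm_uniq ->; apply: enum_uniq. Qed.

Lemma enum_size T (w : seq T) A : is_enum w A -> size w = #|A|.
Proof. by move/perm_size ->; rewrite cardE. Qed.

Lemma is_enum_enum T (A : {set T}) : is_enum (enum A) A.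
Proof. exact: perm_refl. Qed.
Hint Resolve is_enum_enum : core.

Lemma wsgn_perm T (w w' : seq T) : is_enum w (inner T) -> perm_eq w w' ->
  wsgn w = (-1) ^+ par w w' * wsgn w'.
Proof.
move=> ww pw; rewrite /wsgn (par_trans (enum_uniq_of ww) pw) ?signr_addb //.
by rewrite perm_sym in pw; apply: perm_trans pw ww.
Qed.

(** Compares chosen orientations: that of [inner S] followed by that of the new edges, against that
    of [inner T]. *)
Definition hsg S T (f : hom S T) : R :=
  wsgn (map f (enum (inner S)) ++ enum (new_edges f)).

Lemma hsg2 S T (f : hom S T) : hsg f * hsg f = 1.
Proof. exact: wsgn2. Qed.

Lemma hom_enum S T (f : hom S T) w v : is_enum w (inner S) -> is_enum v (new_edges f) ->
  is_enum (map f w ++ v) (inner T).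
Proof.
move=> hw hv; apply: perm_trans (enum_inner_perm f).
by apply: perm_cat => //; apply: perm_map.
Qed.

Lemma wsgn_hom S T (f : hom S T) w v : is_enum w (inner S) -> is_enum v (new_edges f) ->
  wsgn (map f w ++ v) = (-1) ^+ par v (enum (new_edges f)) * (hsg f * wsgn w).
Proof.
move=> hw hv; rewrite (@wsgn_perm _ _ (map f (enum (inner S)) ++ enum (new_edges f))).
- rewrite par_cat //; last by apply: perm_map.
  rewrite par_map ?signr_addb; last exact: hom_inj.
  by rewrite -/(hsg f) -/(wsgn w); ring.
- exact: hom_enum.
- by apply: perm_cat => //; apply: perm_map.
Qed.

Lemma enum_small T (v : seq T) (A : {set T}) : (#|A| <= 1)%N -> is_enum v A -> v = enum A.
Proof. by move=> A1 hv; apply: perm_small_eq hv; rewrite -cardE. Qed.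

Lemma wsgn_hom1 S T (f : hom S T) w v : (codim f <= 1)%N ->
  is_enum w (inner S) -> is_enum v (new_edges f) ->
  wsgn (map f w ++ v) = hsg f * wsgn w.
Proof.
by move=> c1 hw hv; rewrite (wsgn_hom hw hv) (enum_small c1 hv) par_refl mul1r.
Qed.

Lemma wsgn_enum T : wsgn (enum (inner T)) = 1.
Proof. by rewrite /wsgn par_refl. Qed.

Lemma new_codim0 S T (f : hom S T) : codim f = 0%N -> new_edges f = set0.
Proof. exact: cards0_eq. Qed.

(** Multiplicativity requires the new edges of the composite to be enumerated as those of the
    factors; here they are the same set as for [g]. *)
Lemma hsg_comp0 S T U (g : hom T U) (f : hom S T) : codim f = 0%N ->
  hsg (hom_comp g f) = hsg g * hsg f.
Proof.
move=> c0; have e : new_edges (hom_comp g f) = new_edges g.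
  by apply/setP => y; rewrite new_comp (new_codim0 c0) imset0 in_set0 orbF.
rewrite {1}/hsg e (map_comp g f) -[map f _]cats0 wsgn_hom //.
- by rewrite par_refl mul1r; congr (_ * _); rewrite /hsg (new_codim0 c0) enum_set0.
- by apply: hom_enum; rewrite // (new_codim0 c0) /is_enum enum_set0.
Qed.

Lemma enum_map S T (f : hom S T) (A : {set S}) (v : seq S) : is_enum v A ->
  is_enum (map f v) [set f x | x in A].
Proof.
move=> hv; apply: uniq_perm; rewrite ?enum_uniq // ?map_inj_uniq ?(enum_uniq_of hv) //.
  exact: hom_inj.
move=> y; rewrite mem_enum; apply/mapP/imsetP => -[x xv ->]; exists x => //.
  by rewrite -mem_enum -(perm_mem hv).
by rewrite (perm_mem hv) mem_enum.
Qed.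

(** Here [g] carries the new edges of [f] to those of the composite, but need not respect the chosen
    enumerations; the bound on the codimension leaves only one. *)
Lemma hsg_comp1 S T U (g : hom T U) (f : hom S T) : codim g = 0%N -> (codim f <= 1)%N ->
  hsg (hom_comp g f) = hsg g * hsg f.
Proof.
move=> c0 c1; have e : new_edges (hom_comp g f) = [set g x | x in new_edges f].
  by apply/setP => y; rewrite new_comp (new_codim0 c0) in_set0.
have c : (codim (hom_comp g f) <= 1)%N by rewrite codim_comp c0.
have h : is_enum (map g (enum (new_edges f))) (new_edges (hom_comp g f)).
  by rewrite e; apply: enum_map; apply: perm_refl.
have -> : hsg (hom_comp g f) =
   wsgn (map g (map f (enum (inner S)) ++ enum (new_edges f)) ++ [::]).
  by rewrite cats0 map_cat /hsg (enum_small c h) -map_comp.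
rewrite wsgn_hom1 ?c0 //; last by rewrite (new_codim0 c0) /is_enum enum_set0.
by apply: hom_enum; apply: perm_refl.
Qed.

Lemma hsg_id S : hsg (hom_id S) = 1.
Proof.
have c0 : codim (hom_id S) = 0%N := codim_ti (ti_id S).
by rewrite /hsg (new_codim0 c0) enum_set0 cats0 map_id wsgn_enum.
Qed.
End Signs.
#[global] Hint Resolve is_enum_enum : core.

(** Being a code is an existence statement over all trees, decided classically; as the codes are
    sets of subsets of [S], the classes form a finite type. *)
Definition is_cls S (c : {set {set S}}) : bool :=
  `[< exists p : {T : tree & hom S T}, code (projT2 p) = c >].
Definition cls S : Type := {c : {set {set S}} | is_cls c}.
HB.instance Definition _ S := Finite.on (cls S).

(** * Finite sums over isomorphism classes *)

Section ClassSum.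
Variable S : tree.

Lemma cls_ex (c : cls S) : exists p : {T : tree & hom S T}, code (projT2 p) = val c.
Proof. exact/asboolP/(valP c). Qed.
Definition repc (c : cls S) : {T : tree & hom S T} := sval (cid (cls_ex c)).
Lemma code_repc c : code (projT2 (repc c)) = val c.
Proof. exact: svalP (cid (cls_ex c)). Qed.

Lemma code_is_cls T (f : hom S T) : is_cls (code f).
Proof. by apply/asboolP; exists (existT _ T f). Qed.
Definition toc T (f : hom S T) : cls S := exist _ (code f) (code_is_cls f).

Lemma toc_repc c : toc (projT2 (repc c)) = c.
Proof. by apply: val_inj; rewrite /= code_repc. Qed.

Lemma toc_eq T T' (f : hom S T) (f' : hom S T') :
  toc f = toc f' <-> exists t : tiso T T', hom_comp t f = f'.
Proof.
split; first by move/(congr1 val)/code_eq.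
by case=> t <-; apply: val_inj; rewrite /= code_iso.
Qed.

(** Defined for every [F], but independent of the chosen representatives only when [F] is [cinv]. *)
Definition csum (V : nmodType) (F : forall T, hom S T -> V) : V :=
  \sum_(c : cls S) F _ (projT2 (repc c)).

Definition cinv (V : Type) (F : forall T, hom S T -> V) : Prop :=
  forall T T' (t : tiso T T') (f : hom S T), F T' (hom_comp t f) = F T f.

Variable V : nmodType.
Implicit Types F G : forall T, hom S T -> V.

Lemma cinv_toc (W : Type) (F : forall T, hom S T -> W) T T' (f : hom S T) (f' : hom S T') :
  cinv F -> toc f = toc f' -> F T f = F T' f'.
Proof. by move=> iF /toc_eq[t <-]; rewrite iF. Qed.

Lemma cinv_rep (W : Type) (F : forall T, hom S T -> W) T (f : hom S T) :
  cinv F -> F _ (projT2 (repc (toc f))) = F T f.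
Proof. by move=> iF; apply: cinv_toc => //; rewrite toc_repc. Qed.

Lemma eq_csum F G : (forall T f, F T f = G T f) -> csum F = csum G.
Proof. by move=> e; apply: eq_bigr => c _; rewrite e. Qed.

(** Serves the basic changes of indexing: to a single class, to the faces of a morphism, to
    morphisms out of its target, to the two factors of a graft. *)
Lemma csum_reindex (J : finType) (P : pred J) (h : J -> {T : tree & hom S T}) F :
  cinv F ->
  (forall T (f : hom S T), (forall j, P j -> toc (projT2 (h j)) <> toc f) -> F T f = 0) ->
  (forall i j, P i -> P j -> toc (projT2 (h i)) = toc (projT2 (h j)) -> i = j) ->
  csum F = \sum_(j | P j) F _ (projT2 (h j)).
Proof.
move=> iF F0 hi; pose A := [set toc (projT2 (h j)) | j in P].
rewrite /csum (bigID (mem A)) /= [X in _ + X]big1 ?addr0; last first.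
  move=> c cA; apply: F0 => j Pj e; case/negP: cA.
  by rewrite -(toc_repc c) -e imset_f.
rewrite big_imset /=; last by move=> i j; apply: hi.
by apply: eq_bigr => j _; rewrite cinv_rep.
Qed.

Lemma csum_single F T (f : hom S T) : cinv F ->
  (forall T' (f' : hom S T'), toc f' <> toc f -> F T' f' = 0) -> csum F = F T f.
Proof.
move=> iF F0; rewrite (@csum_reindex unit predT (fun _ => existT _ T f)) //.
- by rewrite (big_pred1 tt) // => -[].
- by move=> T' f' h; apply: F0 => e; apply: (h tt).
- by move=> [] [].
Qed.

Lemma csum0 F : (forall T f, F T f = 0) -> csum F = 0.
Proof. by move=> h; apply: big1 => c _. Qed.
End ClassSum.

(** The system of representatives demanded by [class_sum] is [repc] on the classes satisfying [p],
    numbered by [enum_val]. *)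
Lemma csum_class_sum S (V : zmodType) (F : forall T, hom S T -> V) (p : forall T, hom S T -> bool)
   (P : forall T, hom S T -> Prop) :
  (forall T f, reflect (P T f) (p T f)) -> cinv p ->
  class_sum P F (csum (fun T f => if p T f then F T f else 0)).
Proof.
move=> pP ip; pose A := [pred c : cls S | p _ (projT2 (repc c))].
exists #|A|, (fun i => repc (enum_val i)); split.
- by move=> i; apply/pP; have := enum_valP i.
- move=> T f /pP pf; have tA : toc f \in A by rewrite inE /= cinv_rep.
  exists (enum_rank_in tA (toc f)); split.
    rewrite enum_rankK_in //.
    have /toc_eq[t tE] : toc f = toc (projT2 (repc (toc f))) by rewrite toc_repc.
    by exists t => //; apply: ti_isom.
  move=> i [t /isom_ti[t' <-] tE]; apply: enum_val_inj; rewrite enum_rankK_in //.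
  by rewrite -[RHS]toc_repc; apply/toc_eq; exists t'.
- by rewrite /csum -big_mkcond (eq_bigl (mem A)) // big_enum_val.
Qed.

(** * Transport between equal degrees *)

Section Cast.
Variable R : comPzRingType.

(** The value 0 for different degrees makes transport a total linear map whose statement mentions no
    proof of equality. *)
Definition cst (A : int -> lmodType R) m n (x : A m) : A n :=
  if m =P n is ReflectT e then ecast i (A i) e x else 0.

Lemma cst_id (A : int -> lmodType R) n (x : A n) : cst n x = x.
Proof. by rewrite /cst; case: eqP => // e; rewrite eq_axiomK. Qed.
Lemma cst_ne (A : int -> lmodType R) m n (x : A m) : m != n -> cst n x = 0.
Proof. by rewrite /cst; case: eqP. Qed.
Lemma cst_linear (A : int -> lmodType R) m n : linear (fun x : A m => cst n x : A n).
Proof.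
move=> c x y; have [e|ne] := eqVneq m n; last by rewrite !cst_ne // scaler0 addr0.
by subst n; rewrite !cst_id.
Qed.
HB.instance Definition _ (A : int -> lmodType R) m n :=
  GRing.isLinear.Build R (A m) (A n) *:%R (@cst A m n) (@cst_linear A m n).
Lemma cst_map (A B : int -> lmodType R) (f : forall n, A n -> B n) m n (x : A m) :
  f n 0 = 0 -> f n (cst n x) = cst n (f m x).
Proof.
move=> f0; have [e|ne] := eqVneq m n; last by rewrite !cst_ne.
by subst n; rewrite !cst_id.
Qed.
Lemma cst_d (A : complex R) m n (x : A m) : cx_d A n (cst n x) = cst (n - 1) (cx_d A m x).
Proof.
have [e|ne] := eqVneq m n; last by rewrite !cst_ne ?linear0 //; apply: contraNneq ne => e; apply/eqP; lia.
by subst n; rewrite !cst_id.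
Qed.
End Cast.

(** * Equivariant families *)

Section IsoFun.
Variable R : comPzRingType.

(** The common part of a presheaf and a copresheaf on trees is its functoriality
    for isomorphisms; [ix_bar] selects the shift of the bar or cobar construction. *)
Record isofun := IsoFun {
  ix_ob :> tree -> complex R;
  ix_bar : bool;
  ix_map : forall T T', tiso T T' -> chain_map (ix_ob T) (ix_ob T');
  ix_id : forall T n (x : ix_ob T n), ix_map (ti_id T) n x = x;
  ix_comp : forall T T' T'' (s : tiso T' T'') (t : tiso T T') n (x : ix_ob T n),
    ix_map (ti_comp s t) n x = ix_map s n (ix_map t n x) }.

Definition sh (X : isofun) T : int :=
  if ix_bar X then (#|inner T|.+1)%:Z else - (#|inner T|.+1)%:Z.

Lemma sh_iso X T T' (t : tiso T T') : sh X T' = sh X T.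
Proof. by rewrite /sh (card_inner t) codim_ti addn0. Qed.

Section Family.
Variable X : isofun.

(** The sign in [df_iso] is there because components refer to the chosen enumeration of the inner
    edges of the target, which [t] does not respect. *)
Record dfam S (k : int) := DFam {
  df : forall T, hom S T -> forall n, X T n;
  df_deg : forall T (f : hom S T) n, n + sh X T != k -> df f n = 0;
  df_iso : forall T T' (t : tiso T T') (f : hom S T) n,
    df (hom_comp t f) n = hsg R t *: ix_map X t n (df f n) }.

Lemma dfam_ext S k (u v : dfam S k) :
  (forall T (f : hom S T) n, df u f n = df v f n) -> u = v.
Proof.
case: u v => u ud ui [v vd vi] /= e.
have {}e : u = v.
  by do 3 (apply: functional_extensionality_dep => ?).
by subst v; congr DFam; apply: Prop_irrelevance.
Qed.

HB.instance Definition _ S k := gen_eqMixin (dfam S k).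
HB.instance Definition _ S k := gen_choiceMixin (dfam S k).

Section Module.
Variables (S : tree) (k : int).
Implicit Types u v : dfam S k.

Lemma df0_iso T T' (t : tiso T T') (f : hom S T) n :
  (0 : X T' n) = hsg R t *: ix_map X t n (0 : X T n).
Proof. by rewrite linear0 scaler0. Qed.
Definition df0 : dfam S k :=
  @DFam S k (fun T f n => 0) (fun _ _ _ _ => erefl) df0_iso.

Lemma dfl_deg c u v T (f : hom S T) n : n + sh X T != k -> c *: df u f n + df v f n = 0.
Proof. by move=> h; rewrite !df_deg // scaler0 addr0. Qed.
Lemma dfl_iso c u v T T' (t : tiso T T') (f : hom S T) n :
  c *: df u (hom_comp t f) n + df v (hom_comp t f) n =
  hsg R t *: ix_map X t n (c *: df u f n + df v f n).
Proof. by rewrite !df_iso linearP scalerDr !scalerA (mulrC c). Qed.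
Definition dfl c u v : dfam S k := DFam (dfl_deg c u v) (dfl_iso c u v).

Definition dfD u v := dfl 1 u v.
Definition dfZ c u := dfl c u df0.
Definition dfN u := dfZ (-1) u.

Let dfDA : associative dfD.
Proof. by move=> u v w; apply: dfam_ext => T f n /=; rewrite !scale1r addrA. Qed.
Let dfDC : commutative dfD.
Proof. by move=> u v; apply: dfam_ext => T f n /=; rewrite !scale1r addrC. Qed.
Let df0D : left_id df0 dfD.
Proof. by move=> u; apply: dfam_ext => T f n /=; rewrite scale1r add0r. Qed.
Let dfND : left_inverse df0 dfN dfD.
Proof. by move=> u; apply: dfam_ext => T f n /=; rewrite scale1r addr0 scaleN1r addNr. Qed.
HB.instance Definition _ := GRing.isZmodule.Build (dfam S k) dfDA dfDC df0D dfND.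

Let dfZA c c' u : dfZ c (dfZ c' u) = dfZ (c * c') u.
Proof. by apply: dfam_ext => T f n /=; rewrite !addr0 scalerA. Qed.
Let dfZ1 : left_id 1 dfZ.
Proof. by move=> u; apply: dfam_ext => T f n /=; rewrite addr0 scale1r. Qed.
Let dfZDr : right_distributive dfZ +%R.
Proof. by move=> c u v; apply: dfam_ext => T f n /=; rewrite !addr0 !scale1r scalerDr. Qed.
Let dfZDl u : {morph dfZ^~ u : c c' / c + c'}.
Proof. by move=> c c'; apply: dfam_ext => T f n /=; rewrite !addr0 scale1r scalerDl. Qed.
HB.instance Definition _ :=
  GRing.Zmodule_isLmodule.Build R (dfam S k) dfZA dfZ1 dfZDr dfZDl.

Definition pr T (f : hom S T) n u : X T n := df u f n.
Lemma pr_linear T (f : hom S T) n : linear (pr f n).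
Proof. by move=> c u v; rewrite /pr /= scale1r addr0. Qed.
HB.instance Definition _ T (f : hom S T) n :=
  GRing.isLinear.Build R (dfam S k) (X T n) *:%R (pr f n) (pr_linear f n).
Lemma prE T (f : hom S T) n u : pr f n u = df u f n. Proof. by []. Qed.
#[global] Opaque pr.

Lemma pr_ext u v : (forall T (f : hom S T) (n : int), n + sh X T = k -> pr f n u = pr f n v) -> u = v.
Proof.
move=> h; apply: dfam_ext => T f n; have [e|ne] := eqVneq (n + sh X T) k.
  exact: h.
by rewrite !df_deg.
Qed.
Lemma pr_deg T (f : hom S T) n u : n + sh X T != k -> pr f n u = 0.
Proof. exact: df_deg. Qed.
Lemma pr_iso T T' (t : tiso T T') (f : hom S T) n u :
  pr (hom_comp t f) n u = hsg R t *: ix_map X t n (pr f n u).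
Proof. exact: df_iso. Qed.
End Module.

(** By [hom_epi] there is at most one isomorphism under [S], so the chosen one is canonical. *)
Definition pt S T T' (f : hom S T) (f' : hom S T') : option (tiso T T') :=
  match pselect (exists t : tiso T T', hom_comp t f = f') with
  | left h => Some (sval (cid h))
  | right _ => None
  end.

Lemma ptE S T T' (f : hom S T) (t : tiso T T') : pt f (hom_comp t f) = Some t.
Proof.
rewrite /pt; case: pselect => [h|[]]; last by exists t.
by congr Some; apply: tiso_ext; apply: (@hom_epi _ _ _ f); apply: svalP (cid h).
Qed.

Variant pt_spec S T T' (f : hom S T) (f' : hom S T') : option (tiso T T') -> Prop :=
| PtSome (t : tiso T T') of hom_comp t f = f' : pt_spec f f' (Some t)
| PtNone of toc f <> toc f' : pt_spec f f' None.

Lemma ptP S T T' (f : hom S T) (f' : hom S T') : pt_spec f f' (pt f f').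
Proof.
rewrite /pt; case: pselect => [h|h]; constructor; first exact: svalP (cid h).
by move/toc_eq.
Qed.

(** [iota x] is the family of the symbol [[f, d|e, x]] whose word [f(d) e] is the
    chosen enumeration of the inner edges of [T]; its degree has to be [k], otherwise
    it is [0]. *)
Section Iota.
Variables (S : tree) (k : int) (T : tree) (f : hom S T) (n : int).

Definition iota_fun (x : X T n) T' (f' : hom S T') n' : X T' n' :=
  if n + sh X T == k then
    if pt f f' is Some t then hsg R t *: cst n' (ix_map X t n x) else 0
  else 0.

Lemma iota_deg x T' (f' : hom S T') n' : n' + sh X T' != k -> iota_fun x f' n' = 0.
Proof.
move=> ne; rewrite /iota_fun; case: eqP => // e; case: ptP => // t _.
rewrite cst_ne ?scaler0 //; apply: contraNneq ne => <-.
by rewrite (sh_iso X t) e.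
Qed.

Lemma iota_fun_iso x T' T'' (t : tiso T' T'') (f' : hom S T') n' :
  iota_fun x (hom_comp t f') n' = hsg R t *: ix_map X t n' (iota_fun x f' n').
Proof.
rewrite /iota_fun; case: eqP => [_|_]; last by rewrite linear0 scaler0.
case: (ptP f f') => [s <-|ns].
  rewrite (_ : hom_comp t _ = hom_comp (ti_comp t s) f) ?hom_compA // ptE.
  rewrite hsg_comp0 ?codim_ti // linearZ /= scalerA; congr (_ *: _).
  rewrite (cst_map (f := ix_map X t)) ?linear0 //; congr cst; exact: ix_comp.
case: ptP => [s sE|_]; last by rewrite linear0 scaler0.
case: ns; apply/toc_eq; exists (ti_comp (ti_inv t) s); apply: (@hom_monic _ _ _ _ _ t).
by rewrite -sE !hom_compA ti_fg hom_idl.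
Qed.

Definition iota x : dfam S k := DFam (iota_deg x) (iota_fun_iso x).

Lemma iota_linear : linear iota.
Proof.
move=> c x y; apply: dfam_ext => T' f' n' /=; rewrite /iota_fun scale1r addr0.
case: eqP => _; last by rewrite scaler0 addr0.
case: ptP => [t _|_]; last by rewrite scaler0 addr0.
by rewrite (linearP (ix_map X t n)) linearP /= scalerDr !scalerA mulrC.
Qed.
HB.instance Definition _ := GRing.isLinear.Build R (X T n) (dfam S k) *:%R iota iota_linear.

Lemma iota0 x : n + sh X T != k -> iota x = 0.
Proof.
by move=> ne; apply: pr_ext => T' f' n' _; rewrite linear0 prE /= /iota_fun (negbTE ne).
Qed.

Lemma pr_iota_iso T' (t : tiso T T') x : n + sh X T = k ->
  pr (hom_comp t f) n (iota x) = hsg R t *: ix_map X t n x.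
Proof. by move=> e; rewrite prE /= /iota_fun e eqxx ptE cst_id. Qed.

Lemma pr_iota x : n + sh X T = k -> pr f n (iota x) = x.
Proof.
move=> e; rewrite -{1}[f]hom_idl (pr_iota_iso (ti_id T)) //.
by rewrite hsg_id scale1r ix_id.
Qed.

Lemma pr_iota0 T' (f' : hom S T') n' x : toc f <> toc f' -> pr f' n' (iota x) = 0.
Proof.
move=> ne; rewrite prE /= /iota_fun; case: ptP => // [t e|_]; last by case: ifP.
by case: ne; apply/toc_eq; exists t.
Qed.

End Iota.

(** The relation between symbols with isomorphic targets, after normalization of their words. *)
Lemma iota_iso S k T T' (t : tiso T T') (f : hom S T) n (x : X T n) :
  iota k (hom_comp t f) (ix_map X t n x) = hsg R t *: iota k f x.
Proof.
have [e|ne] := eqVneq (n + sh X T) k; last first.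
  by rewrite !iota0 ?scaler0 ?(sh_iso X t).
apply: pr_ext => T1 f' n' _; rewrite linearZ /= !prE /= /iota_fun (sh_iso X t) e eqxx /=.
case: (ptP f f') => [s <-|ns].
  have -> : hom_comp s f = hom_comp (ti_comp s (ti_inv t)) (hom_comp t f).
    by apply: hom_ext => z /=; rewrite ti_KgK.
  rewrite ptE hsg_comp0 ?codim_ti // scalerA (mulrC (hsg R t)).
  have -> : hsg R t = hsg R (ti_inv t).
    have := hsg_id R T; rewrite -(ti_gf t) hsg_comp0 ?codim_ti // => h.
    by rewrite -[RHS]mulr1 -(hsg2 R t) mulrA h mul1r.
  congr (_ *: cst _ _); rewrite ix_comp -(ix_comp (ti_inv t) t).
  suff -> : ti_comp (ti_inv t) t = ti_id T by rewrite ix_id.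
  by apply: tiso_ext; rewrite /= ti_gf.
case: ptP => [s sE|_]; last by rewrite scaler0.
by case: ns; apply/toc_eq; exists (ti_comp s t); rewrite -sE hom_compA.
Qed.

Lemma csum_linear S (U V : lmodType R) (phi : {linear U -> V}) (F : forall T, hom S T -> U) :
  phi (csum F) = csum (fun T f => phi (F T f)).
Proof. exact: raddf_sum. Qed.

(** The only degree in which the component at [f] may be nonzero is [k - sh X T]. *)
Definition coef S k (u : dfam S k) T (f : hom S T) : dfam S k :=
  iota k f (pr f (k - sh X T) u).

Lemma coef_cinv S k (u : dfam S k) : cinv (coef u).
Proof.
move=> T T' t f; rewrite /coef (sh_iso X t) pr_iso linearZ /= iota_iso.
by rewrite scalerA hsg2 scale1r.
Qed.

Lemma dfam_span S k (u : dfam S k) : u = csum (coef u).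
Proof.
apply: pr_ext => T f n e; rewrite (csum_linear (pr f n)).
have nE : n = k - sh X T by lia.
rewrite (@csum_single _ _ _ _ f) /coef.
- by subst n; rewrite /= pr_iota.
- move=> T1 T2 t g; have := coef_cinv u t g; rewrite /coef => ->; exact: erefl.
- by move=> T' f' ne; rewrite /= pr_iota0.
Qed.

Lemma dfam_lin_ext S k (V : lmodType R) (phi psi : {linear dfam S k -> V}) :
  (forall T (f : hom S T) n (x : X T n), n + sh X T = k ->
     phi (iota k f x) = psi (iota k f x)) -> phi =1 psi.
Proof.
move=> h u; rewrite (dfam_span u) !csum_linear; apply: eq_csum => T f.
by rewrite /coef h //; lia.
Qed.
End Family.
End IsoFun.

(** The images of [g1] and [g2] have the same complement, hence are equal, and every edge of [T1]
    lifts through [g2]. *)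
Lemma same_new_iso T1 T2 T (g1 : hom T1 T) (g2 : hom T2 T) :
  new_edges g1 = new_edges g2 -> exists t : tiso T1 T2, hom_comp g2 t = g1.
Proof.
move=> e.
have tP x : exists y, g2 y = g1 x by apply/new_edgesN; rewrite -e new_in.
pose t x := sval (cid (tP x)); have tE x : g2 (t x) = g1 x := svalP (cid (tP x)).
have th : is_hom t.
  apply: is_hom_bij => [x y|y]; first by rewrite -(hom_mono g2) !tE hom_mono.
  have [x xE] : exists x, g1 x = g2 y by apply/new_edgesN; rewrite e new_in.
  by exists x; apply: (@hom_inj _ _ g2); rewrite tE.
have [s sE] : exists s : tiso T1 T2, ti_f s = Hom th.
  apply: surj_ti => y; have [x xE] : exists x, g1 x = g2 y by apply/new_edgesN; rewrite e new_in.
  by exists x; apply: (@hom_inj _ _ g2); rewrite /= tE.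
by exists s; rewrite sE; apply: hom_ext.
Qed.

Lemma new_face T (e : T) : e \in inner T -> new_edges (face_hom e) = [set e].
Proof.
move=> ei; apply/setP => y; rewrite mem_new in_set1; apply/forallP/eqP => [h|-> x].
  apply/eqP/negPn/negP => ne.
  have ky : kept [set e] y by rewrite /kept inE (negbTE ne).
  by have := h (contract_lift ky); rewrite /= contract_liftK eqxx.
apply/negP => /eqP ex; have := contract_kept x.
have ex' : contract_incl x = e by [].
by rewrite /kept ex' inE eqxx ei.
Qed.

Lemma codim_face T (e : T) : e \in inner T -> codim (face_hom e) = 1%N.
Proof. by move/new_face; rewrite /codim => ->; rewrite cards1. Qed.

Lemma new_notin S T (f : hom S T) e :
  e \in new_edges f -> e \notin [set f x | x in inner S].
Proof. by rewrite inE => /andP[]. Qed.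

(** A total form of [face_lift], usable as the index map of a sum; the second branch is a dummy. *)
Definition flift S T (f : hom S T) (e : T) : {T' : tree & hom S T'} :=
  match pselect (e \notin [set f x | x in inner S]) with
  | left ne => existT _ (face e) (face_lift ne)
  | right _ => existT _ T f
  end.

Lemma fliftE S T (f : hom S T) (e : T) (ne : e \notin [set f x | x in inner S]) :
  flift f e = existT _ (face e) (face_lift ne).
Proof.
rewrite /flift; case: pselect => [ne'|//].
by rewrite (bool_irrelevance ne ne').
Qed.

Lemma toc_flift S T T' (g : hom S T') (g' : hom T' T) e :
  new_edges g' = [set e] -> toc (projT2 (flift (hom_comp g' g) e)) = toc g.
Proof.
move=> ge; have en : e \in new_edges (hom_comp g' g) by rewrite new_comp ge set11.
rewrite (fliftE (new_notin en)) /=; apply/toc_eq.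
have ei : e \in inner T by apply: (subsetP (new_inner g')); rewrite ge set11.
have [t tE] : exists t : tiso (face e) T', hom_comp g' t = face_hom e.
  by apply: same_new_iso; rewrite ge new_face.
exists t; apply: (@hom_monic _ _ _ _ _ g').
by rewrite hom_compA tE face_liftK.
Qed.

(** A factorization of [h] whose second factor has codimension 1 is determined by the edge missed by
    that factor, and this can be any new edge of [h]. *)
Lemma csum_below S T (h : hom S T) (V : nmodType) (K : forall T', hom S T' -> V) :
  cinv K ->
  (forall T' (g : hom S T'), (forall g' : hom T' T, codim g' = 1%N -> hom_comp g' g <> h) ->
     K T' g = 0) ->
  csum K = \sum_(e in new_edges h) K _ (projT2 (flift h e)).
Proof.
move=> iK K0; apply: csum_reindex => //.
  move=> T' g hg; apply: K0 => g' c1 gE; have /eqP/cards1P[e eE] := c1.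
  apply: (hg e); last by rewrite -gE toc_flift.
  by rewrite -gE new_comp eE set11.
move=> i j ih jh; rewrite (fliftE (new_notin ih)) (fliftE (new_notin jh)) /=.
case/toc_eq => t tE; have ii := subsetP (new_inner h) _ ih; have ij := subsetP (new_inner h) _ jh.
have e : hom_comp (face_hom j) t = face_hom i.
  by apply: (@hom_epi _ _ _ (face_lift (new_notin ih))); rewrite -hom_compA tE !face_liftK.
have := new_face ii; rewrite -e => e'.
have : i \in new_edges (hom_comp (face_hom j) t) by rewrite e' set11.
rewrite new_comp (new_codim0 (codim_ti t)) imset0 in_set0 orbF new_face // in_set1.
by move/eqP.
Qed.

(** Precomposition with [f] is injective on classes because [f] is an epimorphism. *)
Lemma csum_factor S T (f : hom S T) (V : nmodType) (F : forall T', hom S T' -> V) :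
  cinv F -> (forall T' (h : hom S T'), (forall g, hom_comp g f <> h) -> F T' h = 0) ->
  csum F = csum (fun T' (g : hom T T') => F T' (hom_comp g f)).
Proof.
move=> iF F0.
rewrite (@csum_reindex S V (cls T) predT (fun c => existT _ _ (hom_comp (projT2 (repc c)) f))) //=.
- move=> T' h hh; apply: F0 => g ge; apply: (hh (toc g)) => //.
  have /toc_eq[t tE] := toc_repc (toc g).
  by apply/toc_eq; exists t; rewrite hom_compA tE.
- move=> i j _ _ /toc_eq[t]; rewrite hom_compA => /hom_epi tE.
  by rewrite -(toc_repc i) -(toc_repc j); apply/toc_eq; exists t.
Qed.

Definition fac S T T' (f : hom S T) (h : hom S T') : option (hom T T') :=
  match pselect (exists g, hom_comp g f = h) with
  | left e => Some (sval (cid e))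
  | right _ => None
  end.

Lemma facE S T T' (f : hom S T) (g : hom T T') : fac f (hom_comp g f) = Some g.
Proof.
rewrite /fac; case: pselect => [e|[]]; last by exists g.
by congr Some; apply: hom_epi (svalP (cid e)).
Qed.

Variant fac_spec S T T' (f : hom S T) (h : hom S T') : option (hom T T') -> Prop :=
| FacSome g of hom_comp g f = h : fac_spec f h (Some g)
| FacNone of (forall g, hom_comp g f <> h) : fac_spec f h None.

Lemma facP S T T' (f : hom S T) (h : hom S T') : fac_spec f h (fac f h).
Proof.
rewrite /fac; case: pselect => e; constructor; first exact: svalP (cid e).
by move=> g gE; apply: e; exists g.
Qed.

Lemma fac_comp S T T' T'' (f : hom S T) (h : hom S T') (t : tiso T' T'') :
  fac f (hom_comp t h) = omap (hom_comp t) (fac f h).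
Proof.
case: (facP f h) => [g <-|h0] /=; first by rewrite hom_compA facE.
case: (facP f) => // g gE; case: (h0 (hom_comp (ti_g t) g)).
by rewrite -hom_compA gE hom_compA ti_gf hom_idl.
Qed.

(** * Signed sums over morphisms of codimension one *)

Section Csum1.
Variable R : comPzRingType.

(** The form of both external differentials. On [seqv] families the sign of an isomorphism occurs
    twice, in [hsg] and in [F], so representatives do not matter. *)
Definition csum1 S (V : lmodType R) (F : forall T, hom S T -> V) : V :=
  csum (fun T (f : hom S T) => if codim f == 1%N then hsg R f *: F T f else 0).

Definition seqv S (V : lmodType R) (F : forall T, hom S T -> V) : Prop :=
  forall T T' (t : tiso T T') (f : hom S T), F T' (hom_comp t f) = hsg R t *: F T f.

Lemma codim_tcomp S T T' (t : tiso T T') (f : hom S T) : codim (hom_comp t f) = codim f.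
Proof. by rewrite codim_comp codim_ti. Qed.

Lemma csum1_cinv S (V : lmodType R) (F : forall T, hom S T -> V) : seqv F ->
  cinv (fun T (f : hom S T) => if codim f == 1%N then hsg R f *: F T f else 0).
Proof.
move=> Fs T T' t f; rewrite codim_tcomp; case: eqP => // c1.
rewrite hsg_comp1 ?codim_ti ?c1 // Fs scalerA mulrAC -mulrA mulrA hsg2 mul1r //.
Qed.

Lemma eq_csum1 S (V : lmodType R) (F G : forall T, hom S T -> V) :
  (forall T f, codim f = 1%N -> F T f = G T f) -> csum1 F = csum1 G.
Proof. by move=> e; apply: eq_csum => T f; case: eqP => // c; rewrite e. Qed.

Lemma csum1_linear S (U V : lmodType R) (phi : {linear U -> V}) (F : forall T, hom S T -> U) :
  phi (csum1 F) = csum1 (fun T f => phi (F T f)).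
Proof.
rewrite /csum1 csum_linear; apply: eq_csum => T f.
by case: ifP => _; rewrite ?linearZ ?linear0.
Qed.

Lemma csum1Z S (V : lmodType R) c (F : forall T, hom S T -> V) :
  csum1 (fun T f => c *: F T f) = c *: csum1 F.
Proof.
rewrite /csum1 /csum scaler_sumr; apply: eq_bigr => i _; case: ifP; rewrite ?scaler0 //.
by rewrite !scalerA mulrC.
Qed.

Lemma csum1D S (V : lmodType R) (F G : forall T, hom S T -> V) :
  csum1 (fun T f => F T f + G T f) = csum1 F + csum1 G.
Proof.
rewrite /csum1 /csum -big_split; apply: eq_bigr => i _ /=.
by case: ifP; rewrite ?addr0 // scalerDr.
Qed.

Lemma csum1_0 S (V : lmodType R) (F : forall T, hom S T -> V) :
  (forall T f, codim f = 1%N -> F T f = 0) -> csum1 F = 0.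
Proof. by move=> h; apply: csum0 => T f; case: eqP => // c; rewrite h ?scaler0. Qed.

(** The edge [y] is added by [g] and [x] afterwards by [g'], so the product of the signs orients the
    new edges in this order. *)
Lemma hsg_codim11 S T T' (g : hom S T') (g' : hom T' T) x y :
  new_edges g' = [set x] -> new_edges (hom_comp g' g) = [set x; y] -> x != y ->
  hsg R g * hsg R g' =
  wsgn R (map (hom_comp g' g) (enum (inner S)) ++ [:: y; x]).
Proof.
move=> gx gxy nxy.
have c1' : codim g' = 1%N by rewrite /codim gx cards1.
have c1 : codim g = 1%N by have := codim_comp g' g; rewrite {1}/codim gxy cards2 nxy c1'; lia.
have hE : is_enum (map g (enum (inner S)) ++ enum (new_edges g)) (inner T').
  by apply: hom_enum; apply: perm_refl.
have -> : map (hom_comp g' g) (enum (inner S)) ++ [:: y; x] =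
    map g' (map g (enum (inner S)) ++ enum (new_edges g)) ++ enum (new_edges g').
  rewrite map_cat -map_comp -catA gx enum_set1; congr (_ ++ _).
  have /eqP/cards1P[z zE] := c1; rewrite zE enum_set1 /=; congr [:: _; _].
  have : y \in new_edges (hom_comp g' g) by rewrite gxy set22.
  by rewrite new_comp gx in_set1 eq_sym (negbTE nxy) /= zE imset_set1 in_set1 => /eqP.
by rewrite wsgn_hom1 ?c1' // -/(hsg R g) mulrC.
Qed.

Lemma csum1_csum1 S (V : lmodType R) (F : forall T, hom S T -> V) : seqv F ->
  csum1 (fun T (g : hom S T) => csum1 (fun T' (g' : hom T T') => F T' (hom_comp g' g))) = 0.
Proof.
move=> Fs.
pose K T' (g : hom S T') T (h : hom S T) : V :=
  if fac g h is Some g' then if codim g' == 1%N then hsg R g' *: F T h else 0 else 0.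
(* The sums are exchanged so that the composite [h] is fixed outside; [K] is what the first factor
   [g] contributes to it. *)
transitivity (csum (fun T (h : hom S T) => csum1 (fun T' g => K T' g T h))).
  transitivity (csum1 (fun T' g => csum (fun T h => K T' g T h))).
    apply: eq_csum1 => T' g _; rewrite (csum_factor (f := g)).
    - by apply: eq_csum => T g'; rewrite /K facE.
    - move=> T T1 t h; rewrite /K fac_comp; case: (facP g h) => //= g' gh.
      rewrite codim_tcomp; case: eqP => // c1.
      by rewrite hsg_comp1 ?codim_ti ?c1 // Fs scalerA mulrAC hsg2 mul1r.
    - by move=> T h h0; rewrite /K; case: (facP g h) => // g' /h0.
  rewrite /csum1 /csum.
  under eq_bigr => c _.
    rewrite (_ : (if _ then _ else _) = \sum_(c' : cls S)
      (if codim (projT2 (repc c)) == 1%N then hsg R (projT2 (repc c)) *: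
         K _ (projT2 (repc c)) _ (projT2 (repc c')) else 0)).
      over.
    by case: ifP => _; rewrite ?scaler_sumr // big1.
  exact: exchange_big.
apply: csum0 => T h; rewrite /csum1 (csum_below (h := h)).
- have [c2|nc2] := eqVneq (codim h) 2%N; last first.
    apply: big1 => e eh; have ei := subsetP (new_inner h) _ eh.
    rewrite (fliftE (new_notin eh)) /=; case: eqP => // c1.
    have hK := face_liftK (new_notin eh); move: (face_lift _) c1 hK => g c1 hK.
    rewrite /K; have -> : fac g h = Some (face_hom e) by rewrite -hK facE.
    case: eqP; rewrite ?scaler0 // => c1'.
    by move/eqP: nc2; rewrite -hK codim_comp c1 c1'.
  have /eqP/cards2P[x [y [nxy hE]]] := c2.
  rewrite hE big_setU1 ?in_set1 // big_set1.
  have kE e e' : new_edges h = [set e; e'] -> e != e' ->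
      (if codim (projT2 (flift h e)) == 1%N
       then hsg R (projT2 (flift h e)) *: K (projT1 (flift h e)) (projT2 (flift h e)) T h
       else 0) = wsgn R (map h (enum (inner S)) ++ [:: e'; e]) *: F T h.
    move=> he nee; have eh : e \in new_edges h by rewrite he set21.
    have ei := subsetP (new_inner h) _ eh.
    have hK := face_liftK (new_notin eh); rewrite (fliftE (new_notin eh)) /=.
    have fe := codim_face ei.
    have c1 : codim (face_lift (new_notin eh)) = 1%N.
      by have := codim_comp (face_hom e) (face_lift (new_notin eh)); rewrite hK c2 fe; lia.
    move: (face_lift _) c1 hK => g c1 hK.
    rewrite c1 /K; have -> : fac g h = Some (face_hom e) by rewrite -hK facE.
    rewrite fe scalerA; congr (_ *: _).
    by rewrite (hsg_codim11 (x := e) (y := e')) ?hK ?new_face.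
  have hE' : new_edges h = [set y; x] by rewrite hE setUC.
  have nyx : y != x by rewrite eq_sym.
  rewrite [LHS](congr2 +%R (kE x y hE nxy) (kE y x hE' nyx)) -scalerDl.
  rewrite (_ : _ + _ = 0) ?scale0r //.
  have ex : is_enum (map h (enum (inner S)) ++ [:: y; x]) (inner T).
    apply: hom_enum => //; rewrite hE'.
    apply: uniq_perm; rewrite ?enum_uniq //= ?inE ?nyx //.
    by move=> z; rewrite mem_enum !inE.
  have p : perm_eq (map h (enum (inner S)) ++ [:: y; x]) (map h (enum (inner S)) ++ [:: x; y]).
    by rewrite perm_cat2l (perm_catC [:: y] [:: x]).
  rewrite (wsgn_perm _ ex p).
  rewrite par_cat ?perm_refl //; last by rewrite (perm_catC [:: y] [:: x]).
  rewrite par_refl /= (negbTE nxy) /= !eqxx /=.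
  by rewrite expr1 mulN1r addNr.
- move=> T' T1 t g; rewrite codim_tcomp; case: eqP => // c1.
  rewrite /K hsg_comp1 ?codim_ti ?c1 //.
  have -> : fac (hom_comp t g) h = omap (fun g' => hom_comp g' (ti_g t)) (fac g h).
    case: (facP g h) => [g' <-|h0] /=.
      rewrite (_ : hom_comp g' g = hom_comp (hom_comp g' (ti_g t)) (hom_comp t g)) ?facE //.
      by apply: hom_ext => z /=; rewrite ti_KgK.
    case: facP => // g' gE; case: (h0 (hom_comp g' t)); by rewrite -hom_compA.
  case: (facP g h) => //= [g' gh|_]; last by rewrite !scaler0.
  rewrite codim_comp (codim_ti (ti_inv t)) addn0; case: eqP; rewrite ?scaler0 // => c1'.
  rewrite hsg_comp0 ?(codim_ti (ti_inv t)) // !scalerA; congr (_ *: _).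
  have e : hsg R t * hsg R (ti_g t) = 1.
    by rewrite -hsg_comp0 ?(codim_ti (ti_inv t)) // ti_fg hsg_id.
  by transitivity ((hsg R t * hsg R (ti_g t)) * (hsg R g * hsg R g')); [ring|rewrite e mul1r].
- move=> T' g g0; case: eqP => // c1; rewrite /K.
  case: (facP g h) => [g' gE|_]; rewrite ?scaler0 //.
  by case: eqP; rewrite ?scaler0 // => c1'; case: (g0 g').
Qed.
End Csum1.

(** * Grafting and splitting *)

Section GraftInner.
Variables (S : tree) (a : S) (Q : tree).
Hypotheses (la : leaf a) (vS : has_vertex S) (vQ : has_vertex Q).

Lemma graft_inl_inj : injective (graft_inl a Q).
Proof. by move=> x y /(can_inj (@graft_inK _ _ _)) [->]. Qed.

Lemma graft_inr_inj : injective (@graft_inr S a Q).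
Proof. by move=> x y e; apply: le_edge_anti; rewrite -(le_inr_inr a x y) -(le_inr_inr a y x) e le_edge_refl. Qed.

Lemma graft_inl_inr s (q : Q) : graft_inl a Q s = graft_inr a q ->
  s = a /\ q = root_edge Q.
Proof.
have [->|nq] := eqVneq q (root_edge Q).
  by rewrite graft_inr_root => /graft_inl_inj.
by rewrite (graft_inrE _ nq) => /(can_inj (@graft_inK _ _ _)).
Qed.

Lemma leaf_nroot : a != root_edge S.
Proof. by apply: contraNneq vS => <-. Qed.

(** The additional inner edge is [a], which now joins a vertex of [S] to the root vertex of [Q]. *)
Lemma inner_inl s : (graft_inl a Q s \in inner (graft S a Q)) = (s \in inner S) || (s == a).
Proof.
rewrite !inE graft_root (inj_eq graft_inl_inj).
have [->|nsa] := eqVneq s a.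
  rewrite orbT leaf_nroot /=; apply/nleafP; case/nleafP: vQ => q rq nq.
  by exists (graft_inr a q); rewrite ?le_inl_inr ?le_edge_refl //; apply: contraNneq nq => /esym/graft_inl_inr[_ ->].
rewrite orbF; congr (_ && ~~ _); apply/idP/idP; last by move=> ls; apply: graft_leaf_inl.
move=> lgs; apply/leafP => t st; apply: graft_inl_inj; apply: (leafP _ lgs).
by rewrite le_inl_inl.
Qed.

Lemma inner_inr q : q != root_edge Q -> (graft_inr a q \in inner (graft S a Q)) = (q \in inner Q).
Proof.
move=> nq; rewrite !inE graft_root nq /= graft_inrE graft_leaf_inr_out /=.
by rewrite (inj_eq (can_inj (@graft_inK _ _ _))).
Qed.

Lemma graft_enum w1 w2 : is_enum w1 (inner S) -> is_enum w2 (inner Q) ->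
  is_enum (graft_inl a Q a :: map (graft_inl a Q) w1 ++ map (graft_inr a) w2)
    (inner (graft S a Q)).
Proof.
move=> h1 h2; have m1 := perm_mem h1; have m2 := perm_mem h2.
have nw2 q : q \in w2 -> q != root_edge Q by rewrite m2 mem_enum inE => /andP[].
apply: uniq_perm; rewrite ?enum_uniq //=.
  rewrite mem_cat negb_or cat_uniq !map_inj_uniq ?(enum_uniq_of h1) ?(enum_uniq_of h2);
    [|exact: graft_inr_inj|exact: graft_inl_inj].
  rewrite /= andbT -!andbA; apply/and3P; split.
  - by rewrite mem_map ?m1 ?mem_enum ?inE ?la ?andbF //; apply: graft_inl_inj.
  - by apply/mapP => -[q /nw2 nq /graft_inl_inr[_ e]]; rewrite e eqxx in nq.
  - apply/hasPn => _ /mapP[q /nw2 nq ->]; apply/mapP => -[s _ /esym/graft_inl_inr[_ e]].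
    by rewrite e eqxx in nq.
move=> y; rewrite inE mem_cat mem_enum; have [[s ->]|[q nq ->]] := graftP y.
  rewrite inner_inl (inj_eq graft_inl_inj) (mem_map graft_inl_inj) m1 mem_enum.
  rewrite (_ : (_ \in [seq graft_inr a i | i <- w2]) = false) ?orbF 1?orbC //.
  by apply/mapP => -[q /nw2 nq /graft_inl_inr[_ e]]; rewrite e eqxx in nq.
rewrite inner_inr // (mem_map graft_inr_inj) m2 mem_enum.
case: eqP => [/esym/graft_inl_inr[_ e]|_] /=; first by rewrite e eqxx in nq.
case: mapP => [[s _ /esym/graft_inl_inr[_ e]]|_] //; by rewrite e eqxx in nq.
Qed.

Lemma card_inner_graft : #|inner (graft S a Q)| = (#|inner S| + #|inner Q|).+1.
Proof.
have := graft_enum (is_enum_enum _) (is_enum_enum _).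
by move/enum_size <-; rewrite /= size_cat !size_map -!cardE.
Qed.
Lemma card_inner_graftZ :
  #|inner (graft S a Q)|%:Z = #|inner S|%:Z + #|inner Q|%:Z + 1.
Proof. by rewrite card_inner_graft; lia. Qed.
End GraftInner.

(** * Signs of graftings *)

Section GraftSigns.
Variable R : comPzRingType.

(** The order [a], then [S], then [Q] is the one in which the structure maps expect the enumeration
    of the inner edges. *)
Definition gsgn S (a : S) Q : R :=
  wsgn R (graft_inl a Q a :: map (graft_inl a Q) (enum (inner S))
            ++ map (graft_inr a) (enum (inner Q))).

Lemma gsgn2 S (a : S) Q : gsgn a Q * gsgn a Q = 1.
Proof. exact: wsgn2. Qed.

Lemma wsgn_graft S (a : S) Q w1 w2 : leaf a -> has_vertex S -> has_vertex Q ->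
  is_enum w1 (inner S) -> is_enum w2 (inner Q) ->
  wsgn R (graft_inl a Q a :: map (graft_inl a Q) w1 ++ map (graft_inr a) w2) =
  gsgn a Q * wsgn R w1 * wsgn R w2.
Proof.
move=> la vS vQ h1 h2; rewrite (wsgn_perm _ (graft_enum la vS vQ h1 h2)
   (w' := graft_inl a Q a :: map (graft_inl a Q) (enum (inner S)) ++ map (graft_inr a) (enum (inner Q)))).
  rewrite par_cons par_cat ?perm_map // !par_map ?signr_addb; [|exact: graft_inr_inj|exact: graft_inl_inj].
  by rewrite -/(gsgn a Q) -!/(wsgn _ _); ring.
by rewrite perm_cons perm_cat // perm_map.
Qed.
End GraftSigns.

Section GraftHomTheory.
Variables (S S' : tree) (f : hom S S') (a : S) (Q Q' : tree) (g : hom Q Q').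

Lemma graft_hom_inl s : graft_hom f a g (graft_inl a Q s) = graft_inl (f a) Q' (f s).
Proof. by rewrite /= /graft_hom_fun graft_out_inl. Qed.

Lemma graft_hom_inr q : graft_hom f a g (graft_inr a q) = graft_inr (f a) (g q).
Proof.
have [->|nq] := eqVneq q (root_edge Q).
  by rewrite graft_inr_root graft_hom_inl hom_root graft_inr_root.
rewrite (graft_inrE _ nq) /= /graft_hom_fun graft_inK.
by rewrite (graft_inrE _ (hom_nroot g (exist _ q nq))).
Qed.

Lemma graft_new : new_edges (graft_hom f a g) =
  [set graft_inl (f a) Q' x | x in new_edges f] :|: [set graft_inr (f a) x | x in new_edges g].
Proof.
apply/setP => y; apply/idP/idP; last first.
  case/setUP => /imsetP[x xn ->]; move: xn; rewrite !mem_new => /forallP xn; apply/forallP => z.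
    have [[s ->]|[q nq ->]] := graftP z; rewrite ?graft_hom_inl ?graft_hom_inr.
      by rewrite (inj_eq (@graft_inl_inj _ _ _)).
    apply/eqP => /esym/graft_inl_inr[_ e].
    by move: nq; rewrite -(inj_eq (@hom_inj _ _ g)) e hom_root eqxx.
  have [[s ->]|[q nq ->]] := graftP z; rewrite ?graft_hom_inl ?graft_hom_inr.
    by apply/eqP => /graft_inl_inr[_ e]; have := xn (root_edge Q); rewrite hom_root e eqxx.
  by rewrite (inj_eq (@graft_inr_inj _ _ _)).
move=> yn; have := yn; rewrite mem_new => /forallP h.
have [[s e]|[q nq e]] := graftP y; subst y; apply/setUP; [left|right]; apply/imsetP.
  exists s => //; rewrite mem_new; apply/forallP => x.
  by have := h (graft_inl a Q x); rewrite graft_hom_inl (inj_eq (@graft_inl_inj _ _ _)).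
exists q => //; rewrite mem_new; apply/forallP => x.
by have := h (graft_inr a x); rewrite graft_hom_inr (inj_eq (@graft_inr_inj _ _ _)).
Qed.

Lemma graft_new_enum v1 v2 : is_enum v1 (new_edges f) -> is_enum v2 (new_edges g) ->
  is_enum (map (graft_inl (f a) Q') v1 ++ map (graft_inr (f a)) v2) (new_edges (graft_hom f a g)).
Proof.
move=> h1 h2; apply: uniq_perm; rewrite ?enum_uniq //.
  rewrite cat_uniq !map_inj_uniq ?(enum_uniq_of h1) ?(enum_uniq_of h2);
    [|exact: graft_inr_inj|exact: graft_inl_inj].
  rewrite andbT /=; apply/hasPn => _ /mapP[q qv ->]; apply/mapP => -[s _ /esym/graft_inl_inr[_ e]].
  by move: qv; rewrite (perm_mem h2) mem_enum e -(hom_root g) new_in.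
move=> y; rewrite mem_cat mem_enum graft_new in_setU; congr (_ || _).
  apply/mapP/imsetP => -[x xv ->]; exists x => //.
    by rewrite -mem_enum -(perm_mem h1).
  by rewrite (perm_mem h1) mem_enum.
apply/mapP/imsetP => -[x xv ->]; exists x => //.
  by rewrite -mem_enum -(perm_mem h2).
by rewrite (perm_mem h2) mem_enum.
Qed.

Lemma codim_graft : codim (graft_hom f a g) = (codim f + codim g)%N.
Proof.
have := graft_new_enum (is_enum_enum _) (is_enum_enum _).
by move/enum_size; rewrite /codim => <-; rewrite size_cat !size_map -!cardE.
Qed.

(** The new edges of [f] have to cross the inner edges of [Q]; nothing else moves, and with at most
    one new edge its enumeration is unique. *)
Lemma hsg_graft (R : comPzRingType) : leaf a -> has_vertex S -> has_vertex Q ->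
  (codim f + codim g <= 1)%N ->
  hsg R (graft_hom f a g) * gsgn R a Q =
  (-1) ^+ (odd (codim f * #|inner Q|)) * gsgn R (f a) Q' * hsg R f * hsg R g.
Proof.
move=> la vS vQ c1.
have h := graft_enum la vS vQ (is_enum_enum _) (is_enum_enum _).
have h' := graft_new_enum (is_enum_enum _) (is_enum_enum _).
have c1' : (codim (graft_hom f a g) <= 1)%N by rewrite codim_graft.
have := wsgn_hom1 R c1' h h'; rewrite -/(gsgn R a Q) => <-.
have la' : leaf (f a) by rewrite hom_leaf.
have vS' : has_vertex S' by rewrite (hom_has_vertex f).
have vQ' : has_vertex Q' by rewrite (hom_has_vertex g).
have e1 := hom_enum (is_enum_enum (inner S)) (is_enum_enum (new_edges f)).
have e2 := hom_enum (is_enum_enum (inner Q)) (is_enum_enum (new_edges g)).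
transitivity ((-1) ^+ odd (codim f * #|inner Q|) * (gsgn R (f a) Q' * hsg R f * hsg R g));
  last by rewrite !mulrA.
have <- := wsgn_graft R la' vS' vQ' e1 e2.
have hE : is_enum (map (graft_hom f a g) (graft_inl a Q a :: map (graft_inl a Q) (enum (inner S))
            ++ map (graft_inr a) (enum (inner Q))) ++
   (map (graft_inl (f a) Q') (enum (new_edges f)) ++ map (graft_inr (f a)) (enum (new_edges g))))
   (inner (graft S' (f a) Q')) by apply: hom_enum.
have mE : map (graft_hom f a g) (graft_inl a Q a :: map (graft_inl a Q) (enum (inner S))
            ++ map (graft_inr a) (enum (inner Q))) =
    graft_inl (f a) Q' (f a) :: map (graft_inl (f a) Q') (map f (enum (inner S)))
            ++ map (graft_inr (f a)) (map g (enum (inner Q))).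
  rewrite map_cons graft_hom_inl map_cat -!map_comp; congr (_ :: _ ++ _).
    by apply: eq_map => x; apply: graft_hom_inl.
  by apply: eq_map => x; apply: graft_hom_inr.
rewrite mE in hE *; rewrite cat_cons -catA in hE *.
rewrite !map_cat -!catA.
set s1 := map _ (map f _) in hE *; set s2 := map _ (map g _) in hE *.
set s3 := map _ (enum _) in hE *; set s4 := map _ (enum (new_edges g)) in hE *.
set x := graft_inl _ _ _ in hE *.
have p : perm_eq ((x :: s1) ++ s2 ++ s3 ++ s4) ((x :: s1) ++ s3 ++ s2 ++ s4).
  by rewrite perm_cat2l perm_catCA.
rewrite (wsgn_perm R hE p) (par_move (s0 := x :: s1)) ?(enum_uniq_of hE) //.
by rewrite par_refl addbF /s2 /s3 !size_map -!cardE mulnC.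
Qed.

End GraftHomTheory.

Lemma graft_hom_comp S S' S'' (f' : hom S' S'') (f : hom S S') (a : S) Q Q' Q''
  (g' : hom Q' Q'') (g : hom Q Q') :
  graft_hom (hom_comp f' f) a (hom_comp g' g) = hom_comp (graft_hom f' (f a) g') (graft_hom f a g).
Proof.
apply: hom_ext => z; rewrite -[RHS]/(graft_hom f' (f a) g' (graft_hom f a g z)).
by have [[s ->]|[q nq ->]] := graftP z; rewrite !(graft_hom_inl, graft_hom_inr).
Qed.

Lemma graft_hom_id S (a : S) Q : graft_hom (hom_id S) a (hom_id Q) = hom_id (graft S a Q).
Proof.
apply: hom_ext => z.
by have [[s ->]|[q nq ->]] := graftP z; rewrite ?graft_hom_inl ?graft_hom_inr.
Qed.

Lemma graft_tiso_ex S S' (t1 : tiso S S') (a : S) Q Q' (t2 : tiso Q Q') :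
  exists t : tiso (graft S a Q) (graft S' (t1 a) Q'), ti_f t = graft_hom t1 a t2.
Proof. by apply: codim0_ti; rewrite codim_graft !codim_ti. Qed.
Definition graft_tiso S S' (t1 : tiso S S') (a : S) Q Q' (t2 : tiso Q Q') :
  tiso (graft S a Q) (graft S' (t1 a) Q') := sval (cid (graft_tiso_ex t1 a t2)).
Lemma graft_tisoE S S' (t1 : tiso S S') (a : S) Q Q' (t2 : tiso Q Q') :
  ti_f (graft_tiso t1 a t2) = graft_hom t1 a t2.
Proof. exact: svalP (cid (graft_tiso_ex t1 a t2)). Qed.

Lemma toc_graft S S' S'' (f : hom S S') (f' : hom S S'') (a : S) Q Q' Q''
   (g : hom Q Q') (g' : hom Q Q'') :
  toc f = toc f' -> toc g = toc g' -> toc (graft_hom f a g) = toc (graft_hom f' a g').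
Proof.
case/toc_eq => t1 <- /toc_eq[t2 <-]; apply/toc_eq.
by exists (graft_tiso t1 (f a) t2); rewrite graft_tisoE graft_hom_comp.
Qed.

(** * Codes of grafted morphisms *)

Section GraftCode.
Variables (S : tree) (a : S) (Q : tree).
Hypotheses (la : leaf a) (vS : has_vertex S) (vQ : has_vertex Q).

Lemma graft_leafE s : leaf (graft_inl a Q s) = leaf s && (s != a).
Proof.
have [->|nsa] := eqVneq s a.
  rewrite andbF; apply/negbTE/nleafP; case/nleafP: vQ => q rq nq.
  by exists (graft_inr a q); rewrite ?le_inl_inr ?le_edge_refl //; apply: contraNneq nq => /esym/graft_inl_inr[_ ->].
rewrite andbT; apply/idP/idP; last by move=> ls; apply: graft_leaf_inl.
move=> lgs; apply/leafP => t st; apply: (@graft_inl_inj _ a Q); apply: (leafP _ lgs).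
by rewrite le_inl_inl.
Qed.

Lemma graft_leafrE (q : Q) : leaf (graft_inr a q) = leaf q.
Proof.
have [->|nq] := eqVneq q (root_edge Q).
  by rewrite graft_inr_root graft_leafE eqxx andbF; apply/esym/negbTE.
by rewrite graft_inrE graft_leaf_inr_out.
Qed.

(** Recovers a code of [f] from one of the graft: [a] is no longer a leaf there, and it is above an
    edge of the lower part exactly when some leaf of [Q] is. *)
Definition code_restl (A : {set graft S a Q}) : {set S} :=
  [set s | if s == a then [exists q, graft_inr a q \in A] else graft_inl a Q s \in A].
Definition code_restr (A : {set graft S a Q}) : {set Q} := [set q | graft_inr a q \in A].

Variables (S' Q' : tree) (f : hom S S') (g : hom Q Q').
Let gh := graft_hom f a g.

Lemma restl_inl x : code_restl (cl gh (graft_inl _ Q' x)) = cl f x.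
Proof.
apply/setP => s; rewrite !inE; case: eqP => [->|/eqP nsa].
  rewrite la /=; apply/existsP/idP => [[q]|xa].
    by rewrite inE /gh graft_hom_inr le_inl_inr => /andP[].
  have [l ll _] := leaf_over (root_edge Q); exists l.
  by rewrite inE graft_leafrE ll /gh graft_hom_inr le_inl_inr.
by rewrite graft_leafE nsa andbT /gh graft_hom_inl le_inl_inl.
Qed.

Lemma restl_inr q : q != root_edge Q' -> code_restl (cl gh (graft_inr (f a) q)) = cl f (f a).
Proof.
move=> nq; apply/setP => s; rewrite !inE; case: eqP => [->|/eqP nsa].
  rewrite la le_edge_refl; apply/existsP; have [l ll ql] := leaf_over q.
  have [l' ll' lE] := leaf_onto g ll; exists l'.
  by rewrite inE graft_leafrE ll' /gh graft_hom_inr le_inr_inr lE.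
rewrite graft_leafE nsa /gh graft_hom_inl le_inr_inl (negbTE nq) !andbF hom_mono.
apply/esym; case: (boolP (leaf s)) => //= ls; apply: contraNF nsa => as_.
by apply/eqP; apply: (leafP _ la).
Qed.

Lemma restr_inr q : code_restr (cl gh (graft_inr (f a) q)) = cl g q.
Proof. by apply/setP => s; rewrite !inE graft_leafrE /gh graft_hom_inr le_inr_inr. Qed.

Lemma restr_inl x : code_restr (cl gh (graft_inl (f a) Q' x)) =
  if le_edge x (f a) then cl g (root_edge Q') else set0.
Proof.
apply/setP => s; rewrite !inE graft_leafrE /gh graft_hom_inr le_inl_inr.
by case: (le_edge x _); rewrite !inE ?le_root ?andbF.
Qed.

Lemma code_graftl : code f = [set code_restl A | A in code gh].
Proof.
apply/setP => A; apply/imsetP/imsetP => [[x _ ->]|[_ /imsetP[y _ ->] ->]].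
  by exists (cl gh (graft_inl _ Q' x)); rewrite ?imset_f // restl_inl.
have [[s ->]|[q nq ->]] := graftP y; first by exists s; rewrite ?restl_inl.
by exists (f a) => //; rewrite restl_inr.
Qed.

(** An edge of the lower part restricts either to the code of the root of [Q'] or to the empty set,
    and the latter is no code since every edge has a leaf above it. *)
Lemma code_graftr : code g = [set code_restr A | A in code gh] :\ set0.
Proof.
apply/setP => A; rewrite in_setD1; apply/idP/andP.
  case/imsetP => q _ ->; split.
    have [l ll ql] := leaf_over q; have [l' ll' lE] := leaf_onto g ll.
    by apply/set0Pn; exists l'; rewrite inE ll' lE.
  by apply/imsetP; exists (cl gh (graft_inr (f a) q)); rewrite ?imset_f // restr_inr.
case=> nA /imsetP[_ /imsetP[y _ ->] AE]; move: nA; rewrite AE.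
have [[s ->]|[q nq ->]] := graftP y; last by rewrite restr_inr imset_f.
by rewrite restr_inl; case: ifP; rewrite ?eqxx // imset_f.
Qed.
End GraftCode.

Lemma toc_graft_inj S S' S'' (f : hom S S') (f' : hom S S'') (a : S) Q Q' Q''
   (g : hom Q Q') (g' : hom Q Q'') : leaf a -> has_vertex S -> has_vertex Q ->
  toc (graft_hom f a g) = toc (graft_hom f' a g') -> toc f = toc f' /\ toc g = toc g'.
Proof.
move=> la vS vQ /(congr1 val) /= e; split; apply: val_inj => /=.
  by rewrite (code_graftl la vQ f g) e -code_graftl.
by rewrite (code_graftr a vQ f g) e -code_graftr.
Qed.

(** * Splitting a tree at an edge *)

Section GraftSplit.
Variables (S : tree) (a : S) (Q T : tree) (h : hom (graft S a Q) T).
Hypotheses (la : leaf a) (vS : has_vertex S) (vQ : has_vertex Q).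
Let c : T := h (graft_inl a Q a).

(** The cut edge [c] belongs to both parts: as a leaf of the lower one and as the root of the upper
    one. *)
Definition lowb (x : T) : bool := ~~ (le_edge c x && (x != c)).
Definition low_edge := {x : T | lowb x}.
Definition low_le : rel low_edge := fun x y => le_edge (val x) (val y).
Lemma low_rootP : lowb (root_edge T).
Proof. by apply/negP => /andP[]; rewrite le_edge_root eq_sym => ->. Qed.
Definition low_root : low_edge := exist _ (root_edge T) low_rootP.

Lemma lowP x y : le_edge x y -> lowb y -> lowb x.
Proof.
move=> xy; apply: contra => /andP[cx nx].
by rewrite (le_edge_trans cx xy) (le_edge_neq cx nx xy).
Qed.

Lemma low_is_tree : is_tree low_le low_root.
Proof.
have mr : reflexive low_le by move=> x; apply: le_edge_refl.
have ma : antisymmetric low_le by move=> x y /le_edge_anti /val_inj.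
have mt : transitive low_le by move=> x y z; apply: le_edge_trans.
split => //.
- by move=> x; apply: le_root.
- by move=> x y z; apply: le_edge_chain.
move=> x nlx; apply/(two_inputsP mr ma mt).
have nl : ~~ leaf (val x).
  move: nlx; rewrite /order_leaf negb_forall => /existsP[y]; rewrite negb_imply => /andP[xy nyx].
  by apply/nleafP; exists (val y).
have [y1 [y2 [a1 n1 a2 n2 hw]]] := two_above nl.
have xc : val x != c.
  apply: contraTneq nlx => xc; rewrite negbK; apply/forallP => y; apply/implyP => xy.
  apply/negPn/negP => nyx; have := valP y; rewrite /low_le xc in xy.
  have nyc : val y != c.
    by apply: contraNneq nyx => yc; apply/eqP/val_inj; apply: etrans yc (esym xc).
  by rewrite /lowb xy nyc.
(* an input of [x] that is not in the lower part is replaced by [c] *)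
pose lo y := if le_edge c y && (y != c) then c else y.
have loP y : lowb (lo y).
  by rewrite /lowb /lo; case: ifP => [_|->]; rewrite ?eqxx ?andbF.
have lole y : le_edge (lo y) y.
  by rewrite /lo; case: ifP => [/andP[]|_] //; apply: le_edge_refl.
have lox y : le_edge (val x) y -> y != val x -> le_edge (val x) (lo y) && (lo y != val x).
  move=> xy ny; rewrite /lo; case: ifP => [/andP[cy nc]|_]; last by rewrite xy.
  rewrite [_ == val x]eq_sym xc andbT; case/orP: (le_edge_chain xy cy) => // cx.
  by have := valP x; rewrite /lowb cx xc.
have /andP[p1 q1] := lox _ a1 n1; have /andP[p2 q2] := lox _ a2 n2.
exists (exist _ (lo y1) (loP y1)), (exist _ (lo y2) (loP y2)); rewrite /low_le -!(inj_eq val_inj) /=; split => //.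
move=> w xw; rewrite -(inj_eq val_inj) => nw w1 w2.
by apply: (hw (val w)) => //; [apply: le_edge_trans w1 _|apply: le_edge_trans w2 _]; apply: lole.
Qed.

Definition upb (x : T) : bool := le_edge c x.
Definition up_edge := {x : T | upb x}.
Definition up_le : rel up_edge := fun x y => le_edge (val x) (val y).
Definition up_root : up_edge := exist _ c (le_edge_refl c).

Lemma up_is_tree : is_tree up_le up_root.
Proof.
have mr : reflexive up_le by move=> x; apply: le_edge_refl.
have ma : antisymmetric up_le by move=> x y /le_edge_anti /val_inj.
have mt : transitive up_le by move=> x y z; apply: le_edge_trans.
split => //.
- by move=> x; apply: (valP x).
- by move=> x y z; apply: le_edge_chain.
move=> x nlx; apply/(two_inputsP mr ma mt).
have nl : ~~ leaf (val x).
  move: nlx; rewrite /order_leaf negb_forall => /existsP[y]; rewrite negb_imply => /andP[xy nyx].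
  by apply/nleafP; exists (val y).
have [y1 [y2 [a1 n1 a2 n2 hw]]] := two_above nl.
have cx := valP x.
have u1 : upb y1 := le_edge_trans cx a1; have u2 : upb y2 := le_edge_trans cx a2.
exists (exist _ y1 u1), (exist _ y2 u2).
rewrite /up_le -!(inj_eq val_inj) /=; split => //.
by move=> w xw; rewrite -(inj_eq val_inj) => nw w1 w2; apply: (hw (val w)).
Qed.

Definition low_tree : tree := mk_tree low_is_tree.
Definition up_tree : tree := mk_tree up_is_tree.
Definition low_in (x : T) (hx : lowb x) : low_tree :=
  to_tree low_is_tree (exist _ x hx).
Definition up_in (x : T) (hx : upb x) : up_tree := to_tree up_is_tree (exist _ x hx).
Definition low_out (x : low_tree) : T := val (of_tree x).
Definition up_out (x : up_tree) : T := val (of_tree x).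
Lemma low_inK x hx : low_out (@low_in x hx) = x. Proof. by rewrite /low_out to_treeK. Qed.
Lemma up_inK x hx : up_out (@up_in x hx) = x. Proof. by rewrite /up_out to_treeK. Qed.
Lemma low_outP x : lowb (low_out x).
Proof. exact: valP (of_tree x). Qed.
Lemma up_outP x : upb (up_out x). Proof. exact: valP (of_tree x). Qed.
Lemma low_out_inj : injective low_out. Proof. by move=> x y /val_inj /enum_val_inj. Qed.
Lemma up_out_inj : injective up_out. Proof. by move=> x y /val_inj /enum_val_inj. Qed.
Lemma low_out_root : low_out (root_edge low_tree) = root_edge T.
Proof. exact: low_inK low_rootP. Qed.
Lemma up_out_root : up_out (root_edge up_tree) = c.
Proof. exact: (@up_inK c (le_edge_refl c)). Qed.
Lemma le_low x y : le_edge (low_out x) (low_out y) = le_edge x y. Proof. by []. Qed.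
Lemma le_up x y : le_edge (up_out x) (up_out y) = le_edge x y. Proof. by []. Qed.

Lemma split_lowP s : lowb (h (graft_inl a Q s)).
Proof.
rewrite /lowb /c hom_mono le_inl_inl (inj_eq (@hom_inj _ _ h)) (inj_eq (@graft_inl_inj _ _ _)).
by apply/negP => /andP[as_]; rewrite (leafP _ la _ as_) eqxx.
Qed.
Lemma split_upP q : upb (h (graft_inr a q)).
Proof. by rewrite /upb /c hom_mono le_inl_inr le_edge_refl. Qed.

Lemma split_f_hom : is_hom (fun s : S => low_in (split_lowP s)).
Proof.
apply/is_homP; split=> [x y|y hy].
  by rewrite -le_low !low_inK hom_mono le_inl_inl.
have yn : low_out y \in new_edges h.
  rewrite mem_new; apply/forallP => z; have [[s ->]|[q nq ->]] := graftP z.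
    by apply: contraNneq (hy s) => e; apply/eqP/low_out_inj; rewrite low_inK.
  apply/eqP => e; have := low_outP y; rewrite -e /lowb (split_upP q : le_edge _ _) negbK /c (inj_eq (@hom_inj _ _ h)).
  by move=> /eqP /esym/graft_inl_inr[_ e']; rewrite e' eqxx in nq.
have nyc : low_out y != c by apply: contraTneq yn => ->; rewrite new_in.
have := subsetP (new_inner h) _ yn; rewrite !inE => /andP[nr /nleafP[w yw nw]]; apply/andP; split.
  by apply: contraNneq nr => ->; rewrite low_out_root.
have ncy : ~~ le_edge c (low_out y) by have := low_outP y; rewrite /lowb nyc andbT.
(* The edge [w] found above [low_out y] may lie outside the lower part; then [c] takes its place. *)
apply/nleafP; case: (boolP (le_edge c w && (w != c))) => [/andP[cw nwc]|hw].
  have hc : lowb c by rewrite /lowb eqxx andbF.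
  exists (low_in hc); last by rewrite -(inj_eq low_out_inj) low_inK eq_sym.
  rewrite -le_low low_inK; case/orP: (le_edge_chain yw cw) => // cy; by rewrite cy in ncy.
by exists (low_in hw); [rewrite -le_low low_inK|rewrite -(inj_eq low_out_inj) low_inK].
Qed.
Definition split_f : hom S low_tree := Hom split_f_hom.

Lemma split_g_hom : is_hom (fun q : Q => up_in (split_upP q)).
Proof.
apply/is_homP; split=> [x y|y hy].
  by rewrite -le_up !up_inK hom_mono le_inr_inr.
have nyc : up_out y != c.
  apply: contraNneq (hy (root_edge Q)) => e; apply/eqP/up_out_inj.
  by rewrite up_inK graft_inr_root e.
have yn : up_out y \in new_edges h.
  rewrite mem_new; apply/forallP => z; have [[s ->]|[q nq ->]] := graftP z.
    by apply: contraNneq (split_lowP s) => e; rewrite e (up_outP y : le_edge _ _) nyc.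
  by apply: contraNneq (hy q) => e; apply/eqP/up_out_inj; rewrite up_inK.
have := subsetP (new_inner h) _ yn; rewrite !inE => /andP[nr /nleafP[w yw nw]]; apply/andP; split.
  by apply: contraNneq nyc => ->; rewrite up_out_root.
apply/nleafP; have uw : upb w := le_edge_trans (up_outP y) yw; exists (up_in uw).
  by rewrite -le_up up_inK.
by rewrite -(inj_eq up_out_inj) up_inK.
Qed.
Definition split_g : hom Q up_tree := Hom split_g_hom.

Definition split_t (z : graft low_tree (split_f a) up_tree) : T :=
  match graft_out z with inl x => low_out x | inr y => up_out (val y) end.

Lemma split_t_inl x : split_t (graft_inl _ _ x) = low_out x.
Proof. by rewrite /split_t graft_out_inl. Qed.
Lemma split_t_inr y : split_t (graft_inr _ y) = up_out y.
Proof.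
have [->|ny] := eqVneq y (root_edge up_tree); last by rewrite /split_t graft_inrE graft_inK.
by rewrite graft_inr_root split_t_inl low_inK up_out_root.
Qed.

Lemma split_t_hom : is_hom split_t.
Proof.
have fa : low_out (split_f a) = c by rewrite low_inK.
apply: is_hom_bij => [x y|y].
  have [[s ->]|[q nq ->]] := graftP x; have [[s' ->]|[q' nq' ->]] := graftP y;
    rewrite ?split_t_inl ?split_t_inr ?le_inl_inl ?le_inl_inr ?le_inr_inl ?le_inr_inr //.
    rewrite -le_low fa; apply/idP/idP => [sq|sc]; last exact: le_edge_trans sc (up_outP q').
    case/orP: (le_edge_chain sq (up_outP q')) => // cs.
    by move: (low_outP s); rewrite /lowb cs negbK => /eqP ->; apply: le_edge_refl.
  rewrite (negbTE nq) /=; apply/negP => qs.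
  have nqc : up_out q != c.
    by apply: contraNneq nq => e; apply/eqP/up_out_inj; rewrite e up_out_root.
  by have := lowP qs (low_outP s'); rewrite /lowb (up_outP q : le_edge _ _) nqc.
case: (boolP (le_edge c y && (y != c))) => [/andP[cy _]|hy].
  by exists (graft_inr _ (up_in cy)); rewrite split_t_inr up_inK.
by exists (graft_inl _ _ (low_in hy)); rewrite split_t_inl low_inK.
Qed.

(** The image of [a] cuts [T] in two. Together with [toc_graft_inj], this replaces classes out of
    the graft by pairs of classes. *)
Lemma graft_split : exists S' (f : hom S S') Q' (g : hom Q Q') (t : tiso (graft S' (f a) Q') T),
  h = hom_comp t (graft_hom f a g).
Proof.
have [t tE] : exists t : tiso (graft low_tree (split_f a) up_tree) T, ti_f t = Hom split_t_hom.
  apply: surj_ti => y; case: (boolP (le_edge c y && (y != c))) => [/andP[cy _]|hy].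
    by exists (graft_inr _ (up_in cy)); rewrite /= split_t_inr up_inK.
  by exists (graft_inl _ _ (low_in hy)); rewrite /= split_t_inl low_inK.
exists low_tree, split_f, up_tree, split_g, t; rewrite tE; apply: hom_ext => z.
have [[s ->]|[q nq ->]] := graftP z; rewrite [RHS]/= -/(graft_hom _ _ _ _).
  by rewrite -[graft_hom_fun _ _ _]/(graft_hom split_f a split_g _) graft_hom_inl split_t_inl low_inK.
by rewrite -[graft_hom_fun _ _ _]/(graft_hom split_f a split_g _) graft_hom_inr split_t_inr up_inK.
Qed.
End GraftSplit.

(** * The structure maps on families *)

Section IsoCoop.
Variable R : comPzRingType.

(** In the last two fields [t] is the canonical isomorphism: an [isofun] acts by a [tiso], while
    [graft_assoc] and [graft_exch] are only of type [hom]. *)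
Record isocoop := IsoCoop {
  ic_X :> isofun R;
  ic_theta : forall S (a : S) Q, leaf a -> has_vertex S -> has_vertex Q ->
    chain_map (ic_X (graft S a Q)) (tensor (ic_X S) (ic_X Q));
  ic_natural : forall S S' Q Q' (t1 : tiso S S') (t2 : tiso Q Q') (a : S)
    (la : leaf a) (vS : has_vertex S) (vQ : has_vertex Q)
    (la' : leaf (t1 a)) (vS' : has_vertex S') (vQ' : has_vertex Q')
    n (x : ic_X (graft S a Q) n),
    ic_theta la' vS' vQ' n (ix_map ic_X (graft_tiso t1 a t2) n x) =
    tens_map (ix_map ic_X t1) (ix_map ic_X t2) n (ic_theta la vS vQ n x);
  ic_assoc : forall S Q P (a : S) (b : Q)
    (la : leaf a) (lb : leaf b) (lb' : leaf (graft_inr a b))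
    (vS : has_vertex S) (vQ : has_vertex Q) (vP : has_vertex P)
    (vSQ : has_vertex (graft S a Q)) (vQP : has_vertex (graft Q b P))
    (t : tiso (graft (graft S a Q) (graft_inr a b) P) (graft S a (graft Q b P)))
    n (x : ic_X (graft (graft S a Q) (graft_inr a b) P) n),
    ti_f t = graft_assoc a b P ->
    tens_map (cm_id _) (ic_theta lb vQ vP) n
      (ic_theta la vS vQP n (ix_map ic_X t n x)) =
    tens_assoc_lin n
      (tens_map (ic_theta la vS vQ) (cm_id _) n (ic_theta lb' vSQ vP n x));
  ic_exch : forall S Q P (a b : S)
    (la : leaf a) (lb : leaf b) (nab : a != b)
    (lb' : leaf (graft_inl a Q b)) (la' : leaf (graft_inl b P a))
    (vS : has_vertex S) (vQ : has_vertex Q) (vP : has_vertex P)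
    (vSQ : has_vertex (graft S a Q)) (vSP : has_vertex (graft S b P))
    (t : tiso (graft (graft S a Q) (graft_inl a Q b) P)
              (graft (graft S b P) (graft_inl b P a) Q))
    n (x : ic_X (graft (graft S a Q) (graft_inl a Q b) P) n),
    ti_f t = graft_exch a b Q P ->
    tens_map (ic_theta la vS vQ) (cm_id _) n (ic_theta lb' vSQ vP n x) =
    tens_exch_lin n
      (tens_map (ic_theta lb vS vP) (cm_id _) n
         (ic_theta la' vSP vQ n (ix_map ic_X t n x))) }.

(** The differential stays a parameter, since the formulas for the structure map on families do not
    involve it and the bar and cobar differentials arise differently. *)
Record dstruct (X : isofun R) := DStruct {
  ds_d : forall S k, {linear dfam X S k -> dfam X S (k - 1)};
  ds_dd : forall S k (u : dfam X S k), ds_d S (k - 1) (ds_d S k u) = 0 }.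

Definition DC (X : isofun R) (ds : dstruct X) S : complex R :=
  @Complex R (dfam X S) (ds_d ds S) (@ds_dd X ds S).

Lemma hleaf S S' (f : hom S S') (a : S) : leaf a -> leaf (f a).
Proof. by rewrite hom_leaf. Qed.
Lemma hver S S' (f : hom S S') : has_vertex S -> has_vertex S'.
Proof. by rewrite (hom_has_vertex f). Qed.

Lemma sh_graft (X : isofun R) S (a : S) Q : leaf a -> has_vertex S -> has_vertex Q ->
  sh X (graft S a Q) = sh X S + sh X Q.
Proof. by move=> la vS vQ; rewrite /sh card_inner_graft //; case: (ix_bar X); lia. Qed.

(** With [m1], [m2] inner edges in the two factors, the sign of the structure
    map once the enumerations [d|e] are written as words in all inner edges. *)
Definition lam (bar : bool) (m1 m2 p : int) : int :=
  if bar then 1 + m1 + m2 + m2 * (p + 1) + p else m1 * m2 + p + m2 * (p - 1).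

Section Theta.
Variables (X : isocoop) (ds : dstruct X).
Local Notation D := (DC ds).

Definition lamT T1 T2 p : R := ksgn R (lam (ix_bar X) #|inner T1| #|inner T2| p).
Lemma lamT2 T1 T2 p : lamT T1 T2 p * lamT T1 T2 p = 1. Proof. exact: ksgn2. Qed.

Section JK.
Variables (S S' : tree) (f : hom S S') (a : S) (Q Q' : tree) (g : hom Q Q').
Definition jsg p : R := gsgn R (f a) Q' * lamT S' Q' p.
Lemma jsg2 p : jsg p * jsg p = 1.
Proof. by rewrite mulrACA gsgn2 lamT2 mulr1. Qed.

Definition J_fun k n p q (x : X S' p) (y : X Q' q) : tensor (D S) (D Q) k :=
  if p + q == n then
    jsg p *: @ten R (D S) (D Q) k _ _ (iota (p + sh X S') f x) (iota (q + sh X Q') g y)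
  else 0.
Lemma J_fun0 k n p q (x : X S' p) (y : X Q' q) : p + q != n -> J_fun k n x y = 0.
Proof. by rewrite /J_fun => /negbTE ->. Qed.
Lemma J_funl k n p q (y : X Q' q) : linear (fun x : X S' p => J_fun k n x y).
Proof.
move=> c x x'; rewrite /J_fun; case: eqP => _; last by rewrite scaler0 addr0.
by rewrite linearP ten_linl scalerDr !scalerA (mulrC c).
Qed.
Lemma J_funr k n p q (x : X S' p) : linear (fun y : X Q' q => J_fun k n x y).
Proof.
move=> c y y'; rewrite /J_fun; case: eqP => _; last by rewrite scaler0 addr0.
by rewrite linearP ten_linr scalerDr !scalerA (mulrC c).
Qed.
(** Places a tensor at the pair [(f, g)], and [K] reads off the coordinate there with the same sign.
    Both degrees are arguments, being related only by a provable equation. *)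
Definition J k n : {linear tensor (X S') (X Q') n -> tensor (D S) (D Q) k} :=
  bilift (@J_fun0 k n) (@J_funl k n) (@J_funr k n).
Lemma JE k n p q (x : X S' p) (y : X Q' q) : p + q = n ->
  J k n (ten n x y) =
  jsg p *: @ten R (D S) (D Q) k _ _ (iota (p + sh X S') f x) (iota (q + sh X Q') g y).
Proof. by move=> e; rewrite /J biliftE /J_fun e eqxx. Qed.

Definition K_fun k n p q (u : D S p) (v : D Q q) : tensor (X S') (X Q') n :=
  if p + q == k then
    jsg (p - sh X S') *: ten n (pr f (p - sh X S') u) (pr g (q - sh X Q') v)
  else 0.
Lemma K_fun0 k n p q (u : D S p) (v : D Q q) : p + q != k -> K_fun k n u v = 0.
Proof. by rewrite /K_fun => /negbTE ->. Qed.
Lemma K_funl k n p q (v : D Q q) : linear (fun u : D S p => K_fun k n u v).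
Proof.
move=> c x x'; rewrite /K_fun; case: eqP => _; last by rewrite scaler0 addr0.
by rewrite linearP ten_linl scalerDr !scalerA (mulrC c).
Qed.
Lemma K_funr k n p q (u : D S p) : linear (fun v : D Q q => K_fun k n u v).
Proof.
move=> c x x'; rewrite /K_fun; case: eqP => _; last by rewrite scaler0 addr0.
by rewrite linearP ten_linr scalerDr !scalerA (mulrC c).
Qed.
Definition K k n : {linear tensor (D S) (D Q) k -> tensor (X S') (X Q') n} :=
  bilift (@K_fun0 k n) (@K_funl k n) (@K_funr k n).
Lemma KE k n p q (u : D S p) (v : D Q q) : p + q = k ->
  K k n (ten k u v) = jsg (p - sh X S') *: ten n (pr f (p - sh X S') u) (pr g (q - sh X Q') v).
Proof. by move=> e; rewrite /K biliftE /K_fun e eqxx. Qed.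
Lemma KE' (k n p q m1 m2 : int) (u : D S p) (v : D Q q) :
  p + q = k -> p = m1 + sh X S' -> q = m2 + sh X Q' ->
  K k n (ten k u v) = jsg m1 *: ten n (pr f m1 u) (pr g m2 v).
Proof.
move=> e e1 e2; have -> : m1 = p - sh X S' by lia.
have -> : m2 = q - sh X Q' by lia.
exact: KE.
Qed.
Lemma JE' (k n p q k1 k2 : int) (x : X S' p) (y : X Q' q) : p + q = n ->
  k1 = p + sh X S' -> k2 = q + sh X Q' ->
  J k n (ten n x y) = jsg p *: @ten R (D S) (D Q) k _ _ (iota k1 f x) (iota k2 g y).
Proof. by move=> e -> ->; rewrite JE. Qed.

Lemma ten_lin_ext (A B : complex R) (k : int) (V : lmodType R) (phi psi : {linear tensor A B k -> V}) :
  (forall p q (x : A p) (y : B q), p + q = k -> phi (ten k x y) = psi (ten k x y)) ->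
  phi =1 psi.
Proof.
move=> h; apply: (@ten_ext R A B k V phi psi) => p q x y.
have [e|ne] := eqVneq (p + q) k; first exact: h.
by rewrite (ten0 x y ne) !linear0.
Qed.

#[global] Opaque J K.
Lemma KJ (k n : int) z : n + sh X S' + sh X Q' = k -> K k n (J k n z) = z.
Proof.
move=> e; apply: (@ten_lin_ext _ _ _ _ (K k n \o J k n) idfun) => p q x y pq.
rewrite [LHS]/= JE // linearZ (@KE' k n _ _ p q) //; last by lia.
by rewrite /= !pr_iota // scalerA jsg2 scale1r.
Qed.
End JK.

Lemma KJ0 S S' S'' (f : hom S S') (f' : hom S S'') (a : S) Q Q' Q'' (g : hom Q Q') (g' : hom Q Q'')
  k n n' z : toc f <> toc f' \/ toc g <> toc g' -> K f' a g' k n' (J f a g k n z) = 0.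
Proof.
move=> ne; apply: (@ten_lin_ext _ _ _ _ (K f' a g' k n' \o J f a g k n) \0) => p q x y pq.
rewrite [LHS]/= JE // linearZ /=.
have [e|nk] := eqVneq (p + sh X S' + (q + sh X Q')) k; last first.
  by rewrite (@ten0 R (D S) (D Q)) // linear0 scaler0.
rewrite KE //; case: ne => ne.
  by rewrite [X in ten _ X _]pr_iota0 // ten_0l !scaler0.
by rewrite [X in ten _ _ X]pr_iota0 // ten_0r !scaler0.
Qed.

Lemma J_nat S S' S'' (f : hom S S') (t1 : tiso S' S'') (a : S) Q Q' Q''
  (g : hom Q Q') (t2 : tiso Q' Q'') k n z : leaf a -> has_vertex S -> has_vertex Q ->
  J (hom_comp t1 f) a (hom_comp t2 g) k n (tens_map (ix_map X t1) (ix_map X t2) n z) =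
  hsg R (graft_tiso t1 (f a) t2) *: J f a g k n z.
Proof.
move=> la vS vQ.
apply: (@ten_lin_ext _ _ _ _ (J (hom_comp t1 f) a (hom_comp t2 g) k n \o
  tens_fun (ix_map X t1) (ix_map X t2) n) (hsg R (graft_tiso t1 (f a) t2) \*: J f a g k n)) => p q x y pq.
rewrite [LHS]/= [RHS]/= tens_funE !JE // (sh_iso X t1) (sh_iso X t2).
rewrite !iota_iso ten_Zl ten_Zr !scalerA; congr (_ *: _).
rewrite /jsg /lamT (card_inner t1) (card_inner t2) !codim_ti !addn0.
have := hsg_graft (f := t1) (a := f a) (g := t2) R (hleaf f la) (hver f vS) (hver g vQ).
rewrite !codim_ti mul0n expr0 mul1r => /(_ isT) h.
rewrite graft_tisoE [in RHS]mulrA h; ring.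
Qed.

Section Def.
Variables (S : tree) (a : S) (Q : tree).
Hypotheses (la : leaf a) (vS : has_vertex S) (vQ : has_vertex Q).

Definition thx S' (f : hom S S') Q' (g : hom Q Q') n :
    X (graft S' (f a) Q') n -> tensor (X S') (X Q') n :=
  ic_theta X (hleaf f la) (hver f vS) (hver g vQ) n.
Arguments thx {S'} f {Q'} g {n} x.

Definition thterm k S' (f : hom S S') Q' (g : hom Q Q') (u : dfam X (graft S a Q) k) :
    tensor (D S) (D Q) k :=
  J f a g k (k - sh X S' - sh X Q')
    (thx f g (pr (graft_hom f a g) (k - sh X S' - sh X Q') u)).

Definition theta_fun k (u : dfam X (graft S a Q) k) : tensor (D S) (D Q) k :=
  csum (fun S' (f : hom S S') => csum (fun Q' (g : hom Q Q') => thterm f g u)).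

Lemma theta_linear k : linear (@theta_fun k).
Proof.
move=> c u v; rewrite /theta_fun /csum scaler_sumr -big_split; apply: eq_bigr => i _ /=.
rewrite scaler_sumr -big_split; apply: eq_bigr => j _ /=.
by rewrite /thterm linearP /thx !linearP.
Qed.
HB.instance Definition _ k := GRing.isLinear.Build R (dfam X (graft S a Q) k)
  (tensor (D S) (D Q) k) *:%R (@theta_fun k) (@theta_linear k).

Lemma thterm_iso k S' S'' (f : hom S S') (t1 : tiso S' S'') Q' Q''
  (g : hom Q Q') (t2 : tiso Q' Q'') (u : dfam X (graft S a Q) k) :
  thterm (hom_comp t1 f) (hom_comp t2 g) u = thterm f g u.
Proof.
rewrite /thterm (sh_iso X t1) (sh_iso X t2) /thx.
have -> : graft_hom (hom_comp t1 f) a (hom_comp t2 g) =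
  hom_comp (graft_tiso t1 (f a) t2) (graft_hom f a g) by rewrite graft_hom_comp graft_tisoE.
rewrite pr_iso linearZ /= (@ic_natural X _ _ _ _ t1 t2 (f a) (hleaf f la) (hver f vS) (hver g vQ)).
by rewrite linearZ /= J_nat // scalerA hsg2 scale1r.
Qed.

Lemma csum2_single (V : nmodType) (F : forall S' (f : hom S S') Q' (g : hom Q Q'), V)
    S' (f : hom S S') Q' (g : hom Q Q') :
  (forall S1 S2 (t1 : tiso S1 S2) (f : hom S S1) Q1 Q2 (t2 : tiso Q1 Q2) (g : hom Q Q1),
     F S2 (hom_comp t1 f) Q2 (hom_comp t2 g) = F S1 f Q1 g) ->
  (forall S1 (f1 : hom S S1) Q1 (g1 : hom Q Q1), toc f1 <> toc f \/ toc g1 <> toc g ->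
     F S1 f1 Q1 g1 = 0) ->
  csum (fun S' f => csum (F S' f)) = F S' f Q' g.
Proof.
move=> iF F0.
have iF1 S1 S2 (t1 : tiso S1 S2) f1 Q1 g1 : F S2 (hom_comp t1 f1) Q1 g1 = F S1 f1 Q1 g1.
  by rewrite -[in LHS](hom_idl g1) (iF _ _ t1 _ _ _ (ti_id Q1)).
have iF2 Q1 Q2 (t2 : tiso Q1 Q2) S1 f1 g1 : F S1 f1 Q2 (hom_comp t2 g1) = F S1 f1 Q1 g1.
  by rewrite -[in LHS](hom_idl f1) (iF _ _ (ti_id S1)).
rewrite (@csum_single _ _ _ _ f).
- apply: csum_single; first by move=> Q1 Q2 t2 g1; apply: iF2.
  by move=> Q1 g1 ne; apply: F0; right.
- by move=> S1 S2 t1 f1; apply: eq_csum => Q1 g1; apply: iF1.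
- by move=> S1 f1 ne; apply: csum0 => Q1 g1; apply: F0; left.
Qed.

Lemma theta_iota (k : int) S' (f : hom S S') Q' (g : hom Q Q') (n : int) (x : X (graft S' (f a) Q') n) :
  n + sh X S' + sh X Q' = k ->
  theta_fun (iota k (graft_hom f a g) x) = J f a g k n (thx f g x).
Proof.
move=> e; rewrite /theta_fun (@csum2_single _ _ _ f _ g).
- have nE : k - sh X S' - sh X Q' = n by lia.
  rewrite /thterm nE pr_iota // (@sh_graft X S' (f a) Q') -?e ?addrA //; first exact: hleaf.
    exact: hver vS.
  exact: hver vQ.
- by move=> *; apply: thterm_iso.
move=> S1 f1 Q1 g1 ne; rewrite /thterm pr_iota0 /thx ?linear0 // => /(toc_graft_inj la vS vQ)[e1 e2].
by case: ne => ne; case: ne.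
Qed.

(** In the coordinates [K] the structure map is that of [X], component by component and without any
    sign, because all signs were put into [jsg]. *)
Lemma K_theta (k : int) S' (f : hom S S') Q' (g : hom Q Q') (n : int) (u : dfam X (graft S a Q) k) :
  n + sh X S' + sh X Q' = k ->
  K f a g k n (theta_fun u) = thx f g (pr (graft_hom f a g) n u).
Proof.
move=> e; rewrite /theta_fun csum_linear; under eq_csum => S1 f1 do rewrite csum_linear.
rewrite (@csum2_single _ (fun S1 f1 Q1 g1 => K f a g k n (thterm f1 g1 u)) _ f _ g).
- have nE : k - sh X S' - sh X Q' = n by lia.
  by rewrite /thterm nE KJ.
- by move=> S1 S2 t1 f1 Q1 Q2 t2 g1; rewrite thterm_iso.
by move=> S1 f1 Q1 g1 ne; rewrite /thterm KJ0.
Qed.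

Lemma dfam_graft_ext k (V : lmodType R) (phi psi : {linear dfam X (graft S a Q) k -> V}) :
  (forall S' (f : hom S S') Q' (g : hom Q Q') (n : int) (x : X (graft S' (f a) Q') n),
     n + sh X S' + sh X Q' = k ->
     phi (iota k (graft_hom f a g) x) = psi (iota k (graft_hom f a g) x)) -> phi =1 psi.
Proof.
move=> h; apply: dfam_lin_ext => T hh n x e.
have [S' [f [Q' [g [t hE]]]]] := graft_split hh la; subst hh.
have -> : x = ix_map X t n (ix_map X (ti_inv t) n x).
  rewrite -ix_comp (_ : ti_comp _ _ = ti_id T) ?ix_id //.
  by apply: tiso_ext; rewrite /= ti_fg.
rewrite iota_iso !linearZ; congr (_ *: _); apply: h.
have lfa := hleaf f la; have vS' := hver f vS; have vQ' := hver g vQ.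
by rewrite -addrA -(sh_graft X lfa vS' vQ') -(sh_iso X t).
Qed.
End Def.
Arguments thx {S a Q} la vS vQ {S'} f {Q'} g {n} x.

(** Each factor of a pure tensor is a finite sum of generators, by [dfam_span]. As a consequence the
    coordinates [K] separate tensors, although tensor products over a ring give no such test in
    general. *)
Lemma tens_span S (a : S) Q k (z : tensor (D S) (D Q) k) :
  z = csum (fun S' (f : hom S S') => csum (fun Q' (g : hom Q Q') =>
     J f a g k (k - sh X S' - sh X Q') (K f a g k (k - sh X S' - sh X Q') z))).
Proof.
pose phi (z : tensor (D S) (D Q) k) := csum (fun S' (f : hom S S') => csum (fun Q' (g : hom Q Q') =>
     J f a g k (k - sh X S' - sh X Q') (K f a g k (k - sh X S' - sh X Q') z))).
have phil : linear phi.
  move=> c u v; rewrite /phi /csum scaler_sumr -big_split; apply: eq_bigr => i _ /=.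
  by rewrite scaler_sumr -big_split; apply: eq_bigr => j _ /=; rewrite !linearP.
pose phiL := HB.pack_for {linear tensor (D S) (D Q) k -> tensor (D S) (D Q) k} phi
  (GRing.isLinear.Build R (tensor (D S) (D Q) k) (tensor (D S) (D Q) k) *:%R phi phil).
rewrite -[RHS]/(phiL z); apply: (@ten_lin_ext _ _ _ _ idfun phiL) => p q u v pq.
rewrite /= /phi [in LHS](dfam_span u) [in LHS](dfam_span v).
have tl (w : D Q q) (F : forall T, hom S T -> D S p) :
    @ten R (D S) (D Q) k _ _ (csum F) w = csum (fun T f => @ten R (D S) (D Q) k _ _ (F T f) w).
  apply: (big_morph (fun x : D S p => @ten R (D S) (D Q) k _ _ x w)); last exact: ten_0l.
  by move=> x y; have := ten_linl k w 1 x y; rewrite !scale1r.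
have tr (w : D S p) (F : forall T, hom Q T -> D Q q) :
    @ten R (D S) (D Q) k _ _ w (csum F) = csum (fun T f => @ten R (D S) (D Q) k _ _ w (F T f)).
  apply: (big_morph (fun x : D Q q => @ten R (D S) (D Q) k _ _ w x)); last exact: ten_0r.
  by move=> x y; have := ten_linr k w 1 x y; rewrite !scale1r.
rewrite tl; apply: eq_csum => S' f; rewrite tr; apply: eq_csum => Q' g.
rewrite KE // linearZ (@JE' _ _ f a _ _ g k _ _ _ p q); [|lia..].
by rewrite /= scalerA jsg2 scale1r.
Qed.

Lemma K_sep S (a : S) Q k (z z' : tensor (D S) (D Q) k) :
  (forall S' (f : hom S S') Q' (g : hom Q Q') (n : int), n + sh X S' + sh X Q' = k ->
     K f a g k n z = K f a g k n z') -> z = z'.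
Proof.
move=> h; rewrite (tens_span a z) (tens_span a z').
by apply: eq_csum => S' f; apply: eq_csum => Q' g; rewrite h //; lia.
Qed.
End Theta.
End IsoCoop.
Arguments thx {R X S a Q} la vS vQ {S'} f {Q'} g {n} x.

(** * Functoriality of families in the source *)

Section PullPush.
Variables (R : comPzRingType) (X : isofun R).

Section Pull.
Variables (S S' : tree) (g : hom S S') (k : int).
Lemma dpull_iso (u : dfam X S k) T T' (t : tiso T T') (f : hom S' T) n :
  df u (hom_comp (hom_comp t f) g) n = hsg R t *: ix_map X t n (df u (hom_comp f g) n).
Proof. by rewrite -hom_compA df_iso. Qed.
(** The covariant action on the bar construction: coordinates are reindexed, so a generator that
    does not factor through [g] is killed. *)
Definition dpull (u : dfam X S k) : dfam X S' k :=
  @DFam R X S' k (fun T f n => df u (hom_comp f g) n)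
    (fun T f n => @df_deg R X S k u T (hom_comp f g) n) (dpull_iso u).
Lemma pr_dpull u T (f : hom S' T) n : pr f n (dpull u) = pr (hom_comp f g) n u.
Proof. by []. Qed.
Lemma dpull_linear : linear dpull.
Proof. by move=> c u v; apply: pr_ext => T f n _; rewrite linearP !pr_dpull linearP. Qed.
HB.instance Definition _ := GRing.isLinear.Build R (dfam X S k) (dfam X S' k) *:%R dpull dpull_linear.

Lemma dpull_iota T (f : hom S' T) n (x : X T n) : dpull (iota k (hom_comp f g) x) = iota k f x.
Proof.
apply: pr_ext => T' f' n' e; rewrite pr_dpull !prE /= /iota_fun; case: eqP => // _.
case: (ptP f f') => [t <-|ne]; first by rewrite -hom_compA ptE.
case: ptP => // t; rewrite hom_compA => /hom_epi tE.
by case: ne; apply/toc_eq; exists t.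
Qed.

Lemma dpull_iota0 T (f : hom S T) n (x : X T n) : (forall h, f <> hom_comp h g) ->
  dpull (iota k f x) = 0.
Proof.
move=> h0; apply: pr_ext => T' f' n' e; rewrite pr_dpull linear0 pr_iota0 //.
case/toc_eq => t tE; apply: (h0 (hom_comp (ti_g t) f')).
by rewrite -hom_compA -tE hom_compA ti_gf hom_idl.
Qed.
End Pull.

Section Push.
Variables (S S' : tree) (g : hom S' S) (k : int).
Definition dpush_fun (u : dfam X S k) T (f' : hom S' T) n : X T n :=
  if fac g f' is Some f then df u f n else 0.
Lemma dpush_deg u T (f' : hom S' T) n : n + sh X T != k -> dpush_fun u f' n = 0.
Proof. by move=> h; rewrite /dpush_fun; case: (fac g f') => // f; rewrite df_deg. Qed.
Lemma dpush_iso u T T' (t : tiso T T') (f : hom S' T) n :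
  dpush_fun u (hom_comp t f) n = hsg R t *: ix_map X t n (dpush_fun u f n).
Proof.
rewrite /dpush_fun fac_comp; case: (fac g f) => [f1|] /=; first by rewrite df_iso.
by rewrite linear0 scaler0.
Qed.
(** The contravariant action on the cobar construction: generators are precomposed with [g], so
    coordinates not factoring through [g] are 0. *)
Definition dpush u : dfam X S' k := DFam (dpush_deg u) (dpush_iso u).
Lemma pr_dpush u T (f : hom S T) n : pr (hom_comp f g) n (dpush u) = pr f n u.
Proof. by rewrite prE /= /dpush_fun facE. Qed.
Lemma pr_dpush0 u T (f : hom S' T) n : (forall h, hom_comp h g <> f) -> pr f n (dpush u) = 0.
Proof. by move=> h0; rewrite prE /= /dpush_fun; case: facP => // h /h0. Qed.
Lemma dpush_linear : linear dpush.
Proof.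
move=> c u v; apply: pr_ext => T f n _; case: (facP g f) => [h <-|h0].
  by rewrite [RHS]linearP /= !pr_dpush linearP.
by rewrite [RHS]linearP /= !pr_dpush0 // scaler0 addr0.
Qed.
HB.instance Definition _ := GRing.isLinear.Build R (dfam X S k) (dfam X S' k) *:%R dpush dpush_linear.

Lemma dpush_iota T (f : hom S T) n (x : X T n) : dpush (iota k f x) = iota k (hom_comp f g) x.
Proof.
apply: pr_ext => T' f' n' e; case: (facP g f') => [h <-|h0].
  rewrite pr_dpush !prE /= /iota_fun; case: eqP => // _.
  case: (ptP f h) => [t <-|ne]; first by rewrite -hom_compA ptE.
  case: ptP => // t; rewrite hom_compA => /hom_epi tE.
  by case: ne; apply/toc_eq; exists t.
rewrite pr_dpush0 // pr_iota0 // => /toc_eq[t tE].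
by apply: (h0 (hom_comp t f)); rewrite -hom_compA.
Qed.
End Push.

Lemma dpull_push S S' (t : hom S S') k (u : dfam X S' k) : dpull t (dpush t u) = u.
Proof. by apply: pr_ext => T f n _; rewrite pr_dpull pr_dpush. Qed.
End PullPush.

Section LamSigns.
Variable R : comPzRingType.
Lemma ksgn_eq x y : podd x = podd y -> ksgn R x = ksgn R y.
Proof. by rewrite !ksgnE => ->. Qed.

(** The part of associativity that concerns degrees: [m + m' + 1] is the number of inner edges of a
    graft, and the factor with [1 + m1] is the sign of [assoc_sgn]. *)
Lemma lam_assoc b (m1 m2 m3 p q : int) :
  ksgn R (1 + m1) * ksgn R (lam b m1 (m2 + m3 + 1) p) * ksgn R (lam b m2 m3 q) =
  ksgn R (lam b (m1 + m2 + 1) m3 (p + q)) * ksgn R (lam b m1 m2 p).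
Proof.
rewrite -!ksgnD; apply: ksgn_eq; rewrite /lam; case: b;
rewrite !(poddD, poddN, poddM, podd1);
case: (podd m1) (podd m2) (podd m3) (podd p) (podd q) => [] [] [] [] [] //.
Qed.

(** With [s2] and [s3] the total shifts of the exchanged factors, [r * q] is the Koszul sign in [X]
    and [(r + s3) * (q + s2)] the one for families. *)
Lemma lam_exch b (m1 m2 m3 p q r s2 s3 : int) : podd s2 = ~~ podd m2 -> podd s3 = ~~ podd m3 ->
  ksgn R (r * q) * ksgn R (lam b (m1 + m2 + 1) m3 (p + q)) * ksgn R (lam b m1 m2 p) =
  ksgn R (1 + m2 * m3) * ksgn R (lam b (m1 + m3 + 1) m2 (p + r)) * ksgn R (lam b m1 m3 p) *
  ksgn R ((r + s3) * (q + s2)).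
Proof.
move=> h2 h3; rewrite -!ksgnD; apply: ksgn_eq; rewrite /lam; case: b;
rewrite !(poddD, poddN, poddM, podd1) h2 h3;
case: (podd m1) (podd m2) (podd m3) (podd p) (podd q) (podd r) => [] [] [] [] [] [] //.
Qed.
End LamSigns.

(** * Signs of threefold graftings *)

Section GraftThree.
Variable R : comPzRingType.

Lemma hsg_word S T (t : tiso S T) (w : seq S) : is_enum w (inner S) ->
  hsg R t * wsgn R w = wsgn R (map t w).
Proof.
move=> hw; rewrite -[map t w]cats0 wsgn_hom1 ?codim_ti //.
by rewrite (new_codim0 (codim_ti t)) /is_enum enum_set0.
Qed.

Lemma ksgn_nat n : (-1) ^+ odd n = ksgn R n%:Z.
Proof. by rewrite ksgnE. Qed.

(** In one nesting the edge [b] comes first; in the other it follows [a] and the inner edges of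
    [S]. *)
Lemma assoc_sgn S Q P (a : S) (b : Q)
  (t : tiso (graft (graft S a Q) (graft_inr a b) P) (graft S a (graft Q b P))) :
  leaf a -> leaf b -> has_vertex S -> has_vertex Q -> has_vertex P ->
  ti_f t = graft_assoc a b P ->
  hsg R t * (gsgn R (graft_inr a b) P * gsgn R a Q) =
  ksgn R (1 + #|inner S|%:Z) * (gsgn R a (graft Q b P) * gsgn R b P).
Proof.
move=> la lb vS vQ vP tE.
have lb' := graft_leaf_inr a vQ lb.
have vSQ := @graft_has_vertex S a Q vS; have vQP := @graft_has_vertex Q b P vQ.
have eS := is_enum_enum (inner S); have eQ := is_enum_enum (inner Q).
have eP := is_enum_enum (inner P).
have eSQ := graft_enum la vS vQ eS eQ; have eQP := graft_enum lb vQ vP eQ eP.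
have eL := graft_enum lb' vSQ vP eSQ eP; have eR := graft_enum la vS vQP eS eQP.
have := wsgn_graft R lb' vSQ vP eSQ eP; rewrite -/(gsgn R a Q) wsgn_enum mulr1 => <-.
have := wsgn_graft R la vS vQP eS eQP; rewrite -/(gsgn R b P) wsgn_enum mulr1 => <-.
rewrite hsg_word //.
have mE : map t (graft_inl (graft_inr a b) P (graft_inr a b) ::
   map (graft_inl (graft_inr a b) P) (graft_inl a Q a :: map (graft_inl a Q) (enum (inner S))
     ++ map (graft_inr a) (enum (inner Q))) ++ map (graft_inr (graft_inr a b)) (enum (inner P))) =
  [:: graft_inr a (graft_inl b P b)] ++ (graft_inl a _ a :: map (graft_inl a (graft Q b P)) (enum (inner S)))
    ++ map (graft_inr a) (map (graft_inl b P) (enum (inner Q)) ++ map (graft_inr b) (enum (inner P))).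
  rewrite tE !map_cons !map_cat -!map_comp /= -!catA.
  rewrite -!/(graft_assoc a b P _); congr [:: _, _ & _ ++ _ ++ _].
  - exact: graft_assoc_lr.
  - exact: graft_assoc_ll.
  - by apply: eq_map => x; apply: graft_assoc_ll.
  - by apply: eq_map => x; apply: graft_assoc_lr.
  - by apply: eq_map => x; apply: graft_assoc_r.
have eL' : is_enum (map t (graft_inl (graft_inr a b) P (graft_inr a b) ::
   map (graft_inl (graft_inr a b) P) (graft_inl a Q a :: map (graft_inl a Q) (enum (inner S))
     ++ map (graft_inr a) (enum (inner Q))) ++ map (graft_inr (graft_inr a b)) (enum (inner P))))
   (inner (graft S a (graft Q b P))).
  rewrite -[map t _]cats0; apply: hom_enum => //.
  by rewrite (new_codim0 (codim_ti t)) /is_enum enum_set0.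
rewrite mE in eL' *.
set s1 := [:: _] in eL' *; set s2 := _ :: map _ (enum (inner S)) in eL' *.
set s3 := map _ (_ ++ _) in eL' *.
have p : perm_eq (s1 ++ s2 ++ s3) (s2 ++ s1 ++ s3) by rewrite perm_catCA.
rewrite (wsgn_perm R eL' p) (par_move (s0 := [::]) (s1 := s1) (t := s2) (s2 := s3)) ?(enum_uniq_of eL') //.
have -> : wsgn R (s2 ++ s1 ++ s3) = wsgn R (graft_inl a (graft Q b P) a
     :: map (graft_inl a (graft Q b P)) (enum (inner S)) ++
        map (graft_inr a) (graft_inl b P b :: map (graft_inl b P) (enum (inner Q)) ++
                     map (graft_inr b) (enum (inner P)))) by rewrite map_cons.
rewrite par_refl addbF ksgn_nat; congr (_ * _); congr ksgn.
by rewrite /s2 /= size_map -cardE mul1n intS.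
Qed.

(** Two exchanges happen: of the edges [a] and [b], and of the inner edges of [Q] with those of
    [P]. *)
Lemma exch_sgn S Q P (a b : S)
  (t : tiso (graft (graft S a Q) (graft_inl a Q b) P) (graft (graft S b P) (graft_inl b P a) Q)) :
  leaf a -> leaf b -> a != b -> has_vertex S -> has_vertex Q -> has_vertex P ->
  ti_f t = graft_exch a b Q P ->
  hsg R t * (gsgn R (graft_inl a Q b) P * gsgn R a Q) =
  ksgn R (1 + #|inner Q|%:Z * #|inner P|%:Z) * (gsgn R (graft_inl b P a) Q * gsgn R b P).
Proof.
move=> la lb nab vS vQ vP tE.
have lb' : leaf (graft_inl a Q b) by apply: graft_leaf_inl => //; rewrite eq_sym.
have la' := graft_leaf_inl P la nab.
have vSQ := @graft_has_vertex S a Q vS; have vSP := @graft_has_vertex S b P vS.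
have eS := is_enum_enum (inner S); have eQ := is_enum_enum (inner Q).
have eP := is_enum_enum (inner P).
have eSQ := graft_enum la vS vQ eS eQ; have eSP := graft_enum lb vS vP eS eP.
have eL := graft_enum lb' vSQ vP eSQ eP; have eR := graft_enum la' vSP vQ eSP eQ.
have := wsgn_graft R lb' vSQ vP eSQ eP; rewrite -/(gsgn R a Q) wsgn_enum mulr1 => <-.
have := wsgn_graft R la' vSP vQ eSP eQ; rewrite -/(gsgn R b P) wsgn_enum mulr1 => <-.
rewrite hsg_word //.
set W := (X in map t X).
have eL' : is_enum (map t W) (inner (graft (graft S b P) (graft_inl b P a) Q)).
  rewrite -[map t _]cats0; apply: hom_enum => //.
  by rewrite (new_codim0 (codim_ti t)) /is_enum enum_set0.
pose xa := graft_inl (graft_inl b P a) Q (graft_inl b P a).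
pose xb := graft_inl (graft_inl b P a) Q (graft_inl b P b).
pose s1 := map (graft_inl (graft_inl b P a) Q) (map (graft_inl b P) (enum (inner S))).
pose s2 := map (@graft_inr _ (graft_inl b P a) Q) (enum (inner Q)).
pose s3 := map (graft_inl (graft_inl b P a) Q) (map (graft_inr b) (enum (inner P))).
have mE : map t W = [:: xb] ++ [:: xa] ++ s1 ++ s2 ++ s3.
  rewrite /W tE !map_cons !map_cat -!map_comp /= -!catA /s1 /s2 /s3 -!map_comp.
  rewrite -!/(graft_exch a b Q P _); congr [:: _, _ & _ ++ _ ++ _].
  - exact: graft_exch_ll.
  - exact: graft_exch_ll.
  - by apply: eq_map => x; apply: graft_exch_ll.
  - by apply: eq_map => x; apply: graft_exch_lr.
  - by apply: eq_map => x; apply: graft_exch_r.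
rewrite mE in eL' *.
have -> : xa :: map (graft_inl (graft_inl b P a) Q) (graft_inl b P b :: map (graft_inl b P) (enum (inner S))
   ++ map (graft_inr b) (enum (inner P))) ++ map (graft_inr (graft_inl b P a)) (enum (inner Q)) =
  [:: xa] ++ [:: xb] ++ s1 ++ s3 ++ s2 by rewrite map_cons map_cat /= -catA.
have p1 : perm_eq ([:: xb] ++ [:: xa] ++ s1 ++ s2 ++ s3) ([:: xa] ++ [:: xb] ++ s1 ++ s2 ++ s3).
  by rewrite perm_catCA.
have p2 : perm_eq ([:: xa] ++ [:: xb] ++ s1 ++ s2 ++ s3) ([:: xa] ++ [:: xb] ++ s1 ++ s3 ++ s2).
  by rewrite !perm_cat2l perm_catC.
have eL2 : is_enum ([:: xa] ++ [:: xb] ++ s1 ++ s2 ++ s3) (inner (graft (graft S b P) (graft_inl b P a) Q)).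
  by rewrite perm_sym in p1; apply: perm_trans p1 eL'.
rewrite (wsgn_perm R eL' p1) (wsgn_perm R eL2 p2).
rewrite (par_move (s0 := [::]) (s1 := [:: xb]) (t := [:: xa])) ?(enum_uniq_of eL') //.
have e3 : [:: xa] ++ [:: xb] ++ s1 ++ s2 ++ s3 = ([:: xa] ++ [:: xb] ++ s1) ++ s2 ++ s3 ++ [::].
  by rewrite cats0 -!catA.
have -> : par ([:: xa] ++ [:: xb] ++ s1 ++ s2 ++ s3) ([:: xa] ++ [:: xb] ++ s1 ++ s3 ++ s2) =
    odd (size s2 * size s3).
  have u2 := enum_uniq_of eL2; rewrite e3 in u2 p2 *.
  by rewrite par_move // cats0 -!catA par_refl addbF.
rewrite !par_refl !addbF !ksgn_nat mulrA -ksgnD; congr (ksgn R _ * _).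
by rewrite /s2 /s3 !size_map -!cardE PoszM.
Qed.
End GraftThree.

#[global] Opaque tens_fun tdiff tens_assoc_lin tens_exch_lin.

Section TensExt.
Variable R : comPzRingType.

Lemma ten3_ext (A B C : complex R) (n : int) (V : lmodType R)
   (phi psi : {linear tensor (tensor A B) C n -> V}) :
  (forall p q r (x : A p) (y : B q) (z : C r), p + q + r = n ->
     phi (ten n (ten (p + q) x y : tensor A B _) z) = psi (ten n (ten (p + q) x y : tensor A B _) z)) ->
  phi =1 psi.
Proof.
move=> h; apply: ten_lin_ext => p' r u z e.
elim/ten_ind: u => [p q x y||u v hu hv|c u hu].
- have [pq|ne] := eqVneq (p + q) p'; first by subst p'; apply: h.
  by rewrite (ten0 x y ne) ten_0l !linear0.
- by rewrite ten_0l !linear0.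
- have := @ten_linl R (tensor A B) C n p' r z 1 u v; rewrite !scale1r => ->; by rewrite !linearD hu hv.
- by rewrite ten_Zl !linearZ /= hu.
Qed.

Section TenLinear.
Variables (A B : complex R) (k p q : int).
Definition tenl (y : B q) (x : A p) : tensor A B k := ten k x y.
Definition tenr (x : A p) (y : B q) : tensor A B k := ten k x y.
Lemma tenl_linear y : linear (tenl y). Proof. exact: ten_linl. Qed.
Lemma tenr_linear x : linear (tenr x). Proof. exact: ten_linr. Qed.
HB.instance Definition _ y := GRing.isLinear.Build R (A p) (tensor A B k) *:%R (tenl y) (tenl_linear y).
HB.instance Definition _ x := GRing.isLinear.Build R (B q) (tensor A B k) *:%R (tenr x) (tenr_linear x).
End TenLinear.
End TensExt.

Section AssocX.
Variables (R : comPzRingType) (X : isocoop R).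

(** The leaf [c] will be the image of a grafted leaf under some [graft_hom], which is equal to
    [graft_inr a b] but not by conversion; hence the equation as a hypothesis. *)
Lemma ic_assoc_at S Q P (a : S) (b : Q) (c : graft S a Q)
    (la : leaf a) (lb : leaf b) (lc : leaf c)
    (vS : has_vertex S) (vQ : has_vertex Q) (vP : has_vertex P)
    (vSQ : has_vertex (graft S a Q)) (vQP : has_vertex (graft Q b P)) :
  c = graft_inr a b ->
  exists t : tiso (graft (graft S a Q) c P) (graft S a (graft Q b P)),
  [/\ [/\ forall s, t (graft_inl c P (graft_inl a Q s)) = graft_inl a _ s,
          forall q, t (graft_inl c P (graft_inr a q)) = graft_inr a (graft_inl b P q) &
          forall p, t (graft_inr c p) = graft_inr a (graft_inr b p)],
      hsg R t * (gsgn R c P * gsgn R a Q) =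
        ksgn R (1 + #|inner S|%:Z) * (gsgn R a (graft Q b P) * gsgn R b P) &
      forall n (x : X (graft (graft S a Q) c P) n),
      tens_map (cm_id _) (ic_theta X lb vQ vP) n (ic_theta X la vS vQP n (ix_map X t n x)) =
      tens_assoc_lin n (tens_map (ic_theta X la vS vQ) (cm_id _) n (ic_theta X lc vSQ vP n x))].
Proof.
move=> e; subst c.
have [t tE] : exists t : tiso _ _, ti_f t = graft_assoc a b P.
  apply: surj_ti => y; have [[s ->]|[z nz ->]] := graftP y.
    by exists (graft_inl _ P (graft_inl a Q s)); apply: graft_assoc_ll.
  have [[r ->]|[q nq ->]] := graftP z.
    by exists (graft_inl _ P (graft_inr a r)); apply: graft_assoc_lr.
  by exists (graft_inr _ q); apply: graft_assoc_r.
exists t; split.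
- by rewrite tE; split; [apply: graft_assoc_ll|apply: graft_assoc_lr|apply: graft_assoc_r].
- exact: assoc_sgn.
- by move=> n x; apply: ic_assoc.
Qed.

Lemma ic_exch_at S Q P (a b : S) (c : graft S a Q) (c' : graft S b P)
    (la : leaf a) (lb : leaf b) (nab : a != b) (lc : leaf c) (lc' : leaf c')
    (vS : has_vertex S) (vQ : has_vertex Q) (vP : has_vertex P)
    (vSQ : has_vertex (graft S a Q)) (vSP : has_vertex (graft S b P)) :
  c = graft_inl a Q b -> c' = graft_inl b P a ->
  exists t : tiso (graft (graft S a Q) c P) (graft (graft S b P) c' Q),
  [/\ [/\ forall s, t (graft_inl c P (graft_inl a Q s)) = graft_inl c' Q (graft_inl b P s),
          forall q, t (graft_inl c P (graft_inr a q)) = graft_inr c' q &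
          forall p, t (graft_inr c p) = graft_inl c' Q (graft_inr b p)],
      hsg R t * (gsgn R c P * gsgn R a Q) =
        ksgn R (1 + #|inner Q|%:Z * #|inner P|%:Z) * (gsgn R c' Q * gsgn R b P) &
      forall n (x : X (graft (graft S a Q) c P) n),
      tens_map (ic_theta X la vS vQ) (cm_id _) n (ic_theta X lc vSQ vP n x) =
      tens_exch_lin n (tens_map (ic_theta X lb vS vP) (cm_id _) n
        (ic_theta X lc' vSP vQ n (ix_map X t n x)))].
Proof.
move=> e e'; subst c c'.
have [t tE] : exists t : tiso _ _, ti_f t = graft_exch a b Q P.
  apply: surj_ti => y; have [[z ->]|[r nr ->]] := graftP y; last first.
    by exists (graft_inl _ P (graft_inr a r)); apply: graft_exch_lr.
  have [[s ->]|[q nq ->]] := graftP z.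
    by exists (graft_inl _ P (graft_inl a Q s)); apply: graft_exch_ll.
  by exists (graft_inr _ q); apply: graft_exch_r.
exists t; split.
- by rewrite tE; split; [apply: graft_exch_ll|apply: graft_exch_lr|apply: graft_exch_r].
- exact: exch_sgn.
- by move=> n x; apply: ic_exch.
Qed.
End AssocX.

(** * Coassociativity on families *)

Section AssocD.
Variables (R : comPzRingType) (X : isocoop R) (ds : dstruct X).
Local Notation D := (DC ds).
Hypothesis th_d : forall S (a : S) Q (la : leaf a) (vS : has_vertex S) (vQ : has_vertex Q)
  k (u : dfam X (graft S a Q) k),
  theta_fun ds la vS vQ (ds_d ds _ k u) = tdiff (D S) (D Q) k (theta_fun ds la vS vQ u).

Definition thD S (a : S) Q (la : leaf a) (vS : has_vertex S) (vQ : has_vertex Q) :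
    chain_map (D (graft S a Q)) (tensor (D S) (D Q)) :=
  @ChainMap R (D (graft S a Q)) (tensor (D S) (D Q)) (fun k => @theta_fun R X ds S a Q la vS vQ k)
    (fun k => @theta_linear R X ds S a Q la vS vQ k) (@th_d S a Q la vS vQ).

Section Right.
Variables (S S1 : tree) (f : hom S S1) (a : S) (Q Q1 : tree) (g : hom Q Q1) (b : Q)
  (P P1 : tree) (h : hom P P1).
Hypotheses (la : leaf a) (lb : leaf b) (vS : has_vertex S) (vQ : has_vertex Q) (vP : has_vertex P).

(** The effect of [J] at [(f, graft_hom g b h)] once the second factor has been split in turn;
    [Jl_fun] is the analogue for the first factor. *)
Definition Jr_fun k n p q (x : X S1 p) (w : tensor (X Q1) (X P1) q) : tensor (D S) (tensor (D Q) (D P)) k :=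
  if p + q == n then jsg X f a (graft Q1 (g b) P1) p *:
    @ten R (D S) (tensor (D Q) (D P)) k _ _ (iota (p + sh X S1) f x)
       (J ds g b h (q + sh X Q1 + sh X P1) q w)
  else 0.
Lemma Jr_fun0 k n p q (x : X S1 p) (w : tensor (X Q1) (X P1) q) : p + q != n -> Jr_fun k n x w = 0.
Proof. by rewrite /Jr_fun => /negbTE ->. Qed.
Lemma Jr_funl k n p q (w : tensor (X Q1) (X P1) q) : linear (fun x : X S1 p => Jr_fun k n x w).
Proof.
move=> c x x'; rewrite /Jr_fun; case: eqP => _; last by rewrite scaler0 addr0.
by rewrite linearP ten_linl scalerDr !scalerA (mulrC c).
Qed.
Lemma Jr_funr k n p q (x : X S1 p) : linear (fun w : tensor (X Q1) (X P1) q => Jr_fun k n x w).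
Proof.
move=> c x' x''; rewrite /Jr_fun; case: eqP => _; last by rewrite scaler0 addr0.
by rewrite linearP ten_linr scalerDr !scalerA (mulrC c).
Qed.
Definition Jr k n : {linear tensor (X S1) (tensor (X Q1) (X P1)) n -> tensor (D S) (tensor (D Q) (D P)) k} :=
  bilift (@Jr_fun0 k n) (@Jr_funl k n) (@Jr_funr k n).
Lemma Jr_ten k n p q (x : X S1 p) (w : tensor (X Q1) (X P1) q) : p + q = n ->
  Jr k n (ten n x w) = jsg X f a (graft Q1 (g b) P1) p *:
    @ten R (D S) (tensor (D Q) (D P)) k _ _ (iota (p + sh X S1) f x)
       (J ds g b h (q + sh X Q1 + sh X P1) q w).
Proof. by move=> e; rewrite /Jr biliftE /Jr_fun e eqxx. Qed.
#[global] Opaque Jr.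

Lemma JrE k n z :
  tens_fun (cm_id (D S)) (thD lb vQ vP) k (J ds f a (graft_hom g b h) k n z) =
  Jr k n (tens_map (cm_id (X S1)) (ic_theta X (hleaf g lb) (hver g vQ) (hver h vP)) n z).
Proof.
apply: (@ten_lin_ext _ _ _ _ _ (tens_fun (cm_id (D S)) (thD lb vQ vP) k \o J ds f a (graft_hom g b h) k n)
  (Jr k n \o tens_fun (cm_id (X S1)) (ic_theta X (hleaf g lb) (hver g vQ) (hver h vP)) n)).
move=> p q x y e; rewrite /= JE // linearZ /= !tens_funE Jr_ten //; congr (_ *: _).
rewrite /= theta_iota; last by rewrite (sh_graft X (hleaf g lb) (hver g vQ) (hver h vP)) addrA.
by rewrite (sh_graft X (hleaf g lb) (hver g vQ) (hver h vP)) addrA.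
Qed.
End Right.

Section Left.
Variables (S S1 : tree) (f : hom S S1) (a : S) (Q Q1 : tree) (g : hom Q Q1) (c : graft S a Q)
  (P P1 : tree) (h : hom P P1).
Hypotheses (la : leaf a) (vS : has_vertex S) (vQ : has_vertex Q) (vP : has_vertex P).

Definition Jl_fun k n p q (w : tensor (X S1) (X Q1) p) (z : X P1 q) : tensor (tensor (D S) (D Q)) (D P) k :=
  if p + q == n then jsg X (graft_hom f a g) c P1 p *:
    @ten R (tensor (D S) (D Q)) (D P) k _ _ (J ds f a g (p + sh X S1 + sh X Q1) p w)
      (iota (q + sh X P1) h z)
  else 0.
Lemma Jl_fun0 k n p q (w : tensor (X S1) (X Q1) p) (z : X P1 q) : p + q != n -> Jl_fun k n w z = 0.
Proof. by rewrite /Jl_fun => /negbTE ->. Qed.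
Lemma Jl_funl k n p q (z : X P1 q) : linear (fun w : tensor (X S1) (X Q1) p => Jl_fun k n w z).
Proof.
move=> e x x'; rewrite /Jl_fun; case: eqP => _; last by rewrite scaler0 addr0.
by rewrite linearP ten_linl scalerDr !scalerA (mulrC e).
Qed.
Lemma Jl_funr k n p q (w : tensor (X S1) (X Q1) p) : linear (fun z : X P1 q => Jl_fun k n w z).
Proof.
move=> e x x'; rewrite /Jl_fun; case: eqP => _; last by rewrite scaler0 addr0.
by rewrite linearP ten_linr scalerDr !scalerA (mulrC e).
Qed.
Definition Jl k n : {linear tensor (tensor (X S1) (X Q1)) (X P1) n -> tensor (tensor (D S) (D Q)) (D P) k} :=
  bilift (@Jl_fun0 k n) (@Jl_funl k n) (@Jl_funr k n).
Lemma Jl_ten k n p q (w : tensor (X S1) (X Q1) p) (z : X P1 q) : p + q = n ->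
  Jl k n (ten n w z) = jsg X (graft_hom f a g) c P1 p *:
    @ten R (tensor (D S) (D Q)) (D P) k _ _ (J ds f a g (p + sh X S1 + sh X Q1) p w)
      (iota (q + sh X P1) h z).
Proof. by move=> e; rewrite /Jl biliftE /Jl_fun e eqxx. Qed.
#[global] Opaque Jl.

Lemma JlE k n z :
  tens_fun (thD la vS vQ) (cm_id (D P)) k (J ds (graft_hom f a g) c h k n z) =
  Jl k n (tens_map (ic_theta X (hleaf f la) (hver f vS) (hver g vQ)) (cm_id (X P1)) n z).
Proof.
apply: (@ten_lin_ext _ _ _ _ _ (tens_fun (thD la vS vQ) (cm_id (D P)) k \o J ds (graft_hom f a g) c h k n)
  (Jl k n \o tens_fun (ic_theta X (hleaf f la) (hver f vS) (hver g vQ)) (cm_id (X P1)) n)).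
move=> p q x y e; rewrite /= JE // linearZ /= !tens_funE Jl_ten //; congr (_ *: _).
rewrite /= theta_iota; last by rewrite (sh_graft X (hleaf f la) (hver f vS) (hver g vQ)) addrA.
by rewrite (sh_graft X (hleaf f la) (hver f vS) (hver g vQ)) addrA.
Qed.
End Left.

Lemma iota_tiso S k T T' (t : tiso T T') (f : hom S T) n (x : X T n) :
  iota k f x = hsg R t *: iota k (hom_comp t f) (ix_map X t n x).
Proof. by rewrite iota_iso scalerA hsg2 scale1r. Qed.

Lemma podd_sh T : podd (sh X T) = ~~ podd #|inner T|%:Z.
Proof. by rewrite /sh; case: (ix_bar X); rewrite ?poddN !podd_nat. Qed.

Lemma dfam_graft3_ext S (a : S) Q (c : graft S a Q) P k (V : lmodType R)
   (phi psi : {linear dfam X (graft (graft S a Q) c P) k -> V}) :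
  leaf a -> has_vertex S -> has_vertex Q -> leaf c -> has_vertex P ->
  (forall S1 (f : hom S S1) Q1 (g : hom Q Q1) P1 (h : hom P P1) (n : int)
     (x : X (graft (graft S1 (f a) Q1) (graft_hom f a g c) P1) n),
     n + sh X S1 + sh X Q1 + sh X P1 = k ->
     phi (iota k (graft_hom (graft_hom f a g) c h) x) =
     psi (iota k (graft_hom (graft_hom f a g) c h) x)) -> phi =1 psi.
Proof.
move=> la vS vQ lc vP H; apply: dfam_graft_ext => //; first exact: graft_has_vertex.
move=> T F P1 h n x e; have [S1 [f [Q1 [g [t FE]]]]] := graft_split F la; subst F.
pose tt := graft_tiso t (graft_hom f a g c) (ti_id P1).
have hE : graft_hom (hom_comp t (graft_hom f a g)) c h =
    hom_comp tt (graft_hom (graft_hom f a g) c h).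
  by rewrite graft_tisoE -graft_hom_comp hom_idl.
have -> : x = ix_map X tt n (ix_map X (ti_inv tt) n x).
  rewrite -ix_comp (_ : ti_comp _ _ = ti_id _) ?ix_id //.
  by apply: tiso_ext; rewrite /= ti_fg.
rewrite hE iota_iso !linearZ; congr (_ *: _); apply: H.
by rewrite -e -[n + _ + _]addrA -(sh_graft X (hleaf f la) (hver f vS) (hver g vQ)) (sh_iso X t).
Qed.

(** All signs of associativity meet here: [e0] will be the sign of the canonical isomorphism, its
    relation to the four [gsgn] is [assoc_sgn], and the rest is [lam_assoc]. *)
Lemma JrJl S S1 (f : hom S S1) (a : S) Q Q1 (g : hom Q Q1) (b : Q) (c : graft S a Q) P P1 (h : hom P P1)
   (e0 : R) (k n : int) z : leaf (f a) -> has_vertex S1 -> has_vertex Q1 -> leaf (g b) -> has_vertex P1 ->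
  e0 * (gsgn R (graft_hom f a g c) P1 * gsgn R (f a) Q1) =
    ksgn R (1 + #|inner S1|%:Z) * (gsgn R (f a) (graft Q1 (g b) P1) * gsgn R (g b) P1) ->
  e0 *: Jr f a g b h k n (tens_assoc_lin n z) = tens_assoc_lin k (Jl f g c h k n z).
Proof.
move=> lfa vS1 vQ1 lgb vP1 e0E.
apply: (@ten3_ext R _ _ _ n _ (e0 \*: (Jr f a g b h k n \o tens_assoc_lin n))
  (tens_assoc_lin k \o Jl f g c h k n)) => p q r x y w e.
rewrite /= tens_assocE Jr_ten ?addrA // Jl_ten //.
rewrite (@JE' R X ds S S1 f a Q Q1 g _ _ p q (p + sh X S1) (q + sh X Q1)) //.
rewrite (@JE' R X ds Q Q1 g b P P1 h _ _ q r (q + sh X Q1) (r + sh X P1)) //.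
have e1 : p + q + sh X S1 + sh X Q1 = p + sh X S1 + (q + sh X Q1) by lia.
have e2 : q + r + sh X Q1 + sh X P1 = q + sh X Q1 + (r + sh X P1) by lia.
rewrite e1 e2 ten_Zl ten_Zr !linearZ /= tens_assocE !scalerA; congr (_ *: _).
rewrite /jsg /lamT !card_inner_graftZ //.
have := lam_assoc R (ix_bar X) #|inner S1| #|inner Q1| #|inner P1| p q.
move: e0E; move: (gsgn2 R (graft_hom f a g c) P1) (gsgn2 R (f a) Q1)
  (gsgn2 R (f a) (graft Q1 (g b) P1)) (gsgn2 R (g b) P1).
move: (gsgn R (graft_hom f a g c) P1) (gsgn R (f a) Q1)
  (gsgn R (f a) (graft Q1 (g b) P1)) (gsgn R (g b) P1) => Gc G1 G2 G3 hc h1 h2 h3 e0E.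
(* Each [gsgn] is its own inverse, so the two pairs may change sides. *)
have e0' : e0 * (G2 * G3) = ksgn R (1 + #|inner S1|%:Z) * (Gc * G1).
  transitivity (e0 * (Gc * G1) * (Gc * G1 * (G2 * G3))).
    by transitivity (e0 * (G2 * G3) * ((Gc * Gc) * (G1 * G1))); [rewrite hc h1; ring|ring].
  rewrite e0E; transitivity (ksgn R (1 + #|inner S1|%:Z) * (Gc * G1) * ((G2 * G2) * (G3 * G3))).
    by ring.
  by rewrite h2 h3; ring.
move: e0'; move: (ksgn R (1 + _)) => k0.
move: (ksgn R _) (ksgn R _) (ksgn R _) (ksgn R _) => k1 k2 k3 k4 e0' kE.
transitivity (e0 * (G2 * G3) * (k4 * k3)); first by ring.
rewrite e0'; transitivity (k0 * k4 * k3 * (Gc * G1)); first by ring.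
by rewrite kE; ring.
Qed.

(** On a generator, the square [tE] turns [dpull] along [graft_assoc] into the action of [t] on the
    entry; what is left is the associativity of [X] between [Jr] and [Jl]. *)
Lemma D_assoc S Q P (a : S) (b : Q)
    (la : leaf a) (lb : leaf b) (lb' : leaf (graft_inr a b))
    (vS : has_vertex S) (vQ : has_vertex Q) (vP : has_vertex P)
    (vSQ : has_vertex (graft S a Q)) (vQP : has_vertex (graft Q b P))
    k (u : D (graft (graft S a Q) (graft_inr a b) P) k) :
  tens_map (cm_id _) (thD lb vQ vP) k (thD la vS vQP k (dpull (graft_assoc a b P) u)) =
  tens_assoc_lin k (tens_map (thD la vS vQ) (cm_id _) k (thD lb' vSQ vP k u)).
Proof.
apply: (@dfam_graft3_ext _ _ _ _ _ k _
  (tens_fun (cm_id _) (thD lb vQ vP) k \o (@theta_fun R X ds _ _ _ la vS vQP k \o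
     @dpull R X _ _ (graft_assoc a b P) k))
  (tens_assoc_lin k \o (tens_fun (thD la vS vQ) (cm_id _) k \o @theta_fun R X ds _ _ _ lb' vSQ vP k))) => //.
move=> S1 f Q1 g P1 h n x e.
have [t [[t1 t2 t3] tsg tas]] := @ic_assoc_at R X S1 Q1 P1 (f a) (g b) (graft_hom f a g (graft_inr a b))
  (hleaf f la) (hleaf g lb) (hleaf (graft_hom f a g) lb') (hver f vS) (hver g vQ) (hver h vP)
  (hver (graft_hom f a g) vSQ) (hver (graft_hom g b h) vQP) (graft_hom_inr f a g b).
have tE : hom_comp t (graft_hom (graft_hom f a g) (graft_inr a b) h) =
    hom_comp (graft_hom f a (graft_hom g b h)) (graft_assoc a b P).
  apply: hom_ext => y; rewrite -[LHS]/(t (graft_hom (graft_hom f a g) (graft_inr a b) h y)).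
  rewrite -[RHS]/(graft_hom f a (graft_hom g b h) (graft_assoc_fun y)).
  have [[z ->]|[r nr ->]] := graftP y; last first.
    by rewrite (graft_hom_inr (graft_hom f a g) _ h r) t3 graft_assoc_r !(graft_hom_inr f a) (graft_hom_inr g b).
  have [[s ->]|[q nq ->]] := graftP z.
    by rewrite (graft_hom_inl (graft_hom f a g)) (graft_hom_inl f a g s) t1 graft_assoc_ll (graft_hom_inl f a).
  by rewrite (graft_hom_inl (graft_hom f a g)) (graft_hom_inr f a g q) t2 graft_assoc_lr (graft_hom_inr f a) (graft_hom_inl g b).
have e1 : dpull (graft_assoc a b P) (iota k (graft_hom (graft_hom f a g) (graft_inr a b) h) x) =
    hsg R t *: iota k (graft_hom f a (graft_hom g b h)) (ix_map X t n x).
  by rewrite (iota_tiso k t) tE linearZ /= dpull_iota.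
have e2 := @theta_iota R X ds _ _ _ la vS vQP k _ f _ (graft_hom g b h) n (ix_map X t n x).
have e3 := @theta_iota R X ds _ _ _ lb' vSQ vP k _ (graft_hom f a g) _ h n x.
have shQ := sh_graft X (hleaf g lb) (hver g vQ) (hver h vP).
have shS := sh_graft X (hleaf f la) (hver f vS) (hver g vQ).
have E2 : n + sh X S1 + sh X (graft Q1 (g b) P1) = k by rewrite shQ -e; lia.
have E3 : n + sh X (graft S1 (f a) Q1) + sh X P1 = k by rewrite shS -e; lia.
rewrite [LHS]/= e1 linearZ /= e2 // linearZ /= e3 //.
rewrite JrE.
rewrite /thx tas.
rewrite JlE.
apply: JrJl => //; [exact: hleaf|exact: (hver f)|exact: (hver g)|exact: hleaf|exact: (hver h)].
Qed.

Lemma JlJl S S1 (f : hom S S1) (a b : S) Q Q1 (g : hom Q Q1) (c : graft S a Q) P P1 (h : hom P P1)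
   (c' : graft S b P) (e0 : R) (k n : int) z :
  leaf (f a) -> leaf (f b) -> has_vertex S1 -> has_vertex Q1 -> has_vertex P1 ->
  e0 * (gsgn R (graft_hom f a g c) P1 * gsgn R (f a) Q1) =
    ksgn R (1 + #|inner Q1|%:Z * #|inner P1|%:Z) * (gsgn R (graft_hom f b h c') Q1 * gsgn R (f b) P1) ->
  Jl f g c h k n (tens_exch_lin n z) = e0 *: tens_exch_lin k (Jl f h c' g k n z).
Proof.
move=> lfa lfb vS1 vQ1 vP1 e0E.
apply: (@ten3_ext R _ _ _ n _ (Jl f g c h k n \o tens_exch_lin n)
  (e0 \*: (tens_exch_lin k \o Jl f h c' g k n))) => p r q x w y e.
rewrite /= tens_exchE linearZ /= Jl_ten; last by lia.
rewrite Jl_ten //.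
rewrite (@JE' R X ds S S1 f a Q Q1 g _ _ p q (p + sh X S1) (q + sh X Q1)) //.
rewrite (@JE' R X ds S S1 f b P P1 h _ _ p r (p + sh X S1) (r + sh X P1)) //.
have e1 : p + q + sh X S1 + sh X Q1 = p + sh X S1 + (q + sh X Q1) by lia.
have e2 : p + r + sh X S1 + sh X P1 = p + sh X S1 + (r + sh X P1) by lia.
rewrite e1 e2 !ten_Zl !linearZ /= tens_exchE !scalerA; congr (_ *: _).
rewrite /jsg /lamT !card_inner_graftZ //.
have := lam_exch R (ix_bar X) #|inner S1| p q r (podd_sh Q1) (podd_sh P1).
move: e0E; move: (gsgn2 R (graft_hom f a g c) P1) (gsgn2 R (f a) Q1)
  (gsgn2 R (graft_hom f b h c') Q1) (gsgn2 R (f b) P1).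
move: (gsgn R (graft_hom f a g c) P1) (gsgn R (f a) Q1)
  (gsgn R (graft_hom f b h c') Q1) (gsgn R (f b) P1) => Gc G1 G2 G3 hc h1 h2 h3 e0E.
have e0' : e0 * (G2 * G3) = ksgn R (1 + #|inner Q1|%:Z * #|inner P1|%:Z) * (Gc * G1).
  transitivity (e0 * (Gc * G1) * (Gc * G1 * (G2 * G3))).
    by transitivity (e0 * (G2 * G3) * ((Gc * Gc) * (G1 * G1))); [rewrite hc h1; ring|ring].
  rewrite e0E; transitivity (ksgn R (1 + #|inner Q1|%:Z * #|inner P1|%:Z) * (Gc * G1) * ((G2 * G2) * (G3 * G3))).
    by ring.
  by rewrite h2 h3; ring.
move: e0'; move: (ksgn R (1 + _)) => k0.
move: (ksgn R _) (ksgn R _) (ksgn R _) (ksgn R _) (ksgn R _) (ksgn R _) => k1 k2 k3 k4 k5 k6 e0' kE.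
transitivity (k6 * k5 * k4 * (Gc * G1)); first by ring.
rewrite kE; transitivity (k0 * (Gc * G1) * (k3 * k2 * k1)); first by ring.
by rewrite -e0'; ring.
Qed.

Lemma D_exch S Q P (a b : S)
    (la : leaf a) (lb : leaf b) (nab : a != b)
    (lb' : leaf (graft_inl a Q b)) (la' : leaf (graft_inl b P a))
    (vS : has_vertex S) (vQ : has_vertex Q) (vP : has_vertex P)
    (vSQ : has_vertex (graft S a Q)) (vSP : has_vertex (graft S b P))
    k (u : D (graft (graft S a Q) (graft_inl a Q b) P) k) :
  tens_map (thD la vS vQ) (cm_id _) k (thD lb' vSQ vP k u) =
  tens_exch_lin k (tens_map (thD lb vS vP) (cm_id _) k
    (thD la' vSP vQ k (dpull (graft_exch a b Q P) u))).
Proof.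
apply: (@dfam_graft3_ext _ _ _ _ _ k _
  (tens_fun (thD la vS vQ) (cm_id _) k \o @theta_fun R X ds _ _ _ lb' vSQ vP k)
  (tens_exch_lin k \o (tens_fun (thD lb vS vP) (cm_id _) k \o (@theta_fun R X ds _ _ _ la' vSP vQ k \o
     @dpull R X _ _ (graft_exch a b Q P) k)))) => //.
move=> S1 f Q1 g P1 h n x e.
have nfab : f a != f b by rewrite (inj_eq (@hom_inj _ _ f)).
have [t [[t1 t2 t3] tsg tas]] := @ic_exch_at R X S1 Q1 P1 (f a) (f b) (graft_hom f a g (graft_inl a Q b))
  (graft_hom f b h (graft_inl b P a))
  (hleaf f la) (hleaf f lb) nfab (hleaf (graft_hom f a g) lb') (hleaf (graft_hom f b h) la')
  (hver f vS) (hver g vQ) (hver h vP) (hver (graft_hom f a g) vSQ) (hver (graft_hom f b h) vSP)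
  (graft_hom_inl f a g b) (graft_hom_inl f b h a).
have tE : hom_comp t (graft_hom (graft_hom f a g) (graft_inl a Q b) h) =
    hom_comp (graft_hom (graft_hom f b h) (graft_inl b P a) g) (graft_exch a b Q P).
  apply: hom_ext => y; rewrite -[LHS]/(t (graft_hom (graft_hom f a g) (graft_inl a Q b) h y)).
  rewrite -[RHS]/(graft_hom (graft_hom f b h) (graft_inl b P a) g (graft_exch_fun y)).
  have [[z ->]|[r nr ->]] := graftP y; last first.
    by rewrite (graft_hom_inr (graft_hom f a g) _ h r) t3 graft_exch_r (graft_hom_inl (graft_hom f b h)) (graft_hom_inr f b h r).
  have [[s ->]|[q nq ->]] := graftP z.
    by rewrite (graft_hom_inl (graft_hom f a g)) (graft_hom_inl f a g s) t1 graft_exch_ll (graft_hom_inl (graft_hom f b h)) (graft_hom_inl f b h s).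
  by rewrite (graft_hom_inl (graft_hom f a g)) (graft_hom_inr f a g q) t2 graft_exch_lr (graft_hom_inr (graft_hom f b h)).
have e1 : dpull (graft_exch a b Q P) (iota k (graft_hom (graft_hom f a g) (graft_inl a Q b) h) x) =
    hsg R t *: iota k (graft_hom (graft_hom f b h) (graft_inl b P a) g) (ix_map X t n x).
  by rewrite (iota_tiso k t) tE linearZ /= dpull_iota.
have e2 := @theta_iota R X ds _ _ _ la' vSP vQ k _ (graft_hom f b h) _ g n (ix_map X t n x).
have e3 := @theta_iota R X ds _ _ _ lb' vSQ vP k _ (graft_hom f a g) _ h n x.
have shQ := sh_graft X (hleaf f lb) (hver f vS) (hver h vP).
have shS := sh_graft X (hleaf f la) (hver f vS) (hver g vQ).
have E2 : n + sh X (graft S1 (f b) P1) + sh X Q1 = k by rewrite shQ -e; lia.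
have E3 : n + sh X (graft S1 (f a) Q1) + sh X P1 = k by rewrite shS -e; lia.
rewrite [RHS]/= e1 linearZ /= e2 // !linearZ /= e3 //.
rewrite JlE.
rewrite JlE.
rewrite /thx tas.
apply: JlJl => //; [exact: hleaf|exact: hleaf|exact: (hver f)|exact: (hver g)|exact: (hver h)].
Qed.
End AssocD.

Lemma codim_rep S T (f : hom S T) : codim (projT2 (repc (toc f))) = codim f.
Proof. by apply: (cinv_rep f) => T1 T2 t g; apply: codim_tcomp. Qed.

(** * Codimension one morphisms out of a graft *)

Section Csum1Graft.
Variable R : comPzRingType.

(** The single new edge lies in one of the two factors. If it lies in the first, it has to cross the
    inner edges of [T2], which gives the factor [ksgn]. *)
Lemma csum1_graft T1 (a : T1) T2 (V : lmodType R) (F : forall T, hom (graft T1 a T2) T -> V) :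
  leaf a -> has_vertex T1 -> has_vertex T2 -> seqv F ->
  csum1 F =
  csum1 (fun T' (g : hom T1 T') => (ksgn R #|inner T2|%:Z * gsgn R a T2 * gsgn R (g a) T2) *:
     F _ (graft_hom g a (hom_id T2))) +
  csum1 (fun T' (g : hom T2 T') => (gsgn R a T2 * gsgn R a T') *: F _ (graft_hom (hom_id T1) a g)).
Proof.
move=> la v1 v2 Fs.
have id1 T : codim (hom_id T) = 0%N := codim_ti (ti_id T).
pose h (j : cls T1 + cls T2) : {T : tree & hom (graft T1 a T2) T} :=
  match j with
  | inl c => existT _ _ (graft_hom (projT2 (repc c)) a (hom_id T2))
  | inr c => existT _ _ (graft_hom (hom_id T1) a (projT2 (repc c)))
  end.
pose P (j : cls T1 + cls T2) : bool :=
  match j with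
  | inl c => codim (projT2 (repc c)) == 1%N
  | inr c => codim (projT2 (repc c)) == 1%N
  end.
rewrite {1}/csum1 (@csum_reindex _ _ _ P h); first last.
- move=> [i|i] [j|j] /= /eqP ci /eqP cj e.
  + have [e1 _] := toc_graft_inj la v1 v2 e; congr inl.
    by rewrite -(toc_repc i) -(toc_repc j).
  + have [/toc_eq[t tE] _] := toc_graft_inj la v1 v2 e.
    by have := codim_tcomp t (projT2 (repc i)); rewrite tE id1 ci.
  + have [/toc_eq[t tE] _] := toc_graft_inj la v1 v2 e.
    by have := codim_tcomp t (hom_id T1); rewrite tE id1 cj.
  + have [_ e2] := toc_graft_inj la v1 v2 e; congr inr.
    by rewrite -(toc_repc i) -(toc_repc j).
- move=> T f fh; case: eqP => // c1.
  have [S' [f1 [Q' [g [t fE]]]]] := graft_split f la; subst f.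
  move: c1; rewrite codim_tcomp codim_graft.
  have tE : toc (graft_hom f1 a g) = toc (hom_comp t (graft_hom f1 a g)) by apply/toc_eq; exists t.
  have [c0|c0] := eqVneq (codim g) 0%N => c1.
    have [s sE] := codim0_ti c0.
    case: (fh (inl (toc f1))) => /=; first by rewrite codim_rep; move: c1; rewrite c0 addn0 => ->.
    rewrite -tE; apply: toc_graft; first by rewrite toc_repc.
    by apply/toc_eq; exists s; rewrite hom_idr.
  have c0' : codim f1 = 0%N by lia.
  have [s sE] := codim0_ti c0'.
  case: (fh (inr (toc g))) => /=; first by rewrite codim_rep; move: c1; rewrite c0' add0n => ->.
  rewrite -tE; apply: toc_graft; last by rewrite toc_repc.
  by apply/toc_eq; exists s; rewrite hom_idr.
- exact: csum1_cinv.
have r1 T' (g : hom T1 T') : codim g = 1%N ->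
    (if codim (graft_hom g a (hom_id T2)) == 1%N then
       hsg R (graft_hom g a (hom_id T2)) *: F _ (graft_hom g a (hom_id T2)) else 0) =
    hsg R g *: ((ksgn R #|inner T2|%:Z * gsgn R a T2 * gsgn R (g a) T2) *: F _ (graft_hom g a (hom_id T2))).
  move=> c1; rewrite codim_graft c1 id1 /= scalerA; congr (_ *: _).
  have := hsg_graft (f := g) (a := a) (g := hom_id T2) R la v1 v2; rewrite c1 id1 hsg_id mulr1 mul1n ksgn_nat.
  by move=> /(_ isT) h1; rewrite -[LHS]mulr1 -(gsgn2 R a T2) mulrA h1; ring.
have r2 T' (g : hom T2 T') : codim g = 1%N ->
    (if codim (graft_hom (hom_id T1) a g) == 1%N then
       hsg R (graft_hom (hom_id T1) a g) *: F _ (graft_hom (hom_id T1) a g) else 0) =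
    hsg R g *: ((gsgn R a T2 * gsgn R a T') *: F _ (graft_hom (hom_id T1) a g)).
  move=> c1; rewrite codim_graft c1 id1 /= scalerA; congr (_ *: _).
  have := hsg_graft (f := hom_id T1) (a := a) (g := g) R la v1 v2; rewrite c1 id1 hsg_id mulr1 mul0n expr0 mul1r.
  by move=> /(_ isT) h1; rewrite -[LHS]mulr1 -(gsgn2 R a T2) mulrA h1 /=; ring.
rewrite big_sumType /csum1 /csum; congr (_ + _); rewrite big_mkcond; apply: eq_bigr => c _.
  by rewrite [P _]/=; case: eqP => // c1; apply: r1.
by rewrite [P _]/=; case: eqP => // c1; apply: r2.
Qed.

(** Change of variable along [t]; the weight [hsg R t] compensates the change of [hsg] under
    precomposition. *)
Lemma csum1_tiso T T' (t : tiso T T') (V : lmodType R) (F : forall U, hom T' U -> V) : seqv F ->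
  csum1 (fun U (g : hom T U) => hsg R t *: F U (hom_comp g (ti_g t))) = csum1 F.
Proof.
move=> Fs; rewrite {1}/csum1 (csum_factor (f := t)).
- apply: eq_csum => U g; rewrite codim_comp codim_ti addn0; case: eqP => // c1.
  rewrite hsg_comp0 ?codim_ti // scalerA -mulrA hsg2 mulr1; congr (_ *: F _ _).
  by rewrite -hom_compA ti_fg hom_idr.
- move=> U U' s g; rewrite codim_tcomp; case: eqP => // c1.
  rewrite hsg_comp1 ?codim_ti ?c1 // -hom_compA Fs !scalerA; congr (_ *: _).
  by transitivity (hsg R g * hsg R t * (hsg R s * hsg R s)); [ring|rewrite hsg2 mulr1].
- move=> U g g0; case: (g0 (hom_comp g (ti_g t))).
  by rewrite -hom_compA ti_gf hom_idr.
Qed.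
End Csum1Graft.

(** * The bar and cobar complexes *)

Section BarD.
Variables (R : comPzRingType) (M : presheaf R).

Lemma psh_ix_id T n (x : M T n) : psh_map M (ti_g (ti_id T)) n x = x.
Proof. exact: psh_id. Qed.
Lemma psh_ix_comp T T' T'' (s : tiso T' T'') (t : tiso T T') n (x : M T n) :
  psh_map M (ti_g (ti_comp s t)) n x = psh_map M (ti_g s) n (psh_map M (ti_g t) n x).
Proof. exact: psh_comp. Qed.
Definition barX : isofun R :=
  @IsoFun R M true (fun T T' t => psh_map M (ti_g t)) psh_ix_id psh_ix_comp.

(** The sign [(-1)^{|d|+|e|}] of the internal differentials, which depends on the target only. *)
Definition msg T : R := ksgn R #|inner T|%:Z.
Lemma msg_hom T T' (g : hom T T') : codim g = 1%N -> msg T' = - msg T.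
Proof. by move=> c1; rewrite /msg (card_inner g) c1 -ksgnB1; apply: ksgn_eq; rewrite /podd; lia. Qed.
Lemma msg_iso T T' (t : tiso T T') : msg T' = msg T.
Proof. by rewrite /msg (card_inner t) codim_ti addn0. Qed.

Section Diff.
Variables (S : tree) (k : int).
Definition bar_ext (u : dfam barX S k) T (f : hom S T) n : M T n :=
  csum1 (fun T' (g : hom T T') => psh_map M g n (pr (hom_comp g f) n u)).
(** Moving [e_i] to the end of the word turns [(-1)^{d+i}] into [(-1)^{d+p-1}], which is [msg] of
    the face; hence the common factor, taken at the smaller tree. The minus sign of the internal
    part is that of the differential of [sM]. *)
Definition bar_d_fun (u : dfam barX S k) T (f : hom S T) n : M T n :=
  msg T *: (bar_ext u f n - cst n (cx_d (M T) _ (pr f (n + 1) u))).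

Lemma bar_ext_seqv (u : dfam barX S k) T (f : hom S T) n :
  seqv (fun T' (g : hom T T') => psh_map M g n (pr (hom_comp g f) n u)).
Proof.
move=> T1 T2 t g; rewrite -hom_compA pr_iso linearZ /= -psh_comp; congr (_ *: psh_map M _ _ _).
by rewrite hom_compA ti_gf hom_idl.
Qed.

Lemma sh_succ T T' (g : hom T T') : codim g = 1%N -> sh barX T' = sh barX T + 1.
Proof. by move=> c1; rewrite /sh /barX /= (card_inner g) c1; move: #|_| => m; lia. Qed.

Lemma bar_d_deg u T (f : hom S T) n : n + sh barX T != k - 1 -> bar_d_fun u f n = 0.
Proof.
move=> h; rewrite /bar_d_fun /bar_ext csum1_0 ?sub0r; last first.
  by move=> T' g c1; rewrite pr_deg ?linear0 // (sh_succ c1); apply: contraNneq h => <-; apply/eqP; lia.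
rewrite pr_deg ?linear0 ?oppr0 ?scaler0 //.
by apply: contraNneq h => <-; apply/eqP; lia.
Qed.

Lemma bar_ext_iso u T T' (t : tiso T T') (f : hom S T) n :
  bar_ext u (hom_comp t f) n = hsg R t *: psh_map M (ti_g t) n (bar_ext u f n).
Proof.
rewrite /bar_ext csum1_linear -csum1Z -(csum1_tiso t); last exact: bar_ext_seqv.
apply: eq_csum1 => U g _; congr (_ *: _); rewrite /= psh_comp; congr (psh_map M _ _ (psh_map M _ _ _)).
by rewrite -hom_compA [hom_comp (ti_g t) _]hom_compA ti_gf hom_idl.
Qed.

Lemma bar_d_iso u T T' (t : tiso T T') (f : hom S T) n :
  bar_d_fun u (hom_comp t f) n = hsg R t *: ix_map barX t n (bar_d_fun u f n).
Proof.
rewrite /bar_d_fun (msg_iso t) linearZ /= scalerA (mulrC (hsg R t)) -scalerA; congr (_ *: _).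
rewrite linearB scalerBr; congr (_ - _).
  exact: bar_ext_iso.
rewrite pr_iso !linearZ /=; congr (_ *: _).
by rewrite -cm_d (cst_map (f := psh_map M (ti_g t))) ?linear0.
Qed.

Definition bar_d (u : dfam barX S k) : dfam barX S (k - 1) := DFam (bar_d_deg u) (bar_d_iso u).
Lemma pr_bar_d u T (f : hom S T) n :
  pr f n (bar_d u) = msg T *: (bar_ext u f n - cst n (cx_d (M T) _ (pr f (n + 1) u))).
Proof. by []. Qed.

Lemma bar_d_linear : linear bar_d.
Proof.
move=> c u v; apply: pr_ext => T f n _; rewrite [RHS]linearP /= !pr_bar_d.
have -> : bar_ext (c *: u + v) f n = c *: bar_ext u f n + bar_ext v f n.
  rewrite /bar_ext -csum1Z -csum1D; apply: eq_csum1 => T' g _.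
  rewrite [pr _ _ _]linearP; exact: (linearP (psh_map M g n)).
have -> : cst n (cx_d (M T) _ (pr f (n + 1) (c *: u + v))) =
    c *: cst n (cx_d (M T) _ (pr f (n + 1) u)) + cst n (cx_d (M T) _ (pr f (n + 1) v)).
  by rewrite [pr _ _ _]linearP (linearP (cx_d (M T) (n + 1))) linearP.
rewrite opprD addrACA -scalerBr scalerDr !scalerA.
by rewrite (mulrC c).
Qed.
End Diff.
HB.instance Definition _ S k := GRing.isLinear.Build R (dfam barX S k) (dfam barX S (k - 1)) *:%R
  (@bar_d S k) (@bar_d_linear S k).

(** The mixed terms cancel because [msg] changes sign along a morphism of codimension 1. *)
Lemma bar_dd S k (u : dfam barX S k) : bar_d (bar_d u) = 0.
Proof.
apply: pr_ext => T f n _; rewrite linear0 pr_bar_d pr_bar_d.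
have -> : bar_ext (bar_d u) f n = msg T *: csum1 (fun T' (g : hom T T') =>
    cst n (cx_d (M T) _ (psh_map M g _ (pr (hom_comp g f) (n + 1) u)))).
  (* The 0 that is subtracted is then written as the double sum of [csum1_csum1], to absorb the
     square of the external part. *)
  rewrite /bar_ext -csum1Z -[RHS]subr0 -(scaler0 _ (msg T)).
  rewrite -(@csum1_csum1 R T _ (fun T' (g : hom T T') => psh_map M g n (pr (hom_comp g f) n u)));
    last exact: bar_ext_seqv.
  rewrite -csum1Z -[X in _ = _ + X]scaleN1r -csum1Z -csum1D; apply: eq_csum1 => T' g c1.
  rewrite pr_bar_d (msg_hom c1) linearZ linearB /= scalerBr scaleNr addrC; congr (_ + _).
    rewrite scaleNr opprK; congr (_ *: _).
    by rewrite (cst_map (f := psh_map M g)) ?linear0 // cm_d.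
  rewrite scaleN1r; congr (- (_ *: _)); rewrite /bar_ext csum1_linear; apply: eq_csum1 => U h _.
  by rewrite psh_comp hom_compA.
have -> : cst n (cx_d (M T) (n + 1) (msg T *: (bar_ext u f (n + 1) -
    cst (n + 1) (cx_d (M T) (n + 1 + 1) (pr f (n + 1 + 1) u))))) =
  msg T *: csum1 (fun T' (g : hom T T') =>
    cst n (cx_d (M T) _ (psh_map M g _ (pr (hom_comp g f) (n + 1) u)))).
  rewrite linearZ /= linearZ /=; congr (_ *: _); rewrite linearB /= linearB /=.
  rewrite [X in _ - cst _ X](_ : _ = 0) ?linear0 ?addr0; last by rewrite cst_d cx_dd linear0.
  by rewrite /bar_ext csum1_linear csum1_linear; apply: eq_csum1.
by rewrite subrr scaler0.
Qed.

Definition barDS : dstruct barX := DStruct bar_dd.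
End BarD.

Lemma graft_hom_comp_idl S S' (f : hom S S') (a : S) Q Q' Q'' (g : hom Q Q') (h : hom Q' Q'') :
  hom_comp (graft_hom (hom_id S') (f a) h) (graft_hom f a g) = graft_hom f a (hom_comp h g).
Proof.
apply: hom_ext => z; exact: (congr1 (fun h : hom _ _ => h z) (esym (graft_hom_comp (hom_id S') f a h g))).
Qed.

Section Csum1L.
Variables (R : comPzRingType) (S : tree) (U V : lmodType R).
Variable F : forall T, hom S T -> {linear U -> V}.
Definition csum1L (u : U) : V := csum1 (fun T f => F f u).
Lemma csum1L_linear : linear csum1L.
Proof.
move=> c u v; rewrite /csum1L -csum1Z -csum1D; apply: eq_csum1 => T f _; exact: linearP.
Qed.
HB.instance Definition _ := GRing.isLinear.Build R U V *:%R csum1L csum1L_linear.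
End Csum1L.

Section CstTen.
Variables (R : comPzRingType) (A B : complex R).
Lemma ten_cstl n m m' q (x : A m) (y : B q) : m = m' -> ten n (cst m' x) y = ten n x y.
Proof. by move=> e; subst m'; rewrite cst_id. Qed.
Lemma ten_cstr n p m m' (x : A p) (y : B m) : m = m' -> ten n x (cst m' y) = ten n x y.
Proof. by move=> e; subst m'; rewrite cst_id. Qed.
Lemma cst_tdiff n p q c (x : A p) (y : B q) :
  @cst R (tensor A B) (n + 1 - 1) n (tdiff A B (n + 1) (c *: ten (n + 1) x y)) =
  c *: (ten n (cx_d A p x) y + ksgn R p *: ten n x (cx_d B q y)).
Proof.
rewrite linearZ_LR tdiffE linearZ_LR; congr (_ *: _).
have -> : n + 1 - 1 = n by lia.
exact: cst_id.
Qed.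
Lemma tenBl n p q (x x' : A p) (y : B q) : ten n (x - x') y = ten n x y - ten n x' y.
Proof. exact: (linearB (@tenl R A B n _ _ y)). Qed.
Lemma tenBr n p q (x : A p) (y y' : B q) : ten n x (y - y') = ten n x y - ten n x y'.
Proof. exact: (linearB (@tenr R A B n _ _ x)). Qed.
Lemma ten_csum1l S n p q (F : forall T, hom S T -> A p) (y : B q) :
  ten n (csum1 F) y = csum1 (fun T f => ten n (F T f) y : tensor A B n).
Proof. exact: (csum1_linear (@tenl R A B n _ _ y)). Qed.
Lemma ten_csum1r S n p q (F : forall T, hom S T -> B q) (x : A p) :
  ten n x (csum1 F) = csum1 (fun T f => ten n x (F T f) : tensor A B n).
Proof. exact: (csum1_linear (@tenr R A B n _ _ x)). Qed.
End CstTen.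

(** * The bar differential and the structure maps *)

Section BarTheta.
Variables (R : comPzRingType) (M : preoperad R).
Local Notation X := (barX M).

Lemma tens_map_id2 (A B : complex R) n (z : tensor A B n) : tens_map (cm_id A) (cm_id B) n z = z.
Proof. exact: tens_map_id. Qed.

Lemma bar_natural S S' Q Q' (t1 : tiso S S') (t2 : tiso Q Q') (a : S)
    (la : leaf a) (vS : has_vertex S) (vQ : has_vertex Q)
    (la' : leaf (t1 a)) (vS' : has_vertex S') (vQ' : has_vertex Q')
    n (x : X (graft S a Q) n) :
  po_theta M la' vS' vQ' n (ix_map X (graft_tiso t1 a t2) n x) =
  tens_map (ix_map X t1) (ix_map X t2) n (po_theta M la vS vQ n x).
Proof.
set y := ix_map _ _ _ x.
have -> : x = psh_map M (graft_hom t1 a t2) n y.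
  rewrite /y /= -psh_comp -graft_tisoE ti_gf psh_id //.
rewrite po_natural -[RHS]/(tens_map _ _ n _).
rewrite -tens_map_comp -[LHS]tens_map_id2; congr (tens_map _ _ n _);
  by apply/esym/chain_map_ext => m w /=; rewrite -psh_comp ti_fg psh_id.
Qed.

Lemma bar_assoc S Q P (a : S) (b : Q)
    (la : leaf a) (lb : leaf b) (lb' : leaf (graft_inr a b))
    (vS : has_vertex S) (vQ : has_vertex Q) (vP : has_vertex P)
    (vSQ : has_vertex (graft S a Q)) (vQP : has_vertex (graft Q b P))
    (t : tiso (graft (graft S a Q) (graft_inr a b) P) (graft S a (graft Q b P)))
    n (x : X (graft (graft S a Q) (graft_inr a b) P) n) :
  ti_f t = graft_assoc a b P ->
  tens_map (cm_id _) (po_theta M lb vQ vP) n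
    (po_theta M la vS vQP n (ix_map X t n x)) =
  tens_assoc_lin n
    (tens_map (po_theta M la vS vQ) (cm_id _) n (po_theta M lb' vSQ vP n x)).
Proof.
by move=> tE; rewrite po_assoc /= -tE -psh_comp ti_gf psh_id.
Qed.

Lemma bar_exch S Q P (a b : S)
    (la : leaf a) (lb : leaf b) (nab : a != b)
    (lb' : leaf (graft_inl a Q b)) (la' : leaf (graft_inl b P a))
    (vS : has_vertex S) (vQ : has_vertex Q) (vP : has_vertex P)
    (vSQ : has_vertex (graft S a Q)) (vSP : has_vertex (graft S b P))
    (t : tiso (graft (graft S a Q) (graft_inl a Q b) P)
              (graft (graft S b P) (graft_inl b P a) Q))
    n (x : X (graft (graft S a Q) (graft_inl a Q b) P) n) :
  ti_f t = graft_exch a b Q P ->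
  tens_map (po_theta M la vS vQ) (cm_id _) n (po_theta M lb' vSQ vP n x) =
  tens_exch_lin n
    (tens_map (po_theta M lb vS vP) (cm_id _) n
       (po_theta M la' vSP vQ n (ix_map X t n x))).
Proof.
move=> tE; rewrite -(po_exch la lb nab lb' la' vS vQ vP vSQ vSP).
by rewrite /= -tE -psh_comp ti_gf psh_id.
Qed.

Definition barI : isocoop R := @IsoCoop R X (@po_theta R M) bar_natural bar_assoc bar_exch.
Local Notation D := (DC (barDS M)).

(** This is [msg] of a graft of the two trees; the summand 1 counts the grafted edge. *)
Definition s12 S Q : R := ksgn R (#|inner S|%:Z + #|inner Q|%:Z + 1).

Section KD.
Variables (S S' : tree) (f : hom S S') (a : S) (Q Q' : tree) (g : hom Q Q').
Local Notation KK f g := (@K R barI (barDS M) _ _ f a _ _ g).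

(** The coefficients of the two sums are [s12] times those of [csum1_graft], so the external part of
    the tensor product matches that of the graft term by term. *)
Lemma K_bar_d (k n : int) (z : tensor (D S) (D Q) k) : n + sh X S' + sh X Q' = k - 1 ->
  KK f g (k - 1) n (tdiff (D S) (D Q) k z) =
  - s12 S' Q' *: cst n (tdiff (M S') (M Q') (n + 1) (KK f g k (n + 1) z)) +
  (csum1 (fun S'' (h : hom S' S'') =>
    (s12 S' Q' * ksgn R #|inner Q'|%:Z * gsgn R (f a) Q' * gsgn R (h (f a)) Q') *:
     tens_map (psh_map M h) (cm_id (M Q')) n (KK (hom_comp h f) g k n z)) +
  csum1 (fun Q'' (h : hom Q' Q'') =>
    (s12 S' Q' * gsgn R (f a) Q' * gsgn R (f a) Q'') *:
     tens_map (cm_id (M S')) (psh_map M h) n (KK f (hom_comp h g) k n z))).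
Proof.
move=> e.
pose F1 S'' (h : hom S' S'') := (s12 S' Q' * ksgn R #|inner Q'|%:Z * gsgn R (f a) Q' * gsgn R (h (f a)) Q') \*:
   (tens_fun (psh_map M h) (cm_id (M Q')) n \o KK (hom_comp h f) g k n) : {linear tensor (D S) (D Q) k -> tensor (M S') (M Q') n}.
pose F2 Q'' (h : hom Q' Q'') := (s12 S' Q' * gsgn R (f a) Q' * gsgn R (f a) Q'') \*:
   (tens_fun (cm_id (M S')) (psh_map M h) n \o KK f (hom_comp h g) k n) : {linear tensor (D S) (D Q) k -> tensor (M S') (M Q') n}.
apply: (@ten_lin_ext _ (D S) (D Q) k _ (KK f g (k - 1) n \o tdiff (D S) (D Q) k)
  ((- s12 S' Q' \*: (@cst R (tensor (M S') (M Q')) (n + 1 - 1) n \o tdiff (M S') (M Q') (n + 1) \o KK f g k (n + 1)))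
   \+ (csum1L F1 \+ csum1L F2))) => p q u v pq.
rewrite [LHS]/= [RHS]/= /csum1L /F1 /F2 tdiffE linearD linearZ /=.
have KE2 S1 (f1 : hom S S1) Q1 (g1 : hom Q Q1) (k' n' p' q' m1 m2 : int) (u' : D S p') (v' : D Q q') :
    p' + q' = k' -> p' = m1 + sh X S1 -> q' = m2 + sh X Q1 ->
    KK f1 g1 k' n' (ten k' u' v') = jsg barI f1 a Q1 m1 *: @ten R (M S1) (M Q1) n' _ _ (pr f1 m1 u') (pr g1 m2 v').
  exact: (@KE' R barI (barDS M) S S1 f1 a Q Q1 g1 k' n' p' q' m1 m2 u' v').
(* The components of [u] and [v] in play have degrees [m1 + 1] and [m2 + 1], of which the
   differential lowers one. *)
have [m1 e1] : exists m1 : int, p = m1 + 1 + sh X S' by exists (p - 1 - sh X S'); lia.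
have [m2 e2] : exists m2 : int, q = m2 + 1 + sh X Q' by exists (q - 1 - sh X Q'); lia.
rewrite (KE2 _ _ _ _ _ _ _ _ m1 (m2 + 1)); [|lia..].
rewrite (KE2 _ _ _ _ _ _ _ _ (m1 + 1) m2); [|lia..].
rewrite (KE2 _ _ _ _ _ _ _ _ (m1 + 1) (m2 + 1)); [|lia..].
rewrite cst_tdiff.
rewrite !pr_bar_d.
have jE m : jsg barI f a Q' m = gsgn R (f a) Q' * ksgn R (lam true #|inner S'| #|inner Q'| m) by [].
have pE : podd p = ~~ podd (m1 + #|inner S'|%:Z + 1).
  have -> : p = m1 + #|inner S'|%:Z + 1 + 1 by rewrite e1 /sh /=; move: #|_| => ?; lia.
  by rewrite poddD podd1 addbT.
set x := pr f (m1 + 1) u; set y := pr g (m2 + 1) v.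
rewrite ten_Zl ten_Zr !tenBl !tenBr ten_cstl ?ten_cstr; [|lia..].
rewrite /bar_ext ten_csum1l ten_csum1r.
rewrite !scalerA !scalerBr !scalerDr !scalerA -!csum1Z.
rewrite addrACA [RHS]addrC -opprD; congr (_ + _); [congr (_ + _)|].
- apply: eq_csum1 => S'' h c1.
  rewrite (KE2 _ _ _ _ _ _ _ _ m1 (m2 + 1)); [|by rewrite ?(sh_succ M c1); lia..].
  rewrite linearZ /= tens_funE scalerA; congr (_ *: _).
  have ks : ksgn R (lam true #|inner S'| #|inner Q'| m1) * ksgn R #|inner S'| =
     ksgn R (#|inner S'|%:Z + #|inner Q'|%:Z + 1) * ksgn R #|inner Q'| * ksgn R (lam true #|inner S''| #|inner Q'| m1).
    rewrite (card_inner h) c1 -!ksgnD; apply: ksgn_eq; rewrite /lam PoszD !(poddD, poddN, poddM, podd1).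
    by case: (podd #|inner S'|) (podd #|inner Q'|) (podd m1) => [] [] [].
  rewrite jE /jsg /lamT /s12 /msg -mulrA ks /=.
  by ring: (gsgn2 R (h (f a)) Q').
- apply: eq_csum1 => Q'' h c1.
  rewrite (KE2 _ _ _ _ _ _ _ _ (m1 + 1) m2); [|by rewrite ?(sh_succ M c1); lia..].
  rewrite linearZ /= tens_funE scalerA; congr (_ *: _).
  have ks : ksgn R p * ksgn R (lam true #|inner S'| #|inner Q'| (m1 + 1)) * ksgn R #|inner Q'| =
     ksgn R (#|inner S'|%:Z + #|inner Q'|%:Z + 1) * ksgn R (lam true #|inner S'| #|inner Q''| (m1 + 1)).
    rewrite (card_inner h) c1 -!ksgnD; apply: ksgn_eq; rewrite /lam PoszD !(poddD, poddN, poddM, podd1) pE !poddD podd1.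
    by case: (podd #|inner S'|) (podd #|inner Q'|) (podd m1) => [] [] [].
  rewrite jE /jsg /lamT /s12 /msg /=.
  transitivity (gsgn R (f a) Q' * (ksgn R p * ksgn R (lam true #|inner S'| #|inner Q'| (m1 + 1)) * ksgn R #|inner Q'|)); first by ring.
  by rewrite ks; ring: (gsgn2 R (f a) Q'').
rewrite opprD -!scaleNr; congr (_ *: _ + _ *: _); rewrite !mulNr; congr (- _).
  rewrite !jE /msg /s12.
  have ks : ksgn R (lam true #|inner S'| #|inner Q'| m1) * ksgn R #|inner S'| =
    ksgn R (#|inner S'|%:Z + #|inner Q'|%:Z + 1) * ksgn R (lam true #|inner S'| #|inner Q'| (m1 + 1)).
    rewrite -!ksgnD; apply: ksgn_eq; rewrite /lam !(poddD, poddN, poddM, podd1).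
    by case: (podd #|inner S'|) (podd #|inner Q'|) (podd m1) => [] [] [].
  by rewrite -mulrA ks; ring.
rewrite /msg /s12.
have -> : ksgn R p = ksgn R (m1 + #|inner S'|%:Z) by apply: ksgn_eq; rewrite pE !poddD podd1 addbT negbK.
rewrite !ksgnD; ring: (ksgn2 R 1).
Qed.
End KD.

Lemma psh_id_cm T : psh_map M (hom_id T) = cm_id (M T).
Proof. by apply: chain_map_ext => n x; rewrite psh_id. Qed.

(** In coordinates, the internal parts agree since [po_theta] is a chain map, and the external ones
    by its naturality along a morphism grafted with an identity. *)
Lemma bar_th_d S (a : S) Q (la : leaf a) (vS : has_vertex S) (vQ : has_vertex Q)
    k (u : dfam barI (graft S a Q) k) :
  theta_fun (barDS M : dstruct barI) la vS vQ (ds_d (barDS M) _ k u) =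
  tdiff (D S) (D Q) k (theta_fun (barDS M : dstruct barI) la vS vQ u).
Proof.
apply: (@K_sep _ _ _ _ a) => S' f Q' g n e.
rewrite K_bar_d // K_theta // K_theta; last by move: e; rewrite /=; lia.
have lfa := hleaf f la; have vS' := hver f vS; have vQ' := hver g vQ.
rewrite [ds_d _ _ _ _]/(bar_d u) pr_bar_d.
have -> : msg R (graft S' (f a) Q') = s12 S' Q'.
  by rewrite /msg card_inner_graftZ //; congr ksgn; lia.
rewrite /thx linearZ_LR linearB /= scalerBr addrC -scaleNr; congr (_ *: _ + _).
  have := @cst_map R _ _ (fun m => po_theta M (hleaf f la) (hver f vS) (hver g vQ) m).
  move=> ->; last exact: linear0.
  by congr cst; apply: (cm_d (po_theta M (hleaf f la) (hver f vS) (hver g vQ))).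
rewrite /bar_ext (@csum1_graft R S' (f a) Q') //; last first.
  exact: bar_ext_seqv.
rewrite (linearD (po_theta M _ _ _ n)) scalerDr; congr (_ + _).
  rewrite (csum1_linear (po_theta M (hleaf f la) (hver f vS) (hver g vQ) n)) -csum1Z; apply: eq_csum1 => S'' h c1.
  rewrite linearZ_LR scalerA K_theta; last by have := sh_succ M c1; move: e; rewrite -![sh barI _]/(sh X _); lia.
  rewrite !mulrA; congr (_ *: _).
  apply: (etrans (@po_natural R M _ _ _ _ h (hom_id Q') (f a) (hleaf f la) (hver f vS) (hver g vQ) (hleaf (hom_comp h f) la) (hver (hom_comp h f) vS) (hver g vQ) n _)).
  rewrite psh_id_cm /thx; congr (tens_map _ _ n (po_theta M _ _ _ n _)).
  by rewrite -graft_hom_comp hom_idl.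
rewrite (csum1_linear (po_theta M (hleaf f la) (hver f vS) (hver g vQ) n)) -csum1Z; apply: eq_csum1 => Q'' h c1.
rewrite linearZ_LR scalerA K_theta; last by have := sh_succ M c1; move: e; rewrite -![sh barI _]/(sh X _); lia.
rewrite !mulrA; congr (_ *: _).
apply: (etrans (@po_natural R M _ _ _ _ (hom_id S') h (f a) (hleaf f la) (hver f vS) (hver g vQ) (hleaf f la) (hver f vS) (hver (hom_comp h g) vQ) n _)).
rewrite psh_id_cm /thx; congr (tens_map _ _ n (po_theta M _ _ _ n _)).
exact: (congr1 (fun w : hom _ (graft S' (f a) Q'') => pr w n u) (graft_hom_comp_idl f a g h)).
Qed.
End BarTheta.

(** * The cobar differential on generators *)

Section CobarD.
Variables (R : comPzRingType) (Y : copresheaf R).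

Lemma cps_ix_id T n (x : Y T n) : cps_map Y (ti_id T) n x = x.
Proof. exact: cps_id. Qed.
Lemma cps_ix_comp T T' T'' (s : tiso T' T'') (t : tiso T T') n (x : Y T n) :
  cps_map Y (ti_comp s t) n x = cps_map Y s n (cps_map Y t n x).
Proof. exact: cps_comp. Qed.
Definition cobX : isofun R :=
  @IsoFun R Y false (fun T T' t => cps_map Y t) cps_ix_id cps_ix_comp.

Lemma sh_cob_succ T T' (g : hom T T') : codim g = 1%N -> sh cobX T' = sh cobX T - 1.
Proof. by move=> c1; rewrite /sh /cobX /= (card_inner g) c1; move: #|_| => m; lia. Qed.

Section Diff.
Variables (S : tree) (k : int).

(** In symbols the new edge is appended as the last letter, so [hsg] is the only sign. *)
Definition cob_ext T (f : hom S T) n (y : Y T n) : dfam cobX S (k - 1) :=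
  csum1 (fun T' (g : hom T T') => @iota R cobX S (k - 1) T' (hom_comp g f) n (cps_map Y g n y)).
Definition cob_gen T (f : hom S T) n (y : Y T n) : dfam cobX S (k - 1) :=
  cob_ext f y - msg R T *: @iota R cobX S (k - 1) T f (n - 1) (cx_d (Y T) n y).

Lemma cob_ext_seqv T (f : hom S T) n (y : Y T n) :
  seqv (fun T' (g : hom T T') => @iota R cobX S (k - 1) T' (hom_comp g f) n (cps_map Y g n y)).
Proof.
move=> T1 T2 t g; rewrite -hom_compA cps_comp.
exact: (@iota_iso R cobX).
Qed.

Lemma cob_gen_linear T (f : hom S T) n : linear (cob_gen f (n := n)).
Proof.
move=> c x y; rewrite /cob_gen (linearP (cx_d (Y T) n)) (linearP (@iota R cobX S (k - 1) T f (n - 1))).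
have -> : cob_ext f (c *: x + y) = c *: cob_ext f x + cob_ext f y.
  rewrite /cob_ext -csum1Z -csum1D; apply: eq_csum1 => T' g _.
  by rewrite (linearP (cps_map Y g n)) (linearP (@iota R cobX S (k - 1) T' (hom_comp g f) n)).
by rewrite scalerDr opprD addrACA scalerBr !scalerA (mulrC c).
Qed.
HB.instance Definition _ T (f : hom S T) n :=
  GRing.isLinear.Build R (Y T n) (dfam cobX S (k - 1)) *:%R (@cob_gen T f n) (@cob_gen_linear T f n).

Lemma cob_gen0 T (f : hom S T) n : cob_gen f (0 : Y T n) = 0.
Proof. exact: linear0. Qed.

Definition cob_term (u : dfam cobX S k) T (f : hom S T) : dfam cobX S (k - 1) :=
  cob_gen f (pr f (k - sh cobX T) u).
Definition cob_d (u : dfam cobX S k) : dfam cobX S (k - 1) := csum (cob_term u).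

Lemma cob_d_linear : linear cob_d.
Proof.
move=> c u v; rewrite /cob_d /csum scaler_sumr -big_split; apply: eq_bigr => i _ /=.
by rewrite /cob_term [pr _ _ _]linearP (linearP (cob_gen _ (n := _))).
Qed.
HB.instance Definition _ :=
  GRing.isLinear.Build R (dfam cobX S k) (dfam cobX S (k - 1)) *:%R cob_d cob_d_linear.

Lemma cob_gen_iso T T' (t : tiso T T') (f : hom S T) n (y : Y T n) :
  cob_gen (hom_comp t f) (cps_map Y t n y) = hsg R t *: cob_gen f y.
Proof.
rewrite /cob_gen scalerBr; congr (_ - _).
  rewrite /cob_ext -(csum1_tiso t) -?csum1Z; last exact: cob_ext_seqv.
  apply: eq_csum1 => U g _; rewrite -cps_comp.
  have eg : hom_comp (hom_comp g (ti_g t)) t = g by rewrite -hom_compA ti_gf hom_idr.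
  by rewrite hom_compA eg.
rewrite (msg_iso R t) -cm_d (@iota_iso R cobX) !scalerA; congr (_ *: _).
exact: mulrC.
Qed.

Lemma cob_term_cinv u : cinv (cob_term u).
Proof.
move=> T T' t f; rewrite /cob_term (sh_iso cobX t) pr_iso linearZ_LR.
by rewrite /= cob_gen_iso scalerA hsg2 scale1r.
Qed.

Lemma cob_d_iota T (f : hom S T) n (y : Y T n) : n + sh cobX T = k ->
  cob_d (@iota R cobX S k T f n y) = cob_gen f y.
Proof.
move=> e; have nE : k - sh cobX T = n by lia.
rewrite /cob_d (@csum_single _ _ _ _ f); first by rewrite /cob_term nE pr_iota.
  exact: cob_term_cinv.
move=> T' f' ne; rewrite /cob_term pr_iota0 //.
  exact: cob_gen0.
by apply: nesym.
Qed.
End Diff.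

Lemma cob_dd S k (u : dfam cobX S k) : cob_d (cob_d u) = 0.
Proof.
apply: (@dfam_lin_ext R cobX S k _ (@cob_d S (k - 1) \o @cob_d S k) \0) => T f n y e.
rewrite [LHS]/= [RHS]/= cob_d_iota // /cob_gen linearB linearZ_LR /=.
rewrite cob_d_iota; last by rewrite -e; lia.
rewrite /cob_gen cx_dd linear0 scaler0 subr0 /cob_ext csum1_linear.
apply/eqP; rewrite subr_eq0; apply/eqP.
rewrite -csum1Z -[RHS]add0r.
rewrite -(@csum1_csum1 R T _ (fun T' (g : hom T T') =>
   @iota R cobX S (k - 1 - 1) T' (hom_comp g f) n (cps_map Y g n y))); last exact: cob_ext_seqv.
rewrite -csum1D; apply: eq_csum1 => T' g c1.
rewrite /= cob_d_iota; last by have := sh_cob_succ c1; lia.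
rewrite /cob_gen (msg_hom R c1) scaleNr opprK cm_d; congr (_ + _).
by rewrite /cob_ext; apply: eq_csum1 => U h _; rewrite cps_comp hom_compA.
Qed.

Definition cobDS : dstruct cobX := DStruct cob_dd.
End CobarD.

Lemma graft_hom_comp_idr S S' S'' (f : hom S S') (a : S) Q Q' (g : hom Q Q') (h : hom S' S'') :
  hom_comp (graft_hom h (f a) (hom_id Q')) (graft_hom f a g) = graft_hom (hom_comp h f) a g.
Proof.
apply: hom_ext => z.
have := congr1 (fun h : hom _ _ => h z) (graft_hom_comp h f a (hom_id Q') g).
by rewrite hom_idl => ->.
Qed.

Section CobarTheta.
Variables (R : comPzRingType) (Y : precooperad R).
Local Notation X := (cobX Y).

Lemma cob_natural S S' Q Q' (t1 : tiso S S') (t2 : tiso Q Q') (a : S)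
    (la : leaf a) (vS : has_vertex S) (vQ : has_vertex Q)
    (la' : leaf (t1 a)) (vS' : has_vertex S') (vQ' : has_vertex Q')
    n (x : X (graft S a Q) n) :
  pc_theta Y la' vS' vQ' n (ix_map X (graft_tiso t1 a t2) n x) =
  tens_map (ix_map X t1) (ix_map X t2) n (pc_theta Y la vS vQ n x).
Proof. by rewrite /= graft_tisoE; apply: pc_natural. Qed.

Lemma cob_assoc S Q P (a : S) (b : Q)
    (la : leaf a) (lb : leaf b) (lb' : leaf (graft_inr a b))
    (vS : has_vertex S) (vQ : has_vertex Q) (vP : has_vertex P)
    (vSQ : has_vertex (graft S a Q)) (vQP : has_vertex (graft Q b P))
    (t : tiso (graft (graft S a Q) (graft_inr a b) P) (graft S a (graft Q b P)))
    n (x : X (graft (graft S a Q) (graft_inr a b) P) n) :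
  ti_f t = graft_assoc a b P ->
  tens_map (cm_id _) (pc_theta Y lb vQ vP) n
    (pc_theta Y la vS vQP n (ix_map X t n x)) =
  tens_assoc_lin n
    (tens_map (pc_theta Y la vS vQ) (cm_id _) n (pc_theta Y lb' vSQ vP n x)).
Proof. by move=> tE; rewrite -(pc_assoc la lb lb' vS vQ vP vSQ vQP) -tE. Qed.

Lemma cob_exch S Q P (a b : S)
    (la : leaf a) (lb : leaf b) (nab : a != b)
    (lb' : leaf (graft_inl a Q b)) (la' : leaf (graft_inl b P a))
    (vS : has_vertex S) (vQ : has_vertex Q) (vP : has_vertex P)
    (vSQ : has_vertex (graft S a Q)) (vSP : has_vertex (graft S b P))
    (t : tiso (graft (graft S a Q) (graft_inl a Q b) P)
              (graft (graft S b P) (graft_inl b P a) Q))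
    n (x : X (graft (graft S a Q) (graft_inl a Q b) P) n) :
  ti_f t = graft_exch a b Q P ->
  tens_map (pc_theta Y la vS vQ) (cm_id _) n (pc_theta Y lb' vSQ vP n x) =
  tens_exch_lin n
    (tens_map (pc_theta Y lb vS vP) (cm_id _) n
       (pc_theta Y la' vSP vQ n (ix_map X t n x))).
Proof. by move=> tE; rewrite /= tE; apply: pc_exch. Qed.

Definition cobI : isocoop R := @IsoCoop R X (@pc_theta R Y) cob_natural cob_assoc cob_exch.
Local Notation D := (DC (cobDS Y)).

Section JD.
Variables (S S' : tree) (f : hom S S') (a : S) (Q Q' : tree) (g : hom Q Q').
Local Notation JJ f g := (@J R cobI (cobDS Y) _ _ f a _ _ g).

(** Plays on generators the part of [K_bar_d] on coordinates. The factor [s12] is missing from the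
    external sums because [cob_gen] puts [msg] on the internal part only. *)
Lemma J_cobar_d (k n : int) (z : tensor (Y S') (Y Q') n) : n + sh X S' + sh X Q' = k ->
  tdiff (D S) (D Q) k (JJ f g k n z) =
  - s12 R S' Q' *: JJ f g (k - 1) (n - 1) (tdiff (Y S') (Y Q') n z) +
  (csum1 (fun S'' (h : hom S' S'') =>
    (ksgn R #|inner Q'|%:Z * gsgn R (f a) Q' * gsgn R (h (f a)) Q') *:
     JJ (hom_comp h f) g (k - 1) n (tens_map (cps_map Y h) (cm_id (Y Q')) n z)) +
  csum1 (fun Q'' (h : hom Q' Q'') =>
    (gsgn R (f a) Q' * gsgn R (f a) Q'') *:
     JJ f (hom_comp h g) (k - 1) n (tens_map (cm_id (Y S')) (cps_map Y h) n z))).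
Proof.
move=> e.
pose F1 S'' (h : hom S' S'') := (ksgn R #|inner Q'|%:Z * gsgn R (f a) Q' * gsgn R (h (f a)) Q') \*:
   (JJ (hom_comp h f) g (k - 1) n \o tens_fun (cps_map Y h) (cm_id (Y Q')) n) : {linear tensor (Y S') (Y Q') n -> tensor (D S) (D Q) (k - 1)}.
pose F2 Q'' (h : hom Q' Q'') := (gsgn R (f a) Q' * gsgn R (f a) Q'') \*:
   (JJ f (hom_comp h g) (k - 1) n \o tens_fun (cm_id (Y S')) (cps_map Y h) n) : {linear tensor (Y S') (Y Q') n -> tensor (D S) (D Q) (k - 1)}.
apply: (@ten_lin_ext _ (Y S') (Y Q') n _ (tdiff (D S) (D Q) k \o JJ f g k n)
  ((- s12 R S' Q' \*: (JJ f g (k - 1) (n - 1) \o tdiff (Y S') (Y Q') n))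
   \+ (csum1L F1 \+ csum1L F2))) => p q x y pq.
rewrite [LHS]/= [RHS]/= /csum1L /F1 /F2 tdiffE.
have JE2 S1 (f1 : hom S S1) Q1 (g1 : hom Q Q1) (k' n' p' q' k1 k2 : int) (x' : Y S1 p') (y' : Y Q1 q') :
    p' + q' = n' -> k1 = p' + sh X S1 -> k2 = q' + sh X Q1 ->
    JJ f1 g1 k' n' (ten n' x' y') = jsg cobI f1 a Q1 p' *:
      @ten R (D S) (D Q) k' _ _ (@iota R X S k1 S1 f1 p' x') (@iota R X Q k2 Q1 g1 q' y').
  exact: (@JE' R cobI (cobDS Y) S S1 f1 a Q Q1 g1 k' n' p' q' k1 k2 x' y').
have [k1 e1] : exists k1 : int, k1 = p + sh X S' by exists (p + sh X S').
have [k2 e2] : exists k2 : int, k2 = q + sh X Q' by exists (q + sh X Q').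
have jE m : jsg cobI f a Q' m = gsgn R (f a) Q' * ksgn R (lam false #|inner S'| #|inner Q'| m) by [].
have pE : podd k1 = ~~ podd (p + #|inner S'|%:Z).
  have -> : k1 = p - #|inner S'|%:Z - 1 by rewrite e1 /sh /=; move: #|_| => ?; lia.
  by rewrite !poddD !poddN podd1 addbT.
rewrite linearD linearZ_LR.
rewrite (JE2 _ _ _ _ _ _ _ _ k1 k2) //.
rewrite (JE2 _ _ _ _ _ _ _ _ (k1 - 1) k2) //; [|lia..].
rewrite (JE2 _ _ _ _ _ _ _ _ k1 (k2 - 1)) //; [|lia..].
rewrite linearZ_LR /= tdiffE -[cx_d (D S) _ _]/(cob_d _) -[cx_d (D Q) _ _]/(cob_d _).
rewrite !cob_d_iota // /cob_gen !tenBl !tenBr /cob_ext ten_csum1l ten_csum1r ten_Zl ten_Zr.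
rewrite !scalerDr !scalerN !scalerA -!csum1Z.
rewrite addrACA [RHS]addrC -opprD; congr (_ + _); [congr (_ + _)|].
- apply: eq_csum1 => S'' h c1; rewrite tens_funE.
  rewrite (JE2 _ _ _ _ _ _ _ _ (k1 - 1) k2) // ?(sh_cob_succ Y c1); [|lia..].
  rewrite scalerA; congr (_ *: _).
  have ks : ksgn R (lam false #|inner S'| #|inner Q'| p) =
     ksgn R #|inner Q'| * ksgn R (lam false #|inner S''| #|inner Q'| p).
    rewrite (card_inner h) c1 -!ksgnD; apply: ksgn_eq; rewrite /lam PoszD !(poddD, poddN, poddM, podd1).
    by case: (podd #|inner S'|) (podd #|inner Q'|) (podd p) => [] [] [].
  by rewrite jE /jsg /lamT ks /=; ring: (gsgn2 R (h (f a)) Q').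
- apply: eq_csum1 => Q'' h c1; rewrite tens_funE.
  rewrite (JE2 _ _ _ _ _ _ _ _ k1 (k2 - 1)) // ?(sh_cob_succ Y c1); [|lia..].
  rewrite scalerA; congr (_ *: _).
  have ks : ksgn R (lam false #|inner S'| #|inner Q'| p) * ksgn R k1 =
     ksgn R (lam false #|inner S'| #|inner Q''| p).
    rewrite (card_inner h) c1 -!ksgnD; apply: ksgn_eq; rewrite /lam PoszD !(poddD, poddN, poddM, podd1) pE !poddD.
    by case: (podd #|inner S'|) (podd #|inner Q'|) (podd p) => [] [] [].
  by rewrite jE /jsg /lamT -mulrA ks /=; ring: (gsgn2 R (f a) Q'').
rewrite opprD -!scaleNr; congr (_ *: _ + _ *: _); rewrite !mulNr; congr (- _).
  rewrite !jE /msg /s12.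
  have ks : ksgn R (lam false #|inner S'| #|inner Q'| p) * ksgn R #|inner S'| =
    ksgn R (#|inner S'|%:Z + #|inner Q'|%:Z + 1) * ksgn R (lam false #|inner S'| #|inner Q'| (p - 1)).
    rewrite -!ksgnD; apply: ksgn_eq; rewrite /lam !(poddD, poddN, poddM, podd1).
    by case: (podd #|inner S'|) (podd #|inner Q'|) (podd p) => [] [] [].
  by rewrite -mulrA ks; ring.
rewrite /msg /s12.
have -> : ksgn R k1 = ksgn R (p + #|inner S'|%:Z + 1) by apply: ksgn_eq; rewrite pE !poddD podd1 addbT.
rewrite !ksgnD; ring.
Qed.
End JD.

Lemma cps_id_cm T : cps_map Y (hom_id T) = cm_id (Y T).
Proof. by apply: chain_map_ext => n x; rewrite cps_id. Qed.

Lemma cob_th_d S (a : S) Q (la : leaf a) (vS : has_vertex S) (vQ : has_vertex Q)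
    k (u : dfam cobI (graft S a Q) k) :
  theta_fun (cobDS Y : dstruct cobI) la vS vQ (ds_d (cobDS Y) _ k u) =
  tdiff (D S) (D Q) k (theta_fun (cobDS Y : dstruct cobI) la vS vQ u).
Proof.
pose thi T (w : hom (graft S a Q) T) (n : int) (x : Y T n) :=
  @theta_fun R cobI (cobDS Y) S a Q la vS vQ (k - 1) (@iota R X (graft S a Q) (k - 1) T w n x).
have thiE S2 (f2 : hom S S2) Q2 (g2 : hom Q Q2) (n : int) (x : Y (graft S2 (f2 a) Q2) n) :
    n + sh X S2 + sh X Q2 = k - 1 ->
    thi _ (graft_hom f2 a g2) n x = J (cobDS Y : dstruct cobI) f2 a g2 (k - 1) n (thx (X := cobI) la vS vQ f2 g2 x).
  exact: (@theta_iota R cobI (cobDS Y)).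
pose th k := (@theta_fun R cobI (cobDS Y) S a Q la vS vQ k) : {linear _ -> _}.
apply: (@dfam_graft_ext R cobI S a Q la vS vQ k _
   (th (k - 1) \o @cob_d R Y (graft S a Q) k) (tdiff (D S) (D Q) k \o th k)) => S' f Q' g n x e.
rewrite [LHS]/= [RHS]/= /th.
have lfa := hleaf f la; have vS' := hver f vS; have vQ' := hver g vQ.
rewrite cob_d_iota; last by rewrite -e -addrA; congr (_ + _); apply: (sh_graft X lfa vS' vQ').
rewrite theta_iota // J_cobar_d // /cob_gen (linearB (th (k - 1))) (linearZ_LR (th (k - 1))) /= /th [LHS]addrC -scaleNr.
have -> : msg R (graft S' (f a) Q') = s12 R S' Q'.
  by rewrite /msg card_inner_graftZ //; congr ksgn; lia.
congr (_ *: _ + _).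
  rewrite theta_iota; last by rewrite -e -![sh cobI _]/(sh X _); lia.
  apply: (congr1 (fun w => J (cobDS Y : dstruct cobI) f a g (k - 1) (n - 1) w)); exact: (cm_d (pc_theta Y (hleaf f la) (hver f vS) (hver g vQ))).
rewrite /cob_ext csum1_linear (@csum1_graft R S' (f a) Q') //; last first.
  move=> T1 T2 t h; rewrite cob_ext_seqv linearZ_LR //.
congr (_ + _).
  apply: eq_csum1 => S'' h c1; congr (_ *: _).
  apply: (etrans (congr1 (fun w : hom _ (graft S'' (h (f a)) Q') => thi _ w _ _) (graft_hom_comp_idr f a g h))).
  apply: (etrans (thiE _ (hom_comp h f) _ g n _ _)).
    by have := sh_cob_succ Y c1; move: e; rewrite -![sh cobI _]/(sh X _); lia.
  apply: (congr1 (fun w => J (cobDS Y : dstruct cobI) (hom_comp h f) a g (k - 1) n w)).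
  apply: (etrans (@pc_natural R Y _ _ _ _ h (hom_id Q') (f a) (hleaf f la) (hver f vS) (hver g vQ) (hleaf (hom_comp h f) la) (hver (hom_comp h f) vS) (hver g vQ) n x)).
  by rewrite cps_id_cm.
apply: eq_csum1 => Q'' h c1; congr (_ *: _).
apply: (etrans (congr1 (fun w : hom _ (graft S' (f a) Q'') => thi _ w _ _) (graft_hom_comp_idl f a g h))).
apply: (etrans (thiE _ f _ (hom_comp h g) n _ _)).
  by have := sh_cob_succ Y c1; move: e; rewrite -![sh cobI _]/(sh X _); lia.
apply: (congr1 (fun w => J (cobDS Y : dstruct cobI) f a (hom_comp h g) (k - 1) n w)).
apply: (etrans (@pc_natural R Y _ _ _ _ (hom_id S') h (f a) (hleaf f la) (hver f vS) (hver g vQ) (hleaf f la) (hver f vS) (hver (hom_comp h g) vQ) n x)).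
by rewrite cps_id_cm.
Qed.
End CobarTheta.

(** * The structure maps are quasi-isomorphisms *)

Section QuasiIso.
Variable R : comPzRingType.

(* acyclicity of the mapping cone of [phi], spelled out on elements *)
Definition acyc (A B : complex R) (phi : chain_map A B) : Prop :=
  forall (n : int) (x : A (n - 1 - 1)) (y : B (n - 1)), cx_d A _ x = 0 -> phi _ x = cx_d B _ y ->
    exists (x' : A (n - 1)) (y' : B n), x = cx_d A _ x' /\ y = phi _ x' + cx_d B _ y'.

(** Injectivity gives a primitive of [x], whose image corrects [y] to a cycle; surjectivity then
    adjusts that primitive by a cycle. *)
Lemma quasi_iso_acyc (A B : complex R) (phi : chain_map A B) : quasi_iso phi -> acyc phi.
Proof.
move=> q n x y dx e; have [i _] := q (n - 1); have [_ s] := q n.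
have [x0 xE] : exists a : A (n - 1), x = cx_d A (n - 1) a by apply: i => //; exists y.
have dw : cx_d B _ (y - phi _ x0) = 0 by rewrite linearB /= -e xE cm_d subrr.
have [z dz [y' yE]] := s _ dw.
exists (x0 + z), y'; rewrite linearD /= dz addr0; split=> //.
by rewrite (linearD (phi (n - 1))) -addrA -yE addrC subrK.
Qed.

Lemma acyc_quasi_iso (A B : complex R) (phi : chain_map A B) : acyc phi -> quasi_iso phi.
Proof.
move=> h n; split.
  (* The cone condition speaks of degree [m - 1 - 1]; for injectivity it is used at [m = n + 1] and
     transported along [n + 1 - 1 = n]. *)
  have inj (m : int) (z : A (m - 1 - 1)) : cx_d A _ z = 0 ->
      (exists b : B (m - 1), phi _ z = cx_d B _ b) -> exists a : A (m - 1), z = cx_d A _ a.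
    by move=> dz [b zE]; have [x' [y' [xE _]]] := h m z b dz zE; exists x'.
  by move: (inj (n + 1)); have -> : n + 1 - 1 = n by lia.
move=> w dw; have [||x' [y' [xE yE]]] := h n 0 w; rewrite ?linear0 ?dw //.
by exists x' => //; exists y'.
Qed.

(* The differential of the bar construction lowers codimensions and that of the cobar
   construction raises them, which fixes the order of the elimination. *)
Definition before (b : bool) (m m' : nat) : bool := if b then (m' < m)%N else (m < m')%N.

Lemma sub2_eq0 (V : zmodType) (u v w : V) : u = v + w -> u - v - w = 0.
Proof. by move=> ->; rewrite [v + w]addrC addrK subrr. Qed.

Lemma scale_inj0 (V : lmodType R) (c : R) (v : V) : c * c = 1 -> c *: v = 0 -> v = 0.
Proof. by move=> c2 e; rewrite -[v]scale1r -c2 -scalerA e scaler0. Qed.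

Variables (X : isocoop R) (ds : dstruct X).
Local Notation D := (DC ds).
Hypothesis th_d : forall S (a : S) Q (la : leaf a) (vS : has_vertex S) (vQ : has_vertex Q)
  k (u : dfam X (graft S a Q) k),
  theta_fun ds la vS vQ (ds_d ds _ k u) = tdiff (D S) (D Q) k (theta_fun ds la vS vQ u).
(** If all earlier components vanish, only the internal differential reaches the component at [h].
    This and [K_lead] are all that the elimination knows about the differential besides [th_d]. *)
Hypothesis pr_lead : forall S (k : int) (u : dfam X S k) T (h : hom S T) (n : int), n + sh X T = k ->
  (forall T' (h' : hom S T') n', before (ix_bar X) (codim h') (codim h) -> pr h' n' u = 0) ->
  pr h (n - 1) (ds_d ds _ k u) = - msg R T *: cx_d (X T) n (pr h n u).
Hypothesis K_lead : forall S (a : S) Q (k : int) (z : tensor (D S) (D Q) k)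
  S' (f : hom S S') Q' (g : hom Q Q') (n : int), leaf a -> has_vertex S -> has_vertex Q ->
  n + sh X S' + sh X Q' = k ->
  (forall S1 (f1 : hom S S1) Q1 (g1 : hom Q Q1) n1,
     before (ix_bar X) (codim f1 + codim g1) (codim f + codim g) -> K ds f1 a g1 k n1 z = 0) ->
  K ds f a g (k - 1) (n - 1) (tdiff (D S) (D Q) k z) =
  - s12 R S' Q' *: tdiff (X S') (X Q') n (K ds f a g k n z).

Lemma K_nat S S' S'' (f : hom S S') (t1 : tiso S' S'') (a : S) Q Q' Q''
  (g : hom Q Q') (t2 : tiso Q' Q'') k n z : leaf a -> has_vertex S -> has_vertex Q ->
  K ds (hom_comp t1 f) a (hom_comp t2 g) k n z =
  hsg R (graft_tiso t1 (f a) t2) *: tens_map (ix_map X t1) (ix_map X t2) n (K ds f a g k n z).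
Proof.
move=> la vS vQ.
apply: (@ten_lin_ext _ _ _ _ _ (K ds (hom_comp t1 f) a (hom_comp t2 g) k n)
  (hsg R (graft_tiso t1 (f a) t2) \*: (tens_fun (ix_map X t1) (ix_map X t2) n \o K ds f a g k n))) => p q x y pq.
rewrite [RHS]/= !KE // (linearZ_LR (tens_fun (ix_map X t1) (ix_map X t2) n)) tens_funE.
rewrite (sh_iso X t1) (sh_iso X t2) !pr_iso ten_Zl ten_Zr !scalerA; congr (_ *: _).
rewrite /jsg /lamT (card_inner t1) (card_inner t2) !codim_ti !addn0.
have := hsg_graft (f := t1) (a := f a) (g := t2) R (hleaf f la) (hver f vS) (hver g vQ).
rewrite !codim_ti mul0n expr0 mul1r => /(_ isT) h.
rewrite graft_tisoE [in RHS]mulrA h; ring.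
Qed.

Lemma K_deg S S' (f : hom S S') (a : S) Q Q' (g : hom Q Q') k n z :
  n + sh X S' + sh X Q' != k -> K ds f a g k n z = 0.
Proof.
move=> ne; apply: (@ten_lin_ext _ _ _ _ _ (K ds f a g k n) \0) => p q x y pq.
rewrite KE // ten0 ?scaler0 //; apply: contraNneq ne => e; apply/eqP; lia.
Qed.

Lemma pr_lead' S (k : int) (u : dfam X S k) T (h : hom S T) (n : int) :
  (forall T' (h' : hom S T') n', before (ix_bar X) (codim h') (codim h) -> pr h' n' u = 0) ->
  pr h (n - 1) (ds_d ds _ k u) = - msg R T *: cx_d (X T) n (pr h n u).
Proof.
move=> h0; have [e|ne] := eqVneq (n + sh X T) k; first exact: pr_lead.
by rewrite !pr_deg ?linear0 ?scaler0 //; lia.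
Qed.

Lemma K_lead' S (a : S) Q (k : int) (z : tensor (D S) (D Q) k)
    S' (f : hom S S') Q' (g : hom Q Q') (n : int) : leaf a -> has_vertex S -> has_vertex Q ->
  (forall S1 (f1 : hom S S1) Q1 (g1 : hom Q Q1) n1,
     before (ix_bar X) (codim f1 + codim g1) (codim f + codim g) -> K ds f1 a g1 k n1 z = 0) ->
  K ds f a g (k - 1) (n - 1) (tdiff (D S) (D Q) k z) =
  - s12 R S' Q' *: tdiff (X S') (X Q') n (K ds f a g k n z).
Proof.
move=> la vS vQ h0; have [e|ne] := eqVneq (n + sh X S' + sh X Q') k; first exact: K_lead.
by rewrite !K_deg ?linear0 ?scaler0 //; lia.
Qed.

Lemma K_theta' S (a : S) Q (la : leaf a) (vS : has_vertex S) (vQ : has_vertex Q)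
    (k : int) S' (f : hom S S') Q' (g : hom Q Q') (n : int) (u : dfam X (graft S a Q) k) :
  K ds f a g k n (theta_fun ds la vS vQ u) = thx la vS vQ f g (pr (graft_hom f a g) n u).
Proof.
have [e|ne] := eqVneq (n + sh X S' + sh X Q') k; first exact: K_theta.
rewrite K_deg // pr_deg /thx ?linear0 //.
by rewrite (sh_graft X (hleaf f la) (hver f vS) (hver g vQ)) addrA.
Qed.

Section Elim.
Variables (S : tree) (a : S) (Q : tree).
Hypotheses (la : leaf a) (vS : has_vertex S) (vQ : has_vertex Q).
Hypothesis th_q : forall S' (f : hom S S') Q' (g : hom Q Q'),
  quasi_iso (ic_theta X (hleaf f la) (hver f vS) (hver g vQ)).
Local Notation pairs := (cls S * cls Q)%type.
Let rp (p : pairs) := graft_hom (projT2 (repc p.1)) a (projT2 (repc p.2)).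
Let rf (p : pairs) := projT2 (repc p.1).
Let rg (p : pairs) := projT2 (repc p.2).
Let lev (p : pairs) := (codim (rf p) + codim (rg p))%N.

Lemma pair_rep T (h : hom (graft S a Q) T) : exists (p : pairs) (t : tiso _ T), h = hom_comp t (rp p).
Proof.
have [S' [f [Q' [g [t ->]]]]] := graft_split h la.
have /toc_eq[t1 e1] := toc_repc (toc f); have /toc_eq[t2 e2] := toc_repc (toc g).
exists (toc f, toc g).
have /toc_eq[t3 e3] : toc (rp (toc f, toc g)) = toc (graft_hom f a g).
  by apply: toc_graft; rewrite toc_repc.
by exists (ti_comp t t3); rewrite -e3 hom_compA.
Qed.

Lemma pr_van k (u : D (graft S a Q) k) (P : nat -> Prop) :
  (forall p n, P (lev p) -> pr (rp p) n u = 0) ->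
  forall T (h : hom (graft S a Q) T) n, P (codim h) -> pr h n u = 0.
Proof.
move=> h0 T h n; have [p [t ->]] := pair_rep h.
by rewrite codim_tcomp codim_graft pr_iso => /h0 ->; rewrite linear0 scaler0.
Qed.

Lemma K_van k (z : tensor (D S) (D Q) k) (P : nat -> Prop) :
  (forall p n, P (lev p) -> K ds (rf p) a (rg p) k n z = 0) ->
  forall S1 (f1 : hom S S1) Q1 (g1 : hom Q Q1) n, P (codim f1 + codim g1)%N -> K ds f1 a g1 k n z = 0.
Proof.
move=> h0 S1 f1 Q1 g1 n.
have /toc_eq[t1 <-] := toc_repc (toc f1); have /toc_eq[t2 <-] := toc_repc (toc g1).
by rewrite !codim_tcomp K_nat // => /(h0 (toc f1, toc g1)) ->; rewrite linear0 scaler0.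
Qed.

(** One step of the elimination. The leading coordinates of the cone cycle [(x, y)] at [(f, g)]
    form, up to sign, a cycle in the cone of the structure map of [X], hence a boundary; its
    primitive, placed at [(f, g)], kills these coordinates and disturbs only pairs that come
    later. *)
Lemma elim_pair (k : int) (x : D (graft S a Q) (k - 1 - 1)) (y : tensor (D S) (D Q) (k - 1))
    S' (f : hom S S') Q' (g : hom Q Q') :
  cx_d (D _) _ x = 0 -> theta_fun ds la vS vQ x = tdiff (D S) (D Q) _ y ->
  (forall T (h : hom (graft S a Q) T) n, before (ix_bar X) (codim h) (codim f + codim g) -> pr h n x = 0) ->
  (forall S1 (f1 : hom S S1) Q1 (g1 : hom Q Q1) n,
    before (ix_bar X) (codim f1 + codim g1) (codim f + codim g) -> K ds f1 a g1 (k - 1) n y = 0) ->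
  exists (x' : D (graft S a Q) (k - 1)) (y' : tensor (D S) (D Q) k),
    (forall n, pr (graft_hom f a g) n (x - cx_d (D _) _ x') = 0 /\
       K ds f a g _ n (y - theta_fun ds la vS vQ x' - tdiff (D S) (D Q) _ y') = 0) /\
    (forall S1 (f1 : hom S S1) Q1 (g1 : hom Q Q1), toc f1 <> toc f \/ toc g1 <> toc g ->
       ~~ before (ix_bar X) (codim f + codim g) (codim f1 + codim g1) ->
       forall n, pr (graft_hom f1 a g1) n (cx_d (D _) _ x') = 0 /\
       K ds f1 a g1 _ n (theta_fun ds la vS vQ x' + tdiff (D S) (D Q) _ y') = 0).
Proof.
set gh := graft_hom f a g => dx xy; rewrite -(codim_graft f a g) -/gh => x0; rewrite codim_graft => y0.
have shg : sh X (graft S' (f a) Q') = sh X S' + sh X Q' := sh_graft X (hleaf f la) (hver f vS) (hver g vQ).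
have msgE : msg R (graft S' (f a) Q') = s12 R S' Q'.
  rewrite /msg (card_inner_graftZ (hleaf f la) (hver f vS) (hver g vQ)) //.
have s2 : s12 R S' Q' * s12 R S' Q' = 1 := ksgn2 _ _.
have [n e] : exists n : int, n + sh X S' + sh X Q' = k by exists (k - sh X Q' - sh X S'); lia.
pose al := pr gh (n - 1 - 1) x; pose be := K ds f a g (k - 1) (n - 1) y.
have dal : cx_d (X _) _ al = 0.
  have := pr_lead' (u := x) (h := gh) (n - 1 - 1) x0; rewrite -[ds_d _ _ _ x]/(cx_d (D _) _ x) dx linear0 => /esym.
  by apply: scale_inj0; rewrite mulrNN; apply: ksgn2.
have thal : thx la vS vQ f g al = cx_d (tensor (X S') (X Q')) (n - 1) (- s12 R S' Q' *: be).
  by rewrite -K_theta' xy K_lead' // linearZ_LR.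
have [al' [be' [alE beE]]] := quasi_iso_acyc (th_q f g) dal thal.
(* The sign undoes the one with which the internal differential enters [pr_lead]; on [y'] none is
   needed, since [be] was rescaled in [thal]. *)
pose x' : dfam X (graft S a Q) (k - 1) := - s12 R S' Q' *: iota (k - 1) gh al'.
pose y' := J ds f a g k n be'.
have ngh : n - 1 + sh X (graft S' (f a) Q') = k - 1 by rewrite shg; lia.
have prZ T1 (h1 : hom (graft S a Q) T1) m : pr h1 m x' = - s12 R S' Q' *: pr h1 m (iota (k - 1) gh al').
  exact: (linearZ_LR (pr h1 m)).
have prx T1 (h1 : hom _ T1) m : toc h1 <> toc gh -> pr h1 m x' = 0.
  by move=> ne; rewrite prZ pr_iota0 ?scaler0 //; apply: nesym.
have bN m : before (ix_bar X) m m = false by rewrite /before ltnn; case: ifP.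
have tocc T1 (h1 : hom (graft S a Q) T1) : toc h1 = toc gh -> codim h1 = codim gh.
  by case/toc_eq => t tE; rewrite -[in RHS]tE codim_tcomp.
have tocp S1 (f1 : hom S S1) Q1 (g1 : hom Q Q1) :
    (codim f1 + codim g1 <> codim f + codim g)%N -> toc f <> toc f1 \/ toc g <> toc g1.
  move=> ne; case: (pselect (toc f = toc f1)) => [/toc_eq[t1 e1]|]; last by left.
  by right => /toc_eq[t2 e2]; apply: ne; rewrite -e1 -e2 !codim_tcomp.
have prd T (h : hom _ T) m : (forall T' (h' : hom _ T'), before (ix_bar X) (codim h') (codim h) -> toc h' <> toc gh) ->
    pr h (m - 1) (cx_d (D _) _ x') = - msg R T *: cx_d (X T) m (pr h m x').
  by move=> hh; apply: (@pr_lead' _ _ x') => T' h' n' b; apply/prx/hh.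
exists x', y'; split=> [m|S1 f1 Q1 g1 q bq m]; have [m1 ->] : exists m1 : int, m = m1 - 1 by exists (m + 1); lia.
- split.
    apply: (etrans (linearB (pr gh (m1 - 1)) _ _)); rewrite /= prd => [|T' h' b']; last first.
      by move=> /tocc hE; rewrite hE bN in b'.
    have [mE|mE] := eqVneq m1 (n - 1); last first.
      have d1 : m1 + sh X (graft S' (f a) Q') != k - 1.
        by rewrite shg; apply: contraNneq mE => ?; apply/eqP; lia.
      have d2 : m1 - 1 + sh X (graft S' (f a) Q') != k - 1 - 1.
        by rewrite shg; apply: contraNneq mE => ?; apply/eqP; lia.
      by rewrite (@pr_deg _ _ _ _ _ gh _ x' d1) (@pr_deg _ _ _ _ _ gh _ x d2) linear0 scaler0 subr0.
    rewrite mE -/al alE prZ pr_iota // (linearZ_LR (cx_d (X _) _)) scalerA mulrNN msgE s2 scale1r.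
    by rewrite subrr.
  rewrite linearB /= linearB /= K_theta' K_lead' // => [|S1 f1 Q1 g1 n1 b']; last first.
    by apply: KJ0; apply: tocp => e1; rewrite e1 bN in b'.
  have [mE|mE] := eqVneq m1 n; last first.
    have d1 : m1 - 1 + sh X (graft S' (f a) Q') != k - 1.
      by rewrite shg; apply: contraNneq mE => ?; apply/eqP; lia.
    have d2 : m1 - 1 + sh X S' + sh X Q' != k - 1 by apply: contraNneq mE => ?; apply/eqP; lia.
    have d3 : m1 + sh X S' + sh X Q' != k by apply: contraNneq mE => ?; apply/eqP; lia.
    rewrite (K_deg _ _ _ _ d2) (K_deg _ _ _ _ d3) (@pr_deg _ _ _ _ _ gh _ x' d1) /thx.
    by rewrite (linear0 (ic_theta X _ _ _ (m1 - 1))) (linear0 (tdiff _ _ m1)) scaler0 !subr0.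
  rewrite mE -/be /y' KJ // prZ pr_iota // /thx (linearZ_LR (ic_theta X _ _ _ _)).
  apply: sub2_eq0; rewrite -scalerDr.
  have -> : be = - s12 R S' Q' *: (ic_theta X (hleaf f la) (hver f vS) (hver g vQ) (n - 1) al' +
      tdiff (X S') (X Q') n be').
    by rewrite -[X in _ *: X]beE scalerA mulrNN s2 scale1r.
  by [].
have tq : toc (graft_hom f1 a g1) <> toc gh.
  by case/(toc_graft_inj la vS vQ) => e1 e2; case: q.
split.
  rewrite prd => [|T' h' b']; last first.
    by move=> /tocc hE; rewrite hE !codim_graft (negbTE bq) in b'.
  by rewrite prx // (linear0 (cx_d (X _) _)) scaler0.
rewrite linearD /= K_theta' K_lead' // => [|S2 f2 Q2 g2 n1 b']; last first.
  by apply: KJ0; apply: tocp => e1; rewrite e1 (negbTE bq) in b'.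
rewrite prx // KJ0 /thx ?(linear0 (ic_theta X _ _ _ (m1 - 1))) ?(linear0 (tdiff _ _ m1)) ?scaler0 ?addr0 //.
by case: q => h; [left|right]; apply: nesym.
Qed.

Lemma first_pair (Z : {set pairs}) p0 : p0 \notin Z ->
  exists2 p, p \notin Z & forall q, q \notin Z -> ~~ before (ix_bar X) (lev q) (lev p).
Proof.
rewrite /before; case: (ix_bar X) => p0Z.
  by case: (arg_maxnP (P := fun q => q \notin Z) lev p0Z) => p pZ pm; exists p => // q /pm; rewrite -leqNgt.
by case: (arg_minnP (P := fun q => q \notin Z) lev p0Z) => p pZ pm; exists p => // q /pm; rewrite -leqNgt.
Qed.

(** Induction on the number of pairs still to be treated. The treated ones, [Z], are never preceded
    by an untreated one, so later steps do not spoil the vanishing obtained there. *)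
Lemma elim_pairs (k : int) m (Z : {set pairs}) (x : D (graft S a Q) (k - 1 - 1)) (y : tensor (D S) (D Q) (k - 1)) :
  #|~: Z| = m ->
  (forall q p, q \in Z -> p \notin Z -> ~~ before (ix_bar X) (lev p) (lev q)) ->
  cx_d (D _) _ x = 0 -> theta_fun ds la vS vQ x = tdiff (D S) (D Q) _ y ->
  (forall q n, q \in Z -> pr (rp q) n x = 0 /\ K ds (rf q) a (rg q) _ n y = 0) ->
  exists (x' : D (graft S a Q) (k - 1)) (y' : tensor (D S) (D Q) k),
    x = cx_d (D _) _ x' /\ y = theta_fun ds la vS vQ x' + tdiff (D S) (D Q) _ y'.
Proof.
elim: m Z x y => [|m IH] Z x y cZ hZ dx xy h0.
  have ZT q : q \in Z by move/eqP: cZ; rewrite cards_eq0 => /eqP/setP/(_ q); rewrite !inE => /negbFE.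
  exists 0, 0; rewrite !linear0 addr0; split.
    apply: pr_ext => T h n _; rewrite linear0.
    by apply: (@pr_van _ x (fun=> True)) => // q n1 _; have [] := h0 q n1 (ZT q).
  apply: (@K_sep _ _ _ _ a) => S' f Q' g n _; rewrite linear0.
  by apply: (@K_van _ y (fun=> True)) => // q n1 _; have [] := h0 q n1 (ZT q).
have /card_gt0P[p0] : (0 < #|~: Z|)%N by rewrite cZ.
rewrite inE => /first_pair[p pZ pm].
have [||x' [y' [h1 h2]]] := @elim_pair k x y _ (rf p) _ (rg p) dx xy.
- move=> T h n b; apply: (@pr_van _ x (fun m => before (ix_bar X) m (lev p))) => // q n1 bq.
  by have [] := h0 q n1; first by apply: contraTT bq => /pm.
- move=> S1 f1 Q1 g1 n b; apply: (@K_van _ y (fun m => before (ix_bar X) m (lev p))) => // q n1 bq.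
  by have [] := h0 q n1; first by apply: contraTT bq => /pm.
have tN q : q != p -> toc (rf q) <> toc (rf p) \/ toc (rg q) <> toc (rg p).
  rewrite !toc_repc; case: q p {pZ pm h1 h2} => q1 q2 [p1 p2] /= ne.
  by case: (pselect (q1 = p1)) => [e1|]; [right => e2; case/eqP: ne; rewrite e1 e2|left].
have [|||||x2 [y2 [xE yE]]] := IH (p |: Z) (x - cx_d (D _) _ x') (y - theta_fun ds la vS vQ x' - tdiff (D S) (D Q) _ y').
- have := cardsC1 p; have -> : ~: (p |: Z) = (~: Z) :\ p by apply/setP => q; rewrite !inE negb_or.
  by move=> _; have := cardsD1 p (~: Z); rewrite cZ inE pZ => -[].
- move=> q r; rewrite !inE negb_or => /orP[/eqP->|qZ] /andP[rp' rZ]; first exact: pm.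
  exact: hZ.
- by rewrite linearB /= dx (cx_dd (c := D _)) subrr.
- have := @th_d _ _ _ la vS vQ _ x'; rewrite -/(cx_d (D _) _ x') => td.
  by rewrite linearB /= td !linearB /= tdiff_dd subr0 xy.
- move=> q n; rewrite !inE => /orP[/eqP->|qZ]; first exact: h1.
  have [->|qp] := eqVneq q p; first exact: h1.
  have [e1 e2] := h2 _ _ _ _ (tN q qp) (hZ _ _ qZ pZ) n.
  have [e3 e4] := h0 q n qZ.
  rewrite linearB /= e1 e3 subrr; split=> //.
  by rewrite -addrA -opprD linearB /= e2 e4 subrr.
exists (x' + x2), (y' + y2); split; first by rewrite linearD /= -xE [RHS]addrC subrK.
rewrite !linearD /= addrACA -yE.
by rewrite -[_ - _ - _]addrA -opprD addrC subrK.
Qed.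

Lemma D_quasi_iso : quasi_iso (thD th_d la vS vQ).
Proof.
apply: acyc_quasi_iso => k x y dx xy.
by have := @elim_pairs k _ set0 x y erefl; apply=> // [q p|q n]; rewrite inE.
Qed.
End Elim.
End QuasiIso.

(** Absorbs the index [n - 1 + 1] that arises when the bar differential is read in degree
    [n - 1]. *)
Lemma cst_pred (R : comPzRingType) (A : complex R) (F : forall m : int, A m) (n : int) :
  cst (n - 1) (cx_d A (n - 1 + 1) (F (n - 1 + 1))) = cx_d A n (F n).
Proof.
have e : n - 1 + 1 = n by lia.
by rewrite e cst_id.
Qed.

Section KPull.
Variables (R : comPzRingType) (X : isocoop R) (ds : dstruct X).
Local Notation D := (DC ds).
Lemma K_dpull S S' (f : hom S S') (a : S) Q Q' (g : hom Q Q')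
    (F : chain_map (D S) (D S')) (G : chain_map (D Q) (D Q')) S1 (f1 : hom S' S1) Q1 (g1 : hom Q' Q1) k n z :
  (forall n u, F n u = dpull f u) -> (forall n u, G n u = dpull g u) ->
  K ds f1 (f a) g1 k n (tens_map F G k z) = K ds (hom_comp f1 f) a (hom_comp g1 g) k n z.
Proof.
move=> FE GE.
apply: (@ten_lin_ext _ _ _ _ _ (K ds f1 (f a) g1 k n \o tens_fun F G k)
  (K ds (hom_comp f1 f) a (hom_comp g1 g) k n)) => p q x y pq.
by rewrite [LHS]/= tens_funE !KE // FE GE !pr_dpull.
Qed.

Lemma J_dpush S S' (f : hom S S') (a : S) Q Q' (g : hom Q Q')
    (F : chain_map (D S') (D S)) (G : chain_map (D Q') (D Q)) S1 (f1 : hom S' S1) Q1 (g1 : hom Q' Q1) k n z :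
  (forall n u, F n u = dpush f u) -> (forall n u, G n u = dpush g u) ->
  tens_map F G k (J ds f1 (f a) g1 k n z) = J ds (hom_comp f1 f) a (hom_comp g1 g) k n z.
Proof.
move=> FE GE.
apply: (@ten_lin_ext _ _ _ _ _ (tens_fun F G k \o J ds f1 (f a) g1 k n)
  (J ds (hom_comp f1 f) a (hom_comp g1 g) k n)) => p q x y pq.
rewrite [LHS]/= !JE // linearZ_LR; congr (_ *: _).
by rewrite [LHS]tens_funE FE GE !dpush_iota.
Qed.

Lemma thx_irr S (a : S) Q (la la' : leaf a) (vS vS' : has_vertex S) (vQ vQ' : has_vertex Q) n x :
  ic_theta X la vS vQ n x = ic_theta X la' vS' vQ' n x.
Proof. by rewrite (bool_irrelevance la la') (bool_irrelevance vS vS') (bool_irrelevance vQ vQ'). Qed.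
End KPull.

(** * The bar construction as a cooperad *)

Section BarCoop.
Variables (R : comPzRingType) (M : preoperad R).
Local Notation D := (DC (barDS M)).

Lemma dpull_d S S' (g : hom S S') k (u : D S k) :
  dpull g (cx_d (D S) k u) = cx_d (D S') k (dpull g u).
Proof.
apply: pr_ext => T f n _; rewrite pr_dpull; apply: (etrans (pr_bar_d _ _ _)); apply: (etrans _ (esym (pr_bar_d _ _ _))).
congr (_ *: (_ - _)); apply: eq_csum1 => T' h _; rewrite pr_dpull hom_compA //.
Qed.

Definition bar_push S S' (g : hom S S') : chain_map (D S) (D S') :=
  @ChainMap R (D S) (D S') (fun k => @dpull R (barX M) S S' g k) (fun k => @dpull_linear R (barX M) S S' g k)
    (@dpull_d S S' g).

Lemma bar_push_id S n (u : D S n) : bar_push (hom_id S) n u = u.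
Proof. by apply: pr_ext => T f m _; rewrite /= pr_dpull hom_idr. Qed.
Lemma bar_push_comp S T U (g : hom T U) (f : hom S T) n (u : D S n) :
  bar_push (hom_comp g f) n u = bar_push g n (bar_push f n u).
Proof. by apply: pr_ext => T' f' m _; rewrite /= !pr_dpull hom_compA. Qed.

Definition bar_cps : copresheaf R := @Copresheaf R D bar_push bar_push_id bar_push_comp.

Definition bar_theta S (a : S) Q (la : leaf a) (vS : has_vertex S) (vQ : has_vertex Q) :
    chain_map (bar_cps (graft S a Q)) (tensor (bar_cps S) (bar_cps Q)) :=
  @thD R (barI M) (barDS M) (@bar_th_d R M) S a Q la vS vQ.

Lemma bar_theta_natural S S' Q Q' (f : hom S S') (g : hom Q Q') (a : S)
    (la : leaf a) (vS : has_vertex S) (vQ : has_vertex Q)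
    (la' : leaf (f a)) (vS' : has_vertex S') (vQ' : has_vertex Q')
    n (y : bar_cps (graft S a Q) n) :
  bar_theta la' vS' vQ' n (cps_map bar_cps (graft_hom f a g) n y) =
  tens_map (cps_map bar_cps f) (cps_map bar_cps g) n (bar_theta la vS vQ n y).
Proof.
apply: (@K_sep R (barI M) (barDS M) _ (f a)) => S1 f1 Q1 g1 m e.
rewrite (@K_dpull R (barI M) (barDS M) _ _ f a _ _ g) //.
rewrite [LHS]K_theta // [RHS]K_theta // /thx pr_dpull.
have -> := congr1 (fun w : hom _ (graft S1 (f1 (f a)) Q1) => pr w m y) (esym (graft_hom_comp f1 f a g1 g)).
exact: (@thx_irr R (barI M)).
Qed.

Definition bar_pre : precooperad R :=
  @Precooperad R bar_cps bar_theta bar_theta_natural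
    (@D_assoc R (barI M) (barDS M) (@bar_th_d R M)) (@D_exch R (barI M) (barDS M) (@bar_th_d R M)).

(** The external sum at [h] consists of components of codimension one more, which vanish by
    assumption. *)
Lemma bar_pr_lead S (k : int) (u : dfam (barX M) S k) T (h : hom S T) (n : int) : n + sh (barX M) T = k ->
  (forall T' (h' : hom S T') n', before true (codim h') (codim h) -> pr h' n' u = 0) ->
  pr h (n - 1) (bar_d u) = - msg R T *: cx_d (M T) n (pr h n u).
Proof.
move=> _ h0; rewrite pr_bar_d (cst_pred (fun m => pr h m u)) /bar_ext csum1_0 ?sub0r ?scalerN ?scaleNr //.
by move=> T' g c1; rewrite h0 ?linear0 // /before codim_comp c1; lia.
Qed.

Lemma bar_K_lead S (a : S) Q (k : int) (z : tensor (D S) (D Q) k)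
  S' (f : hom S S') Q' (g : hom Q Q') (n : int) : leaf a -> has_vertex S -> has_vertex Q ->
  n + sh (barX M) S' + sh (barX M) Q' = k ->
  (forall S1 (f1 : hom S S1) Q1 (g1 : hom Q Q1) n1,
     before true (codim f1 + codim g1) (codim f + codim g) -> @K R (barI M) (barDS M) _ _ f1 a _ _ g1 k n1 z = 0) ->
  @K R (barI M) (barDS M) _ _ f a _ _ g (k - 1) (n - 1) (tdiff (D S) (D Q) k z) =
  - s12 R S' Q' *: tdiff (M S') (M Q') n (@K R (barI M) (barDS M) _ _ f a _ _ g k n z).
Proof.
move=> la vS vQ e h0; rewrite K_bar_d; last by rewrite -e; lia.
have := @cst_pred R (tensor (M S') (M Q')) (fun m => @K R (barI M) (barDS M) _ _ f a _ _ g k m z) n.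
rewrite /= => ->.
rewrite !csum1_0 ?addr0 //.
  by move=> T h c1; rewrite h0 ?linear0 ?scaler0 // /before codim_comp c1; lia.
by move=> T h c1; rewrite h0 ?linear0 ?scaler0 // /before codim_comp c1; lia.
Qed.
End BarCoop.

Definition bar_coop (R : comPzRingType) (M : operad R) : cooperad R.
Proof.
exists (bar_pre M) => S a Q la vS vQ.
apply: (@D_quasi_iso R (barI M) (barDS M) (@bar_th_d R M) (@bar_pr_lead R M) (@bar_K_lead R M) S a Q la vS vQ).
by move=> S' f Q' g; apply: op_qi.
Defined.

(** * The cobar construction as an operad *)

Section CobarOp.
Variables (R : comPzRingType) (Y : precooperad R).
Local Notation X := (cobX Y).
Local Notation D := (DC (cobDS Y)).

Lemma dpush_d S S' (g : hom S' S) k (u : D S k) :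
  dpush g (cx_d (D S) k u) = cx_d (D S') k (dpush g u).
Proof.
apply: (@dfam_lin_ext R X S k _ (@dpush R X S S' g (k - 1) \o @cob_d R Y S k)
  (@cob_d R Y S' k \o @dpush R X S S' g k)) => T f n x e.
rewrite [LHS]/= [RHS]/= dpush_iota !cob_d_iota // /cob_gen linearB linearZ_LR /= dpush_iota; congr (_ - _).
by rewrite /cob_ext csum1_linear; apply: eq_csum1 => T' h _; rewrite /= dpush_iota hom_compA.
Qed.

Definition cob_pull S S' (g : hom S' S) : chain_map (D S) (D S') :=
  @ChainMap R (D S) (D S') (fun k => @dpush R X S S' g k) (fun k => @dpush_linear R X S S' g k)
    (@dpush_d S S' g).

Lemma cob_pull_id S n (u : D S n) : cob_pull (hom_id S) n u = u.
Proof.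
apply: (@dfam_lin_ext R X S n _ (@dpush R X S S (hom_id S) n) idfun) => T f m x e.
by rewrite /= dpush_iota hom_idr.
Qed.
Lemma cob_pull_comp S T U (g : hom T U) (f : hom S T) n (u : D U n) :
  cob_pull (hom_comp g f) n u = cob_pull f n (cob_pull g n u).
Proof.
apply: (@dfam_lin_ext R X U n _ (@dpush R X U S (hom_comp g f) n)
  (@dpush R X T S f n \o @dpush R X U T g n)) => T' f' m x e.
by rewrite /= !dpush_iota hom_compA.
Qed.

Definition cob_psh : presheaf R :=
  @Presheaf R D (fun S T f => @cob_pull T S f) cob_pull_id cob_pull_comp.

Definition cob_theta S (a : S) Q (la : leaf a) (vS : has_vertex S) (vQ : has_vertex Q) :
    chain_map (cob_psh (graft S a Q)) (tensor (cob_psh S) (cob_psh Q)) :=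
  @thD R (cobI Y) (cobDS Y) (@cob_th_d R Y) S a Q la vS vQ.

Lemma cob_theta_natural S S' Q Q' (f : hom S S') (g : hom Q Q') (a : S)
    (la : leaf a) (vS : has_vertex S) (vQ : has_vertex Q)
    (la' : leaf (f a)) (vS' : has_vertex S') (vQ' : has_vertex Q')
    n (x : cob_psh (graft S' (f a) Q') n) :
  cob_theta la vS vQ n (psh_map cob_psh (graft_hom f a g) n x) =
  tens_map (psh_map cob_psh f) (psh_map cob_psh g) n (cob_theta la' vS' vQ' n x).
Proof.
apply: (@dfam_graft_ext R (cobI Y) S' (f a) Q' la' vS' vQ' n _
   (@theta_fun R (cobI Y) (cobDS Y) S a Q la vS vQ n \o @dpush R X _ _ (graft_hom f a g) n)
   (tens_fun (psh_map cob_psh f) (psh_map cob_psh g) n \o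
    @theta_fun R (cobI Y) (cobDS Y) S' (f a) Q' la' vS' vQ' n)) => S1 f1 Q1 g1 m w e.
rewrite [LHS]/= [RHS]/= dpush_iota (@theta_iota R (cobI Y) (cobDS Y) S' (f a) Q' la' vS' vQ' n _ f1 _ g1 m w e).
rewrite [RHS](@J_dpush R (cobI Y) (cobDS Y) _ _ f a _ _ g) //.
have -> := congr1 (fun h : hom _ (graft S1 (f1 (f a)) Q1) => @iota R X _ n _ h m w) (esym (graft_hom_comp f1 f a g1 g)).
rewrite [LHS](@theta_iota R (cobI Y) (cobDS Y) S a Q la vS vQ n _ (hom_comp f1 f) _ (hom_comp g1 g) m) //.
apply: (congr1 (fun w => J (cobDS Y : dstruct (cobI Y)) (hom_comp f1 f) a (hom_comp g1 g) n m w)).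
exact: (@thx_irr R (cobI Y)).
Qed.

(** Obtained from [D_assoc] at the pushforward of [x] along the canonical morphism, which [dpull]
    undoes. *)
Lemma cob_theta_assoc S Q P (a : S) (b : Q)
    (la : leaf a) (lb : leaf b) (lb' : leaf (graft_inr a b))
    (vS : has_vertex S) (vQ : has_vertex Q) (vP : has_vertex P)
    (vSQ : has_vertex (graft S a Q)) (vQP : has_vertex (graft Q b P))
    n (x : cob_psh (graft S a (graft Q b P)) n) :
  tens_map (cm_id _) (cob_theta lb vQ vP) n (cob_theta la vS vQP n x) =
  tens_assoc_lin n
    (tens_map (cob_theta la vS vQ) (cm_id _) n
       (cob_theta lb' vSQ vP n (psh_map cob_psh (graft_assoc a b P) n x))).
Proof.
have := @D_assoc R (cobI Y) (cobDS Y) (@cob_th_d R Y) S Q P a b la lb lb' vS vQ vP vSQ vQP n (psh_map cob_psh (graft_assoc a b P) n x).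
by rewrite dpull_push.
Qed.

Lemma cob_theta_exch S Q P (a b : S)
    (la : leaf a) (lb : leaf b) (nab : a != b)
    (lb' : leaf (graft_inl a Q b)) (la' : leaf (graft_inl b P a))
    (vS : has_vertex S) (vQ : has_vertex Q) (vP : has_vertex P)
    (vSQ : has_vertex (graft S a Q)) (vSP : has_vertex (graft S b P))
    n (x : cob_psh (graft (graft S b P) (graft_inl b P a) Q) n) :
  tens_map (cob_theta la vS vQ) (cm_id _) n
    (cob_theta lb' vSQ vP n (psh_map cob_psh (graft_exch a b Q P) n x)) =
  tens_exch_lin n
    (tens_map (cob_theta lb vS vP) (cm_id _) n (cob_theta la' vSP vQ n x)).
Proof.
have := @D_exch R (cobI Y) (cobDS Y) (@cob_th_d R Y) S Q P a b la lb nab lb' la' vS vQ vP vSQ vSP n (psh_map cob_psh (graft_exch a b Q P) n x).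
by rewrite dpull_push.
Qed.

Definition cob_pre : preoperad R :=
  @Preoperad R cob_psh cob_theta cob_theta_natural cob_theta_assoc cob_theta_exch.

(** The external part of the generator at [f] lives in codimension one more than that of [f]. *)
Lemma pr_cob_ext0 S k T (f : hom S T) n (y : Y T n) U (h : hom S U) m : (codim h <= codim f)%N ->
  pr h m (cob_ext k f y) = 0.
Proof.
move=> hf; rewrite /cob_ext csum1_linear; apply: csum1_0 => V g c1.
rewrite /= pr_iota0 // => /toc_eq[t e]; move: hf.
by rewrite -e codim_tcomp codim_comp c1; lia.
Qed.

Lemma cob_pr_lead S (k : int) (u : dfam X S k) T (h : hom S T) (n : int) : n + sh X T = k ->
  (forall T' (h' : hom S T') n', before false (codim h') (codim h) -> pr h' n' u = 0) ->
  pr h (n - 1) (cob_d u) = - msg R T *: cx_d (Y T) n (pr h n u).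
Proof.
move=> e h0; have nE : k - sh X T = n by lia.
rewrite /cob_d csum_linear (@csum_single _ _ _ _ h).
- rewrite /= /cob_term nE /cob_gen linearB /= linearZ_LR /= pr_cob_ext0 // sub0r.
  by rewrite pr_iota ?scaleNr //; lia.
- by move=> T' T'' t g; rewrite cob_term_cinv.
move=> T' f ne; rewrite /= /cob_term /cob_gen linearB /= linearZ_LR /= pr_iota0 //.
rewrite (_ : msg R T' *: _ = 0) ?subr0; last exact: scaler0.
have [c|c] := leqP (codim h) (codim f); first exact: pr_cob_ext0.
by rewrite h0 // [cob_ext _ _ _]csum1_0 ?linear0 // => T1 g c1; rewrite !linear0.
Qed.

(** As [J_cobar_d] speaks of generators, [z] is expanded by [tens_span]. Pairs of smaller
    codimension contribute nothing by hypothesis, and of the others only [(f, g)] itself reaches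
    [(f, g)]. *)
Lemma cob_K_lead S (a : S) Q (k : int) (z : tensor (D S) (D Q) k)
  S' (f : hom S S') Q' (g : hom Q Q') (n : int) : leaf a -> has_vertex S -> has_vertex Q ->
  n + sh X S' + sh X Q' = k ->
  (forall S1 (f1 : hom S S1) Q1 (g1 : hom Q Q1) n1,
     before false (codim f1 + codim g1) (codim f + codim g) -> @K R (cobI Y) (cobDS Y) _ _ f1 a _ _ g1 k n1 z = 0) ->
  @K R (cobI Y) (cobDS Y) _ _ f a _ _ g (k - 1) (n - 1) (tdiff (D S) (D Q) k z) =
  - s12 R S' Q' *: tdiff (Y S') (Y Q') n (@K R (cobI Y) (cobDS Y) _ _ f a _ _ g k n z).
Proof.
move=> la vS vQ e h0.
pose KK S1 (f1 : hom S S1) Q1 (g1 : hom Q Q1) k n := @K R (cobI Y) (cobDS Y) _ _ f1 a _ _ g1 k n.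
pose JJ S1 (f1 : hom S S1) Q1 (g1 : hom Q Q1) k n := @J R (cobI Y) (cobDS Y) _ _ f1 a _ _ g1 k n.
pose Phi S1 (f1 : hom S S1) Q1 (g1 : hom Q Q1) := let n1 := k - sh X S1 - sh X Q1 in
  KK _ f _ g (k - 1) (n - 1) (tdiff (D S) (D Q) k (JJ _ f1 _ g1 k n1 (KK _ f1 _ g1 k n1 z))).
have ext0 S1 (f1 : hom S S1) Q1 (g1 : hom Q Q1) (n1 : int) w : n1 + sh X S1 + sh X Q1 = k ->
    (codim f + codim g <= codim f1 + codim g1)%N ->
    KK _ f _ g (k - 1) (n - 1) (tdiff (D S) (D Q) k (JJ _ f1 _ g1 k n1 w)) =
    - s12 R S1 Q1 *: KK _ f _ g (k - 1) (n - 1) (JJ _ f1 _ g1 (k - 1) (n1 - 1) (tdiff (Y S1) (Y Q1) n1 w)).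
  move=> e1 c; rewrite /KK /JJ J_cobar_d // linearD /= linearZ_LR linearD /= !csum1_linear !csum1_0 ?addr0 //.
    (* A new edge leads to codimension one more than that of [(f1, g1)]; by [c] this cannot be the
       pair [(f, g)]. *)
    move=> T h c1; rewrite /= linearZ_LR KJ0 ?scaler0 //.
    case: (pselect (toc f1 = toc f)) => [/toc_eq[t1 e1']|]; last by left.
    right => /toc_eq[t2 e2]; move: c; rewrite -e1' -e2 !codim_tcomp codim_comp c1; lia.
  move=> T h c1; rewrite /= linearZ_LR KJ0 ?scaler0 //.
  case: (pselect (toc g1 = toc g)) => [/toc_eq[t1 e1']|]; last by right.
  left => /toc_eq[t2 e2]; move: c; rewrite -e1' -e2 !codim_tcomp codim_comp c1; lia.
transitivity (csum (fun S1 f1 => csum (fun Q1 g1 => Phi S1 f1 Q1 g1))).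
  rewrite [in LHS](@tens_span R (cobI Y) (cobDS Y) S a Q k z) !csum_linear; apply: eq_csum => S1 f1.
  by rewrite !csum_linear; apply: eq_csum.
rewrite (@csum2_single _ _ _ Phi _ f _ g).
- have nE : k - sh X S' - sh X Q' = n by lia.
  by rewrite /Phi nE ext0 // /KK /JJ KJ //= -![sh (cobI Y) _]/(sh X _); lia.
- move=> S1 S2 t1 f1 Q1 Q2 t2 g1; rewrite /Phi (sh_iso X t1) (sh_iso X t2) /KK /JJ; congr (K _ _ _ _ _ _ (tdiff _ _ _ _)).
  by rewrite K_nat // linearZ_LR J_nat // scalerA hsg2 scale1r.
move=> S1 f1 Q1 g1 ne; rewrite /Phi.
have [c|c] := leqP (codim f + codim g) (codim f1 + codim g1); last first.
  by rewrite [X in JJ _ _ _ _ _ _ X]h0 // !linear0.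
rewrite ext0 //; last by lia.
by rewrite /KK /JJ KJ0 ?scaler0 //.
Qed.
End CobarOp.

Definition cob_op (R : comPzRingType) (Y : cooperad R) : operad R.
Proof.
exists (cob_pre Y) => S a Q la vS vQ.
apply: (@D_quasi_iso R (cobI Y) (cobDS Y) (@cob_th_d R Y) (@cob_pr_lead R Y) (@cob_K_lead R Y) S a Q la vS vQ).
by move=> S' f Q' g; apply: co_qi.
Defined.

(** * Comparison with symbols *)

Section Sym.
Variables (R : comPzRingType) (X : isofun R) (S : tree) (k : int).

(** Counts lengths of arbitrary sequences, as the degree of a symbol does; it agrees with [sh] only
    for genuine enumerations. *)
Definition soff (a b : nat) : int := if ix_bar X then 1 + a%:Z + b%:Z else - 1 - a%:Z - b%:Z.
Definition sok T (f : hom S T) (d : seq S) (e : seq T) : bool :=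
  is_enum d (inner S) && is_enum e (new_edges f).

(* the family represented by the symbol [[f, d|e, x]] *)
Definition sval_of T (f : hom S T) d e n (x : X T n) : dfam X S k :=
  if (n + soff (size d) (size e) == k) && sok f d e then wsgn R (map f d ++ e) *: iota k f x else 0.

Lemma soff_sh T (f : hom S T) d e : sok f d e -> soff (size d) (size e) = sh X T.
Proof.
case/andP => hd he; rewrite /soff /sh (card_inner f) (enum_size hd) (enum_size he) -/(codim f).
by case: (ix_bar X); move: #|_| (codim f) => a b; lia.
Qed.

Lemma sval_ok T (f : hom S T) d e n (x : X T n) : sok f d e -> n + sh X T = k ->
  sval_of f d e x = wsgn R (map f d ++ e) *: iota k f x.
Proof. by move=> ok nk; rewrite /sval_of ok (soff_sh ok) nk eqxx. Qed.

Lemma sval_enum T (f : hom S T) d e n (x : X T n) :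
  is_enum d (inner S) -> is_enum e (new_edges f) -> n + sh X T = k ->
  sval_of f d e x = wsgn R (map f d ++ e) *: iota k f x.
Proof. by move=> hd he; apply: sval_ok; rewrite /sok hd. Qed.

Lemma sval_zero T (f : hom S T) d e n (x : X T n) :
  ~~ ((n + soff (size d) (size e) == k) && sok f d e) -> sval_of f d e x = 0.
Proof. by rewrite /sval_of => /negbTE ->. Qed.

Lemma sval_linear T (f : hom S T) d e n : linear (fun x : X T n => sval_of f d e x).
Proof.
move=> c x y; rewrite /sval_of; case: ifP => _; last by rewrite scaler0 addr0.
by rewrite (linearP (@iota R X S k T f n)) scalerDr !scalerA (mulrC c).
Qed.
HB.instance Definition _ T (f : hom S T) d e n := GRing.isLinear.Build R (X T n) (dfam X S k) *:%R
  (@sval_of T f d e n) (@sval_linear T f d e n).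

Lemma sok_iso T T' (t : tiso T T') (f : hom S T) d e : sok (hom_comp t f) d (map t e) = sok f d e.
Proof.
have tn y : (t y \in new_edges (hom_comp t f)) = (y \in new_edges f).
  by rewrite !mem_new; apply: eq_forallb => x; rewrite (inj_eq (hom_inj (f := t))).
have pe : perm_eq (map t (enum (new_edges f))) (enum (new_edges (hom_comp t f))).
  apply: uniq_perm; rewrite ?enum_uniq ?map_inj_uniq ?enum_uniq //; first exact: hom_inj.
  move=> y; rewrite mem_enum; rewrite -[y](ti_KfK t); move: (ti_g t y) => x.
  by rewrite tn mem_map ?mem_enum //; apply: hom_inj.
rewrite /sok; congr (_ && _); rewrite /is_enum -(permPr pe).
apply/idP/idP; last exact: perm_map.
by move/(perm_map (ti_g t)); rewrite -!map_comp !(eq_map (g := id)) ?map_id // => y /=; rewrite ti_KgK.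
Qed.

Lemma sval_iso T T' (t : tiso T T') (f : hom S T) d e n (x : X T n) :
  sval_of (hom_comp t f) d (map t e) (ix_map X t n x) = sval_of f d e x.
Proof.
rewrite /sval_of size_map sok_iso; case: ifP => // /andP[_ /andP[hd he]].
have -> : map (hom_comp t f) d ++ map t e = map t (map f d ++ e) by rewrite map_cat -map_comp.
rewrite iota_iso -(hsg_word R t (hom_enum hd he)) scalerA mulrAC hsg2 mul1r //.
Qed.

Lemma sok_perm T (f : hom S T) d e d' e' : perm_eq d' d -> perm_eq e' e -> sok f d' e' = sok f d e.
Proof. by move=> pd pe; rewrite /sok /is_enum (permPl pd) (permPl pe). Qed.

Lemma sval_perm T (f : hom S T) d e n (x : X T n) (sigma : 'S_(size d)) (tau : 'S_(size e)) :
  sval_of f d e x = ((-1) ^+ sigma * (-1) ^+ tau) *: sval_of f (perm_enum sigma) (perm_enum tau) x.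
Proof.
have pd := perm_enum_perm sigma; have pe := perm_enum_perm tau.
rewrite /sval_of !par_perm_size (sok_perm f pd pe); case: ifP => [/andP[_ /andP[hd he]]|]; last by rewrite scaler0.
rewrite scalerA; congr (_ *: _).
rewrite (@wsgn_perm R _ (map f (perm_enum sigma) ++ perm_enum tau) (map f d ++ e)); last by apply: perm_cat => //; apply: perm_map.
  rewrite par_cat //; last exact: perm_map.
  rewrite par_map; last exact: hom_inj.
  rewrite par_perm_enum ?(enum_uniq_of hd) // par_perm_enum ?(enum_uniq_of he) // signr_addb.
  rewrite !mulrA [_ * _ * (-1) ^+ sigma]mulrAC sgn2 mul1r sgn2 mul1r //.
by apply: hom_enum; [apply: perm_trans pd hd|apply: perm_trans pe he].
Qed.

Section Inverse.
Variables (V : lmodType R) (gen : forall T (f : hom S T) (d : seq S) (e : seq T) n, X T n -> V).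
Hypothesis gen0 : forall T (f : hom S T) d e n (x : X T n),
  ~~ ((n + soff (size d) (size e) == k) && sok f d e) -> gen f d e x = 0.
Hypothesis gen_lin : forall T (f : hom S T) d e n, linear (fun x : X T n => gen f d e x).
Hypothesis gen_iso : forall T T' (t : tiso T T') (f : hom S T) d e n (x : X T n),
  gen (hom_comp t f) d (map t e) (ix_map X t n x) = gen f d e x.
Hypothesis gen_perm : forall T (f : hom S T) d e n (x : X T n) (sigma : 'S_(size d)) (tau : 'S_(size e)),
  gen f d e x = ((-1) ^+ sigma * (-1) ^+ tau) *: gen f (perm_enum sigma) (perm_enum tau) x.

(** The symbol freed from its enumerations by the sign of its word; it is the candidate preimage of
    [iota k f x]. *)
Definition ngen T (f : hom S T) n (x : X T n) : V :=
  wsgn R (map f (enum (inner S)) ++ enum (new_edges f)) *: gen f (enum (inner S)) (enum (new_edges f)) x.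

Lemma gen_norm T (f : hom S T) d e n (x : X T n) : sok f d e ->
  gen f d e x = wsgn R (map f d ++ e) *: ngen f x.
Proof.
case/andP => hd he.
have pd : perm_eq (enum (inner S)) d by rewrite perm_sym.
have pe : perm_eq (enum (new_edges f)) e by rewrite perm_sym.
have [sigma dE] := perm_enum_exists pd; have [tau eE] := perm_enum_exists pe.
rewrite (gen_perm f x sigma tau) -dE -eE /ngen scalerA; congr (_ *: _).
rewrite (@wsgn_perm R _ (map f (enum (inner S)) ++ enum (new_edges f)) (map f d ++ e)); last by apply: perm_cat => //; apply: perm_map.
  rewrite par_cat //; last exact: perm_map.
  rewrite par_map; last exact: hom_inj.
  rewrite dE eE par_perm_enum ?(enum_uniq_of hd) // par_perm_enum ?(enum_uniq_of he) // signr_addb.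
  by rewrite mulrCA wsgn2 mulr1.
exact: (hom_enum (is_enum_enum _) (is_enum_enum _)).
Qed.

Lemma ngen_iso T T' (t : tiso T T') (f : hom S T) n (x : X T n) :
  ngen (hom_comp t f) (ix_map X t n x) = hsg R t *: ngen f x.
Proof.
have ok : sok f (enum (inner S)) (enum (new_edges f)) by rewrite /sok !is_enum_enum.
have hw : is_enum (map f (enum (inner S)) ++ enum (new_edges f)) (inner T).
  exact: (hom_enum (is_enum_enum _) (is_enum_enum _)).
rewrite [in RHS]/ngen -(gen_iso t) gen_norm ?sok_iso //; move: (ngen (hom_comp t f) _) => N; rewrite !scalerA.
have -> : map (hom_comp t f) (enum (inner S)) ++ map t (enum (new_edges f)) = map t (map f (enum (inner S)) ++ enum (new_edges f)).
  by rewrite map_cat -map_comp.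
rewrite -(hsg_word R t hw) -[LHS]scale1r; congr (_ *: _).
transitivity (hsg R t * hsg R t * (wsgn R (map f (enum (inner S)) ++ enum (new_edges f)) * wsgn R (map f (enum (inner S)) ++ enum (new_edges f)))); last by ring.
by rewrite hsg2 wsgn2 mulr1.
Qed.

Definition sinv_fun (u : dfam X S k) : V := csum (fun T (f : hom S T) => ngen f (pr f (k - sh X T) u)).
Lemma sinv_linear : linear sinv_fun.
Proof.
move=> c u v; rewrite /sinv_fun /csum scaler_sumr -big_split; apply: eq_bigr => i _ /=.
by rewrite linearP /ngen gen_lin scalerDr !scalerA (mulrC c).
Qed.
HB.instance Definition _ := GRing.isLinear.Build R (dfam X S k) V *:%R sinv_fun sinv_linear.

Lemma sinv_iota T (f : hom S T) n (x : X T n) : n + sh X T = k -> sinv_fun (iota k f x) = ngen f x.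
Proof.
move=> e; have nE : k - sh X T = n by lia.
rewrite /sinv_fun (@csum_single _ _ _ _ f).
- by rewrite nE pr_iota.
- move=> T' T'' t g; rewrite (sh_iso X t) pr_iso; set y := pr _ _ _.
  have gZ c (z : X T'' (k - sh X T')) : ngen (hom_comp t g) (c *: z) = c *: ngen (hom_comp t g) z.
    have gL d e' : linear (fun x : X T'' (k - sh X T') => gen (hom_comp t g) d e' x) by [].
    have g00 d e' : gen (hom_comp t g) d e' (0 : X T'' (k - sh X T')) = 0.
      by have := gL d e' (-1) 0 0; rewrite scaler0 addr0 scaleN1r addNr.
    by have := gL (enum (inner S)) (enum (new_edges (hom_comp t g))) c z 0; rewrite !addr0 g00 addr0 /ngen => ->; rewrite !scalerA mulrC.
  by rewrite gZ ngen_iso scalerA hsg2 scale1r.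
move=> T' g ne; rewrite pr_iota0; last exact: nesym.
rewrite /ngen; have := @gen_lin _ g (enum (inner S)) (enum (new_edges g)) (k - sh X T') (-1) 0 0.
by rewrite scaler0 addr0 scaleN1r addNr => ->; rewrite scaler0.
Qed.

Lemma sinvE T (f : hom S T) d e n (x : X T n) : sinv_fun (sval_of f d e x) = gen f d e x.
Proof.
rewrite /sval_of; case: ifP => [/andP[/eqP nk ok]|/negbT h]; last by rewrite linear0 gen0.
by rewrite linearZ_LR /= sinv_iota ?gen_norm // -(soff_sh ok).
Qed.

(** Stated for any module [V] with symbols [gen] subject to the relations, so as to cover both
    presentations. The second hypothesis expresses that the symbols generate [V]. *)
Lemma sval_bij (phi : {linear V -> dfam X S k}) :
  (forall T (f : hom S T) d e n (x : X T n), phi (gen f d e x) = sval_of f d e x) ->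
  (forall (psi : {linear V -> V}), (forall T (f : hom S T) d e n (x : X T n), psi (gen f d e x) = gen f d e x) ->
     psi =1 id) ->
  bijective phi.
Proof.
move=> h0 h1; exists sinv_fun => [v|u].
  apply: (h1 (sinv_fun \o phi)) => T f d e n x /=.
  by rewrite h0 sinvE.
apply: (@dfam_lin_ext R X S k _ (phi \o sinv_fun) idfun) => T f n x e /=.
rewrite sinv_iota // /ngen (linearZ_LR phi) h0 sval_enum //.
by apply: (etrans (scalerA _ _ _)); rewrite wsgn2 scale1r.
Qed.
End Inverse.
End Sym.

(** * Faces and the bar differential of a generator *)

Section FaceSeq.
Variables (T : tree) (e0 : T).
Hypothesis e0i : e0 \in inner T.

Lemma map_face_seq (s : seq T) : map (face_hom e0) (face_seq e0 s) = [seq y <- s | y != e0].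
Proof.
rewrite /face_seq -map_comp (eq_map (g := val)); last first.
  by move=> x /=; rewrite /contract_incl to_treeK.
rewrite (pmap_filter (@insubK _ _ _)); apply: eq_filter => y.
by rewrite isSome_insub /kept in_set1; case: eqVneq => //= ->; rewrite e0i.
Qed.
End FaceSeq.

Section FaceEnum.
Variables (R : comPzRingType) (S T : tree) (f : hom S T) (d : seq S) (e : seq T).
Hypotheses (hd : is_enum d (inner S)) (he : is_enum e (new_edges f)).
Variable i : 'I_(size e).
Let ei := tnth (in_tuple e) i.
Let fl := face_lift (enum_new_notin he i).

Lemma face_new : ei \in new_edges f.
Proof. by rewrite -mem_enum -(perm_mem he) mem_tnth. Qed.
Lemma face_inner : ei \in inner T.
Proof. exact: (subsetP (new_inner f)) face_new. Qed.

Lemma face_seq_enum : is_enum (face_seq ei e) (new_edges fl).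
Proof.
have mE := map_face_seq face_inner e; have fi := @hom_inj _ _ (face_hom ei).
apply: uniq_perm; rewrite ?enum_uniq //.
  by rewrite -(map_inj_uniq fi) mE filter_uniq // (enum_uniq_of he).
move=> y; rewrite -(mem_map fi) mE mem_filter (perm_mem he) !mem_enum !mem_new.
have -> : (face_hom ei y != ei) = true.
  have : ei \in new_edges (face_hom ei) by rewrite (new_face face_inner) set11.
  by rewrite mem_new => /forallP/(_ y).
apply: eq_forallb => x; rewrite -(inj_eq fi); congr (_ != _).
exact: (esym (homE (face_liftK (enum_new_notin he i)) x)).
Qed.

(** The letter [ei] is moved to the end, past the [size e - 1 - i] letters that follow it, where it
    is the new edge of [face_hom ei]. *)
Lemma face_wsgn : wsgn R (map f d ++ e) =
  ksgn R ((size e)%:Z - 1 - i%:Z) * (hsg R (face_hom ei) * wsgn R (map fl d ++ face_seq ei e)).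
Proof.
have c1 := codim_face face_inner.
have hw : is_enum (map fl d ++ face_seq ei e) (inner (face ei)) by apply: hom_enum => //; apply: face_seq_enum.
have hn : is_enum [:: ei] (new_edges (face_hom ei)).
  by rewrite (new_face face_inner) /is_enum enum_set1.
rewrite -(@wsgn_hom1 R _ _ (face_hom ei) _ [:: ei]) ?c1 // map_cat (map_face_seq face_inner).
have -> : map (face_hom ei) (map fl d) = map f d.
  by rewrite -map_comp; apply: eq_map => x; apply: (homE (face_liftK (enum_new_notin he i)) x).
have ue := enum_uniq_of he.
have eE : e = take i e ++ ei :: drop i.+1 e.
  by rewrite /ei (tnth_nth ei) /= -drop_nth ?cat_take_drop.
have fE : [seq y <- e | y != ei] = take i e ++ drop i.+1 e.
  move: ue; rewrite {1 2}eE cat_uniq /= filter_cat /= eqxx /= => /and3P[_ h /andP[nd _]].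
  congr (_ ++ _); apply/all_filterP/allP => y yin.
    by apply: contraNneq h => <-; rewrite yin.
  by apply: contraNneq nd => <-.
have pE : perm_eq (map f d ++ e) ((map f d ++ [seq y <- e | y != ei]) ++ [:: ei]).
  by rewrite -catA perm_cat2l fE [in X in perm_eq X]eE -catA perm_cat2l perm_sym perm_catC.
rewrite (@wsgn_perm R _ _ _ (hom_enum hd he) pE); congr (_ * _).
rewrite fE [in X in par X]eE.
have -> : map f d ++ take i e ++ ei :: drop i.+1 e = (map f d ++ take i e) ++ [:: ei] ++ drop i.+1 e ++ [::].
  by rewrite cats0 -catA.
have q1 : (map f d ++ take i e) ++ [:: ei] ++ drop i.+1 e ++ [::] = map f d ++ e.
  by rewrite cats0 -catA /= -eE.
rewrite par_move; last by rewrite q1 -catA -fE catA; exact: pE.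
  rewrite cats0 mul1n size_drop -!catA par_refl addbF ksgn_odd; congr (_ ^+ nat_of_bool (odd _)).
  by move: (nat_of_ord i) (ltn_ord i) => j; move: (seq.size e) => m; lia.
by rewrite q1 (enum_uniq_of (hom_enum hd he)).
Qed.
End FaceEnum.

Section BarSum.
Variables (R : comPzRingType) (M : presheaf R).
Local Notation X := (barX M).

Lemma bar_ext_iota S k T U (h : hom S U) (g : hom U T) n (x : M T n) : codim g = 1%N -> n + sh X T = k ->
  bar_ext (@iota R X S k T (hom_comp g h) n x) h n = hsg R g *: psh_map M g n x.
Proof.
move=> c1 nk; rewrite /bar_ext /csum1 (@csum_single _ _ _ _ g).
- by rewrite c1 eqxx pr_iota.
- exact: csum1_cinv (bar_ext_seqv _ _ _).
move=> U' g' ne; case: eqP => // _; rewrite pr_iota0 ?linear0 ?scaler0 // => /toc_eq[t].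
by rewrite hom_compA => /hom_epi tE; case: ne; apply: esym; apply/toc_eq; exists t.
Qed.

Lemma bar_ext_iota0 S k T (f : hom S T) U (h : hom S U) n m (x : M T n) :
  (forall g : hom U T, codim g = 1%N -> hom_comp g h <> f) -> bar_ext (@iota R X S k T f n x) h m = 0.
Proof.
move=> h0; apply: csum1_0 => V g c1; rewrite pr_iota0 ?linear0 // => /toc_eq[t tE].
apply: (h0 (hom_comp (ti_g t) g)); first by rewrite codim_comp c1 (codim_ti (ti_inv t)).
by rewrite -hom_compA -tE hom_compA ti_gf hom_idl.
Qed.

Lemma iota_bar_iso S k T T' (t : tiso T T') (f : hom S T) n (x : M T n) :
  @iota R X S k T' (hom_comp t f) n (hsg R t *: psh_map M (ti_g t) n x) = @iota R X S k T f n x.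
Proof.
apply: (etrans (linearZ_LR (@iota R X S k T' (hom_comp t f) n) _ _)).
apply: (etrans (congr1 (fun v => hsg R t *: v) (@iota_iso R X S k _ _ t f n x))).
by rewrite scalerA hsg2 scale1r.
Qed.

(** The passage from coordinates back to faces: the external part has a component at [h] only if [f]
    extends [h] by one edge, and by [csum_below] these [h] are the faces of [f]. *)
Lemma bar_d_iota S k T (f : hom S T) e n (x : M T n) (he : is_enum e (new_edges f)) : n + sh X T = k ->
  bar_d (@iota R X S k T f n x) =
  \sum_(i < size e) (- msg R T * hsg R (face_hom (tnth (in_tuple e) i))) *:
     @iota R X S (k - 1) _ (face_lift (enum_new_notin he i)) n (psh_map M (face_hom (tnth (in_tuple e) i)) n x)
  - msg R T *: @iota R X S (k - 1) T f (n - 1) (cx_d (M T) n x).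
Proof.
move=> nk; rewrite [LHS]dfam_span.
pose C U (h : hom S U) : dfam X S (k - 1) :=
  @iota R X S (k - 1) U h (k - 1 - sh X U) (msg R U *: bar_ext (@iota R X S k T f n x) h (k - 1 - sh X U)).
pose E U (h : hom S U) : dfam X S (k - 1) :=
  @iota R X S (k - 1) U h (k - 1 - sh X U) (- msg R U *: cst (k - 1 - sh X U) (cx_d (M U) _ (pr h (k - 1 - sh X U + 1) (@iota R X S k T f n x)))).
have -> : csum (coef (bar_d (@iota R X S k T f n x))) = csum C + csum E.
  rewrite /csum -big_split; apply: eq_bigr => c _ /=; rewrite /coef pr_bar_d /C /E.
  by rewrite -(linearD (@iota R X S (k - 1) _ _ _)) scalerBr scaleNr.
congr (_ + _).
- rewrite (@csum_below S T f).
  + rewrite -big_enum /= (perm_big e); last by rewrite perm_sym.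
    rewrite big_tnth; apply: eq_bigr => i _; rewrite (fliftE (enum_new_notin he i)) /= /C.
    have c1 := codim_face (face_inner he i).
    have -> : k - 1 - sh X (face (tnth (in_tuple e) i)) = n by rewrite -nk (sh_succ M c1); lia.
    have := @bar_ext_iota S k T _ (face_lift (enum_new_notin he i)) (face_hom (tnth (in_tuple e) i)) n x c1 nk.
    rewrite (face_liftK (enum_new_notin he i)) => ->.
    rewrite scalerA linearZ_LR; congr (_ *: _); congr (_ * _).
    by rewrite (msg_hom R c1) opprK.
  + move=> U U' t h; rewrite /C (sh_iso X t) (msg_iso R t) bar_ext_iso scalerA (mulrC (msg R U)) -scalerA.
    by rewrite -(linearZ_LR (psh_map M (ti_g t) _)) iota_bar_iso.
  + by move=> U h h0; rewrite /C bar_ext_iota0 // scaler0 linear0.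
have -> : csum E = E T f.
  apply: csum_single.
  + move=> U U' t h; rewrite /E (sh_iso X t) (msg_iso R t) pr_iso (linearZ_LR (cx_d (M U') _)) (linearZ_LR (@cst R (M U') _ _)).
    rewrite scalerA (mulrC _ (hsg R t)) -scalerA -cm_d -[ix_map X t]/(psh_map M (ti_g t)).
    transitivity (@iota R X S (k - 1) U' (hom_comp t h) (k - 1 - sh X U) (hsg R t *: (- msg R U *:
       psh_map M (ti_g t) (k - 1 - sh X U) (cst (k - 1 - sh X U) (cx_d (M U) (k - 1 - sh X U + 1)
         (pr h (k - 1 - sh X U + 1) (@iota R X S k T f n x))))))).
      congr (iota _ _ (_ *: (_ *: _))); apply: esym.
      by apply: (@cst_map R _ _ (fun m => psh_map M (ti_g t) m)); apply: linear0.
    by rewrite -(linearZ_LR (psh_map M (ti_g t) _)) iota_bar_iso.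
  + move=> U h ne; rewrite /E pr_iota0; last exact: nesym.
    by rewrite (linear0 (cx_d (M U) _)) linear0 scaler0 linear0.
rewrite /E; have -> : k - 1 - sh X T = n - 1 by lia.
rewrite (cst_pred (fun m => pr f m (@iota R X S k T f n x))) pr_iota // -scaleNr.
exact: (linearZ_LR (@iota R X S (k - 1) T f (n - 1))).
Qed.
End BarSum.

Section WordSigns.
Variable R : comPzRingType.

Lemma new_enum_comp S S' T (h : hom S' T) (g : hom S S') c e :
  is_enum c (new_edges g) -> is_enum e (new_edges h) -> is_enum (map h c ++ e) (new_edges (hom_comp h g)).
Proof.
move=> hc he.
have h1 := hom_enum (hom_enum (is_enum_enum (inner S)) hc) he.
have h2 := hom_enum (is_enum_enum (inner S)) (is_enum_enum (new_edges (hom_comp h g))).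
rewrite /is_enum -(perm_cat2l (map (hom_comp h g) (enum (inner S)))).
have -> : map (hom_comp h g) (enum (inner S)) ++ map h c ++ e = map h (map g (enum (inner S)) ++ c) ++ e.
  by rewrite map_cat -map_comp catA.
by apply: perm_trans h1 _; rewrite perm_sym.
Qed.

(** The edges in [dQ] cross those in [eS]. This is the term [e_S d_R] of both sign exponents, and
    the reason why [lam] does not contain it. *)
Lemma wsgn_graft_word S S' Q Q' (f : hom S S') (a : S) (g : hom Q Q') dS dQ eS eQ :
  leaf a -> has_vertex S -> has_vertex Q ->
  is_enum dS (inner S) -> is_enum dQ (inner Q) -> is_enum eS (new_edges f) -> is_enum eQ (new_edges g) ->
  wsgn R (map (graft_hom f a g) (graft_inl a Q a :: map (graft_inl a Q) dS ++ map (graft_inr a) dQ) ++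
    (map (graft_inl (f a) Q') eS ++ map (graft_inr (f a)) eQ)) =
  ksgn R ((size eS)%:Z * (size dQ)%:Z) * gsgn R (f a) Q' * wsgn R (map f dS ++ eS) * wsgn R (map g dQ ++ eQ).
Proof.
move=> la vS vQ hS hQ hS' hQ'.
have e1 := hom_enum hS hS'; have e2 := hom_enum hQ hQ'.
have := wsgn_graft R (hleaf f la) (hver f vS) (hver g vQ) e1 e2.
have := graft_enum (hleaf f la) (hver f vS) (hver g vQ) e1 e2.
set w2 := _ :: _ => ew2 w2E.
have -> : map (graft_hom f a g) (graft_inl a Q a :: map (graft_inl a Q) dS ++ map (graft_inr a) dQ) ++
    (map (graft_inl (f a) Q') eS ++ map (graft_inr (f a)) eQ) =
  (graft_inl (f a) Q' (f a) :: map (graft_inl (f a) Q') (map f dS)) ++ map (graft_inr (f a)) (map g dQ) ++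
    map (graft_inl (f a) Q') eS ++ map (graft_inr (f a)) eQ.
  rewrite map_cons map_cat -!map_comp (graft_hom_inl f a g) !cat_cons -!catA; congr (_ :: _ ++ _ ++ _).
    by apply: eq_map => x; exact: graft_hom_inl.
  by apply: eq_map => x; exact: graft_hom_inr.
set w1 := (X in wsgn R X).
have w2' : w2 = (graft_inl (f a) Q' (f a) :: map (graft_inl (f a) Q') (map f dS)) ++
    map (graft_inl (f a) Q') eS ++ map (graft_inr (f a)) (map g dQ) ++ map (graft_inr (f a)) eQ.
  by rewrite /w2 !map_cat /= -!catA.
have p12 : perm_eq w1 w2 by rewrite w2' /w1 perm_cat2l !catA perm_cat2r perm_catC.
have ew1 : is_enum w1 (inner (graft S' (f a) Q')) := perm_trans p12 ew2.
rewrite (wsgn_perm R ew1 p12) w2E -!mulrA; congr (_ * _).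
rewrite /w1 par_move; [|exact: (enum_uniq_of ew1)|exact: p12].
by rewrite -w2' par_refl addbF !size_map ksgn_nat mulnC PoszM.
Qed.
End WordSigns.

(** * The bar construction on symbols *)

Section BarModel.
Variables (R : comPzRingType) (M : preoperad R).
Local Notation X := (barX M).

Definition bsym S k (s : bar_sym M S) : dfam X S k :=
  @sval_of R X S k (bs_T s) (bs_hom s) (bs_d s) (bs_e s) (bs_n s) (bs_x s).

Lemma bar_deg_soff S (s : bar_sym M S) :
  bar_deg s = bs_n s + soff X (size (bs_d s)) (size (bs_e s)).
Proof. by rewrite /bar_deg /soff /=; lia. Qed.

Lemma bar_deg_sh S T (f : hom S T) d e n (x : M T n) : sok f d e ->
  n + sh X T = bar_deg (BarSym f d e x).
Proof. by move=> ok; rewrite bar_deg_soff /= -(soff_sh X ok). Qed.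

Lemma bsym_rel S k t u : bar_rel k t u -> leval (@bsym S k) t = leval (@bsym S k) u.
Proof.
case=> {t u} /=.
- by move=> s h; apply: sval_zero; rewrite -bar_deg_soff.
- by move=> T f d e n c x x'; apply: (@sval_linear R X).
- move=> T T' t0 f d e n x' /isom_ti[t tE]; subst t0.
  rewrite /bsym /=; apply: esym; apply: (etrans _ (@sval_iso R X S k _ _ t f d e n _)).
  by rewrite /= -psh_comp ti_fg psh_id.
- by move=> T f d e n x sigma tau; apply: (@sval_perm R X).
Qed.

Definition bar_lin S k : {linear bar_mod M S k -> dfam X S k} := plift (@bsym_rel S k).

Lemma bar_lin_gen S k (s : bar_sym M S) : bar_lin S k (pgen _ s) = bsym k s.
Proof. exact: plift_gen. Qed.

Lemma bar_lin_bij S k : bijective (bar_lin S k).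
Proof.
pose gen T (f : hom S T) d e n (x : M T n) : bar_mod M S k := pgen _ (BarSym f d e x).
apply: (@sval_bij R X S k _ gen).
- by move=> T f d e n x h; apply: (pres_rel (bar_rel_zero _)); rewrite bar_deg_soff.
- by move=> T f d e n c x y; apply: (pres_rel (bar_rel_linear k f d e c x y)).
- move=> T T' t f d e n x; apply: esym.
  have := pres_rel (bar_rel_iso k f d e (psh_map M (ti_g t) n x : M T' n) (ti_isom t)).
  by rewrite /= -psh_comp ti_gf psh_id.
- by move=> T f d e n x sigma tau; apply: (pres_rel (bar_rel_perm k f x sigma tau)).
- by move=> T f d e n x; apply: bar_lin_gen.
- by move=> psi h; apply: (@pres_ext R _ _ _ psi idfun) => -[T f d e n x]; apply: h.
Qed.

Lemma bsym_enum S k T (f : hom S T) d e n (x : M T n) :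
  is_enum d (inner S) -> is_enum e (new_edges f) -> k = bar_deg (BarSym f d e x) ->
  bsym k (BarSym f d e x) = wsgn R (map f d ++ e) *: @iota R X S k T f n x.
Proof.
move=> hd he ->; apply: (@sval_enum R X) => //; apply: bar_deg_sh.
by rewrite /sok hd.
Qed.

Lemma bar_lin_d S T (f : hom S T) d e n (x : M T n)
      (hd : is_enum d (inner S)) (he : is_enum e (new_edges f)) (k := bar_deg (BarSym f d e x)) :
  bar_d (bar_lin S k (pgen _ (BarSym f d e x))) =
      \sum_(i < size e)
        ksgn R ((size d)%:Z + i%:Z) *:
        bar_lin S (k - 1) (pgen _
          (BarSym (face_lift (enum_new_notin he i)) d
             (face_seq (tnth (in_tuple e) i) e)
             (psh_map M (face_hom (tnth (in_tuple e) i)) n x)))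
      + ksgn R ((size d)%:Z + (size e)%:Z) *:
        bar_lin S (k - 1) (pgen _ (BarSym f d e (- cx_d (M T) n x))).
Proof.
have ok : sok f d e by rewrite /sok hd.
have nk := bar_deg_sh x ok; rewrite -/k in nk.
have szT : ksgn R ((size d)%:Z + (size e)%:Z) = msg R T.
  rewrite /msg (card_inner f) (enum_size hd) (enum_size he) -/(codim f).
  by congr ksgn; rewrite PoszD.
rewrite !bar_lin_gen bsym_enum // linearZ_LR /= (bar_d_iota (n := n) x he nk).
rewrite scalerBr scaler_sumr; congr (_ + _).
  apply: eq_bigr => i _; rewrite bar_lin_gen.
  have fsz : size e = (size (face_seq (tnth (in_tuple e) i) e)).+1.
    have /(congr1 size) := map_face_seq (face_inner he i) e; rewrite size_map size_filter => ->.
    have := count_predC (pred1 (tnth (in_tuple e) i)) e.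
    by rewrite (count_uniq_mem _ (enum_uniq_of he)) mem_tnth => /esym.
  rewrite bsym_enum //; [|exact: face_seq_enum|by rewrite /k /bar_deg /=; move: fsz; lia].
  rewrite !scalerA; congr (_ *: _).
  rewrite (face_wsgn R hd he i) -szT; set h := hsg R _; set w := wsgn R _.
  (* The exponents [e - 1 - i] of [face_wsgn] and [d + e] of [msg], with the minus sign, add up to
     the prescribed [d + i]; the sign of the face occurs twice. *)
  transitivity (- (ksgn R ((size e)%:Z - 1 - i%:Z) * ksgn R ((size d)%:Z + (size e)%:Z)) * w * (h * h)); first by ring.
  rewrite hsg2 mulr1; congr (_ * _); rewrite -ksgnD -ksgnB1; apply: ksgn_eq.
  by rewrite !(poddD, poddN, podd1); case: (podd (size e)) (podd (size d)) (podd i) => [] [] [].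
rewrite bsym_enum //; last by rewrite /k /bar_deg /=; lia.
rewrite szT !scalerA (linearN (@iota R X S (k - 1) T f (n - 1))) /= scalerN.
by congr (- (_ *: _)); apply: mulrC.
Qed.

Lemma bar_lin_map S S' T (g : hom S S') (h : hom S' T) d (c : seq S') e n (x : M T n)
    (s := BarSym (hom_comp h g) d (map h c ++ e) x) :
  is_enum d (inner S) -> is_enum c (new_edges g) -> is_enum e (new_edges h) ->
  dpull g (bar_lin S (bar_deg s) (pgen _ s)) =
  bar_lin S' (bar_deg s) (pgen _ (BarSym h (map g d ++ c) e x)).
Proof.
move=> hd hc he; rewrite !bar_lin_gen /s bsym_enum //; last exact: new_enum_comp.
rewrite linearZ_LR /= dpull_iota bsym_enum //; last first.
- by rewrite /bar_deg /= !size_cat !size_map !PoszD; lia.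
- exact: hom_enum.
by rewrite map_cat -map_comp catA.
Qed.

Lemma bar_lin_map0 S S' T (g : hom S S') (f : hom S T) d e n (x : M T n) (k : int) :
  (forall h : hom S' T, f <> hom_comp h g) ->
  dpull g (bar_lin S k (pgen _ (BarSym f d e x))) = 0.
Proof.
move=> h0; rewrite bar_lin_gen /bsym /sval_of /=; case: ifP => _; last by rewrite linear0.
by rewrite linearZ_LR /= dpull_iota0 // scaler0.
Qed.

Lemma bar_lin_theta S (a : S) Q (la : leaf a) (vS : has_vertex S) (vQ : has_vertex Q)
      S' Q' (f : hom S S') (g : hom Q Q')
      (la' : leaf (f a)) (vS' : has_vertex S') (vQ' : has_vertex Q')
      (dS : seq S) (dQ : seq Q) (eS : seq S') (eQ : seq Q')
      n (x : M (graft S' (f a) Q') n) (l : seq (tsym (M S') (M Q')))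
      (s := BarSym (graft_hom f a g)
      (graft_inl a Q a :: map (graft_inl a Q) dS ++ map (graft_inr a) dQ)
      (map (graft_inl (f a) Q') eS ++ map (graft_inr (f a)) eQ) x) :
    is_enum dS (inner S) -> is_enum dQ (inner Q) ->
    is_enum eS (new_edges f) -> is_enum eQ (new_edges g) ->
    po_theta M la' vS' vQ' n x = \sum_(t <- l) ten n (ts_a t) (ts_b t) ->
  @theta_fun R (barI M) (barDS M) S a Q la vS vQ (bar_deg s) (bar_lin _ (bar_deg s) (pgen _ s)) =
    \sum_(t <- l)
      let: (ds, es, dr, er) := ((size dS)%:Z, (size eS)%:Z, (size dQ)%:Z, (size eQ)%:Z) in
      let s1 := BarSym f dS eS (ts_a t) in
      let s2 := BarSym g dQ eQ (ts_b t) in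
      ksgn R (1 + ds + es + dr + er + es * dr
              + (dr + er) * (ts_p t + 1) + ts_p t) *:
      @ten R (DC (barDS M) S) (DC (barDS M) Q) (bar_deg s) _ _
        (bar_lin S (bar_deg s1) (pgen _ s1)) (bar_lin Q (bar_deg s2) (pgen _ s2)).
Proof.
move=> hdS hdQ heS heQ xE; set k := bar_deg s.
have hd := graft_enum la vS vQ hdS hdQ.
have he := graft_new_enum a heS heQ.
have sE : k = n + sh X S' + sh X Q'.
  have ok : sok (graft_hom f a g) (graft_inl a Q a :: map (graft_inl a Q) dS ++ map (graft_inr a) dQ)
     (map (graft_inl (f a) Q') eS ++ map (graft_inr (f a)) eQ) by rewrite /sok hd.
  rewrite /k /s -(bar_deg_sh x ok) -addrA; congr (_ + _); exact: (sh_graft X la' vS' vQ').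
rewrite bar_lin_gen /s bsym_enum // linearZ_LR /=.
rewrite [theta_fun _ _ _ _ _](@theta_iota R (barI M) (barDS M) S a Q la vS vQ k S' f Q' g n x (esym sE)).
have -> : thx (X := barI M) la vS vQ f g x = \sum_(t <- l) ten n (ts_a t) (ts_b t).
  by rewrite -xE; apply: (@thx_irr R (barI M)).
rewrite raddf_sum scaler_sumr; apply: eq_bigr => -[p q u v] _ /=.
set s1 := BarSym f dS eS u; set s2 := BarSym g dQ eQ v.
have d1 : bar_deg s1 = p + sh X S' by rewrite -(@bar_deg_sh _ _ f dS eS p u) // /sok hdS.
have d2 : bar_deg s2 = q + sh X Q' by rewrite -(@bar_deg_sh _ _ g dQ eQ q v) // /sok hdQ.
have [pq|pq] := eqVneq (p + q) n; last first.
  (* The given expression of [po_theta] may contain tensors of the wrong degree; they vanish on both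
     sides. *)
  rewrite (ten0 _ _ pq) linear0 (@ten0 R (DC (barDS M) S) (DC (barDS M) Q)) ?scaler0 //.
  by rewrite d1 d2 sE addrACA -[X in _ != X]addrA (inj_eq (addIr _)).
rewrite [J _ _ _ _ _ _ _](@JE' R (barI M) (barDS M) S S' f a Q Q' g k n p q _ _ u v pq d1 d2).
rewrite !bar_lin_gen /s1 /s2 !bsym_enum // ten_Zl ten_Zr !scalerA; congr (_ *: _).
rewrite wsgn_graft_word // /jsg /lamT.
(* Inner edges of the targets number [ds + es] and [dr + er], so the exponent is [lam] plus the
   product [es * dr] supplied by the word. *)
have -> : ksgn R (1 + (size dS)%:Z + (size eS)%:Z + (size dQ)%:Z + (size eQ)%:Z + (size eS)%:Z * (size dQ)%:Z
    + ((size dQ)%:Z + (size eQ)%:Z) * (p + 1) + p) =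
  ksgn R ((size eS)%:Z * (size dQ)%:Z) * ksgn R (lam true #|inner S'| #|inner Q'| p).
  rewrite -ksgnD; apply: ksgn_eq; rewrite /lam (card_inner f) (card_inner g) (enum_size hdS) (enum_size hdQ) (enum_size heS) (enum_size heQ).
  rewrite -/(codim f) -/(codim g) !PoszD !(poddD, poddM, podd1).
  by case: (podd #|inner S|) (podd #|inner Q|) (podd (codim f)) (podd (codim g)) (podd p) => [] [] [] [] [].
transitivity (ksgn R ((size eS)%:Z * (size dQ)%:Z) * ksgn R (lam true #|inner S'| #|inner Q'| p) *
  wsgn R (map f dS ++ eS) * wsgn R (map g dQ ++ eQ) * (gsgn R (f a) Q' * gsgn R (f a) Q')); first by rewrite /=; ring.
by rewrite gsgn2 mulr1; ring.
Qed.

Definition bar_mdl : bar_model M (bar_pre M) :=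
  @BarModel R M (bar_pre M) bar_lin bar_lin_bij bar_lin_d bar_lin_map
    (fun S S' T g f d e n x h => @bar_lin_map0 S S' T g f d e n x _ h) bar_lin_theta.
End BarModel.

(** * The cobar construction on symbols *)

Section CobarModel.
Variables (R : comPzRingType) (Y : precooperad R).
Local Notation X := (cobX Y).

Definition csym S k (s : cobar_sym Y S) : dfam X S k :=
  @sval_of R X S k (cs_T s) (cs_hom s) (cs_b s) (cs_d s) (cs_n s) (cs_y s).

Lemma cobar_deg_soff S (s : cobar_sym Y S) :
  cobar_deg s = cs_n s + soff X (size (cs_b s)) (size (cs_d s)).
Proof. by rewrite /cobar_deg /soff /=; lia. Qed.

Lemma cobar_deg_sh S T (f : hom S T) b d n (y : Y T n) : sok f b d ->
  n + sh X T = cobar_deg (CobarSym f b d y).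
Proof. by move=> ok; rewrite cobar_deg_soff /= -(soff_sh X ok). Qed.

Lemma csym_rel S k t u : cobar_rel k t u -> leval (@csym S k) t = leval (@csym S k) u.
Proof.
case=> {t u} /=.
- by move=> s h; apply: sval_zero; rewrite -cobar_deg_soff.
- by move=> T f b d n c y y'; apply: (@sval_linear R X).
- move=> T T' t0 f b d n y /isom_ti[t tE]; subst t0.
  exact: (esym (@sval_iso R X S k _ _ t f b d n _)).
- by move=> T f b d n y sigma tau; apply: (@sval_perm R X).
Qed.

Definition cob_lin S k : {linear cobar_mod Y S k -> dfam X S k} := plift (@csym_rel S k).

Lemma cob_lin_gen S k (s : cobar_sym Y S) : cob_lin S k (pgen _ s) = csym k s.
Proof. exact: plift_gen. Qed.

Lemma cob_lin_bij S k : bijective (cob_lin S k).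
Proof.
pose gen T (f : hom S T) b d n (y : Y T n) : cobar_mod Y S k := pgen _ (CobarSym f b d y).
apply: (@sval_bij R X S k _ gen).
- by move=> T f b d n y h; apply: (pres_rel (cobar_rel_zero _)); rewrite cobar_deg_soff.
- by move=> T f b d n c y y'; apply: (pres_rel (cobar_rel_linear k f b d c y y')).
- move=> T T' t f b d n y; apply: esym.
  exact: (pres_rel (cobar_rel_iso k f b d y (ti_isom t))).
- by move=> T f b d n y sigma tau; apply: (pres_rel (cobar_rel_perm k f y sigma tau)).
- by move=> T f b d n y; apply: cob_lin_gen.
- by move=> psi h; apply: (@pres_ext R _ _ _ psi idfun) => -[T f b d n y]; apply: h.
Qed.

Lemma csym_enum S k T (f : hom S T) b d n (y : Y T n) :
  is_enum b (inner S) -> is_enum d (new_edges f) -> k = cobar_deg (CobarSym f b d y) ->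
  csym k (CobarSym f b d y) = wsgn R (map f b ++ d) *: @iota R X S k T f n y.
Proof.
move=> hb hd ->; apply: (@sval_enum R X) => //; apply: cobar_deg_sh.
by rewrite /sok hb.
Qed.

Lemma cob_lin_d S T (f : hom S T) b d n (y : Y T n) (k := cobar_deg (CobarSym f b d y)) :
    is_enum b (inner S) -> is_enum d (new_edges f) ->
    exists2 v : dfam X S (k - 1),
      class_sum (fun T' (g : hom T T') => codim g = 1%N)
        (fun T' g => cob_lin S (k - 1) (pgen _
           (CobarSym (hom_comp g f) b (map g d ++ enum (new_edges g))
              (cps_map Y g n y)))) v &
      cob_d (cob_lin S k (pgen _ (CobarSym f b d y))) =
        v + ksgn R ((size b)%:Z + (size d)%:Z) *:
            cob_lin S (k - 1) (pgen _ (CobarSym f b d (- cx_d (Y T) n y))).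
Proof.
move=> hb hd.
have ok : sok f b d by rewrite /sok hb.
have nk := cobar_deg_sh y ok; rewrite -/k in nk.
have szT : ksgn R ((size b)%:Z + (size d)%:Z) = msg R T.
  rewrite /msg (card_inner f) (enum_size hb) (enum_size hd) -/(codim f).
  by congr ksgn; rewrite PoszD.
have := @csum_class_sum T (dfam X S (k - 1)) (fun T' g => cob_lin S (k - 1) (pgen _
           (CobarSym (hom_comp g f) b (map g d ++ enum (new_edges g)) (cps_map Y g n y))))
   (fun T' g => codim g == 1%N) (fun T' g => codim g = 1%N).
move=> /(_ (fun _ _ => eqP) (fun T1 T2 t g => congr1 (fun c => c == 1%N) (codim_tcomp t g))).
set v := csum _ => vc; exists v => //.
(* Appending the new edge multiplies the sign of the word by [hsg], which is the weight in
   [csum1]. *)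
have -> : v = wsgn R (map f b ++ d) *: cob_ext k f y.
  rewrite /v /cob_ext -csum1Z; apply: eq_csum => T' g; case: eqP => // c1.
  rewrite cob_lin_gen csym_enum //; last first.
  - rewrite /k /cobar_deg /= size_cat size_map -cardE -/(codim g) c1; lia.
  - exact: new_enum_comp.
  rewrite scalerA; congr (_ *: _).
  rewrite -(@wsgn_hom1 R _ _ g (map f b ++ d) (enum (new_edges g))) ?c1 //; last exact: hom_enum.
  by rewrite map_cat -map_comp catA.
rewrite !cob_lin_gen csym_enum // linearZ_LR /= (cob_d_iota f y nk) /cob_gen scalerBr; congr (_ + _).
rewrite csym_enum //; last by rewrite /k /cobar_deg /=; lia.
rewrite szT !scalerA (linearN (@iota R X S (k - 1) T f (n - 1))) /= scalerN.
by congr (- (_ *: _)); apply: mulrC.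
Qed.

Lemma cob_lin_map S' S T (g : hom S' S) (f : hom S T) (b' : seq S') b'' d n (y : Y T n)
    (s := CobarSym f (map g b' ++ b'') d y) :
    is_enum b' (inner S') -> is_enum b'' (new_edges g) -> is_enum d (new_edges f) ->
    dpush g (cob_lin S (cobar_deg s) (pgen _ s)) =
    cob_lin S' (cobar_deg s) (pgen _ (CobarSym (hom_comp f g) b' (map f b'' ++ d) y)).
Proof.
move=> hb hb2 hd; rewrite !cob_lin_gen /s csym_enum //; last exact: hom_enum.
rewrite linearZ_LR /= dpush_iota csym_enum //; last first.
- by rewrite /cobar_deg /= !size_cat !size_map !PoszD; lia.
- exact: new_enum_comp.
by rewrite map_cat -map_comp catA.
Qed.

Lemma cob_lin_theta S (a : S) Q (la : leaf a) (vS : has_vertex S) (vQ : has_vertex Q)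
      S' Q' (f : hom S S') (g : hom Q Q')
      (la' : leaf (f a)) (vS' : has_vertex S') (vQ' : has_vertex Q')
      (dS : seq S) (dQ : seq Q) (eS : seq S') (eQ : seq Q')
      n (y : Y (graft S' (f a) Q') n) (l : seq (tsym (Y S') (Y Q')))
      (s := CobarSym (graft_hom f a g)
      (graft_inl a Q a :: map (graft_inl a Q) dS ++ map (graft_inr a) dQ)
      (map (graft_inl (f a) Q') eS ++ map (graft_inr (f a)) eQ) y) :
    is_enum dS (inner S) -> is_enum dQ (inner Q) ->
    is_enum eS (new_edges f) -> is_enum eQ (new_edges g) ->
    pc_theta Y la' vS' vQ' n y = \sum_(t <- l) ten n (ts_a t) (ts_b t) ->
  @theta_fun R (cobI Y) (cobDS Y) S a Q la vS vQ (cobar_deg s) (cob_lin _ (cobar_deg s) (pgen _ s)) =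
    \sum_(t <- l)
      let: (ds, es, dr, er) := ((size dS)%:Z, (size eS)%:Z, (size dQ)%:Z, (size eQ)%:Z) in
      let s1 := CobarSym f dS eS (ts_a t) in
      let s2 := CobarSym g dQ eQ (ts_b t) in
      ksgn R ((ds + es) * (dr + er) + dr * es + ts_p t
              + (dr + er) * (ts_p t - 1)) *:
      @ten R (DC (cobDS Y) S) (DC (cobDS Y) Q) (cobar_deg s) _ _
        (cob_lin S (cobar_deg s1) (pgen _ s1)) (cob_lin Q (cobar_deg s2) (pgen _ s2)).
Proof.
move=> hdS hdQ heS heQ yE; set k := cobar_deg s.
have hd := graft_enum la vS vQ hdS hdQ.
have he := graft_new_enum a heS heQ.
have sE : k = n + sh X S' + sh X Q'.
  have ok : sok (graft_hom f a g) (graft_inl a Q a :: map (graft_inl a Q) dS ++ map (graft_inr a) dQ)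
     (map (graft_inl (f a) Q') eS ++ map (graft_inr (f a)) eQ) by rewrite /sok hd.
  rewrite /k /s -(cobar_deg_sh y ok) -addrA; congr (_ + _); exact: (sh_graft X la' vS' vQ').
rewrite cob_lin_gen /s csym_enum // linearZ_LR /=.
rewrite [theta_fun _ _ _ _ _](@theta_iota R (cobI Y) (cobDS Y) S a Q la vS vQ k S' f Q' g n y (esym sE)).
have -> : thx (X := cobI Y) la vS vQ f g y = \sum_(t <- l) ten n (ts_a t) (ts_b t).
  by rewrite -yE; apply: (@thx_irr R (cobI Y)).
rewrite raddf_sum scaler_sumr; apply: eq_bigr => -[p q u v] _ /=.
set s1 := CobarSym f dS eS u; set s2 := CobarSym g dQ eQ v.
have d1 : cobar_deg s1 = p + sh X S' by rewrite -(@cobar_deg_sh _ _ f dS eS p u) // /sok hdS.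
have d2 : cobar_deg s2 = q + sh X Q' by rewrite -(@cobar_deg_sh _ _ g dQ eQ q v) // /sok hdQ.
have [pq|pq] := eqVneq (p + q) n; last first.
  rewrite (ten0 _ _ pq) linear0 (@ten0 R (DC (cobDS Y) S) (DC (cobDS Y) Q)) ?scaler0 //.
  by rewrite d1 d2 sE addrACA -[X in _ != X]addrA (inj_eq (addIr _)).
rewrite [J _ _ _ _ _ _ _](@JE' R (cobI Y) (cobDS Y) S S' f a Q Q' g k n p q _ _ u v pq d1 d2).
rewrite !cob_lin_gen /s1 /s2 !csym_enum // ten_Zl ten_Zr !scalerA; congr (_ *: _).
rewrite wsgn_graft_word // /jsg /lamT.
have -> : ksgn R (((size dS)%:Z + (size eS)%:Z) * ((size dQ)%:Z + (size eQ)%:Z) + (size dQ)%:Z * (size eS)%:Z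
    + p + ((size dQ)%:Z + (size eQ)%:Z) * (p - 1)) =
  ksgn R ((size eS)%:Z * (size dQ)%:Z) * ksgn R (lam false #|inner S'| #|inner Q'| p).
  rewrite -ksgnD; apply: ksgn_eq; rewrite /lam (card_inner f) (card_inner g) (enum_size hdS) (enum_size hdQ) (enum_size heS) (enum_size heQ).
  rewrite -/(codim f) -/(codim g) !PoszD !(poddD, poddM, poddN, podd1).
  by case: (podd #|inner S|) (podd #|inner Q|) (podd (codim f)) (podd (codim g)) (podd p) => [] [] [] [] [].
transitivity (ksgn R ((size eS)%:Z * (size dQ)%:Z) * ksgn R (lam false #|inner S'| #|inner Q'| p) *
  wsgn R (map f dS ++ eS) * wsgn R (map g dQ ++ eQ) * (gsgn R (f a) Q' * gsgn R (f a) Q')); first by rewrite /=; ring.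
by rewrite gsgn2 mulr1; ring.
Qed.

Definition cob_mdl : cobar_model Y (cob_pre Y) :=
  @CobarModel R Y (cob_pre Y) cob_lin cob_lin_bij cob_lin_d cob_lin_map cob_lin_theta.
End CobarModel.

(** * Functoriality and adjunction *)

Section FamilyMap.
Variables (R : comPzRingType) (X Z : isofun R) (F : forall T, chain_map (X T) (Z T)).
Hypothesis F_bar : ix_bar X = ix_bar Z.
Hypothesis F_iso : forall T T' (t : tiso T T') n (x : X T n), F T' n (ix_map X t n x) = ix_map Z t n (F T n x).

Lemma sh_map T : sh X T = sh Z T. Proof. by rewrite /sh F_bar. Qed.

Section Map.
Variables (S : tree) (k : int).
Lemma dmap_deg (u : dfam X S k) T (f : hom S T) n : n + sh Z T != k -> F T n (df u f n) = 0.
Proof. by rewrite -sh_map => h; rewrite df_deg // linear0. Qed.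
Lemma dmap_iso (u : dfam X S k) T T' (t : tiso T T') (f : hom S T) n :
  F T' n (df u (hom_comp t f) n) = hsg R t *: ix_map Z t n (F T n (df u f n)).
Proof. by rewrite df_iso (linearZ_LR (F T' n)); congr (_ *: _); exact: F_iso. Qed.
Definition dmap (u : dfam X S k) : dfam Z S k := DFam (dmap_deg u) (dmap_iso u).
Lemma pr_dmap u T (f : hom S T) n : pr f n (dmap u) = F T n (pr f n u).
Proof. by []. Qed.
Lemma dmap_linear : linear dmap.
Proof.
move=> c u v; apply: pr_ext => T f n _; rewrite [RHS]linearP /= !pr_dmap [pr _ _ _]linearP.
exact: (linearP (F T n)).
Qed.
HB.instance Definition _ := GRing.isLinear.Build R (dfam X S k) (dfam Z S k) *:%R dmap dmap_linear.
Lemma dmap_iota T (f : hom S T) n (x : X T n) : dmap (iota k f x) = iota k f (F T n x).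
Proof.
apply: pr_ext => T' f' n' _; rewrite pr_dmap !prE /= /iota_fun -sh_map; case: eqP => _; last exact: linear0.
case: (pt f f') => [t|]; last exact: linear0.
rewrite (linearZ_LR (F T' n')); congr (_ *: _).
apply: (etrans (@cst_map R _ _ (fun m => F T' m) _ _ _ (linear0 (F T' n')))).
by rewrite F_iso.
Qed.
End Map.
End FamilyMap.

Section CoopMap.
Variables (R : comPzRingType) (X Z : isocoop R) (F : forall T, chain_map (X T) (Z T)).
Hypothesis F_bar : ix_bar X = ix_bar Z.
Hypothesis F_iso : forall T T' (t : tiso T T') n (x : X T n), F T' n (ix_map X t n x) = ix_map Z t n (F T n x).
Hypothesis F_theta : forall S (a : S) Q (la : leaf a) (vS : has_vertex S) (vQ : has_vertex Q)
  n (x : X (graft S a Q) n),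
  tens_map (F S) (F Q) n (ic_theta X la vS vQ n x) = ic_theta Z la vS vQ n (F _ n x).
Variables (dx : dstruct X) (dz : dstruct Z).
Hypothesis F_d : forall S k (u : dfam X S k),
  dmap F_bar F_iso (ds_d dx _ k u) = ds_d dz _ k (dmap F_bar F_iso u).

Definition dmap_cm S : chain_map (DC dx S) (DC dz S) :=
  @ChainMap R (DC dx S) (DC dz S) (fun k => @dmap R X Z F F_bar F_iso S k)
    (fun k => @dmap_linear R X Z F F_bar F_iso S k) (@F_d S).

Lemma dmap_theta S (a : S) Q (la : leaf a) (vS : has_vertex S) (vQ : has_vertex Q) k (u : dfam X (graft S a Q) k) :
  tens_map (dmap_cm S) (dmap_cm Q) k (theta_fun dx la vS vQ u) =
  theta_fun dz la vS vQ (dmap F_bar F_iso u).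
Proof.
apply: (@K_sep _ _ dz _ a) => S' f Q' g n e.
rewrite K_theta // pr_dmap /thx -F_theta.
rewrite -[ic_theta X _ _ _ n _](@K_theta _ X dx S a Q la vS vQ k _ f _ g n u); last by rewrite !(sh_map F_bar).
apply: (@ten_lin_ext _ (DC dx S) (DC dx Q) k _ (K dz f a g k n \o tens_fun (dmap_cm S) (dmap_cm Q) k)
  (tens_fun (F S') (F Q') n \o K dx f a g k n)) => p q v w pq.
rewrite [LHS]/= [RHS]/= tens_funE !KE // (linearZ_LR (tens_fun _ _ _)) tens_funE !(sh_map F_bar) /= !pr_dmap.
by rewrite /jsg /lamT F_bar.
Qed.
End CoopMap.

Section Functors.
Variable R : comPzRingType.

Section BarMor.
Variables (M N : operad R) (phi : operad_mor M N).
Lemma bar_F_iso T T' (t : tiso T T') n (x : barX M T n) :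
  phi T' n (ix_map (barX M) t n x) = ix_map (barX N) t n (phi T n x).
Proof. exact: om_natural. Qed.
Definition bdmap S k := @dmap R (barX M) (barX N) phi erefl bar_F_iso S k.
Lemma bar_F_d S k (u : dfam (barX M) S k) : bdmap (bar_d u) = bar_d (bdmap u).
Proof.
apply: pr_ext => T f n _; rewrite pr_dmap !pr_bar_d (linearZ_LR (phi T n)) (linearB (phi T n)).
congr (_ *: (_ - _)).
  rewrite /bar_ext (csum1_linear (phi T n)); apply: eq_csum1 => T' g _.
  exact: (om_natural phi).
apply: (etrans (@cst_map R _ _ (fun m => phi T m) _ _ _ (linear0 (phi T n)))).
by congr cst; apply: cm_d.
Qed.
Definition bar_mor : cooperad_mor (bar_coop M) (bar_coop N).
Proof.
apply: (@CooperadMor R (bar_pre M) (bar_pre N) (@dmap_cm R (barI M) (barI N) phi erefl bar_F_iso (barDS M) (barDS N) bar_F_d)).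
- by move=> S T f n y; apply: pr_ext.
- move=> S a Q la vS vQ n y.
  apply: (@dmap_theta R (barI M) (barI N) phi erefl bar_F_iso _ (barDS M) (barDS N) bar_F_d).
  exact: om_theta.
Defined.
End BarMor.

Section CobMor.
Variables (Y Z : cooperad R) (phi : cooperad_mor Y Z).
Lemma cob_F_iso T T' (t : tiso T T') n (x : cobX Y T n) :
  phi T' n (ix_map (cobX Y) t n x) = ix_map (cobX Z) t n (phi T n x).
Proof. exact: cmor_natural. Qed.
Definition cdmap S k := @dmap R (cobX Y) (cobX Z) phi erefl cob_F_iso S k.
Lemma cob_F_d S k (u : dfam (cobX Y) S k) : cdmap (cob_d u) = cob_d (cdmap u).
Proof.
apply: (@dfam_lin_ext R (cobX Y) S k _ (@cdmap S (k - 1) \o @cob_d R Y S k) (@cob_d R Z S k \o @cdmap S k)).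
move=> T f n x e; rewrite [LHS]/= [RHS]/= /cdmap dmap_iota !cob_d_iota // /cob_gen linearB linearZ_LR /= dmap_iota cm_d.
congr (_ - _); rewrite /cob_ext csum1_linear; apply: eq_csum1 => T' g _.
by rewrite /= dmap_iota cmor_natural.
Qed.
Definition cob_mor : operad_mor (cob_op Y) (cob_op Z).
Proof.
apply: (@OperadMor R (cob_pre Y) (cob_pre Z) (@dmap_cm R (cobI Y) (cobI Z) phi erefl cob_F_iso (cobDS Y) (cobDS Z) cob_F_d)).
- move=> S T f n y.
  apply: (@dfam_lin_ext R (cobX Y) T n _ (@cdmap S n \o @dpush R (cobX Y) T S f n)
    (@dpush R (cobX Z) T S f n \o @cdmap T n)) => U g m x e.
  by rewrite /= /cdmap dpush_iota !dmap_iota dpush_iota.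
- move=> S a Q la vS vQ n y.
  apply: (@dmap_theta R (cobI Y) (cobI Z) phi erefl cob_F_iso _ (cobDS Y) (cobDS Z) cob_F_d).
  exact: cmor_theta.
Defined.
End CobMor.

Definition barF : functor (Operads R) (Cooperads R).
Proof.
apply: (@Functor (Operads R) (Cooperads R) (@bar_coop R) bar_mor).
- by move=> M; apply: cooperad_mor_ext => T n y; apply: pr_ext.
- by move=> M N P g f; apply: cooperad_mor_ext => T n y; apply: pr_ext.
Defined.

Definition cobF : functor (Cooperads R) (Operads R).
Proof.
apply: (@Functor (Cooperads R) (Operads R) (@cob_op R) cob_mor).
- by move=> Y; apply: operad_mor_ext => T n y; apply: pr_ext.
- by move=> Y Z W g f; apply: operad_mor_ext => T n y; apply: pr_ext.
Defined.
End Functors.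

(** * The unit *)

Section Unit.
Variables (R : comPzRingType) (Y : precooperad R).
Local Notation CY := (cob_pre Y).
Local Notation X := (barX CY).

Lemma sh_bar_cob T : sh X T = - sh (cobX Y) T.
Proof. by rewrite /sh /= opprK. Qed.

Section Eta.
Variables (S : tree) (n : int).
(** Sign-free form of the inner symbol of the unit formula: its word is also the word of the outer
    symbol, and the two signs cancel. *)
Definition eta_co (y : Y S n) T (f : hom S T) (p : int) : dfam (cobX Y) T p :=
  @iota R (cobX Y) T p T (hom_id T) n (cps_map Y f n y).

Lemma eta_deg y T (f : hom S T) (p : int) : p + sh X T != n -> eta_co y f p = 0.
Proof.
move=> h; rewrite /eta_co iota0 //; apply: contraNneq h => <-.
by rewrite sh_bar_cob addrK.
Qed.

Lemma eta_iso y T T' (t : tiso T T') (f : hom S T) p :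
  eta_co y (hom_comp t f) p = hsg R t *: ix_map X t p (eta_co y f p).
Proof.
rewrite /eta_co [ix_map _ _ _ _]dpush_iota hom_idl cps_comp.
rewrite -[RHS](@iota_iso R (cobX Y) T' p _ _ t (ti_g t) n).
by rewrite ti_fg.
Qed.

Definition eta_fun (y : Y S n) : dfam X S n := DFam (eta_deg y) (eta_iso y).

Lemma pr_eta y T (f : hom S T) p :
  pr f p (eta_fun y) = @iota R (cobX Y) T p T (hom_id T) n (cps_map Y f n y).
Proof. by []. Qed.

Lemma eta_linear : linear eta_fun.
Proof.
move=> c x y; apply: pr_ext => T f p _; rewrite [RHS]linearP /= !pr_eta (linearP (cps_map Y f n)).
exact: (linearP (@iota R (cobX Y) T p T (hom_id T) n)).
Qed.
End Eta.

(** The internal bar differential is the cobar one, whose external part cancels the external bar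
    part. The internal differential of [Y] remains, with [msg] squared. *)
Lemma eta_d S n (y : Y S n) : eta_fun (cx_d (Y S) n y) = bar_d (eta_fun y).
Proof.
apply: pr_ext => T f p e; rewrite pr_bar_d !pr_eta.
have nk : n + sh (cobX Y) T = p + 1 by move: e; rewrite sh_bar_cob; lia.
rewrite -[cx_d (CY T) _ _]/(cob_d _) (cob_d_iota (hom_id T) (cps_map Y f n y) nk).
have -> : cst p (cob_gen (p + 1) (hom_id T) (cps_map Y f n y)) =
    csum1 (fun T' (g : hom T T') => @iota R (cobX Y) T p T' g n (cps_map Y g n (cps_map Y f n y)))
    - msg R T *: @iota R (cobX Y) T p T (hom_id T) (n - 1) (cx_d (Y T) n (cps_map Y f n y)).
  have e1 : p + 1 - 1 = p by lia.
  rewrite /cob_gen /cob_ext e1 cst_id; congr (_ - _).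
  by apply: eq_csum1 => T' g _; rewrite hom_idr.
have -> : bar_ext (eta_fun y) f p =
    csum1 (fun T' (g : hom T T') => @iota R (cobX Y) T p T' g n (cps_map Y g n (cps_map Y f n y))).
  apply: eq_csum1 => T' g _; rewrite pr_eta [LHS]dpush_iota hom_idl; congr (iota _ _ _).
  exact: cps_comp.
rewrite subKr scalerA ksgn2 scale1r; congr (iota _ _ _); exact: cm_d.
Qed.

Definition eta_cm S : chain_map (Y S) (bar_pre CY S) :=
  @ChainMap R (Y S) (bar_pre CY S) (@eta_fun S) (@eta_linear S) (@eta_d S).

(** The two degrees of the left factor differ by its total shift [m1 + 1], so the exponents [kappa]
    and [kappa'] give the same sign. Used for the unit and for the counit. *)
Lemma lam_bar_cob (m1 m2 p : int) : ksgn R (lam true m1 m2 (p - (m1 + 1))) = ksgn R (lam false m1 m2 p).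
Proof.
apply: ksgn_eq; rewrite /lam !(poddD, poddM, poddN, podd1).
by case: (podd m1) (podd m2) (podd p) => [] [] [].
Qed.

Lemma eta_theta S (a : S) Q (la : leaf a) (vS : has_vertex S) (vQ : has_vertex Q) n (y : Y (graft S a Q) n) :
  tens_map (eta_cm S) (eta_cm Q) n (pc_theta Y la vS vQ n y) =
  pc_theta (bar_pre CY) la vS vQ n (eta_cm _ n y).
Proof.
apply: (@K_sep R (barI CY) (barDS CY) _ a) => S' f Q' g p e.
have := @K_theta R (barI CY) (barDS CY) S a Q la vS vQ n S' f Q' g p (eta_fun y) e.
move=> ->; rewrite /thx pr_eta.
have lfa := hleaf f la; have vS' := hver f vS; have vQ' := hver g vQ.
have nk : n + sh (cobX Y) S' + sh (cobX Y) Q' = p.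
  by move: e; rewrite -![sh (barI CY) _]/(sh X _) !sh_bar_cob; lia.
(* The identity of the graft is written as a graft of identities, to which [theta_iota] applies. *)
have := congr1 (fun w => @theta_fun R (cobI Y) (cobDS Y) S' (f a) Q' lfa vS' vQ' p
   (@iota R (cobX Y) _ p _ w n (cps_map Y (graft_hom f a g) n y))) (graft_hom_id (f a) Q').
have := @theta_iota R (cobI Y) (cobDS Y) S' (f a) Q' lfa vS' vQ' p S' (hom_id S') Q' (hom_id Q') n
   (cps_map Y (graft_hom f a g) n y) nk.
move=> e1 e2; rewrite [RHS]thx_irr.
apply: (etrans _ (etrans (esym e1) e2)).
have -> : thx (X := cobI Y) lfa vS' vQ' (hom_id S') (hom_id Q') (cps_map Y (graft_hom f a g) n y) =
   tens_map (cps_map Y f) (cps_map Y g) n (pc_theta Y la vS vQ n y).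
  rewrite -(@pc_natural R Y S S' Q Q' f g a la vS vQ lfa vS' vQ').
  exact: (@thx_irr R (cobI Y)).
apply: (@ten_lin_ext R (Y S) (Y Q) n _
  (@K R (barI CY) (barDS CY) _ _ f a _ _ g n p \o tens_fun (eta_cm S) (eta_cm Q) n)
  (@J R (cobI Y) (cobDS Y) _ _ (hom_id S') (f a) _ _ (hom_id Q') p n \o tens_fun (cps_map Y f) (cps_map Y g) n)).
move=> q r u v qr; rewrite [LHS]/= [RHS]/= !tens_funE.
rewrite (@KE R (barI CY) (barDS CY)) // (@JE R (cobI Y) (cobDS Y)) //.
rewrite -![sh (barI CY) _]/(sh X _) !pr_eta !sh_bar_cob !opprK; congr (_ *: _).
rewrite /jsg /lamT; congr (_ * _).
rewrite -lam_bar_cob; congr (ksgn R (lam true _ _ _)).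
by rewrite /sh /=; move: #|_| => ?; lia.
Qed.

Definition eta_mor : cooperad_mor Y (bar_pre CY).
Proof.
apply: (@CooperadMor R Y (bar_pre CY) eta_cm) => [S T f n y|S a Q la vS vQ n y].
  apply: pr_ext => U h p _; rewrite /= pr_dpull !pr_eta; congr (iota _ _ _).
  exact: (esym (cps_comp _ _ _)).
exact: eta_theta.
Defined.
End Unit.

(** * The counit *)

Section Counit.
Variables (R : comPzRingType) (M : preoperad R).
Local Notation BM := (bar_pre M).
Local Notation X := (cobX BM).

Section Eps.
Variables (S : tree) (k : int).
(** The component at the identity detects codimension 0: the family of a symbol at [beta] has a
    component there only if [beta] is an isomorphism. *)
Definition eps_term (u : dfam X S k) T (f : hom S T) : M S k :=
  psh_map M f k (pr (hom_id T) k (pr f (k - sh X T) u : dfam (barX M) T (k - sh X T))).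
Definition eps_fun (u : dfam X S k) : M S k := csum (eps_term u).

Lemma eps_linear : linear eps_fun.
Proof.
move=> c u v; rewrite /eps_fun /csum scaler_sumr -big_split; apply: eq_bigr => i _ /=.
by rewrite /eps_term [pr _ _ (c *: u + v)]linearP [pr _ _ (c *: _ + _)]linearP (linearP (psh_map M _ k)).
Qed.
HB.instance Definition _ := GRing.isLinear.Build R (dfam X S k) (M S k) *:%R eps_fun eps_linear.

Lemma eps_cinv u : cinv (eps_term u).
Proof.
move=> T T' t f; rewrite /eps_term (sh_iso X t) pr_iso; set w := pr f _ u.
have e1 : pr (hom_id T') k (hsg R t *: dpull t w : dfam (barX M) T' (k - sh X T)) =
    psh_map M (ti_g t) k (pr (hom_id T) k (w : dfam (barX M) T (k - sh X T))).
  rewrite linearZ_LR /= pr_dpull.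
  have -> : hom_comp (hom_id T') t = hom_comp t (hom_id T) by rewrite hom_idl hom_idr.
  by rewrite pr_iso scalerA hsg2 scale1r.
apply: (etrans (congr1 (psh_map M (hom_comp t f) k) e1)); rewrite psh_comp.
by congr (psh_map M f k _); rewrite /= -psh_comp ti_gf psh_id.
Qed.

Lemma eps_iota T (f : hom S T) n (v : dfam (barX M) T n) : n + sh X T = k ->
  eps_fun (@iota R X S k T f n v) = psh_map M f k (pr (hom_id T) k v).
Proof.
move=> e; have nE : k - sh X T = n by lia.
rewrite /eps_fun (@csum_single _ _ _ _ f); first by rewrite /eps_term nE pr_iota.
  exact: eps_cinv.
move=> T' g ne; rewrite /eps_term pr_iota0; last exact: nesym.
by rewrite [pr (hom_id T') k _](linear0 (pr (hom_id T') k)) (linear0 (psh_map M g k)).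
Qed.
End Eps.

(** The cancellation of [eta_d] with the roles exchanged: the external cobar part meets the external
    part of the bar differential inside. *)
Lemma eps_d S k (u : dfam X S k) : eps_fun (cob_d u) = cx_d (M S) k (eps_fun u).
Proof.
apply: (@dfam_lin_ext R X S k _ (@eps_fun S (k - 1) \o @cob_d R BM S k) (cx_d (M S) k \o @eps_fun S k)).
move=> T f n v e; rewrite [LHS]/= [RHS]/= cob_d_iota // eps_iota // /cob_gen.
rewrite (linearB (@eps_fun S (k - 1))) (linearZ_LR (@eps_fun S (k - 1))) /=.
rewrite eps_iota; last by rewrite -e; lia.
rewrite -[cx_d (BM T) n v]/(bar_d v).
have -> : pr (hom_id T) (k - 1) (bar_d v) = msg R T *:
   (csum1 (fun T' (g : hom T T') => psh_map M g (k - 1) (pr g (k - 1) v)) - cx_d (M T) k (pr (hom_id T) k v)).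
  rewrite pr_bar_d (cst_pred (fun m => pr (hom_id T) m v)); congr (_ *: (_ - _)).
  by apply: eq_csum1 => T' g _; rewrite hom_idr.
rewrite (linearZ_LR (psh_map M f (k - 1))) scalerA ksgn2 scale1r (linearB (psh_map M f (k - 1))).
have -> : eps_fun (cob_ext k f v) =
    psh_map M f (k - 1) (csum1 (fun T' (g : hom T T') => psh_map M g (k - 1) (pr g (k - 1) v))).
  rewrite /cob_ext (csum1_linear (@eps_fun S (k - 1))) (csum1_linear (psh_map M f (k - 1))).
  apply: eq_csum1 => T' g c1; rewrite /= eps_iota; last by have := sh_cob_succ BM c1; lia.
  by rewrite psh_comp; congr (psh_map M f _ (psh_map M g _ _)); rewrite [LHS]pr_dpull hom_idl.
rewrite subKr; exact: cm_d.
Qed.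

Definition eps_cm S : chain_map (cob_pre BM S) (M S) :=
  @ChainMap R (cob_pre BM S) (M S) (@eps_fun S) (@eps_linear S) (@eps_d S).

Lemma eps_natural S T (f : hom S T) n (u : dfam X T n) :
  eps_fun (dpush f u) = psh_map M f n (eps_fun u).
Proof.
apply: (@dfam_lin_ext R X T n _ (@eps_fun S n \o @dpush R X T S f n) (psh_map M f n \o @eps_fun T n)).
by move=> U g m v e; rewrite /= dpush_iota !eps_iota // psh_comp.
Qed.

Lemma eps_theta S (a : S) Q (la : leaf a) (vS : has_vertex S) (vQ : has_vertex Q) k
    (u : dfam X (graft S a Q) k) :
  tens_map (eps_cm S) (eps_cm Q) k (@theta_fun R (cobI BM) (cobDS BM) S a Q la vS vQ k u) =
  po_theta M la vS vQ k (eps_fun u).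
Proof.
apply: (@dfam_graft_ext R (cobI BM) S a Q la vS vQ k (tensor (M S) (M Q) k)
  (tens_fun (eps_cm S) (eps_cm Q) k \o @theta_fun R (cobI BM) (cobDS BM) S a Q la vS vQ k)
  (po_theta M la vS vQ k \o @eps_fun (graft S a Q) k)) => S' f Q' g n v e.
rewrite [LHS]/= [RHS]/= (@theta_iota R (cobI BM) (cobDS BM) S a Q la vS vQ k S' f Q' g n v e).
have lfa := hleaf f la; have vS' := hver f vS; have vQ' := hver g vQ.
have ek : n + sh X (graft S' (f a) Q') = k by rewrite (sh_graft X lfa vS' vQ') addrA.
rewrite eps_iota // (@po_natural R M _ _ _ _ f g a la vS vQ lfa vS' vQ').
have kn : k + sh (barX M) S' + sh (barX M) Q' = n.
  by move: e; rewrite -![sh (cobI BM) _]/(sh X _) /sh /=; move: #|_| #|_| => ? ?; lia.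
have kt := @K_theta R (barI M) (barDS M) S' (f a) Q' lfa vS' vQ' n S' (hom_id S') Q' (hom_id Q') k v kn.
(* The component at the identity of the graft is the coordinate [K] at the pair of identities, so
   both sides become functions of the same tensor. *)
have -> : po_theta M lfa vS' vQ' k (pr (hom_id (graft S' (f a) Q')) k v) =
   @K R (barI M) (barDS M) _ _ (hom_id S') (f a) _ _ (hom_id Q') n k
     (@theta_fun R (barI M) (barDS M) S' (f a) Q' lfa vS' vQ' n v).
  rewrite [RHS]kt -(congr1 (fun w : hom _ (graft S' (f a) Q') => pr w k v) (graft_hom_id (f a) Q')).
  exact: (@thx_irr R (barI M)).
have -> : thx (X := cobI BM) la vS vQ f g v = @theta_fun R (barI M) (barDS M) S' (f a) Q' lfa vS' vQ' n v.
  exact: (@thx_irr R (cobI BM)).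
move: (theta_fun _ _ _ _ _) => z.
apply: (@ten_lin_ext R (BM S') (BM Q') n _
  (tens_fun (eps_cm S) (eps_cm Q) k \o @J R (cobI BM) (cobDS BM) _ _ f a _ _ g k n)
  (tens_fun (psh_map M f) (psh_map M g) k \o @K R (barI M) (barDS M) _ _ (hom_id S') (f a) _ _ (hom_id Q') n k)).
move=> p q x y pq; rewrite [LHS]/= [RHS]/=.
rewrite (@JE R (cobI BM) (cobDS BM)) // (@KE R (barI M) (barDS M)) //.
rewrite (linearZ_LR (tens_fun (eps_cm S) (eps_cm Q) k)) (linearZ_LR (tens_fun (psh_map M f) (psh_map M g) k)).
rewrite [tens_fun (eps_cm S) _ _ _]tens_funE tens_funE /= !eps_iota //.
have shE T m : m + sh (cobI BM) T = m - sh (barI M) T by rewrite /sh /=.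
rewrite !shE; congr (_ *: _).
rewrite /jsg /lamT; congr (_ * _).
rewrite -lam_bar_cob; congr (ksgn R (lam true _ _ _)).
by rewrite /sh /=; move: #|_| => ?; lia.
Qed.

Definition eps_mor : operad_mor (cob_pre BM) M.
Proof.
apply: (@OperadMor R (cob_pre BM) M eps_cm) => [S T f n u|S a Q la vS vQ n u].
  exact: eps_natural.
exact: eps_theta.
Defined.
End Counit.

(** * Triangle identities and the formulas for unit and counit *)

Section Adjunction.
Variable R : comPzRingType.

Definition bar_adj : adjunction (cobF R) (barF R).
Proof.
apply: (@Adjunction (Cooperads R) (Operads R) (cobF R) (barF R)
  (fun Y : cooperad R => eta_mor Y) (fun M : operad R => eps_mor M)).
- move=> Y Z phi; apply: cooperad_mor_ext => S n y; apply: pr_ext => T f p _.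
  rewrite /= !pr_dmap !pr_eta [RHS]dmap_iota; congr (iota _ _ _); exact: (esym (cmor_natural phi f y)).
- move=> M N phi; apply: operad_mor_ext => S k u.
  apply: (@dfam_lin_ext R (cobX (bar_pre M)) S k _ (phi S k \o @eps_fun R M S k)
    (@eps_fun R N S k \o @cdmap R (bar_coop M) (bar_coop N) (bar_mor phi) S k)) => T f n v e.
  rewrite /= /cdmap dmap_iota !eps_iota //; exact: (om_natural phi).
(* The counit reads the component of the unit at the identity, which is the generator of [y]
   itself. *)
- move=> Y; apply: operad_mor_ext => S k u.
  apply: (@dfam_lin_ext R (cobX Y) S k _ (@eps_fun R (cob_pre Y) S k \o
    @cdmap R Y (bar_coop (cob_op Y)) (eta_mor Y) S k) idfun) => T f n y e.
  rewrite /= /cdmap dmap_iota eps_iota // [pr _ _ _]pr_eta [LHS]dpush_iota hom_idl; congr (iota _ _ _).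
  exact: cps_id.
(* The counit takes the component at the identity of the pushforward of [u] along [f], and this is
   the component of [u] at [f]. *)
- move=> M; apply: cooperad_mor_ext => S n u; apply: pr_ext => T f p e.
  rewrite [LHS]pr_dmap [pr f p _]pr_eta; apply: (etrans (@eps_iota R M T p T (hom_id T) n _ _)).
    by move: e; rewrite /sh /=; move: #|_| => ?; lia.
  by rewrite [LHS]psh_id [LHS]pr_dpull hom_idl.
Defined.

(** For any choice of [a] and [e], the summand at [f] is the coefficient of the unit family at [f],
    and [dfam_span] adds these up. *)
Lemma bar_unit : is_bar_unit (fun M : operad R => bar_mdl M) (fun Y : cooperad R => cob_mdl Y)
  (B := barF R) (Bv := cobF R) (fun Y : cooperad R => adj_unit bar_adj Y).
Proof.
move=> Y S n y a e ha he.
pose F T (f : hom S T) := let u := CobarSym (hom_id T) (map f a ++ e T f) [::] (cps_map Y f n y) in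
  bar_lin (cob_pre Y) S n (pgen _ (@BarSym R (cob_pre Y) S T f a (e T f) (cobar_deg u) (cob_lin Y T (cobar_deg u) (pgen _ u)))).
have FE T (f : hom S T) : F T f = coef (eta_fun y) f.
  have hw := hom_enum ha (he T f).
  have h0 : is_enum [::] (new_edges (hom_id T)).
    by rewrite (new_codim0 (codim_ti (ti_id T))) /is_enum enum_set0.
  have ok : sok (hom_id T) (map f a ++ e T f) [::] by rewrite /sok hw.
  rewrite /F cob_lin_gen csym_enum //.
  have sz : (size a + size (e T f))%N = #|inner T| by rewrite -(enum_size hw) size_cat size_map.
  rewrite bar_lin_gen bsym_enum //; last first.
    rewrite /bar_deg /cobar_deg /= size_cat size_map; lia.
  rewrite (linearZ_LR (@iota R (barX (cob_pre Y)) S n T f _)) scalerA map_id cats0 wsgn2 scale1r /coef pr_eta.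
  have -> : n - sh (barX (cob_pre Y)) T = cobar_deg (CobarSym (hom_id T) (map f a ++ e T f) [::] (cps_map Y f n y)).
    by rewrite -(cobar_deg_sh (cps_map Y f n y) ok) sh_bar_cob opprK.
  by [].
have := @csum_class_sum S (dfam (barX (cob_pre Y)) S n) F (fun _ _ => true) (fun _ _ => True).
move=> /(_ (fun _ _ => ReflectT _ I) (fun _ _ _ _ => erefl)).
have -> : csum (fun T (f : hom S T) => if true then F T f else 0) = eta_fun y.
  by rewrite [RHS]dfam_span; apply: eq_csum => T f; apply: FE.
by [].
Qed.

Lemma bar_counit : is_bar_counit (fun M : operad R => bar_mdl M) (fun Y : cooperad R => cob_mdl Y)
  (B := barF R) (Bv := cobF R) (fun M : operad R => adj_counit bar_adj M).
Proof.
move=> M S T U al be n x a e f ha he hf v w.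
have hw := hom_enum ha he.
have okw : sok al a e by rewrite /sok ha.
pose V : dfam (barX M) T (bar_deg v) := bar_lin M T (bar_deg v) (pgen _ v).
have epsE k : k = cobar_deg w -> eps_fun (cob_lin (bar_pre M) S k (pgen _ w)) =
    wsgn R (map al a ++ e) *: psh_map M al k (pr (hom_id T) k V).
  move=> kE; rewrite cob_lin_gen csym_enum // (linearZ_LR (@eps_fun R M S k)).
  congr (_ *: _); apply: (@eps_iota R M S k T al (bar_deg v) V).
  by rewrite kE; apply: (@cobar_deg_sh R (bar_pre M) S T al a e (bar_deg v) V okw).
have VE : V = wsgn R (map be (map al a ++ e) ++ f) *: @iota R (barX M) T (bar_deg v) U be n x.
  by rewrite /V bar_lin_gen bsym_enum.
split=> c.
  rewrite -[LHS]/(eps_fun (cob_lin (bar_pre M) S (cobar_deg w) (pgen _ w))) epsE // VE.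
  rewrite linearZ_LR /= pr_iota0 ?scaler0 ?(linear0 (psh_map M al _)) ?scaler0 // => /toc_eq[t tE].
  have := codim_tcomp t be; rewrite tE (codim_ti (ti_id T)) => c0.
  by rewrite -c0 in c.
rewrite -[LHS]/(eps_fun (cob_lin (bar_pre M) S n (pgen _ w))) epsE; last first.
  have := enum_size hf; rewrite -/(codim be) c => f0.
  by rewrite /w /v /cobar_deg /bar_deg /= size_cat size_map f0; lia.
rewrite VE linearZ_LR /=.
have [t tE] := codim0_ti c.
have c1 : (codim be <= 1)%N by rewrite c.
have dv : n + sh (barX M) U = bar_deg v by apply: bar_deg_sh; rewrite /sok hw.
have idE : hom_id T = hom_comp (ti_inv t) be by rewrite -tE /= ti_gf.
have -> : pr (hom_id T) n (@iota R (barX M) T (bar_deg v) U be n x) = hsg R (ti_inv t) *: psh_map M be n x.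
  by rewrite idE pr_iota_iso //= tE.
rewrite (wsgn_hom1 R c1 hw hf) scalerA (linearZ_LR (psh_map M al n)) scalerA.
(* In codimension 0, [be] is the isomorphism [t], and the identity is reached from it by the
   inverse. *)
have hh : hsg R (ti_inv t) * hsg R be = 1.
  by rewrite -hsg_comp0 // -idE hsg_id.
rewrite -[RHS]scale1r; congr (_ *: _).
transitivity ((hsg R (ti_inv t) * hsg R be) * (wsgn R (map al a ++ e) * wsgn R (map al a ++ e))); first by ring.
by rewrite hh wsgn2 mulr1.
Qed.
End Adjunction.

Theorem proposition7p2 (R : comPzRingType) :
  exists (B : functor (Operads R) (Cooperads R))
         (Bv : functor (Cooperads R) (Operads R))
         (mB : forall M : operad R, bar_model M (B M : cooperad R))
         (mBv : forall Y : cooperad R, cobar_model Y (Bv Y : operad R))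
         (adj : adjunction Bv B),
    [/\ bar_functorial mB,
        cobar_functorial mBv,
        is_bar_unit mB mBv (fun Y : cooperad R => adj_unit adj Y) &
        is_bar_counit mB mBv (fun M : operad R => adj_counit adj M)].
Proof.
exists (barF R), (cobF R), (fun M : operad R => bar_mdl M), (fun Y : cooperad R => cob_mdl Y), (bar_adj R).
split; [| |exact: bar_unit|exact: bar_counit].
- move=> M N phi S T f d e n x s.
  apply: (etrans (congr1 (bdmap phi (k := _)) (bar_lin_gen _ _))).
  rewrite [RHS]bar_lin_gen /bsym /sval_of /=; case: ifP => _; last exact: linear0.
  by rewrite /bdmap linearZ_LR /= dmap_iota.
- move=> Y Z phi S T f b d n y s.
  apply: (etrans (congr1 (cdmap phi (k := _)) (cob_lin_gen _ _))).
  rewrite [RHS]cob_lin_gen /csym /sval_of /=; case: ifP => _; last exact: linear0.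
  by rewrite /cdmap linearZ_LR /= dmap_iota.
Qed.
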